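(* Let $d\ge1$, $s\in\mathbb{R}$, $0<p,q\le\infty$, and suppose that $$\sup_{N\geq0}\,\|\mathbb{E}_N\|_{B^s_{p,q}\to B^s_{p,q}}\,+\,\sup_{N\geq-1,\ \|\mathfrak{a}\|_\infty\leq1}\|T_N[\cdot,\mathfrak{a}]\|_{B^s_{p,q}\to B^s_{p,q}}<\infty.$$ Then, for every strongly admissible enumeration $\mathcal{U}$ of $\mathscr{H}_d$ and every cube $Q$ it holds $$\sup_{R\in \mathbb{N}} \;\mathrm{Op}\big(S^{\mathcal{U}}_R, B^s_{p,q}(\mathbb{R}^d), Q\big)<\infty.$$ Moreover, $\mathcal{U}$ is a local basic sequence of $B^s_{p,q}(\mathbb{R}^d)$, that is, $$\lim_{R\to\infty}\big\|\chi\cdot(S_R^{\mathcal{U}} f-f)\big\|_{B^s_{p,q}}=0$$ for all $\chi\in C^\infty_c(\mathbb{R}^d)$ and all $f$ in the closure of $\operatorname{span}\mathscr{H}_d$ in $B^s_{p,q}(\mathbb{R}^d)$.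
   Context: $B^s_{p,q}=B^s_{p,q}(\mathbb{R}^d)$ is the usual inhomogeneous Besov space. Haar system: let $h^{(0)}=\mathbf{1}_{[0,1)}$ and $h^{(1)}=\mathbf{1}_{[0,1/2)}-\mathbf{1}_{[1/2,1)}$ on $\mathbb{R}$. For $\epsilon\in\{0,1\}^d$, $k\in\mathbb{N}_0$, $\mu\in\mathbb{Z}^d$ put $h^{\epsilon}_{k,\mu}(x)=\prod_{i=1}^d h^{(\epsilon_i)}(2^kx_i-\mu_i)$. With $\Upsilon=\{0,1\}^d\setminus\{\vec 0\}$, $\mathscr{H}_d=\{h^{\vec 0}_{0,\mu}\}_{\mu\in\mathbb{Z}^d}\cup\{h^{\epsilon}_{k,\mu}: k\in\mathbb{N}_0,\mu\in\mathbb{Z}^d,\epsilon\in\Upsilon\}$. For an enumeration $\mathcal{U}=\{u_n\}_{n\ge1}$ of $\mathscr{H}_d$, $u_n=h^{\epsilon(n)}_{k(n),\mu(n)}$, put $u_n^*(f)=2^{k(n)d}\langle f,u_n\rangle$ and $S_R^{\mathcal{U}}f=\sum_{n=1}^Ru_n^*(f)u_n$. Strong admissibility: for $\nu\in\mathbb{Z}^d$ let $I_\nu=\nu+[0,1]^d$ and let $I_\nu^{**}$ be its five-fold dilate with respect to its center. $\mathcal{U}$ is strongly admissible if there is $b\in\mathbb{N}$ such that for each $\nu\in\mathbb{Z}^d$: if $u_n,u_{n'}$ are supported in $I_\nu^{**}$ and $|\mathrm{supp}(u_n)|\ge2^{bd}|\mathrm{supp}(u_{n'})|$, then $n<n'$.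 Operators: with $I_{N,\mu}=2^{-N}(\mu+[0,1)^d)$, $\mathbb{E}_Nf=\sum_{\mu\in\mathbb{Z}^d}\mathbf{1}_{I_{N,\mu}}2^{Nd}\int_{I_{N,\mu}}f$; for $N\ge0$ and $\mathfrak{a}=(a_{\mu,\epsilon})\in\ell^\infty(\mathbb{Z}^d\times\Upsilon)$, $T_N[f,\mathfrak{a}]=\sum_{\epsilon\in\Upsilon}\sum_{\mu\in\mathbb{Z}^d}a_{\mu,\epsilon}2^{Nd}\langle f,h^\epsilon_{N,\mu}\rangle h^\epsilon_{N,\mu}$; and $T_{-1}[f,\mathfrak{a}]=\sum_{\mu\in\mathbb{Z}^d}a_\mu\langle f,h^{\vec0}_{0,\mu}\rangle h^{\vec0}_{0,\mu}$ for $\mathfrak{a}=(a_\mu)\in\ell^\infty(\mathbb{Z}^d)$. These formulas are for locally integrable $f$. For general $f\in B^s_{p,q}$ each of the operators $\mathbb{E}_N$, $T_N[\cdot,\mathfrak{a}]$, $S_R^{\mathcal{U}}$ (call it $T$) is understood as $Tf=\sum_{j\ge0}T(f_j)$ with convergence in $B^s_{p,q}$, where $\widehat{f_0}=\eta_0\widehat f$, $\widehat{f_j}=(\eta_0(2^{-j}\cdot)-\eta_0(2^{-j+1}\cdot))\widehat f$ for $j\ge1$, and $\eta_0\in C_c^\infty(\mathbb{R}^d)$ is supported in $\{|\xi|<3/8\}$ with $\eta_0=1$ on $\{|\xi|\le1/4\}$. $\mathrm{Op}(T,X,Q)=\sup\{\|Tf\|_X:\ \|f\|_X\le1,\ \mathrm{supp}(f)\subset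 Q\}$ for an open cube $Q$. *)

(* Defs.v *)
From HB Require Import structures.
From mathcomp Require Import all_boot all_order all_algebra.
From mathcomp Require Import all_classical all_reals all_analysis.
From mathcomp Require Import complex.

Set Implicit Arguments.
Unset Strict Implicit.
Unset Printing Implicit Defensive.

Import Order.TTheory GRing.Theory Num.Theory.
Import numFieldNormedType.Exports.

Local Open Scope classical_set_scope.
Local Open Scope ring_scope.

Definition rV_display : measure_display.
Proof. exact. Qed.

(* The product sigma-algebra, which is the Borel one, on R^n. *)
Section measurable_rV.
Context {R : realType} (n : nat).

Let coor : 'I_n -> 'rV[R]_n -> measurableTypeR R := fun i x => x ord0 i.

Let rV_set0 : g_sigma_preimage coor set0.
Proof. exact: sigma_algebra0. Qed.

Let rV_setC A : g_sigma_preimage coor A -> g_sigma_preimage coor (~` A).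
Proof. exact: sigma_algebraC. Qed.

Let rV_bigcup (F : _^nat) : (forall i, g_sigma_preimage coor (F i)) ->
  g_sigma_preimage coor (\bigcup_i (F i)).
Proof. exact: sigma_algebra_bigcup. Qed.

HB.instance Definition _ := @isMeasurable.Build rV_display
  'rV[R]_n (g_sigma_preimage coor) rV_set0 rV_setC rV_bigcup.

Lemma measurable_coor (i : 'I_n) : measurable_fun [set: 'rV[R]_n] (coor i).
Proof.
move=> _ Y mY; rewrite setTI; apply: sub_sigma_algebra => /=.
rewrite -bigcup_seq/=; exists i => /=; first by rewrite mem_index_enum.
by exists Y => //; rewrite setTI.
Qed.

Lemma measurable_fun_coorP {disp} {T : measurableType disp}
    (f : T -> 'rV[R]_n) :
  (forall i, measurable_fun [set: T] (coor i \o f)) ->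
  measurable_fun [set: T] f.
Proof.
move=> mf.
have H : g_sigma_preimage (fun i => coor i \o f) `<=` measurable.
  apply: smallest_sub; first exact: sigma_algebra_measurable.
  rewrite -bigcup_seq => A [i _ [B mB <-]].
  exact: mf.
rewrite g_sigma_preimage_comp in H.
by move=> _ A mA; apply: H; exists A.
Qed.

End measurable_rV.

Section lebesgue_step.
Context {R : realType} (n : nat).
Variable m : {sigma_finite_measure set 'rV[R]_n -> \bar R}.

Definition rV_cons (z : measurableTypeR R * 'rV[R]_n) : 'rV[R]_n.+1 :=
  @row_mx R 1 1 n (const_mx z.1) z.2.

Lemma measurable_rV_cons : measurable_fun setT rV_cons.
Proof.
apply: measurable_fun_coorP => i; case: (@split_ordP 1 n i) => j ->.
  rewrite (_ : _ \o _ = fst) //.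
  apply/funext => z.
  exact: etrans (@row_mxEl R 1 1 n _ _ _ _) (mxE _ _ _ _).
rewrite (_ : _ \o _ = (fun x : 'rV[R]_n => x ord0 j : measurableTypeR R) \o snd).
  by apply: measurableT_comp => //; exact: measurable_coor.
by apply/funext => z; exact: (@row_mxEr R 1 1 n).
Qed.

Definition lebesgue_step : set 'rV[R]_n.+1 -> \bar R :=
  pushforward (@lebesgue_measure R \x m)%E rV_cons.

Let step0 : (lebesgue_step set0 = 0)%E.
Proof. by rewrite /lebesgue_step /pushforward preimage_set0 measure0. Qed.

Let step_ge0 A : (0 <= lebesgue_step A)%E.
Proof. by rewrite /lebesgue_step /pushforward; exact: measure_ge0. Qed.

Let step_sigma_additive : semi_sigma_additive lebesgue_step.
Proof.
by rewrite /lebesgue_step; apply: measure_semi_sigma_additive;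
  exact: measurable_rV_cons.
Qed.

HB.instance Definition _ := isMeasure.Build _ _ _ lebesgue_step
  step0 step_ge0 step_sigma_additive.

Let step_sigma_finite : sigma_finite setT lebesgue_step.
Proof.
have /sigma_finiteP[F [TF ndF mF]] := sigma_finiteT (@lebesgue_measure R).
have /sigma_finiteP[G [TG ndG mG]] := sigma_finiteT m.
pose h (x : 'rV[R]_n.+1) : measurableTypeR R * 'rV[R]_n :=
  (x ord0 ord0, rsubmx (x : 'rV_(1 + n))).
have mh : measurable_fun setT h.
  apply: measurable_fun_pair => /=; first exact: measurable_coor.
  apply: measurable_fun_coorP => i.
  rewrite (_ : _ \o _ = fun x : 'rV[R]_n.+1 => (x ord0 (rshift 1 i) : measurableTypeR R)).
    exact: measurable_coor.
  by apply/funext => x /=; rewrite mxE.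
have hK : cancel rV_cons h.
  case=> a b; congr pair; last exact: (@row_mxKr R 1 1 n).
  rewrite (_ : ord0 = lshift n (ord0 : 'I_1)); last exact: val_inj.
  exact: etrans (@row_mxEl R 1 1 n _ _ _ _) (mxE _ _ _ _).
exists (fun i => h @^-1` (F i `*` G i)).
  rewrite -preimage_bigcup; apply/esym/seteqP; split => // x _ /=.
  have [i _ Fi] : (\bigcup_i F i) (h x).1 by rewrite -TF.
  have [j _ Gj] : (\bigcup_j G j) (h x).2 by rewrite -TG.
  exists (maxn i j) => //; split.
  - by move: Fi; exact/subsetPset/ndF/leq_maxl.
  - by move: Gj; exact/subsetPset/ndG/leq_maxr.
move=> i; have [mFi Fioo] := mF i; have [mGi Gioo] := mG i; split.
  by rewrite -[X in measurable X]setTI; apply: mh => //; exact: measurableX.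
rewrite /lebesgue_step /pushforward -comp_preimage.
rewrite (_ : h \o rV_cons = id); last by apply/funext => z /=; rewrite hK.
by rewrite preimage_id product_measure1E// lte_mul_pinfty// ge0_fin_numE.
Qed.

HB.instance Definition _ := Measure_isSigmaFinite.Build _ _ _ lebesgue_step
  step_sigma_finite.

End lebesgue_step.

Fixpoint lebesgue_rV {R : realType} (n : nat) :
    {sigma_finite_measure set 'rV[R]_n -> \bar R} :=
  match n with
  | 0 => \d_(0 : 'rV[R]_0)
  | k.+1 => lebesgue_step (lebesgue_rV k)
  end.

Section complex_functions.
Context {R : realType} {d : nat}.
Local Notation C := R[i].
Local Notation Rd := 'rV[R]_d.
Local Notation leb := (@lebesgue_rV R d).
Implicit Types (f g : Rd -> C) (x xi : Rd) (l : seq 'I_d).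

Definition cabs (z : C) : R := ComplexField.Normc.normc z.

Definition cint (D : set Rd) f : C :=
  Complex (\int[leb]_(x in D) complex.Re (f x))
          (\int[leb]_(x in D) complex.Im (f x)).

Definition dot x xi : R := \sum_i x 0 i * xi 0 i.

(* The norm of 'rV[R]_d in the library is the maximum norm. *)
Definition eucl x : R := Num.sqrt (dot x x).

(* Iterated partial derivatives along a list of coordinate directions. *)
Definition pderiv l (u : Rd -> R) : Rd -> R :=
  foldr (fun i v => 'D_(delta_mx 0 i) v) u l.

Definition smooth_real (u : Rd -> R) : Prop :=
  forall l, continuous (pderiv l u) /\
    forall i x, derivable (pderiv l u) x (delta_mx 0 i).

Definition smooth f : Prop :=
  smooth_real (fun x => complex.Re (f x)) /\
  smooth_real (fun x => complex.Im (f x)).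

Definition cpderiv l f x : C :=
  Complex (pderiv l (fun y => complex.Re (f y)) x)
          (pderiv l (fun y => complex.Im (f y)) x).

Definition fsupp f : set Rd := closure [set x | f x != 0].

Definition test_function f : Prop := smooth f /\ compact (fsupp f).

Definition schwartz_norm (k : nat) f : \bar R :=
  ereal_sup [set ((1 + eucl z.2) ^+ k * cabs (cpderiv z.1 f z.2))%:E
            | z in [set z : seq 'I_d * Rd | (size z.1 <= k)%N]].

Definition schwartz f : Prop :=
  smooth f /\ forall k, (schwartz_norm k f < +oo)%E.

Definition loc_integrable f : Prop := forall r : R,
  leb.-integrable [set x | eucl x <= r] (fun x => (complex.Re (f x))%:E) /\
  leb.-integrable [set x | eucl x <= r] (fun x => (complex.Im (f x))%:E).

Definition expi (t : R) : C := Complex (cos t) (sin t).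

Definition fourier f xi : C :=
  cint setT (fun x => f x * expi (- (2 * pi * dot x xi))).

Definition ifourier f x : C :=
  cint setT (fun xi => f xi * expi (2 * pi * dot x xi)).

End complex_functions.

(* A distribution is represented by its values on the Schwartz functions; the
   values at other arguments are irrelevant, all notions below ignore them. *)
Notation distr R d := (('rV[R]_d -> R[i]) -> R[i]).

Section distributions.
Context {R : realType} {d : nat}.
Local Notation C := R[i].
Local Notation Rd := 'rV[R]_d.
Implicit Types (f g m : Rd -> C) (u v : distr R d).

Definition tempered u : Prop :=
  (forall (a : C) f g, schwartz f -> schwartz g ->
     u (fun x => a * f x + g x) = a * u f + u g) /\
  (exists (c : R) (k : nat), forall f, schwartz f ->
     ((cabs (u f))%:E <= c%:E * schwartz_norm k f)%E).

Definition dist_of f : distr R d := fun g => cint setT (fun x => f x * g x).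

Definition dmul m u : distr R d := fun f => u (fun x => m x * f x).

Definition dfourier u : distr R d := fun f => u (fourier f).

Definition difourier u : distr R d := fun f => u (ifourier f).

Definition dsupp u : set Rd := [set x | forall V : set Rd, open V -> V x ->
  exists f, [/\ test_function f, fsupp f `<=` V & u f != 0]].

Definition represents f u : Prop :=
  loc_integrable f /\ forall g, test_function g -> u g = dist_of f g.

(* The locally integrable function representing u, unique almost everywhere;
   junk if u is not such a function. *)
Definition fun_of u : Rd -> C := xget (fun=> 0) [set f | represents f u].

End distributions.

Section besov.
Context {R : realType} {d : nat}.
Local Notation C := R[i].
Local Notation Rd := 'rV[R]_d.
Variable eta : Rd -> C.
Variables (s : R) (p q : \bar R).
Implicit Types (u v : distr R d) (T : (Rd -> C) -> (Rd -> C)).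

Definition lp_cutoff : Prop :=
  [/\ test_function eta,
      fsupp eta `<=` [set xi | eucl xi < 3 / 8] &
      forall xi, eucl xi <= 1 / 4 -> eta xi = 1].

Definition dyadic (j : nat) (xi : Rd) : C :=
  if j is k.+1 then eta (2 ^- k.+1 *: xi) - eta (2 ^- k *: xi) else eta xi.

(* The distribution whose Fourier transform is dyadic j times that of u. *)
Definition block u (j : nat) : distr R d :=
  difourier (dmul (dyadic j) (dfourier u)).

(* If u is tempered, block u j has compact spectrum, hence is a function. *)
Definition besov_norm u : \bar R :=
  if `[< tempered u >] then
    Lnorm counting q (fun j : nat => (2 `^ (s * j%:R))%R%:E *
      Lnorm (@lebesgue_rV R d) p
        (fun x => (cabs (fun_of (block u j) x))%:E))%E
  else +oo%E.

Definition besov : set (distr R d) := [set u | (besov_norm u < +oo)%E].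

(* T u = v, where T u is defined as the sum of T (u_j), convergent in B^s_pq. *)
Definition op_value T u v : Prop :=
  besov v /\
  besov_norm (\sum_(j < J) dist_of (T (fun_of (block u j))) - v)
    @[J --> \oo] --> 0%E.

(* The norm of T restricted to the elements of B^s_pq lying in D. The limit v
   is unique, so the infimum is the norm of T u, or +oo if T u is undefined. *)
Definition op_norm T (D : set (distr R d)) : \bar R :=
  ereal_sup [set ereal_inf [set besov_norm v | v in op_value T u]
            | u in [set u | D u /\ (besov_norm u <= 1)%E]].

End besov.

Section haar.
Context {R : realType} {d : nat}.
Local Notation C := R[i].
Local Notation Rd := 'rV[R]_d.
Local Notation Zd := 'rV[int]_d.

Definition haar1 (e : bool) (t : R) : R :=
  if e then \1_(`[0, 1/2[%classic) t - \1_(`[1/2, 1[%classic) t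
  else \1_(`[0, 1[%classic) t.

Definition haar (e : {ffun 'I_d -> bool}) (k : nat) (m : Zd) (x : Rd) : C :=
  (\prod_i haar1 (e i) (2 ^+ k * x 0 i - (m 0 i)%:~R))%:C%C.

Definition haar0 : {ffun 'I_d -> bool} := [ffun=> false].

Record haar_index := HaarIndex {
  hi_type : {ffun 'I_d -> bool}; hi_level : nat; hi_pos : Zd }.

Definition haar_of (z : haar_index) : Rd -> C :=
  haar (hi_type z) (hi_level z) (hi_pos z).

(* The Haar functions h^e_{k,m} are pairwise distinct, so the Haar system is
   identified with its set of indices. *)
Definition haar_system : set haar_index :=
  [set z | (hi_type z = haar0 /\ hi_level z = 0%N) \/ hi_type z != haar0].

Definition pairing (f g : Rd -> C) : C := cint setT (fun x => f x * g x).

(* An enumeration u_1, u_2, ... is indexed from 0: U n is u_(n+1). *)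
Definition enumeration (U : nat -> haar_index) : Prop :=
  set_bij setT haar_system U.

Definition partial_sum_op (U : nat -> haar_index) (N : nat)
    (f : Rd -> C) (x : Rd) : C :=
  \sum_(n < N) 2 ^+ (hi_level (U n) * d) * pairing f (haar_of (U n))
    * haar_of (U n) x.

Definition five_fold_cube (nu : Zd) : set Rd :=
  [set x | forall i, `|x 0 i - ((nu 0 i)%:~R + 1/2)| <= 5/2].

Definition strongly_admissible (U : nat -> haar_index) : Prop :=
  exists b : nat, forall (nu : Zd) (n n' : nat),
    fsupp (haar_of (U n)) `<=` five_fold_cube nu ->
    fsupp (haar_of (U n')) `<=` five_fold_cube nu ->
    ((2 ^+ (b * d))%:E * @lebesgue_rV R d (fsupp (haar_of (U n')))
       <= @lebesgue_rV R d (fsupp (haar_of (U n))))%E ->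
    (n < n')%N.

Definition dyadic_cube (N : nat) (m : Zd) : set Rd :=
  [set x | forall i,
     2 ^- N * (m 0 i)%:~R <= x 0 i < 2 ^- N * ((m 0 i)%:~R + 1)].

(* At each x the sum below, and those in haar_mult and haar_mult0, have at
   most one nonzero term for each e. *)
Definition expect (N : nat) (f : Rd -> C) (x : Rd) : C :=
  \sum_(m \in [set: Zd]) \1_(dyadic_cube N m) x
    * (2 ^+ (N * d) * cint (dyadic_cube N m) f).

(* Only the coefficients a m e with e != haar0 matter. *)
Definition haar_mult (N : nat) (a : Zd -> {ffun 'I_d -> bool} -> C)
    (f : Rd -> C) (x : Rd) : C :=
  \sum_(e | e != haar0) \sum_(m \in [set: Zd])
    a m e * 2 ^+ (N * d) * pairing f (haar e N m) * haar e N m x.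

Definition haar_mult0 (a : Zd -> C) (f : Rd -> C) (x : Rd) : C :=
  \sum_(m \in [set: Zd]) a m * pairing f (haar haar0 0 m) * haar haar0 0 m x.

Definition haar_span : set (Rd -> C) :=
  [set f | exists (n : nat) (c : 'I_n -> C) (z : 'I_n -> haar_index),
     (forall i, haar_system (z i)) /\
     f = (fun x => \sum_(i < n) c i * haar_of (z i) x)].

Definition open_cube (c : Rd) (r : R) : set Rd :=
  [set x | forall i, `|x 0 i - c 0 i| < r].

Definition haar_closure (eta : Rd -> C) (s : R) (p q : \bar R) :
    set (distr R d) :=
  [set u | besov eta s p q u /\ forall e : R, 0 < e ->
     exists2 f, haar_span f & (besov_norm eta s p q (u - dist_of f)%R < e%:E)%E].

End haar.

Arguments strongly_admissible R {d} U.

(* Main.v *)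
From HB Require Import structures.
From mathcomp Require Import all_boot all_order all_algebra.
From mathcomp Require Import all_classical all_reals all_analysis.
From mathcomp Require Import measurable_realfun complex zify ring lra.
Require Import Defs.

(** Inside a bounded box, strong admissibility forces an initial segment of the enumeration to
    contain all Haar functions below some level [N] and none that lie more than a fixed number
    [B] of levels above [N] ([first_levels]). Admissibility itself compares only Haar functions
    in neighbouring cubes; chains of neighbouring cubes extend the comparison to the box
    ([admissible_chain], [near_order]). Since the martingale differences of the conditional
    expectations are sums over one level of the Haar system ([expect_levels]), a partial sum
    agrees in the box with a conditional expectation plus at most [B.+1] operators that multiply
    the Haar coefficients of one level by zeros and ones. These are bounded uniformly, by
    hypothesis. Multiplication by a test function [chi] is bounded on Besov spaces
    ([besov_multiplier]), hence so is [chi] times a partial sum, uniformly in its length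
    ([partial_sum_local]).

    For distributions supported in a cube, the Haar functions far from the cube do not
    contribute: their coefficients are limits of those of the partial Littlewood-Paley sums, which
    decay away from the support ([far_haar_coef]). Near the cube one may take [chi = 1], so that
    the localized bound bounds the whole partial sum ([partial_sum_supported]).

    For the convergence, write [f = h + g] with [g] a Haar polynomial and [h] small. The partial
    sums reproduce [g] once they contain all Haar functions of its levels near its support
    ([haar_span_reproduced]), because the finer ones are orthogonal to [g]; and the localized
    partial sums of [h] are uniformly small ([partial_sum_closure]).

    All operators act on the functions that represent the Littlewood-Paley blocks of [f], and
    their values are limits in a quasinorm. Three facts make this workable. The blocks are the
    continuous functions [blockf] of polynomial growth up to null sets ([fun_of_block]), so that the
    norm and the Haar coefficients can be computed from these. The [j]-th block reproduces itself
    under convolution with a kernel of its own scale ([blockf_reproduce]); this gives Peetre's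
    maximal inequality ([peetre]) for all exponents, and with it the multiplier theorem, since
    distant scales hardly interact in a product with a test function ([product_estimate]). Finally
    the rank one projections have explicit values ([rank_one_value]), determined by the limits
    of the Haar coefficients of the partial Littlewood-Paley sums ([haar_coef_cvg]). The underlying
    calculus consists of Fourier transforms of test functions, of which only the inversion formula
    ([ifourierK]) and the decay ([schwartz_fourier]) are used, and of the exchange of a tempered
    distribution with a convolution integral ([tempered_conv]). *)

Set Implicit Arguments.
Unset Strict Implicit.
Unset Printing Implicit Defensive.

Import Order.TTheory GRing.Theory Num.Theory.
Import numFieldNormedType.Exports.

Local Open Scope classical_set_scope.
Local Open Scope ring_scope.

(** * Lebesgue measure on coordinate space *)

Section coordinates.
Context {R : realType} {d : nat}.
Implicit Types x y : 'rV[R]_d.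

Lemma coord_le x i : `|x 0 i| <= `|x|.
Proof.
rewrite [leRHS]/Num.norm /= mx_normrE.
by apply: (le_bigmax _ (fun ij => `|x ij.1 ij.2|) (0, i)).
Qed.

Lemma norm_le x (r : R) : 0 <= r -> (forall i, `|x 0 i| <= r) -> `|x| <= r.
Proof.
move=> r0 H; rewrite [leLHS]/Num.norm /= mx_normrE.
by apply: bigmax_le => // -[i j] _ /=; rewrite ord1.
Qed.

Lemma norm_lt x (r : R) : 0 < r -> (forall i, `|x 0 i| < r) -> `|x| < r.
Proof.
move=> r0 H; rewrite [ltLHS]/Num.norm /= mx_normrE.
by apply: bigmax_lt => // -[i j] _ /=; rewrite ord1.
Qed.

Definition fl (N : nat) x : 'rV[int]_d := \row_i Num.floor (2 ^+ N * x 0 i).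

(** Functions of the integer parts [fl N x] are measurable: they are constant on countably many
    boxes. *)
Lemma measurable_fl N (Y : set 'rV[int]_d) : measurable [set x | Y (fl N x)].
Proof.
pose cube m : set 'rV[R]_d := [set x | fl N x = m].
have -> : [set x | Y (fl N x)] =
    \bigcup_(m in [set: 'rV[int]_d]) (if `[< Y m >] then cube m else set0).
  apply/seteqP; split => x /=.
    by move=> Yx; exists (fl N x) => //; rewrite asboolT.
  by move=> [m _]; case: asboolP => // Ym; rewrite /cube /= => ->.
apply: countable_bigcupT_measurable; first exact: countableP.
move=> m; case: asboolP => // _.
have -> : cube m = \bigcap_(i in [set: 'I_d])
   ((fun x => 2 ^+ N * x 0 i) @^-1` [set t | Num.floor t = m 0 i]).
  apply/seteqP; split => [x /= <- i _ /=|x /= H]; first by rewrite mxE.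
  by apply/rowP => i; rewrite mxE; apply: H.
apply: fin_bigcap_measurable => // i _.
rewrite -[X in measurable X]setTI.
have mf : measurable_fun [set: 'rV[R]_d] (fun x => 2 ^+ N * x 0 i).
  by apply: measurable_funM => //; exact: measurable_coor.
apply: mf => //.
rewrite (_ : [set t | _] = `[(m 0 i)%:~R, (m 0 i + 1)%:~R[%classic) //.
apply/seteqP; split => t /=; rewrite in_itv /=.
  by move=> <-; rewrite floor_le_tmp floorD1_gt.
by move=> /floor_def.
Qed.

Lemma measurable_fun_fl N disp (T : measurableType disp) (h : 'rV[int]_d -> T) :
  measurable_fun setT (h \o fl N).
Proof.
move=> _ Y mY; rewrite setTI (_ : _ @^-1` _ = [set x | (h @^-1` Y) (fl N x)]) //.
exact: measurable_fl.
Qed.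

Definition grid N (m : 'rV[int]_d) : 'rV[R]_d := \row_i (2 ^- N * (m 0 i)%:~R).

Lemma grid_fl N x : `|x - grid N (fl N x)| <= 2 ^- N.
Proof.
apply: norm_le => [|i]; first by rewrite invr_ge0 exprn_ge0.
rewrite !mxE.
have e0 : (0 : R) < 2 ^+ N by rewrite exprn_gt0.
have h1 := floor_le_tmp (2 ^+ N * x 0 i); have h2 := floorD1_gt (2 ^+ N * x 0 i).
rewrite -{1}[x 0 i](mulKf (lt0r_neq0 e0)) -mulrBr normrM gtr0_norm ?invr_gt0//.
rewrite ler_piMr ?invr_ge0 ?(ltW e0)// ler_norml.
move: h1 h2; rewrite intrD; lra.
Qed.

(** A continuous function is the pointwise limit of its values at the corners of the dyadic
    cubes. *)
Lemma continuous_measurable_rV (f : 'rV[R]_d -> R) :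
  continuous f -> measurable_fun setT f.
Proof.
move=> cf; apply: (@measurable_fun_cvg _ _ _ _ (fun N => f \o grid N \o fl N)).
  by move=> N; exact: measurable_fun_fl.
move=> x _; apply: (@cvg_comp _ _ _ (fun N => grid N (fl N x)) f _ (nbhs x));
  last exact: cf.
apply/cvgrPdist_le => e e0.
have : (2 ^- n : R) @[n --> \oo] --> 0.
  by under eq_fun do rewrite -exprVn; apply: cvg_expr; rewrite ger0_norm// ?invr_ge0// invf_lt1// ltr1n.
move=> /cvgr0_norm_le /(_ _ e0); apply: filterS => N H.
by apply: le_trans (grid_fl N x) _; move: H; rewrite ger0_norm// invr_ge0 exprn_ge0.
Qed.

End coordinates.

Section affine_line.
Context {R : realType}.
Local Notation mu := (@lebesgue_measure R).
Local Open Scope ereal_scope.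

Lemma pushforward_measureE disp disp' (T1 : measurableType disp)
    (T2 : measurableType disp') (m : {measure set T1 -> \bar R}) (f : T1 -> T2) :
  measurable_fun setT f ->
  exists m' : {measure set T2 -> \bar R}, m' = pushforward m f :> (set T2 -> \bar R).
Proof. by move=> mf; unshelve eexists (pushforward m f). Qed.

Lemma measurable_line_affine (c b : R) :
  measurable_fun [set: measurableTypeR R]
    (fun t : measurableTypeR R => (c * t + b)%R : measurableTypeR R).
Proof. by apply: measurable_funD => //; exact: measurable_funM. Qed.

(** By uniqueness of the Lebesgue measure it suffices to compare half-open intervals. *)
Lemma lebesgue_measure_affine (c b : R) (A : set (measurableTypeR R)) : c != 0%R ->
  measurable A ->
  `|c|%:E * mu ((fun t => c * t + b)%R @^-1` A) = mu A.
Proof.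
move=> c0 mA; have [m1 m1E] := pushforward_measureE mu (measurable_line_affine c b).
pose m := mscale (NngNum (normr_ge0 c)) m1.
suff -> : mu A = m A by rewrite /m /mscale/= m1E.
apply: lebesgue_measure_unique => //= _ [[x y]] _ <-.
rewrite /m /mscale /= m1E /pushforward /=.
have [cp|cn] := ltrP 0%R c.
  have -> : ((fun t => c * t + b)%R @^-1` `]x, y]) = `]((x - b) / c)%R, ((y - b) / c)%R]%classic.
    apply/seteqP; split => t /=; rewrite !in_itv /= ltr_pdivrMr// ler_pdivlMr//; lra.
  rewrite !lebesgue_measure_itv /= !lte_fin ltr_pM2r ?invr_gt0// ltrD2r.
  case: ifP => _; last by rewrite mule0.
  by rewrite gtr0_norm// -!EFinD -EFinM; congr EFin; field.
have {}cn : (c < 0)%R by rewrite lt_neqAle c0.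
have -> : ((fun t => c * t + b)%R @^-1` `]x, y]) = `[((y - b) / c)%R, ((x - b) / c)%R[%classic.
  apply/seteqP; split => t /=; rewrite !in_itv /= ler_ndivrMr// ltr_ndivlMr//; lra.
rewrite !lebesgue_measure_itv /= !lte_fin ltr_nM2r ?invr_lt0// ltrD2r.
case: ifP => _; last by rewrite mule0.
by rewrite ltr0_norm// -!EFinD -EFinM; congr EFin; field.
Qed.

Lemma ge0_integral_affine (c b : R) (f : R -> \bar R) : c != 0%R ->
  measurable_fun setT f -> (forall t, 0 <= f t) ->
  `|c|%:E * \int[mu]_t f (c * t + b)%R = \int[mu]_t f t.
Proof.
move=> c0 mf f0; have mphi := measurable_line_affine c b.
have [m1 m1E] := pushforward_measureE mu mphi.
have := @ge0_integral_pushforward _ _ _ _ R _ mphi mu setT f measurableT mf (fun y _ => f0 y).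
rewrite preimage_setT -m1E => <-.
rewrite -(@ge0_integral_mscale _ _ _ m1 setT measurableT (NngNum (normr_ge0 c)))//=.
apply: eq_measure_integral => A mA _; rewrite -[RHS](@lebesgue_measure_affine c b)//.
by rewrite /= /mscale /= m1E.
Qed.

End affine_line.

Section integrals_rV.
Context {R : realType}.
Local Notation mu := (@lebesgue_measure R).
Local Notation leb := (@lebesgue_rV R).
Local Open Scope ereal_scope.

Lemma rV_cons_ord0 n (z : R * 'rV[R]_n) : rV_cons z 0%R ord0 = z.1.
Proof.
rewrite (_ : ord0 = lshift n (ord0 : 'I_1)); last exact: val_inj.
exact: etrans (@row_mxEl R 1 1 n _ _ _ _) (mxE _ _ _ _).
Qed.

Lemma rV_cons_lift n (z : R * 'rV[R]_n) i : rV_cons z 0%R (lift ord0 i) = z.2 0%R i.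
Proof.
rewrite (_ : lift ord0 i = rshift 1 i); last exact: val_inj.
exact: (@row_mxEr R 1 1 n).
Qed.

Lemma ge0_integral_rV_cons n (f : 'rV[R]_n.+1 -> \bar R) :
  measurable_fun setT f -> (forall x, 0 <= f x) ->
  \int[leb n.+1]_x f x = \int[mu]_t \int[leb n]_y f (rV_cons (t, y)).
Proof.
move=> mf f0; rewrite [leb n.+1]/= /lebesgue_step.
rewrite (@ge0_integral_pushforward _ _ _ _ R _ (@measurable_rV_cons R n))//.
rewrite preimage_setT (fubini_tonelli1 (m1 := mu) (m2 := leb n) (f \o @rV_cons R n))//; last by move=> ?; exact: f0.
by apply: measurableT_comp => //; exact: measurable_rV_cons.
Qed.

Lemma integral_rV0 (f : 'rV[R]_0 -> \bar R) : \int[leb 0]_x f x = f 0%R.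
Proof.
rewrite [leb 0]/= integral_dirac//= ?diracT ?mul1e//.
move=> _ Y mY; rewrite setTI.
have [Y0|Y0] := pselect (Y (f 0%R)).
  by rewrite (_ : _ @^-1` _ = setT)//; apply/seteqP; split => // x _; rewrite /= [x]thinmx0 in Y0 *.
by rewrite (_ : _ @^-1` _ = set0)//; apply/seteqP; split => // x; rewrite /= [x]thinmx0.
Qed.

Lemma measurable_prod_coor n (f : 'I_n -> R -> \bar R) :
  (forall i, measurable_fun setT (f i)) ->
  measurable_fun [set: 'rV[R]_n] (fun x => \prod_(i < n) f i (x 0%R i)).
Proof.
move=> mf.
elim: (index_enum _) => [|i s IH].
  by under eq_fun do rewrite big_nil; exact: measurable_cst.
under eq_fun do rewrite big_cons.
by apply: emeasurable_funM => //; apply: measurableT_comp => //; exact: measurable_coor.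
Qed.

Lemma ge0_integral_prod n (f : 'I_n -> R -> \bar R) :
  (forall i, measurable_fun setT (f i)) -> (forall i t, 0 <= f i t) ->
  \int[leb n]_x \prod_(i < n) f i (x 0%R i) = \prod_(i < n) \int[mu]_t f i t.
Proof.
elim: n f => [|n IH] f mf f0; first by rewrite integral_rV0 !big_ord0.
rewrite ge0_integral_rV_cons; last 2 first.
- exact: measurable_prod_coor.
- by move=> x; apply: prode_ge0.
rewrite big_ord_recl -IH//.
rewrite -ge0_integralZr//; [|exact: mf|by apply: integral_ge0 => x _; exact: prode_ge0].
apply: eq_integral => t _; rewrite -ge0_integralZl//;
  [|exact: (measurable_prod_coor (fun i => mf (lift ord0 i)))|by move=> x _; exact: prode_ge0].
apply: eq_integral => y _; rewrite big_ord_recl rV_cons_ord0/=; congr (_ * _).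
by under eq_bigr do rewrite rV_cons_lift.
Qed.

Lemma measurable_affine n (c : R) (b : 'rV[R]_n) :
  measurable_fun setT (fun x : 'rV[R]_n => c *: x + b)%R.
Proof.
apply: measurable_fun_coorP => i.
rewrite (_ : _ \o _ = fun x : 'rV[R]_n => c * x 0 i + b 0 i)%R; last first.
  by apply/funext => x; rewrite /= !mxE.
by apply: measurable_funD => //; apply: measurable_funM => //; exact: measurable_coor.
Qed.

Lemma ge0_integral_affine_rV n (c : R) (b : 'rV[R]_n) (f : 'rV[R]_n -> \bar R) :
  c != 0%R -> measurable_fun setT f -> (forall x, 0 <= f x) ->
  (`|c| ^+ n)%:E * \int[leb n]_x f (c *: x + b)%R = \int[leb n]_x f x.
Proof.
move=> c0; elim: n b f => [|n IH] b f mf f0.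
  by rewrite !integral_rV0 expr0 mul1e; congr f; apply/rowP => -[].
have mfa : measurable_fun setT (fun x : 'rV[R]_n.+1 => f (c *: x + b)%R).
  by apply: (measurableT_comp mf); exact: measurable_affine.
rewrite !ge0_integral_rV_cons//.
pose b' : 'rV[R]_n := (\row_i b 0 (lift ord0 i))%R.
pose g t := \int[leb n]_y f (rV_cons (t, y)).
have mcons t : measurable_fun setT (fun y => f (rV_cons (t, y))).
  by apply: (measurableT_comp mf); apply: (measurableT_comp (@measurable_rV_cons R n)).
have mg : measurable_fun setT g.
  apply: (measurable_fun_fubini_tonelli_F (m2 := leb n) (f \o @rV_cons R n)).
    by apply: (measurableT_comp mf); exact: measurable_rV_cons.
  by move=> z; exact: f0.
have g0 t : 0 <= g t by apply: integral_ge0.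
rewrite -(ge0_integral_affine (b 0%R ord0) c0 mg g0).
rewrite exprS EFinM -muleA; congr (_ * _).
rewrite -ge0_integralZl//; last 2 first.
- apply: (measurable_fun_fubini_tonelli_F (m2 := leb n) ((fun x => f (c *: x + b)%R) \o @rV_cons R n)).
    by apply: (measurableT_comp mfa); exact: measurable_rV_cons.
  by move=> z; exact: f0.
- by move=> t _; exact: integral_ge0.
apply: eq_integral => t _; rewrite /g -[RHS](IH b')//.
congr (_ * _); apply: eq_integral => y _; congr f.
apply/rowP => i; case: (unliftP ord0 i) => [j ->|->].
  by rewrite [LHS]mxE [X in (X + _)%R]mxE !rV_cons_lift/= !mxE.
by rewrite [LHS]mxE [X in (X + _)%R]mxE !rV_cons_ord0.
Qed.

Lemma integral_line_wt : \int[mu]_t ((1 + t ^+ 2)^-1)%:E = pi%:E.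
Proof.
have cf : continuous (fun t : R => (1 + t ^+ 2)^-1)%R := @continuous_oneDsqrV R.
rewrite ge0_symfun_integralT//.
- rewrite (_ : [set x | _] = `[0%R, +oo[%classic); last first.
    by apply/seteqP; split => t /=; rewrite in_itv/= andbT.
  by rewrite integral0y_oneDsqr -EFinM; congr EFin; field.
- by move=> t; rewrite invr_ge0 addr_ge0// sqr_ge0.
- by move=> t; rewrite /= sqrrN.
Qed.

(** A product weight of finite integral that dominates rapid decay in all directions. *)
Definition wt n (x : 'rV[R]_n) : R := (\prod_(i < n) (1 + (x 0 i) ^+ 2)^-1)%R.

Lemma wt_gt0 n (x : 'rV[R]_n) : (0 < wt x)%R.
Proof. by apply: prodr_gt0 => i _; rewrite invr_gt0 ltr_wpDr ?sqr_ge0. Qed.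

Lemma integral_wt n : \int[leb n]_x (wt x)%:E = (pi ^+ n)%:E.
Proof.
under eq_integral do rewrite /wt -prodEFin.
rewrite (ge0_integral_prod (f := fun=> fun t => ((1 + t ^+ 2)^-1)%:E)).
- by rewrite integral_line_wt prodEFin prodr_const card_ord.
- by move=> i; apply/measurable_EFinP; apply: continuous_measurable_fun; exact: continuous_oneDsqrV.
- by move=> i t; rewrite lee_fin invr_ge0 addr_ge0// sqr_ge0.
Qed.

Lemma measurable_wt n : measurable_fun setT (@wt n).
Proof.
apply/measurable_EFinP; rewrite (_ : _ \o _ = fun x : 'rV[R]_n => \prod_(i < n) ((1 + (x 0%R i) ^+ 2)^-1)%:E); last first.
  by apply/funext => x; rewrite /= /wt -prodEFin.
apply: (measurable_prod_coor (f := fun=> fun t => ((1 + t ^+ 2)^-1)%:E)) => i.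
by apply/measurable_EFinP; apply: continuous_measurable_fun; exact: continuous_oneDsqrV.
Qed.

End integrals_rV.

(** * Integrals of complex-valued functions *)

Section null_sequences.
Context {R : realType}.
Implicit Types a b : nat -> R.

(** Convergence to zero, phrased for nonnegative sequences that are only known through upper
    bounds. *)
Definition null a := forall e, 0 < e -> exists N, forall n, (N <= n)%N -> a n <= e.

Lemma null_cvg a : (forall n, 0 <= a n) -> null a <-> a n @[n --> \oo] --> 0.
Proof.
move=> a0; split => [na|/cvgrPdist_le ca e e0].
  apply/cvgrPdist_le => e e0; have [N HN] := na e e0.
  by exists N => // n /= Nn; rewrite sub0r normrN ger0_norm// HN.
have [N _ HN] := ca e e0; exists N => n Nn.
by have := HN n Nn; rewrite /= sub0r normrN ger0_norm.
Qed.

Lemma nullD a b : null a -> null b -> null (fun n => a n + b n).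
Proof.
move=> na nb e e0; have e2 : 0 < e / 2 by rewrite divr_gt0.
have [N HN] := na _ e2; have [M HM] := nb _ e2.
exists (maxn N M) => n; rewrite geq_max => /andP[Nn Mn].
by rewrite (splitr e) lerD ?HN ?HM.
Qed.

Lemma nullZ a k : 0 <= k -> null a -> null (fun n => k * a n).
Proof.
move=> k0 na e e0; have [N HN] := na (e / (k + 1)) (divr_gt0 e0 (ltr_wpDl k0 ltr01)).
exists N => n /HN h; apply: (@le_trans _ _ (k * (e / (k + 1)))); first exact: ler_wpM2l.
by rewrite mulrCA ler_piMr ?(ltW e0)// ler_pdivrMr ?mul1r ?lerDl// ltr_wpDl.
Qed.

Lemma null_le a b : (exists N, forall n, (N <= n)%N -> a n <= b n) -> null b -> null a.
Proof.
move=> [N ab] nb e /nb[M HM]; exists (maxn N M) => n; rewrite geq_max => /andP[Nn Mn].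
exact: le_trans (ab _ Nn) (HM _ Mn).
Qed.

Lemma null_expr (x : R) : 0 <= x < 1 -> null (fun n => x ^+ n).
Proof.
move=> /andP[x0 x1]; apply/null_cvg; first by move=> n; rewrite exprn_ge0.
by apply: cvg_expr; rewrite ger0_norm.
Qed.

Lemma null_exp2 : null (fun n => 2 ^- n).
Proof.
have -> : (fun n => 2 ^- n) = (fun n => (2^-1 : R) ^+ n) by apply/funext => n; rewrite exprVn.
by apply: null_expr; rewrite invr_ge0 ler0n/= invf_lt1// ltr1n.
Qed.

Lemma null_eq0 (x : R) : 0 <= x -> null (fun=> x) -> x = 0.
Proof.
move=> x0 nx; apply/eqP; rewrite eq_le x0 andbT; apply/ler_addgt0Pr => e e0.
by have [N /(_ N (leqnn N))] := nx e e0; rewrite add0r.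
Qed.

End null_sequences.

Section complex_modulus.
Context {R : realType}.
Implicit Types z w : R[i].
Local Notation Re := complex.Re.
Local Notation Im := complex.Im.

Lemma cabsE z : cabs z = Num.sqrt (Re z ^+ 2 + Im z ^+ 2).
Proof. by case: z. Qed.

Lemma cabs_ge0 z : 0 <= cabs z.
Proof. by rewrite cabsE sqrtr_ge0. Qed.

Lemma cabsM z w : cabs (z * w) = cabs z * cabs w.
Proof. exact: ComplexField.Normc.normcM. Qed.

Lemma cabsD z w : cabs (z + w) <= cabs z + cabs w.
Proof. by rewrite -lecR rmorphD /=; exact: (ler_normD z w). Qed.

Lemma cabsN z : cabs (- z) = cabs z.
Proof. by case: z => a b; rewrite /cabs /= !sqrrN. Qed.

Lemma cabsB z w : cabs (z - w) <= cabs z + cabs w.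
Proof. by rewrite (le_trans (cabsD _ _))// cabsN. Qed.

Lemma cabsBC z w : cabs (z - w) = cabs (w - z).
Proof. by rewrite -cabsN opprB. Qed.

Lemma cabs0 : cabs (0 : R[i]) = 0.
Proof. exact: ComplexField.Normc.normc0. Qed.

Lemma cabs1 : cabs (1 : R[i]) = 1.
Proof. exact: ComplexField.Normc.normc1. Qed.

Lemma cabs_eq0 z : cabs z = 0 -> z = 0.
Proof. exact: ComplexField.Normc.eq0_normc. Qed.

Lemma cabs_real (x : R) : cabs x%:C%C = `|x|.
Proof. by rewrite cabsE /= expr0n addr0 sqrtr_sqr. Qed.

Lemma cabs_sum I (s : seq I) (P : pred I) (F : I -> R[i]) :
  cabs (\sum_(i <- s | P i) F i) <= \sum_(i <- s | P i) cabs (F i).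
Proof.
elim/big_ind2: _ => [|x y x' y' h h'|//]; first by rewrite cabs0.
by rewrite (le_trans (cabsD _ _))// lerD.
Qed.

Lemma Re_le_cabs z : `|Re z| <= cabs z.
Proof. by rewrite cabsE -sqrtr_sqr ler_wsqrtr// lerDl sqr_ge0. Qed.

Lemma Im_le_cabs z : `|Im z| <= cabs z.
Proof. by rewrite cabsE -sqrtr_sqr ler_wsqrtr// lerDr sqr_ge0. Qed.

Lemma cabs_le_ReIm z : cabs z <= `|Re z| + `|Im z|.
Proof.
rewrite cabsE -[leRHS]ger0_norm ?addr_ge0// -sqrtr_sqr ler_wsqrtr//.
rewrite sqrrD !real_normK ?num_real// lerD2r lerDl.
by rewrite mulrn_wge0// mulr_ge0.
Qed.

Lemma cReD z w : Re (z + w) = Re z + Re w. Proof. by case: z; case: w. Qed.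
Lemma cImD z w : Im (z + w) = Im z + Im w. Proof. by case: z; case: w. Qed.
Lemma cReN z : Re (- z) = - Re z. Proof. by case: z. Qed.
Lemma cImN z : Im (- z) = - Im z. Proof. by case: z. Qed.
Lemma cReM z w : Re (z * w) = Re z * Re w - Im z * Im w.
Proof. by case: z; case: w. Qed.
Lemma cImM z w : Im (z * w) = Re z * Im w + Im z * Re w.
Proof. by case: z; case: w. Qed.

Lemma cabs_rotate z : exists2 u : R[i], cabs u = 1 & Re (u * z) = cabs z.
Proof.
have [z0|z0] := eqVneq (cabs z) 0.
  by exists 1; rewrite ?cabs1// mul1r z0 (cabs_eq0 z0).
have zE : Re z ^+ 2 + Im z ^+ 2 = cabs z ^+ 2.
  by rewrite cabsE sqr_sqrtr// addr_ge0// sqr_ge0.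
have {}z0 : Num.sqrt (Re z ^+ 2 + Im z ^+ 2) != 0 by rewrite -cabsE.
exists (Complex (Re z / cabs z) (- Im z / cabs z)); last first.
  rewrite cReM /= mulrAC [X in _ - X]mulrAC -mulrBl mulNr opprK -!expr2 zE expr2.
  by rewrite mulfK// cabsE.
rewrite (cabsE (Complex _ _)) /= !exprMn sqrrN -mulrDl zE -exprMn mulfV ?cabsE//.
by rewrite expr1n sqrtr1.
Qed.

Lemma complex_ext z w : Re z = Re w -> Im z = Im w -> z = w.
Proof. by case: z; case: w => a b c e /= -> ->. Qed.

Lemma cabs_realB (x y : R) : cabs (x%:C%C - y%:C%C) = `|x - y|.
Proof. by rewrite -cabs_real; congr cabs; apply: complex_ext; rewrite /= ?subrr. Qed.

Lemma cabs_expi (t : R) : cabs (expi t) = 1.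
Proof. by rewrite cabsE /= cos2Dsin2 sqrtr1. Qed.

Lemma expiD (s t : R) : expi (s + t) = expi s * expi t.
Proof.
by apply: complex_ext; rewrite ?cReM ?cImM /= ?cosD ?sinD//; rewrite addrC.
Qed.

Lemma expi0 : expi (0 : R) = 1.
Proof. by apply: complex_ext; rewrite /= ?cos0 ?sin0. Qed.

End complex_modulus.

Section complex_measurable.
Context {R : realType} {disp} {T : measurableType disp}.
Implicit Types f g : T -> R[i].
Local Notation Re := complex.Re.
Local Notation Im := complex.Im.

Definition cmeas f : Prop :=
  measurable_fun setT (fun x => Re (f x)) /\ measurable_fun setT (fun x => Im (f x)).

Lemma cmeas_cst z : cmeas (fun=> z).
Proof. by split; exact: measurable_cst. Qed.

Lemma cmeasD f g : cmeas f -> cmeas g -> cmeas (fun x => f x + g x).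
Proof.
move=> [f1 f2] [g1 g2]; split.
  by under eq_fun do rewrite cReD; exact: measurable_funD.
by under eq_fun do rewrite cImD; exact: measurable_funD.
Qed.

Lemma cmeasN f : cmeas f -> cmeas (fun x => - f x).
Proof.
move=> [f1 f2]; split.
  by under eq_fun do rewrite cReN; exact: measurableT_comp.
by under eq_fun do rewrite cImN; exact: measurableT_comp.
Qed.

Lemma cmeasM f g : cmeas f -> cmeas g -> cmeas (fun x => f x * g x).
Proof.
move=> [f1 f2] [g1 g2]; split.
  by under eq_fun do rewrite cReM; apply: measurable_funB; exact: measurable_funM.
by under eq_fun do rewrite cImM; apply: measurable_funD; exact: measurable_funM.
Qed.

Lemma cmeas_sum I (s : seq I) (P : pred I) (F : I -> T -> R[i]) :
  (forall i, cmeas (F i)) -> cmeas (fun x => \sum_(i <- s | P i) F i x).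
Proof.
move=> mF; elim: s => [|i s IH].
  by under eq_fun do rewrite big_nil; exact: cmeas_cst.
under eq_fun do rewrite big_cons.
by case: (P i) => //; exact: cmeasD.
Qed.

Lemma cmeas_comp disp' (T' : measurableType disp') (h : T' -> T) f :
  cmeas f -> measurable_fun setT h ->
  measurable_fun setT (fun x => Re (f (h x))) /\ measurable_fun setT (fun x => Im (f (h x))).
Proof. by move=> [f1 f2] mh; split; [exact: (measurableT_comp f1)|exact: (measurableT_comp f2)]. Qed.

Lemma cmeas_expi (h : T -> R) : measurable_fun setT h -> cmeas (fun x => expi (h x)).
Proof.
move=> mh; split => /=; apply: (measurableT_comp _ mh); apply: continuous_measurable_fun.
  exact: continuous_cos.
exact: continuous_sin.
Qed.

Lemma cmeas_real (h : T -> R) : measurable_fun setT h -> cmeas (fun x => (h x)%:C%C).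
Proof. by move=> mh; split => //=; exact: measurable_cst. Qed.

Lemma measurable_cabs f : cmeas f -> measurable_fun setT (fun x => cabs (f x)).
Proof.
move=> [f1 f2]; under eq_fun do rewrite cabsE.
apply: (measurableT_comp (f := @Num.sqrt R)).
  by apply: continuous_measurable_fun; exact: sqrt_continuous.
by apply: measurable_funD; exact: measurable_funX.
Qed.

Lemma cmeas_cvg (F : nat -> T -> R[i]) f : (forall n, cmeas (F n)) ->
  (forall x, null (fun n => cabs (F n x - f x))) -> cmeas f.
Proof.
move=> mF cF; split; [apply: (@measurable_fun_cvg _ _ _ _ (fun n x => Re (F n x)))
  | apply: (@measurable_fun_cvg _ _ _ _ (fun n x => Im (F n x)))] => [n|x _|n|x _];
  try by case: (mF n).
- apply/cvgrPdist_le => e e0; have [N HN] := cF x _ e0.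
  exists N => // n /= /HN; apply: le_trans.
  by rewrite -cReN -cReD (le_trans (Re_le_cabs _))// cabsBC.
- apply/cvgrPdist_le => e e0; have [N HN] := cF x _ e0.
  exists N => // n /= /HN; apply: le_trans.
  by rewrite -cImN -cImD (le_trans (Im_le_cabs _))// cabsBC.
Qed.

End complex_measurable.

Lemma integrable_le disp (T : measurableType disp) (R : realType)
   (mu : {measure set T -> \bar R}) (f g : T -> R) (B : R) :
  measurable_fun setT f -> measurable_fun setT g ->
  (forall x, `|f x| <= g x) -> (\int[mu]_x (g x)%:E <= B%:E)%E ->
  mu.-integrable setT (EFin \o f).
Proof.
move=> mf mg fg gB; apply/integrableP; split; first exact/measurable_EFinP.
apply: (@le_lt_trans _ _ (\int[mu]_x (g x)%:E)%E); last exact: le_lt_trans gB (ltry _).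
apply: ge0_le_integral => //; try exact/measurable_EFinP/measurableT_comp.
all: try by move=> x _; rewrite lee_fin (le_trans _ (fg x)).
Qed.

Lemma integrable_mulr disp (T : measurableType disp) (R : realType)
   (mu : {measure set T -> \bar R}) (f : T -> R) (k : R) :
  mu.-integrable setT (fun x => (f x)%:E) -> mu.-integrable setT (fun x => (k * f x)%:E).
Proof. by move=> fi; under eq_fun do rewrite EFinM; exact: integrableZl. Qed.

Section complex_integral.
Context {R : realType} {d : nat}.
Local Notation C := R[i].
Local Notation Rd := 'rV[R]_d.
Local Notation leb := (@lebesgue_rV R d).
Local Notation Re := complex.Re.
Local Notation Im := complex.Im.
Implicit Types (f : Rd -> C).

Definition cintble f : Prop :=
  leb.-integrable setT (fun x => (Re (f x))%:E) /\
  leb.-integrable setT (fun x => (Im (f x))%:E).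

(** An integrable dominating function together with an upper bound of its integral: bounds of
    integrals can then be added and scaled without being computed. *)
Definition majorant (g : Rd -> R) (B : R) : Prop :=
  [/\ measurable_fun setT g, forall x, 0 <= g x & (\int[leb]_x (g x)%:E <= B%:E)%E].

Lemma cintble_majorant f g B : cmeas f -> majorant g B ->
  (forall x, cabs (f x) <= g x) -> cintble f.
Proof.
move=> [f1 f2] [mg g0 gB] fg; split.
  by apply: (integrable_le f1 mg _ gB) => x; exact: le_trans (Re_le_cabs _) (fg x).
by apply: (integrable_le f2 mg _ gB) => x; exact: le_trans (Im_le_cabs _) (fg x).
Qed.

Lemma cintD (f g : Rd -> C) : cintble f -> cintble g ->
  cint setT (fun x => f x + g x) = cint setT f + cint setT g.
Proof.
move=> [f1 f2] [g1 g2]; apply: complex_ext; rewrite ?cReD ?cImD /cint /=.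
  by under eq_Rintegral do rewrite cReD; rewrite RintegralD.
by under eq_Rintegral do rewrite cImD; rewrite RintegralD.
Qed.

Lemma cintZ (c : C) f : cintble f -> cint setT (fun x => c * f x) = c * cint setT f.
Proof.
move=> [f1 f2]; apply: complex_ext; rewrite ?cReM ?cImM /cint /=.
  under eq_Rintegral do rewrite cReM.
  rewrite RintegralB//.
  - by rewrite !RintegralZl.
  - exact: integrable_mulr.
  - exact: integrable_mulr.
under eq_Rintegral do rewrite cImM.
rewrite RintegralD//.
- by rewrite !RintegralZl.
- exact: integrable_mulr.
- exact: integrable_mulr.
Qed.

Lemma cintbleZ (c : C) f : cintble f -> cintble (fun x => c * f x).
Proof.
move=> [f1 f2]; split.
  under eq_fun do rewrite cReM EFinB.
  by apply: integrableB => //; exact: integrable_mulr.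
under eq_fun do rewrite cImM EFinD.
by apply: integrableD => //; exact: integrable_mulr.
Qed.

Lemma cintbleD (f g : Rd -> C) : cintble f -> cintble g -> cintble (fun x => f x + g x).
Proof.
move=> [f1 f2] [g1 g2]; split.
  by under eq_fun do rewrite cReD EFinD; exact: integrableD.
by under eq_fun do rewrite cImD EFinD; exact: integrableD.
Qed.

Lemma cint0 : cint setT (fun _ : Rd => 0 : C) = 0.
Proof. by apply: complex_ext; rewrite /= /Rintegral integral0. Qed.

Lemma cintble0 : cintble (fun _ : Rd => 0 : C).
Proof. by split; exact: integrable0. Qed.

Lemma cintN f : cintble f -> cint setT (fun x => - f x) = - cint setT f.
Proof. by move=> fi; under eq_fun do rewrite -mulN1r; rewrite cintZ// mulN1r. Qed.

Lemma cintB (f g : Rd -> C) : cintble f -> cintble g ->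
  cint setT (fun x => f x - g x) = cint setT f - cint setT g.
Proof.
move=> fi gi; rewrite -cintN// -cintD//.
by under eq_fun do rewrite -mulN1r; exact: cintbleZ.
Qed.

Lemma cintble_sum I (s : seq I) (P : pred I) (F : I -> Rd -> C) :
  (forall i, cintble (F i)) -> cintble (fun x => \sum_(i <- s | P i) F i x).
Proof.
move=> iF; elim: s => [|i s IH].
  by under eq_fun do rewrite big_nil; exact: cintble0.
under eq_fun do rewrite big_cons.
by case: (P i) => //; exact: cintbleD.
Qed.

Lemma cint_sum I (s : seq I) (P : pred I) (F : I -> Rd -> C) :
  (forall i, cintble (F i)) ->
  cint setT (fun x => \sum_(i <- s | P i) F i x) = \sum_(i <- s | P i) cint setT (F i).
Proof.
move=> iF; elim: s => [|i s IH].
  by under eq_fun do rewrite big_nil; rewrite big_nil cint0.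
under eq_fun do rewrite big_cons.
by rewrite big_cons; case: (P i) => //; rewrite cintD ?IH//; exact: cintble_sum.
Qed.

(** Rotating the value of the integral to the positive axis reduces the bound to real functions.
    *)
Lemma cabs_cint_le f g B : cmeas f -> majorant g B ->
  (forall x, cabs (f x) <= g x) -> cabs (cint setT f) <= B.
Proof.
move=> mf mgB fg; have [mg g0 gB] := mgB.
have fi : cintble f := cintble_majorant mf mgB fg.
have B0 : 0 <= B by rewrite -lee_fin (le_trans _ gB)// integral_ge0// => x _; rewrite lee_fin.
set z := cint setT f.
have [u u1 uz] := cabs_rotate z.
rewrite -uz -cintZ// /cint /=.
have ufi := cintbleZ u fi.
apply: (@le_trans _ _ (\int[leb]_x g x)).
  apply: le_Rintegral => //; first by case: ufi.
    by apply: (integrable_le mg mg _ gB) => x; rewrite ger0_norm.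
  move=> x _; apply: le_trans (ler_norm _) _; apply: le_trans (Re_le_cabs _) _.
  by rewrite cabsM u1 mul1r.
rewrite /Rintegral -lee_fin fineK// ge0_fin_numE ?integral_ge0//.
  exact: le_lt_trans gB (ltry _).
by move=> x _; rewrite lee_fin.
Qed.

Lemma majorant_ge0 g B : majorant g B -> 0 <= B.
Proof.
by move=> [_ g0 gB]; rewrite -lee_fin (le_trans _ gB)// integral_ge0// => x _; rewrite lee_fin.
Qed.

Lemma majorantZ g B k : 0 <= k -> majorant g B -> majorant (fun x => k * g x) (k * B).
Proof.
move=> k0 [mg g0 gB]; split; first exact: measurable_funM.
  by move=> x; exact: mulr_ge0.
under eq_integral do rewrite EFinM.
rewrite ge0_integralZl//; last by move=> x _; rewrite lee_fin.
  by rewrite EFinM lee_wpmul2l// lee_fin.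
exact/measurable_EFinP.
Qed.

Lemma majorantD g1 g2 B1 B2 : majorant g1 B1 -> majorant g2 B2 ->
  majorant (fun x => g1 x + g2 x) (B1 + B2).
Proof.
move=> [m1 p1 h1] [m2 p2 h2]; split; first exact: measurable_funD.
  by move=> x; exact: addr_ge0.
under eq_integral do rewrite EFinD.
rewrite ge0_integralD//; try (by move=> x _; rewrite lee_fin); try exact/measurable_EFinP.
by rewrite EFinD leeD.
Qed.

Lemma majorant_wt (c : R) (y : Rd) : 0 < c ->
  majorant (fun x => c ^+ d * wt (c *: (x - y))) (pi ^+ d).
Proof.
move=> c0.
have mf : measurable_fun setT (fun x : Rd => wt (c *: (x - y))).
  under eq_fun do rewrite scalerBr.
  by apply: (measurableT_comp (@measurable_wt R d)); exact: measurable_affine.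
split; first exact: measurable_funM.
  by move=> x; rewrite mulr_ge0 ?exprn_ge0 ?ltW ?wt_gt0.
under eq_integral do rewrite EFinM.
rewrite ge0_integralZl//; last 3 first.
- exact/measurable_EFinP.
- by move=> x _; rewrite lee_fin ltW ?wt_gt0.
- by rewrite lee_fin exprn_ge0// ltW.
rewrite -integral_wt -(@ge0_integral_affine_rV R d c (- (c *: y)) (fun x => (wt x)%:E)).
- by rewrite gtr0_norm//; under eq_integral do rewrite scalerBr.
- by rewrite gt_eqF.
- by apply/measurable_EFinP; exact: measurable_wt.
- by move=> x; rewrite lee_fin ltW ?wt_gt0.
Qed.

Lemma majorant_wt0 : majorant (@wt R d) (pi ^+ d).
Proof.
have := @majorant_wt 1 0 ltr01; congr majorant; apply/funext => x.
by rewrite expr1n mul1r subr0 scale1r.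
Qed.

(** The weight is dominated by the bracket, hence so is every rapidly decreasing
    function. *)
Lemma bracket_wt (x : Rd) : (1 + `|x|) ^- (2 * d) <= wt x.
Proof.
rewrite exprM -exprVn -[X in _ ^+ X](card_ord d) -prodr_const /wt.
apply: ler_prod => i _; apply/andP; split; first by rewrite invr_ge0 exprn_ge0.
rewrite lef_pV2 ?posrE ?exprn_gt0//; last by rewrite ltr_wpDr ?sqr_ge0.
  have := coord_le x i; have := normr_ge0 (x 0 i); rewrite -[x 0 i ^+ 2]real_normK ?num_real//.
  by move: `|x 0 i| `|x| => a b; nra.
Qed.

Lemma wt_box (x : Rd) (r : R) : `|x| <= r -> (1 + r ^+ 2) ^- d <= wt x.
Proof.
move=> xr; rewrite -exprVn -[X in _ ^+ X](card_ord d) -prodr_const /wt.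
apply: ler_prod => i _; apply/andP; split; first by rewrite invr_ge0 addr_ge0// sqr_ge0.
rewrite lef_pV2 ?posrE; try by rewrite ltr_wpDr ?sqr_ge0.
rewrite lerD2l -[x 0 i ^+ 2]real_normK ?num_real// lerXn2r ?nnegrE//.
  exact: le_trans xr.
exact: le_trans (coord_le x i) xr.
Qed.

Lemma majorant_supported (r : R) : exists2 B, 0 <= B &
  exists2 g, majorant g B & forall x, g x >= if `|x| <= r then 1 else 0.
Proof.
pose K := (1 + r ^+ 2) ^+ d; have K0 : 0 < K by rewrite exprn_gt0// ltr_wpDr ?sqr_ge0.
exists (K * pi ^+ d); first by rewrite mulr_ge0 ?ltW// exprn_gt0// pi_gt0.
exists (fun x => K * wt x); first exact/majorantZ/majorant_wt0/ltW.
move=> x; case: ifP => xr; last by rewrite mulr_ge0 ?ltW ?wt_gt0.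
by rewrite -ler_pdivrMl// mulr1 wt_box.
Qed.

Lemma cint_affine (c : R) (b : Rd) f : c != 0 -> cintble f ->
  cintble (fun x => f (c *: x + b)) /\
  (`|c| ^+ d)%:C%C * cint setT (fun x => f (c *: x + b)) = cint setT f.
Proof.
move=> c0 [f1 f2].
have key (h : Rd -> R) : leb.-integrable setT (EFin \o h) ->
  leb.-integrable setT (EFin \o (fun x => h (c *: x + b))) /\
  `|c| ^+ d * (\int[leb]_x h (c *: x + b)) = \int[leb]_x h x.
  move=> /integrableP[mh hoo].
  have mhr : measurable_fun setT h by apply/measurable_EFinP.
  have cd0 : 0 < `|c| ^+ d by rewrite exprn_gt0// normr_gt0.
  have mha : measurable_fun setT (fun x : Rd => h (c *: x + b)).
    by apply: (measurableT_comp mhr); exact: measurable_affine.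
  have ih : leb.-integrable setT (EFin \o (fun x => h (c *: x + b))).
    apply/integrableP; split; first exact/measurable_EFinP.
    rewrite -(@lte_pmul2l _ (`|c| ^+ d)%:E)//.
    rewrite (@ge0_integral_affine_rV R d c b (fun x => `|(h x)%:E|%E)); first by rewrite gt0_muley ?lte_fin.
    - by [].
    - exact: measurableT_comp.
    - by [].
  split => //.
  have ePos := @ge0_integral_affine_rV R d c b _ c0 (measurable_funepos mh) (funepos_ge0 _).
  have eNeg := @ge0_integral_affine_rV R d c b _ c0 (measurable_funeneg mh) (funeneg_ge0 _).
  have eAll : ((`|c| ^+ d)%:E * \int[leb]_x (h (c *: x + b)%R)%:E = \int[leb]_x (h x)%:E)%E.
    rewrite [in RHS]integralE -ePos -eNeg [in LHS]integralE muleBr//.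
      by congr (_ - _)%E; congr (_ * _)%E; apply: eq_integral => x _; rewrite ?funeposE ?funenegE.
    by apply: fin_num_adde_defl; rewrite fin_numN; exact: (integrable_neg_fin_num measurableT ih).
  by rewrite /Rintegral -eAll fineM//; exact: integrable_fin_num.
have [i1 e1] := key _ f1; have [i2 e2] := key _ f2.
split; first by split.
by apply: complex_ext; rewrite ?cReM ?cImM /= mul0r ?subr0 ?addr0.
Qed.

Lemma cint_shift (b : Rd) f : cintble f -> cint setT (fun x => f (x + b)) = cint setT f.
Proof.
move=> fi; have [_ <-] := @cint_affine 1 b f (oner_neq0 _) fi.
rewrite normr1 expr1n mul1r; congr cint; apply/funext => x; by rewrite scale1r.
Qed.

Lemma cint_reflect (b : Rd) f : cintble f -> cint setT (fun x => f (b - x)) = cint setT f.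
Proof.
move=> fi; have [|_ <-] := @cint_affine (-1) b f _ fi; first by rewrite oppr_eq0 oner_eq0.
rewrite normrN normr1 expr1n mul1r; congr cint; apply/funext => x; by rewrite scaleN1r addrC.
Qed.

Lemma cint_dominated (F : nat -> Rd -> C) f g B :
  (forall n, cmeas (F n)) -> cmeas f -> majorant g B ->
  (forall n x, cabs (F n x) <= g x) ->
  {ae leb, forall x, null (fun n => cabs (F n x - f x))} ->
  null (fun n => cabs (cint setT (F n) - cint setT f)).
Proof.
move=> mF mf [mg g0 gB] Fg Ff.
have gi : leb.-integrable setT (EFin \o g).
  by apply: (integrable_le mg mg _ gB) => x; rewrite ger0_norm.
have key (p : C -> R) : (forall z w, p (z - w) = p z - p w) -> (forall z, `|p z| <= cabs z) ->
   (forall n, measurable_fun setT (fun x => p (F n x))) -> measurable_fun setT (fun x => p (f x)) ->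
   null (fun n => `|(\int[leb]_x p (F n x)) - (\int[leb]_x p (f x))|).
  move=> pB pc mpF mpf.
  have [] := @dominated_convergence _ _ _ leb setT measurableT (fun n x => (p (F n x))%:E)
    (fun x => (p (f x))%:E) (EFin \o g).
  - by move=> n; exact/measurable_EFinP.
  - exact/measurable_EFinP.
  - apply: filterS Ff => x h _; apply/fine_cvgP; split => /=; first exact: nearW.
    apply/cvgrPdist_le => e e0; have [N HN] := h _ e0.
    by exists N => // n /= /HN; apply: le_trans; rewrite -pB (le_trans (pc _))// cabsBC.
  - exact: gi.
  - by apply: aeW => x n _; rewrite /= lee_fin (le_trans (pc _)).
  move=> ip _; rewrite -[X in _ --> X -> _]fineK; last exact: integrable_fin_num.
  move=> /fine_cvgP[_ /cvgrPdist_le h] e /h[N _ HN].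
  by exists N => n /HN; rewrite /= distrC.
have k1 := key (@complex.Re R) (fun z w => etrans (cReD z (-w)) (congr1 _ (cReN w))) (@Re_le_cabs R)
  (fun n => (mF n).1) mf.1.
have k2 := key (@complex.Im R) (fun z w => etrans (cImD z (-w)) (congr1 _ (cImN w))) (@Im_le_cabs R)
  (fun n => (mF n).2) mf.2.
apply: null_le (nullD k1 k2); exists 0%N => n _.
by apply: le_trans (cabs_le_ReIm _) _; rewrite cReD cImD cReN cImN.
Qed.

Lemma cint_fubini (H : Rd -> Rd -> C) g1 B1 g2 B2 :
  cmeas (fun z : Rd * Rd => H z.1 z.2) -> majorant g1 B1 -> majorant g2 B2 ->
  (forall x y, cabs (H x y) <= g1 x * g2 y) ->
  [/\ cmeas (fun x => cint setT (H x)), cmeas (fun y => cint setT (H^~ y)) &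
   cint setT (fun x => cint setT (H x)) = cint setT (fun y => cint setT (H^~ y))].
Proof.
move=> mH [m1 p1 b1] [m2 p2 b2] Hg.
have key (p : C -> R) : (forall z, `|p z| <= cabs z) ->
  measurable_fun setT (fun z : Rd * Rd => p (H z.1 z.2)) ->
  [/\ measurable_fun setT (fun x => \int[leb]_y p (H x y)),
     measurable_fun setT (fun y => \int[leb]_x p (H x y)) &
   \int[leb]_x (\int[leb]_y p (H x y)) = \int[leb]_y (\int[leb]_x p (H x y))].
  move=> pc mpH.
  have mp1 x : measurable_fun setT (fun y => p (H x y)).
    exact: (measurableT_comp mpH (measurable_pair1 x)).
  have mp2 y : measurable_fun setT (fun x => p (H x y)).
    exact: (measurableT_comp mpH (measurable_pair2 y)).
  have mpH' : measurable_fun setT (fun z : Rd * Rd => (p (H z.1 z.2))%:E) by exact/measurable_EFinP.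
  have iH : (leb \x leb)%E.-integrable setT (fun z : Rd * Rd => (p (H z.1 z.2))%:E).
    apply/integrable12ltyP => //=.
    apply: (@le_lt_trans _ _ (\int[leb]_x ((g1 x)%:E * \int[leb]_y (g2 y)%:E))%E).
      apply: ge0_le_integral => //.
      - by move=> x _; exact: integral_ge0.
      - have := @measurable_fun_fubini_tonelli_F _ _ Rd Rd R leb (fun z => `|(p (H z.1 z.2))%:E|%E).
        by apply => //; exact: measurableT_comp.
      - by apply: emeasurable_funM => //; exact/measurable_EFinP.
      move=> x _; rewrite -ge0_integralZl//; last 3 first.
      - exact/measurable_EFinP.
      - by move=> y _; rewrite lee_fin.
      - by rewrite lee_fin.
      apply: ge0_le_integral => //.
      - by apply/measurable_EFinP; exact: measurableT_comp.
      - by apply: emeasurable_funM => //; exact/measurable_EFinP.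
      - by move=> y _; rewrite lee_fin (le_trans (pc _)).
    rewrite ge0_integralZr//; last 3 first.
    - exact/measurable_EFinP.
    - by move=> x _; rewrite lee_fin.
    - by apply: integral_ge0 => y _; rewrite lee_fin.
    by apply: lte_mul_pinfty; [apply: integral_ge0 => y _; rewrite lee_fin|
       rewrite ge0_fin_numE ?(le_lt_trans b1) ?ltry// integral_ge0// => x _; rewrite lee_fin|
       exact: le_lt_trans b2 (ltry _)].
  have mF := measurable_fubini_F iH; have mG := measurable_fubini_G iH.
  split.
  - exact: (measurableT_comp (fine_measurable measurableT) mF).
  - exact: (measurableT_comp (fine_measurable measurableT) mG).
  have fin1 x : (\int[leb]_y (p (H x y))%:E)%E \is a fin_num.
    apply: integrable_fin_num => //.
    apply: (@integrable_le _ _ _ leb (fun y => p (H x y)) (fun y => g1 x * g2 y) (g1 x * B2)).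
    - exact: mp1.
    - exact: measurable_funM.
    - by move=> y; exact: le_trans (pc _) (Hg _ _).
    - by have [] := @majorantZ g2 B2 (g1 x) (p1 x) (And3 m2 p2 b2).
  have fin2 y : (\int[leb]_x (p (H x y))%:E)%E \is a fin_num.
    apply: integrable_fin_num => //.
    apply: (@integrable_le _ _ _ leb (fun x => p (H x y)) (fun x => g2 y * g1 x) (g2 y * B1)).
    - exact: mp2.
    - exact: measurable_funM.
    - by move=> x; rewrite mulrC; exact: le_trans (pc _) (Hg _ _).
    - by have [] := @majorantZ g1 B1 (g2 y) (p2 y) (And3 m1 p1 b1).
  rewrite /Rintegral; congr fine.
  transitivity (\int[leb]_x \int[leb]_y (p (H x y))%:E)%E.
    by apply: eq_integral => x _; rewrite fineK.
  transitivity (\int[leb]_y \int[leb]_x (p (H x y))%:E)%E.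
    exact: (Fubini iH).
  by apply: eq_integral => y _; rewrite fineK.
have [a1 a2 a3] := key (@complex.Re R) (@Re_le_cabs R) mH.1.
have [c1 c2 c3] := key (@complex.Im R) (@Im_le_cabs R) mH.2.
by split; [split|split|apply: complex_ext].
Qed.

End complex_integral.

(** * Partial derivatives and smooth functions *)

Section one_variable.
Context {R : realType}.

Lemma derive_eq (V W : normedModType R) (f : V -> W) x v a b :
  is_derive x v f a -> a = b -> is_derive x v f b.
Proof. by move=> h <-. Qed.

Lemma line_lipschitz (h dh : R -> R) (a b B : R) :
  (forall t : R, is_derive t 1 h (dh t)) ->
  (forall t, Num.min a b <= t <= Num.max a b -> `|dh t| <= B) ->
  `|h b - h a| <= B * `|b - a|.
Proof.
wlog ab : a b / a <= b.
  move=> H hd hB; have [|/ltW ba] := leP a b; first by move=> ab; apply: H.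
  by rewrite distrC [X in _ * X]distrC; apply: H => // t; rewrite minC maxC; apply: hB.
move=> hd hB; have [|c cab ->] := MVT_segment ab (fun x _ => hd x).
  apply: continuous_in_subspaceT => x _; apply: differentiable_continuous.
  by apply/derivable1_diffP; case: (hd x).
rewrite normrM ler_wpM2r// hB//.
by move: cab; rewrite in_itv /= min_l// max_r.
Qed.

End one_variable.

Section line_derivatives.
Context {R : realType} {d : nat}.
Implicit Types (f g : 'rV[R]_d -> R) (x v : 'rV[R]_d).

Lemma is_derive_line f x v (t df : R) :
  is_derive t 1 (fun s => f (s *: v + x)) df <-> is_derive (t *: v + x) v f df.
Proof.
have E : (fun h : R => h^-1 *: (((fun s => f (s *: v + x)) \o shift t) (h *: 1) -
    f (t *: v + x))) = (fun h : R => h^-1 *: ((f \o shift (t *: v + x)) (h *: v) - f (t *: v + x))).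
  apply/funext => h; congr (_ *: (_ - _)); rewrite /=; congr f.
  by rewrite [h *: 1]mulr1 scalerDl addrA.
split=> -[h1 h2].
  constructor; first by rewrite /derivable -E.
  by rewrite -h2 /derive E.
constructor; first by rewrite /derivable E.
by rewrite -h2 /derive E.
Qed.

(** One changes the coordinates one after the other, and applies the mean value
    theorem to each change. *)
Lemma real_lipschitz f (f' : 'I_d -> 'rV[R]_d -> R) x v (B : R) :
  (forall i z, is_derive z (delta_mx 0 i) f (f' i z)) ->
  (forall i z, `|z - x| <= `|v| -> `|f' i z| <= B) ->
  `|f (x + v) - f x| <= d%:R * B * `|v|.
Proof.
move=> fd fB.
pose p (k : nat) : 'rV[R]_d := \row_i (x 0 i + (if (i < k)%N then v 0 i else 0)).
have p0 : p 0%N = x by apply/rowP => i; rewrite !mxE addr0.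
have pd : p d = x + v by apply/rowP => i; rewrite !mxE ltn_ord.
have -> : f (x + v) - f x = \sum_(k < d) (f (p k.+1) - f (p k)).
  suff tel n : \sum_(k < n) (f (p k.+1) - f (p k)) = f (p n) - f (p 0%N) by rewrite tel pd p0.
  elim: n => [|n IH]; first by rewrite big_ord0 subrr.
  by rewrite big_ord_recr /= IH addrC addrA subrK.
apply: le_trans (ler_norm_sum _ _ _) _.
rewrite -mulrA mulr_natl -[X in _ *+ X](card_ord d) -sumr_const; apply: ler_sum => k _.
have -> : p k.+1 = v 0 k *: delta_mx 0 k + p k.
  apply/rowP => i; rewrite !mxE eqxx /= ltnS leq_eqVlt.
  case: (eqVneq k i) => [->|ki] /=; first by rewrite ltnn eqxx /= mulr1 addr0 addrC.
  by rewrite eq_sym -val_eqE /= in ki; rewrite (negbTE ki) /= mulr0 add0r.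
have -> : f (p k) = f (0 *: delta_mx 0 k + p k) by rewrite scale0r add0r.
apply: le_trans (line_lipschitz (h := fun t => f (t *: delta_mx 0 k + p k)) (dh := fun t => f' k (t *: delta_mx 0 k + p k)) (B := B) _ _) _.
- by move=> t; apply/is_derive_line.
- move=> t ht; apply: fB; apply: norm_le => // i.
  rewrite !mxE eqxx /=.
  case: (eqVneq k i) => [<-|ki] /=.
    rewrite ltnn addr0 mulr1 addrK; apply: le_trans (coord_le v k).
    move: ht; rewrite minEle maxEle; case: ifPn => h1 /andP[h2 h3].
      by rewrite !ger0_norm.
    by move: h1; rewrite -ltNge => h1; rewrite !ler0_norm ?lerN2// ltW.
  rewrite mulr0 add0r addrAC subrr add0r; case: ifP => _; first exact: coord_le.
  by rewrite normr0.
- rewrite subr0 ler_wpM2l ?coord_le//.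
  by apply: le_trans (fB k x _); rewrite ?subrr ?normr0.
Qed.

End line_derivatives.

Section complex_derivatives.
Context {R : realType} {d : nat}.
Local Notation C := R[i].
Local Notation Rd := 'rV[R]_d.
Local Notation Re := complex.Re.
Local Notation Im := complex.Im.
Implicit Types (f g : Rd -> C) (x v : Rd) (l : seq 'I_d).

Definition ccont f : Prop :=
  continuous (fun x => Re (f x)) /\ continuous (fun x => Im (f x)).

Lemma ccont_cst c : ccont (fun=> c).
Proof. by split => x; exact: cst_continuous. Qed.

Lemma ccontD f g : ccont f -> ccont g -> ccont (fun x => f x + g x).
Proof.
move=> [f1 f2] [g1 g2]; split => x.
  by under eq_fun do rewrite cReD; exact: (continuousD (f1 x) (g1 x)).
by under eq_fun do rewrite cImD; exact: (continuousD (f2 x) (g2 x)).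
Qed.

Lemma ccontM f g : ccont f -> ccont g -> ccont (fun x => f x * g x).
Proof.
move=> [f1 f2] [g1 g2]; split => x.
  under eq_fun do rewrite cReM.
  exact: (continuousB (continuousM (f1 x) (g1 x)) (continuousM (f2 x) (g2 x))).
under eq_fun do rewrite cImM.
exact: (continuousD (continuousM (f1 x) (g2 x)) (continuousM (f2 x) (g1 x))).
Qed.

Lemma near_norm_lt x (r : R) : 0 < r -> \forall y \near x, `|y - x| < r.
Proof.
by move=> r0; apply/nbhs_ballP; exists r => //= y; rewrite -ball_normE /= distrC.
Qed.

Lemma ccontP f : ccont f <-> forall x (e : R), 0 < e -> exists2 r : R, 0 < r &
  forall y, `|y - x| < r -> cabs (f y - f x) <= e.
Proof.
split => [[f1 f2] x e e0|H].
  have e2 : 0 < e / 2 by rewrite divr_gt0.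
  have /(@cvgrPdist_le _ _ _ _ (nbhs_filter x))/(_ _ e2)/nbhs_ballP[r1 /= r10 h1] := f1 x.
  have /(@cvgrPdist_le _ _ _ _ (nbhs_filter x))/(_ _ e2)/nbhs_ballP[r2 /= r20 h2] := f2 x.
  exists (Num.min r1 r2); first by rewrite lt_min r10.
  move=> y; rewrite lt_min => /andP[y1 y2]; rewrite cabsBC.
  apply: le_trans (cabs_le_ReIm _) _; rewrite (splitr e) cReD cImD cReN cImN.
  by apply: lerD; [apply: h1|apply: h2]; rewrite -ball_normE /= distrC.
split => x; apply/(@cvgrPdist_le _ _ _ _ (nbhs_filter x)) => e e0; have [r r0 h] := H x e e0;
  apply: filterS (near_norm_lt x r0) => y /h; rewrite cabsBC; apply: le_trans.
  by rewrite -cReN -cReD; exact: Re_le_cabs.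
by rewrite -cImN -cImD; exact: Im_le_cabs.
Qed.

Lemma ccont_affine (c : R) (b : Rd) f : ccont f -> ccont (fun x => f (c *: x + b)).
Proof.
move=> /ccontP cf; apply/ccontP => x e e0; have [r r0 h] := cf (c *: x + b) e e0.
exists (r / (`|c| + 1)); first by rewrite divr_gt0// ltr_wpDl.
move=> y hy; apply: h; rewrite opprD addrACA subrr addr0 -scalerBr normrZ.
apply: le_lt_trans (_ : (`|c| + 1) * `|y - x| < r); first by rewrite ler_wpM2r// lerDl.
by rewrite mulrC -ltr_pdivlMr// ltr_wpDl.
Qed.

Lemma ccont_cmeas f : ccont f -> cmeas f.
Proof. by move=> [f1 f2]; split; exact: continuous_measurable_rV. Qed.

(** Local Lipschitz bounds are how continuity is established here. *)
Lemma ccont_lip f : (forall x, exists2 K : R, 0 <= K &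
  forall y, `|y - x| <= 1 -> cabs (f y - f x) <= K * `|y - x|) -> ccont f.
Proof.
move=> H.
apply/ccontP => x e e0; have [K K0 HK] := H x.
exists (Num.min 1 (e / (K + 1))); first by rewrite lt_min ltr01 divr_gt0// ltr_wpDl.
move=> y; rewrite lt_min => /andP[/ltW h1 /ltW h2].
apply: le_trans (HK _ h1) _.
apply: (@le_trans _ _ (K * (e / (K + 1)))); first exact: ler_wpM2l.
by rewrite mulrCA ler_piMr ?(ltW e0)// ler_pdivrMr ?mul1r ?lerDl// ltr_wpDl.
Qed.

Definition is_cder (i : 'I_d) f f' : Prop := forall x,
  is_derive x (delta_mx 0 i) (fun y => Re (f y)) (Re (f' x)) /\
  is_derive x (delta_mx 0 i) (fun y => Im (f y)) (Im (f' x)).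

Definition cder (i : 'I_d) f : Rd -> C := cpderiv [:: i] f.

Lemma cpderiv_cons i l f : cpderiv (i :: l) f = cder i (cpderiv l f).
Proof. by []. Qed.

Lemma cpderiv_nil f : cpderiv [::] f = f.
Proof. by apply/funext => x; rewrite /cpderiv /=; case: (f x). Qed.

Lemma is_cderE i f f' : is_cder i f f' -> cder i f = f'.
Proof.
move=> H; apply/funext => x; have [h1 h2] := H x.
by apply: complex_ext; rewrite /cder /cpderiv /=; exact: derive_val.
Qed.

Lemma cpderiv_rcons l i f : cpderiv (rcons l i) f = cpderiv l (cder i f).
Proof.
by elim: l => [|j l IH]; rewrite ?cpderiv_nil// /= !cpderiv_cons IH.
Qed.

Lemma is_cderD i f g f' g' : is_cder i f f' -> is_cder i g g' ->
  is_cder i (fun x => f x + g x) (fun x => f' x + g' x).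
Proof.
move=> hf hg x; have [a1 a2] := hf x; have [b1 b2] := hg x; split.
  by rewrite cReD; under eq_fun do rewrite cReD; exact: is_deriveD.
by rewrite cImD; under eq_fun do rewrite cImD; exact: is_deriveD.
Qed.

Lemma is_cderM i f g f' g' : is_cder i f f' -> is_cder i g g' ->
  is_cder i (fun x => f x * g x) (fun x => f' x * g x + f x * g' x).
Proof.
move=> hf hg x; have [a1 a2] := hf x; have [b1 b2] := hg x; split.
  rewrite cReD !cReM; under eq_fun do rewrite cReM.
  apply: (derive_eq (is_deriveB (is_deriveM a1 b1) (is_deriveM a2 b2))); rewrite /= /GRing.scale /=; ring.
rewrite cImD !cImM; under eq_fun do rewrite cImM.
apply: (derive_eq (is_deriveD (is_deriveM a1 b2) (is_deriveM a2 b1))); rewrite /= /GRing.scale /=; ring.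
Qed.

Lemma is_cder_cst i c : is_cder i (fun=> c) (fun=> 0).
Proof. by move=> x; split; exact: is_derive_cst. Qed.

Lemma is_cder_affine i f f' (c : R) (b : Rd) : is_cder i f f' ->
  is_cder i (fun x => f (c *: x + b)) (fun x => c%:C%C * f' (c *: x + b)).
Proof.
have key (h h' : Rd -> R) x : (forall y, is_derive y (delta_mx 0 i) h (h' y)) ->
   is_derive x (delta_mx 0 i) (fun x => h (c *: x + b)) (c * h' (c *: x + b)).
  move=> hd; rewrite -{1}[x]add0r -{1}(scale0r (delta_mx 0 i : Rd)); apply/is_derive_line.
  have -> : (fun s : R => h (c *: (s *: delta_mx 0 i + x) + b)) =
     (fun s => h (s *: delta_mx 0 i + (c *: x + b))) \o (fun s => c * s).
    by apply/funext => s /=; rewrite scalerDr scalerA addrA.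
  rewrite mulrC; apply: is_derive1_comp.
    apply/is_derive_line.
    have := hd ((c * 0) *: delta_mx 0 i + (c *: x + b)).
    by rewrite mulr0 scale0r add0r.
  have := @is_deriveM R R (cst c) id 0 1 0 1 (is_derive_cst _ _ _) (is_derive_id _ _).
  by move=> hh; apply: (derive_eq hh); rewrite scaler0 addr0 /GRing.scale /= mulr1.
move=> hf x; split.
  by rewrite cReM /= mul0r subr0; apply: (key (fun y => Re (f y)) (fun y => Re (f' y))) => y; case: (hf y).
by rewrite cImM /= mul0r addr0; apply: (key (fun y => Im (f y)) (fun y => Im (f' y))) => y; case: (hf y).
Qed.

Lemma is_cder_coord i j :
  is_cder i (fun x => (x 0 j)%:C%C) (fun=> (i == j)%:R%:C%C).
Proof.
move=> x; split; last exact: is_derive_cst.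
rewrite /= -{1}[x]add0r -{1}(scale0r (delta_mx 0 i : Rd)); apply/is_derive_line.
have -> : (fun s : R => (s *: delta_mx 0 i + x) 0 j) = (fun s => s * (i == j)%:R + x 0 j).
  by apply/funext => s; rewrite !mxE eqxx /= eq_sym.
have h := @is_deriveM R R id (cst ((i == j)%:R : R)) 0 1 1 0 (is_derive_id _ _) (is_derive_cst _ _ _).
have := is_deriveD h (is_derive_cst (x 0 j) 0 (1 : R)).
by move=> hh; apply: (derive_eq hh); rewrite scaler0 add0r addr0 /GRing.scale /= mulr1.
Qed.

Lemma is_cder_fun1 i j (h h' : R -> R) : (forall t : R, is_derive t 1 h (h' t)) ->
  is_cder i (fun x => (h (x 0 j))%:C%C) (fun x => (if i == j then h' (x 0 j) else 0)%:C%C).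
Proof.
move=> hd x; split; last exact: is_derive_cst.
have cj : is_derive (0 : R) 1 (fun s : R => (s *: delta_mx 0 i + x) 0 j) (i == j)%:R.
  apply/(is_derive_line (fun y : Rd => y 0 j)); rewrite scale0r add0r.
  by have [] := is_cder_coord i j x.
rewrite /= -{1}[x]add0r -{1}(scale0r (delta_mx 0 i : Rd)); apply/is_derive_line.
have := @is_derive1_comp R h (fun s : R => (s *: delta_mx 0 i + x) 0 j) 0 _ _ (hd _) cj.
move=> hh; apply: (derive_eq hh).
by rewrite scale0r add0r; case: ifP; rewrite ?mulr1 ?mulr0.
Qed.

Lemma is_cder_expi i (y : Rd) (k : R) :
  is_cder i (fun x => expi (k * dot x y))
    (fun x => Complex 0 (k * y 0 i) * expi (k * dot x y)).
Proof.
have key (h h' : R -> R) x : (forall t : R, is_derive t 1 h (h' t)) ->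
   is_derive x (delta_mx 0 i) (fun x => h (k * dot x y)) (h' (k * dot x y) * (k * y 0 i)).
  move=> hd; rewrite -{1}[x]add0r -{1}(scale0r (delta_mx 0 i : Rd)); apply/is_derive_line.
  have -> : (fun s : R => h (k * dot (s *: delta_mx 0 i + x) y)) =
     h \o (fun s => (k * y 0 i) * s + k * dot x y).
    apply/funext => s /=; congr h; rewrite -[X in _ = X + _]mulrA -mulrDr; congr (_ * _).
    rewrite /dot (bigD1 i) //= [in RHS](bigD1 i)//= addrA; congr (_ + _).
      by rewrite !mxE !eqxx /=; ring.
    by apply: eq_bigr => j /negbTE ji; rewrite !mxE eqxx /= ji mulr0 add0r.
  apply: is_derive1_comp; first by rewrite mulr0 add0r.
  have h1 := @is_deriveM R R (cst (k * y 0 i)) id 0 1 0 1 (is_derive_cst _ _ _) (is_derive_id _ _).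
  have := is_deriveD h1 (is_derive_cst (k * dot x y) 0 (1 : R)).
  by move=> hh; apply: (derive_eq hh); rewrite scaler0 !addr0 /GRing.scale /= mulr1.
move=> x; split.
  rewrite cReM /= mul0r sub0r; apply: (derive_eq (key _ _ x (@is_derive_cos R))).
  by rewrite mulNr mulrC.
rewrite cImM /= mul0r add0r; apply: (derive_eq (key _ _ x (@is_derive_sin R))).
by rewrite mulrC.
Qed.

Lemma clipschitz f (f' : 'I_d -> Rd -> C) x v (B : R) :
  (forall i, is_cder i f (f' i)) ->
  (forall i z, `|z - x| <= `|v| -> cabs (f' i z) <= B) ->
  cabs (f (x + v) - f x) <= (2 * d)%:R * B * `|v|.
Proof.
move=> fd fB; apply: le_trans (cabs_le_ReIm _) _.
rewrite natrM -!mulrA mulr_natl mulr2n mulrA cReD cImD cReN cImN.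
apply: lerD.
  apply: (@real_lipschitz _ _ (fun y => Re (f y)) (fun i y => Re (f' i y))).
    by move=> i z; case: (fd i z).
  by move=> i z h; apply: le_trans (Re_le_cabs _) (fB i z h).
apply: (@real_lipschitz _ _ (fun y => Im (f y)) (fun i y => Im (f' i y))).
  by move=> i z; case: (fd i z).
by move=> i z h; apply: le_trans (Im_le_cabs _) (fB i z h).
Qed.

(** Smoothness is a coinductive notion: a class of continuous functions that is
    stable under the partial derivatives consists of smooth functions. *)
Lemma smooth_coind (P : (Rd -> C) -> Prop) :
  (forall f, P f -> ccont f /\ forall i, exists2 f', P f' & is_cder i f f') ->
  forall f, P f -> smooth f /\ forall l, P (cpderiv l f).
Proof.
move=> HP f Pf.
have Pl l : P (cpderiv l f).
  elim: l => [|i l IH]; first by rewrite cpderiv_nil.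
  have [_ /(_ i)[f' Pf' hf']] := HP _ IH.
  by rewrite cpderiv_cons (is_cderE hf').
split=> //; split => l; have [[c1 c2] hd] := HP _ (Pl l); split => // i x.
  by have [f' _ /(_ x)[[]]] := hd i.
by have [f' _ /(_ x)[_ []]] := hd i.
Qed.

Lemma smooth_ccont f : smooth f -> ccont f.
Proof. by move=> [h1 h2]; split; [case: (h1 [::])|case: (h2 [::])]. Qed.

Lemma smooth_is_cder f i : smooth f -> is_cder i f (cder i f).
Proof.
move=> [h1 h2] x; split.
  by have [_ /(_ i x)] := h1 [::] => /derivableP.
by have [_ /(_ i x)] := h2 [::] => /derivableP.
Qed.

Lemma smooth_cpderiv f l : smooth f -> smooth (cpderiv l f).
Proof.
move=> [h1 h2]; split => l'.
  by have := h1 (l' ++ l); rewrite /pderiv foldr_cat.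
by have := h2 (l' ++ l); rewrite /pderiv foldr_cat.
Qed.

Lemma smooth_cder f i : smooth f -> smooth (cder i f).
Proof. exact: smooth_cpderiv. Qed.

Inductive smooth_alg : (Rd -> C) -> Prop :=
| sa_smooth f : smooth f -> smooth_alg f
| sa_add f g : smooth_alg f -> smooth_alg g -> smooth_alg (fun x => f x + g x)
| sa_mul f g : smooth_alg f -> smooth_alg g -> smooth_alg (fun x => f x * g x)
| sa_affine f (c : R) (b : Rd) : smooth_alg f -> smooth_alg (fun x => f (c *: x + b)).

Lemma smooth_alg_cst c : smooth_alg (fun=> c).
Proof.
apply: sa_smooth; apply: (@smooth_coind (fun f => exists c, f = fun=> c) _ _ _).1; last by exists c.
move=> _ [c' ->]; split; first exact: ccont_cst.
by move=> i; exists (fun=> 0); [exists 0|exact: is_cder_cst].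
Qed.

Lemma smooth_algP f : smooth_alg f -> smooth f.
Proof.
move=> af; apply: (@smooth_coind smooth_alg _ f af).1 => {f af} f; elim=> {f}.
- move=> f sf; split; first exact: smooth_ccont.
  by move=> i; exists (cder i f); [exact/sa_smooth/smooth_cder|exact: smooth_is_cder].
- move=> f g af [cf hf] ag [cg hg]; split; first exact: ccontD.
  move=> i; have [f' af' hf'] := hf i; have [g' ag' hg'] := hg i.
  by exists (fun x => f' x + g' x); [exact: sa_add|exact: is_cderD].
- move=> f g af [cf hf] ag [cg hg]; split; first exact: ccontM.
  move=> i; have [f' af' hf'] := hf i; have [g' ag' hg'] := hg i.
  exists (fun x => f' x * g x + f x * g' x); last exact: is_cderM.
  by apply: sa_add; exact: sa_mul.
- move=> f c b af [cf hf]; split; first exact: ccont_affine.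
  move=> i; have [f' af' hf'] := hf i.
  exists (fun x => c%:C%C * f' (c *: x + b)); last exact: is_cder_affine.
  by apply: sa_mul; [exact: smooth_alg_cst|exact: sa_affine].
Qed.

Lemma smooth_cst (c : C) : smooth (fun _ : Rd => c).
Proof. exact/smooth_algP/smooth_alg_cst. Qed.

Lemma smoothD f g : smooth f -> smooth g -> smooth (fun x => f x + g x).
Proof. by move=> sf sg; apply/smooth_algP/sa_add; apply: sa_smooth. Qed.

Lemma smoothM f g : smooth f -> smooth g -> smooth (fun x => f x * g x).
Proof. by move=> sf sg; apply/smooth_algP/sa_mul; apply: sa_smooth. Qed.

Lemma smoothB f g : smooth f -> smooth g -> smooth (fun x => f x - g x).
Proof.
move=> sf sg; have := smoothD sf (smoothM (smooth_cst (-1)) sg).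
by congr smooth; apply/funext => x; rewrite mulN1r.
Qed.

Lemma smooth_affine f (c : R) (b : Rd) : smooth f -> smooth (fun x => f (c *: x + b)).
Proof. by move=> sf; apply/smooth_algP/sa_affine; apply: sa_smooth. Qed.

Lemma smooth_shift f (b : Rd) : smooth f -> smooth (fun x => f (x - b)).
Proof.
by move=> sf; have := smooth_affine 1 (- b) sf; under eq_fun do rewrite scale1r.
Qed.

Lemma smooth_coord j : smooth (fun x : Rd => (x 0 j)%:C%C).
Proof.
apply: (@smooth_coind (fun f => f = (fun x : Rd => (x 0 j)%:C%C) \/ exists c, f = fun=> c) _ _ _).1;
  last by left.
move=> _ [->|[c ->]]; split.
- by split => x; [exact: coord_continuous|exact: cst_continuous].
- move=> i; exists (fun=> (i == j)%:R%:C%C); last exact: is_cder_coord.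
  by right; eexists.
- exact: ccont_cst.
- by move=> i; exists (fun=> 0); [right; exists 0|exact: is_cder_cst].
Qed.

Lemma cpderivD l f g x : smooth f -> smooth g ->
  cpderiv l (fun x => f x + g x) x = cpderiv l f x + cpderiv l g x.
Proof.
move=> sf sg; elim: l x => [|i l IH] x; first by rewrite !cpderiv_nil.
have E : cpderiv l (fun x => f x + g x) = (fun x => cpderiv l f x + cpderiv l g x).
  exact/funext.
rewrite !cpderiv_cons E.
by rewrite (is_cderE (is_cderD (smooth_is_cder i (smooth_cpderiv l sf)) (smooth_is_cder i (smooth_cpderiv l sg)))).
Qed.

Lemma cpderiv_affine l f (c : R) (b : Rd) x : smooth f ->
  cpderiv l (fun x => f (c *: x + b)) x = (c ^+ size l)%:C%C * cpderiv l f (c *: x + b).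
Proof.
move=> sf; elim: l x => [|i l IH] x; first by rewrite !cpderiv_nil mul1r.
have E : cpderiv l (fun x => f (c *: x + b)) =
   (fun x => (c ^+ size l)%:C%C * cpderiv l f (c *: x + b)) by exact/funext.
rewrite !cpderiv_cons E.
rewrite (is_cderE (is_cderM (is_cder_cst i _) (is_cder_affine c b (smooth_is_cder i (smooth_cpderiv l sf))))).
by rewrite mul0r add0r mulrA -rmorphM /= -exprSr.
Qed.

Lemma cpderiv_shift l f (b : Rd) x : smooth f ->
  cpderiv l (fun x => f (x - b)) x = cpderiv l f (x - b).
Proof.
move=> sf; have := cpderiv_affine l 1 (- b) x sf; rewrite expr1n mul1r scale1r => <-.
by congr cpderiv; apply/funext => y; rewrite scale1r.
Qed.

Lemma cpderiv_cst l c x : cpderiv l (fun _ : Rd => c) x = if l is [::] then c else 0.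
Proof.
case/lastP: l => [|l i]; first by rewrite cpderiv_nil.
rewrite cpderiv_rcons (is_cderE (is_cder_cst i c)) headI /=.
elim: l x => [|j l IH] x; first by rewrite cpderiv_nil.
rewrite cpderiv_cons; have -> : cpderiv l (fun _ : Rd => 0 : C) = fun=> 0 by exact/funext.
by rewrite (is_cderE (is_cder_cst j 0)).
Qed.

(** A crude Leibniz rule: only the number of terms matters. *)
Lemma leibniz_bound k l (b g : Rd -> C) x (B G : R) : smooth b -> smooth g ->
  (forall l', (size l' <= k)%N -> cabs (cpderiv l' b x) <= B) ->
  (forall l', (size l' <= k)%N -> cabs (cpderiv l' g x) <= G) ->
  (size l <= k)%N ->
  cabs (cpderiv l (fun x => b x * g x) x) <= 2 ^+ size l * (B * G).
Proof.
elim/last_ind: l k b g => [|l i IH] k b g sb sg hB hG lk.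
  rewrite cpderiv_nil cabsM mul1r ler_pM ?cabs_ge0//.
    by have := hB [::] isT; rewrite cpderiv_nil.
  by have := hG [::] isT; rewrite cpderiv_nil.
move: lk; rewrite size_rcons; case: k hB hG => // k hB hG lk.
rewrite cpderiv_rcons (is_cderE (is_cderM (smooth_is_cder i sb) (smooth_is_cder i sg))).
have sb' := smooth_cder i sb; have sg' := smooth_cder i sg.
rewrite (cpderivD l x (smoothM sb' sg) (smoothM sb sg')); apply: le_trans (cabsD _ _) _.
rewrite exprS -mulrA mulr_natl mulr2n; apply: lerD; apply: (IH k) => //.
- by move=> l' h; rewrite -cpderiv_rcons hB// size_rcons.
- by move=> l' h; rewrite hG// ltnW.
- by move=> l' h; rewrite hB// ltnW.
- by move=> l' h; rewrite -cpderiv_rcons hG// size_rcons.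
Qed.

Lemma cpderiv_local_zero f (A : set Rd) l x : smooth f -> open A ->
  (forall y, A y -> f y = 0) -> A x -> cpderiv l f x = 0.
Proof.
move=> sf oA fA; elim: l x => [|i l IH] x Ax; first by rewrite cpderiv_nil fA.
have nA : \forall y \near x, A y by exact: open_nbhs_nbhs.
rewrite cpderiv_cons; apply: complex_ext; rewrite /= -[RHS](@derive_val _ _ _ _ _ _ _ (is_derive_cst (0 : R) x (delta_mx 0 i))); apply: near_eq_derive.
  by apply: filterS nA => y /IH/(congr1 (@complex.Re R)).
by apply: filterS nA => y /IH/(congr1 (@complex.Im R)).
Qed.

End complex_derivatives.

(** * Schwartz functions, tempered distributions and cutoffs *)

Section brackets.
Context {R : realType} {d : nat}.
Implicit Types x y : 'rV[R]_d.

Definition br x : R := 1 + `|x|.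

Lemma br_ge1 x : 1 <= br x.
Proof. by rewrite lerDl. Qed.

Lemma br_gt0 x : 0 < br x.
Proof. exact: lt_le_trans (br_ge1 x). Qed.

Lemma brN x : br (- x) = br x.
Proof. by rewrite /br normrN. Qed.

Lemma br_add x y : br (x + y) <= br x * br y.
Proof.
have := ler_normD x y; have := normr_ge0 x; have := normr_ge0 y.
by rewrite /br; move: `|x| `|y| `|x + y| => a b c; nra.
Qed.

Lemma br_sub x y : br x <= br (x - y) * br y.
Proof. by rewrite -{1}(subrK y x) br_add. Qed.

Lemma br_expM x y k : br (x + y) ^+ k <= br x ^+ k * br y ^+ k.
Proof. by rewrite -exprMn lerXn2r ?nnegrE ?br_add// ?mulr_ge0 ?ltW ?br_gt0. Qed.

Lemma br_exp_ge1 x k : 1 <= br x ^+ k.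
Proof. by rewrite exprn_ege1// br_ge1. Qed.

Lemma br_le_exp x k k' : (k <= k')%N -> br x ^+ k <= br x ^+ k'.
Proof. by move=> kk; rewrite ler_weXn2l// br_ge1. Qed.

Lemma dot_ge0 x : 0 <= dot x x.
Proof. by apply: sumr_ge0 => i _; rewrite -expr2 sqr_ge0. Qed.

Lemma norm_le_eucl x : `|x| <= eucl x.
Proof.
apply: norm_le => [|i]; first exact: sqrtr_ge0.
rewrite -sqrtr_sqr ler_wsqrtr// /dot (bigD1 i)//= -expr2 lerDl.
by apply: sumr_ge0 => j _; rewrite -expr2 sqr_ge0.
Qed.

Lemma eucl_le_norm x : eucl x <= d%:R * `|x|.
Proof.
rewrite -[leRHS]ger0_norm ?mulr_ge0// -sqrtr_sqr ler_wsqrtr//.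
apply: (@le_trans _ _ (\sum_(i < d) `|x| ^+ 2)).
  apply: ler_sum => i _; rewrite -expr2 -[x 0 i ^+ 2]real_normK ?num_real//.
  by rewrite lerXn2r ?nnegrE// coord_le.
rewrite sumr_const card_ord -[leLHS]mulr_natl exprMn; apply: ler_wpM2r; first exact: sqr_ge0.
by rewrite -natrX ler_nat; case: d => // n; rewrite expnS leq_pmulr.
Qed.

End brackets.

Section schwartz_class.
Context {R : realType} {d : nat}.
Local Notation C := R[i].
Local Notation Rd := 'rV[R]_d.
Implicit Types (f g : Rd -> C) (x v : Rd) (l : seq 'I_d) (k : nat).

(** Bounds of the Schwartz seminorms, with the maximum norm as weight. *)
Definition sbound k f (B : R) : Prop :=
  forall l x, (size l <= k)%N -> br x ^+ k * cabs (cpderiv l f x) <= B.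

Lemma sbound_ge0 k f B : sbound k f B -> 0 <= B.
Proof.
move=> /(_ [::] 0 isT); apply: le_trans.
by rewrite mulr_ge0 ?cabs_ge0// exprn_ge0// ltW// br_gt0.
Qed.

Lemma list_bound (P : seq 'I_d -> R -> Prop) :
  (forall l B B', B <= B' -> P l B -> P l B') ->
  (forall l, exists B, P l B) ->
  forall k, exists2 B : R, 0 <= B & forall l, (size l <= k)%N -> P l B.
Proof.
move=> Pm Pe k; elim: k P Pm Pe => [|k IH] P Pm Pe.
  have [B PB] := Pe [::]; exists (Num.max 0 B); first by rewrite le_max lexx.
  by case => // _; apply: Pm PB; rewrite le_max lexx orbT.
have [||B1 B10 H1] := IH (fun l B => forall i, P (i :: l) B).
- by move=> l B B' BB h i; apply: Pm (h i).
- move=> l; have /choice[F HF] : forall i, exists B, P (i :: l) B by move=> i.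
  exists (\sum_i `|F i|) => i; apply: Pm (HF i).
  by rewrite (bigD1 i)//= (le_trans (ler_norm _))// lerDl sumr_ge0.
have [B PB] := Pe [::].
exists (B1 + `|B|); first by rewrite addr_ge0.
case => [|i l] h; first by apply: Pm PB; rewrite (le_trans (ler_norm _))// lerDr.
by apply: Pm (H1 l h i); rewrite lerDl.
Qed.

Lemma schwartz_norm_sbound k f B : (schwartz_norm k f <= B%:E)%E -> sbound k f B.
Proof.
move=> h l x lk; rewrite -lee_fin; apply: le_trans h.
apply: (@le_trans _ _ ((1 + eucl x) ^+ k * cabs (cpderiv l f x))%:E).
  rewrite lee_fin ler_wpM2r ?cabs_ge0// lerXn2r ?nnegrE ?lerD2l ?norm_le_eucl//.
    by rewrite ltW// br_gt0.
  by rewrite addr_ge0// sqrtr_ge0.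
by apply: ereal_sup_ubound; exists (l, x).
Qed.

Lemma sbound_schwartz_norm k f B : sbound k f B ->
  (schwartz_norm k f <= ((1 + d%:R) ^+ k * B)%:E)%E.
Proof.
move=> h; apply: ge_ereal_sup => _ [[l x] /= lk <-].
rewrite lee_fin; apply: le_trans (ler_wpM2l _ (h l x lk)); last by rewrite exprn_ge0// addr_ge0.
rewrite mulrA ler_wpM2r ?cabs_ge0// -exprMn lerXn2r// ?nnegrE.
- by rewrite addr_ge0// sqrtr_ge0.
- by rewrite mulr_ge0 ?addr_ge0// ltW// br_gt0.
have := eucl_le_norm x; have := normr_ge0 x; have : (0 : R) <= d%:R by [].
by rewrite /br; move: (eucl x) `|x| (d%:R) => a b c; nra.
Qed.

Lemma schwartzP f : schwartz f <-> smooth f /\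
  forall l k, exists B, forall x, br x ^+ k * cabs (cpderiv l f x) <= B.
Proof.
split=> [[sf H]|[sf H]]; (split; first exact: sf); [move=> l k|move=> k].
  have : schwartz_norm (maxn k (size l)) f \is a fin_num.
    rewrite ge0_fin_numE ?H//; apply: le_trans (ereal_sup_ubound (ex_intro2 _ _ ([::], 0) isT erefl)).
    by rewrite lee_fin mulr_ge0 ?cabs_ge0// exprn_ge0// addr_ge0// sqrtr_ge0.
  move=> fn; have := @schwartz_norm_sbound (maxn k (size l)) f (fine (schwartz_norm (maxn k (size l)) f)).
  rewrite fineK// => /(_ (lexx _)) h; exists (fine (schwartz_norm (maxn k (size l)) f)) => x.
  apply: le_trans (h l x (leq_maxr _ _)).
  by rewrite ler_wpM2r ?cabs_ge0// br_le_exp// leq_maxl.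
have [||B B0 HB] := @list_bound (fun l B => forall x, br x ^+ k * cabs (cpderiv l f x) <= B) _ _ k.
- by move=> l B B' BB h x; exact: le_trans (h x) BB.
- by move=> l; exact: H.
apply: le_lt_trans (@sbound_schwartz_norm k f B _) (ltry _).
by move=> l x lk; exact: HB.
Qed.

Lemma schwartz_smooth f : schwartz f -> smooth f.
Proof. by case. Qed.

Lemma schwartz_sbound f k : schwartz f -> exists2 B : R, 0 <= B & sbound k f B.
Proof.
move=> /schwartzP[sf H].
have [||B B0 HB] := @list_bound (fun l B => forall x, br x ^+ k * cabs (cpderiv l f x) <= B) _ _ k.
- by move=> l B B' BB h x; exact: le_trans (h x) BB.
- by move=> l; exact: H.
by exists B => // l x lk; exact: HB.
Qed.

Lemma schwartz_decay f k : schwartz f ->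
  exists2 B : R, 0 <= B & forall x, cabs (f x) <= B * br x ^- k.
Proof.
move=> sf; have [B B0 h] := schwartz_sbound k sf; exists B => // x.
rewrite ler_pdivlMr ?exprn_gt0 ?br_gt0// mulrC.
by have := h [::] x isT; rewrite cpderiv_nil.
Qed.

Lemma schwartz_cder f i : schwartz f -> schwartz (cder i f).
Proof.
move=> /schwartzP[sf H]; apply/schwartzP; split; first exact: smooth_cder.
by move=> l k; have := H (rcons l i) k; rewrite cpderiv_rcons.
Qed.

Lemma schwartz_cpderiv f l : schwartz f -> schwartz (cpderiv l f).
Proof.
move=> /schwartzP[sf H]; apply/schwartzP; split; first exact: smooth_cpderiv.
move=> l' k; have [B h] := H (l' ++ l) k; exists B => x; apply: le_trans (h x).
by rewrite /cpderiv /pderiv !foldr_cat.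
Qed.

(** Multiplication by a smooth function whose derivatives are bounded where the
    other factor lives. *)
Lemma sboundM k (b g : Rd -> C) (A B : R) : smooth b -> smooth g ->
  (forall l x, (size l <= k)%N -> cabs (cpderiv l b x) <= A) -> sbound k g B ->
  sbound k (fun x => b x * g x) (2 ^+ k * (A * B)).
Proof.
move=> sb sg hA hB l x lk.
have A0 : 0 <= A by apply: le_trans (hA [::] 0 isT); exact: cabs_ge0.
have B0 := sbound_ge0 hB.
rewrite mulrC -ler_pdivlMr ?exprn_gt0 ?br_gt0//.
apply: le_trans (leibniz_bound (k := k) (x := x) (B := A) (G := B / br x ^+ k) sb sg _ _ lk) _.
- by move=> l'; exact: hA.
- by move=> l' h; rewrite ler_pdivlMr ?exprn_gt0 ?br_gt0// mulrC hB.
rewrite !mulrA ler_wpM2r ?invr_ge0 ?exprn_ge0 ?(ltW (br_gt0 x))// ler_wpM2r// ler_wpM2r//.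
by rewrite ler_weXn2l// ler1n.
Qed.

Lemma schwartzM b g : smooth b -> schwartz g ->
  (forall l, exists B, forall x, cabs (cpderiv l b x) <= B) ->
  schwartz (fun x => b x * g x).
Proof.
move=> sb sg hb; apply/schwartzP; split; first exact: (smoothM sb (schwartz_smooth sg)).
move=> l k; pose K := maxn k (size l).
have [|A A0 HA] := @list_bound (fun l B => forall x, cabs (cpderiv l b x) <= B) _ hb K.
  by move=> l' B B' BB h x; exact: le_trans (h x) BB.
have [B B0 hB] := schwartz_sbound K sg.
have h := sboundM sb (schwartz_smooth sg) (fun l x lk => HA l lk x) hB.
exists (2 ^+ K * (A * B)) => x; apply: le_trans (h l x (leq_maxr _ _)).
by rewrite ler_wpM2r ?cabs_ge0// br_le_exp// leq_maxl.
Qed.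

Lemma schwartzD f g : schwartz f -> schwartz g -> schwartz (fun x => f x + g x).
Proof.
move=> /schwartzP[sf Hf] /schwartzP[sg Hg]; apply/schwartzP; split; first exact: smoothD.
move=> l k; have [B1 h1] := Hf l k; have [B2 h2] := Hg l k; exists (B1 + B2) => x.
rewrite cpderivD//; apply: le_trans (lerD (h1 x) (h2 x)).
by rewrite -mulrDr ler_wpM2l ?cabsD// exprn_ge0// ltW// br_gt0.
Qed.

Lemma schwartzZ (c : C) f : schwartz f -> schwartz (fun x => c * f x).
Proof.
move=> sf; apply: schwartzM => //; first exact: smooth_cst.
by move=> l; exists (cabs c) => x; rewrite cpderiv_cst; case: l => //; rewrite cabs0 cabs_ge0.
Qed.

Lemma schwartz0 : schwartz (fun _ : Rd => 0 : C).
Proof.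
apply/schwartzP; split; first exact: smooth_cst.
by move=> l k; exists 0 => x; rewrite cpderiv_cst; case: l; rewrite cabs0 mulr0.
Qed.

Lemma schwartzB f g : schwartz f -> schwartz g -> schwartz (fun x => f x - g x).
Proof.
move=> sf sg; have := schwartzD sf (schwartzZ (-1) sg).
by congr schwartz; apply/funext => x; rewrite mulN1r.
Qed.

Lemma schwartz_sum I (s : seq I) (P : pred I) (F : I -> Rd -> C) :
  (forall i, schwartz (F i)) -> schwartz (fun x => \sum_(i <- s | P i) F i x).
Proof.
move=> sF; elim: s => [|i s IH].
  by under eq_fun do rewrite big_nil; exact: schwartz0.
under eq_fun do rewrite big_cons.
by case: (P i) => //; exact: schwartzD.
Qed.

Lemma sbound_shift k f B (b : Rd) : smooth f -> sbound k f B ->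
  sbound k (fun x => f (x - b)) (br b ^+ k * B).
Proof.
move=> sf h l x lk; rewrite cpderiv_shift//.
apply: le_trans (ler_wpM2l _ (h l (x - b) lk)); last by rewrite exprn_ge0// ltW// br_gt0.
rewrite mulrA ler_wpM2r ?cabs_ge0// mulrC.
by rewrite -{1}(subrK b x) br_expM.
Qed.

Lemma schwartz_shift f (b : Rd) : schwartz f -> schwartz (fun x => f (x - b)).
Proof.
move=> sf; have sm := schwartz_smooth sf; apply/schwartzP; split; first exact: smooth_shift.
move=> l k; have [B B0 h] := schwartz_sbound (maxn k (size l)) sf.
exists (br b ^+ (maxn k (size l)) * B) => x.
apply: le_trans (sbound_shift b sm h x (leq_maxr k _)).
by rewrite ler_wpM2r ?cabs_ge0// br_le_exp// leq_maxl.
Qed.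

Lemma schwartz_cmeas f : schwartz f -> cmeas f.
Proof. by move=> sf; exact/ccont_cmeas/smooth_ccont/schwartz_smooth. Qed.

Lemma schwartz_cintble f : schwartz f -> cintble f.
Proof.
move=> sf; have [B B0 h] := schwartz_decay (2 * d) sf.
apply: (cintble_majorant (schwartz_cmeas sf) (majorantZ B0 majorant_wt0)) => x.
by apply: le_trans (h x) _; rewrite ler_wpM2l// bracket_wt.
Qed.

Lemma cpderiv_far f (r : R) l x : smooth f -> (forall x, r < `|x| -> f x = 0) ->
  r < `|x| -> cpderiv l f x = 0.
Proof.
move=> sf fr rx; apply: (@cpderiv_local_zero R d f [set y | r < `|y|]) => //.
by apply: (@open_comp _ _ (fun y : Rd => `|y|) [set t | r < t]);
  [move=> y _; exact: norm_continuous|exact: open_gt].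
Qed.

Lemma test_functionP f : test_function f <-> smooth f /\
  exists2 r : R, 0 < r & forall x, r < `|x| -> f x = 0.
Proof.
split=> [[sf cf]|[sf [r r0 fr]]]; split => //.
  have [r [_ hr]] := compact_bounded cf.
  exists (Num.max 1 (r + 1)); first by rewrite lt_max ltr01.
  move=> x; rewrite gt_max => /andP[_ rx]; apply/eqP; apply: contraPT rx => fx.
  apply/negP; rewrite -leNgt; apply: hr; first by rewrite ltrDl.
  exact: subset_closure.
apply: bounded_closed_compact; last exact: closed_closure.
exists r; split; first exact: num_real.
move=> M rM x; rewrite /fsupp => cx; rewrite /= leNgt; apply/negP => Mx.
have [y [/= /eqP fy xy]] := cx _ (near_norm_lt x (etrans (subr_gt0 _ _) Mx)).
apply: fy; apply: fr; apply: lt_trans rM _.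
have := ler_normB (x - y) (- y); rewrite opprK subrK normrN distrC; lra.
Qed.

Lemma test_smooth f : test_function f -> smooth f. Proof. by case. Qed.

Lemma ball_compact (r : R) : compact [set x : Rd | `|x| <= r].
Proof.
apply: bounded_closed_compact.
  by exists r; split; [exact: num_real|move=> M rM x /= xr; exact: le_trans xr (ltW rM)].
have -> : [set x : Rd | `|x| <= r] = ~` [set x | r < `|x|].
  by apply/seteqP; split => x /=; rewrite leNgt => /negP.
apply: open_closedC.
by apply: (@open_comp _ _ (fun y : Rd => `|y|) [set t | r < t]);
  [move=> y _; exact: norm_continuous|exact: open_gt].
Qed.

Lemma ccont_bounded f (r : R) : ccont f ->
  exists2 B : R, 0 <= B & forall x, `|x| <= r -> cabs (f x) <= B.
Proof.
have key (h : Rd -> R) : continuous h -> exists2 B : R, 0 <= B & forall x, `|x| <= r -> `|h x| <= B.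
  move=> ch; have := continuous_compact (continuous_subspaceT ch) (@ball_compact r).
  move=> /compact_bounded[M [_ HM]]; exists (`|M| + 1) => // x xr.
  by apply: HM; [rewrite (le_lt_trans (ler_norm M))// ltrDl|exists x].
move=> [/key[B1 p1 h1] /key[B2 p2 h2]]; exists (B1 + B2); first exact: addr_ge0.
by move=> x xr; apply: le_trans (cabs_le_ReIm _) _; apply: lerD; [exact: h1|exact: h2].
Qed.

Lemma test_schwartz f : test_function f -> schwartz f.
Proof.
move=> /test_functionP[sf [r r0 fr]]; apply/schwartzP; split => // l k.
have [B B0 HB] := ccont_bounded r (smooth_ccont (smooth_cpderiv l sf)).
exists ((1 + r) ^+ k * B) => x; have [xr|rx] := leP `|x| r.
  rewrite ler_pM ?cabs_ge0 ?HB// ?exprn_ge0 ?(ltW (br_gt0 x))//.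
  by rewrite lerXn2r ?nnegrE ?(ltW (br_gt0 x)) ?addr_ge0 ?(ltW r0)// lerD2l.
by rewrite (cpderiv_far l sf fr rx) cabs0 mulr0 mulr_ge0// exprn_ge0// addr_ge0// ltW.
Qed.

Lemma testM f g : smooth f -> test_function g -> test_function (fun x => f x * g x).
Proof.
move=> sf /test_functionP[sg [r r0 gr]]; apply/test_functionP; split; first exact: smoothM.
by exists r => // x /gr ->; rewrite mulr0.
Qed.

Lemma testMr f g : test_function f -> smooth g -> test_function (fun x => f x * g x).
Proof.
move=> /test_functionP[sg [r r0 gr]] sf; apply/test_functionP; split; first exact: smoothM.
by exists r => // x /gr ->; rewrite mul0r.
Qed.

Lemma testD f g : test_function f -> test_function g -> test_function (fun x => f x + g x).
Proof.
move=> /test_functionP[sf [r r0 fr]] /test_functionP[sg [q q0 gq]]; apply/test_functionP.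
split; first exact: smoothD.
exists (Num.max r q); first by rewrite lt_max r0.
by move=> x; rewrite gt_max => /andP[/fr -> /gq ->]; rewrite addr0.
Qed.

Lemma test_cder f i : test_function f -> test_function (cder i f).
Proof.
move=> /test_functionP[sf [r r0 fr]]; apply/test_functionP; split; first exact: smooth_cder.
by exists r => // x; exact: (@cpderiv_far f r [:: i]).
Qed.

Lemma test_affine f (c : R) (b : Rd) : c != 0 -> test_function f ->
  test_function (fun x => f (c *: x + b)).
Proof.
move=> c0 /test_functionP[sf [r r0 fr]]; apply/test_functionP; split; first exact: smooth_affine.
have cp : 0 < `|c| by rewrite normr_gt0.
exists ((r + `|b|) / `|c|); first by rewrite divr_gt0// ltr_wpDr.
move=> x; rewrite ltr_pdivrMr// => h; apply: fr.
have := ler_normB (c *: x + b) b; rewrite addrK normrZ; lra.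
Qed.

Lemma test_scale f (c : R) : c != 0 -> test_function f -> test_function (fun x => f (c *: x)).
Proof.
move=> c0 /(test_affine 0 c0); congr test_function; apply/funext => x; by rewrite addr0.
Qed.

Lemma schwartz_wt f : schwartz f -> exists2 B : R, 0 <= B & forall x, cabs (f x) <= B * wt x.
Proof.
move=> sf; have [B B0 h] := schwartz_decay (2 * d) sf; exists B => // x.
by apply: le_trans (h x) _; rewrite ler_wpM2l// bracket_wt.
Qed.

Lemma test_bounded f : test_function f -> exists2 B : R, 0 <= B & forall x, cabs (f x) <= B.
Proof.
move=> /test_schwartz/(schwartz_decay 0)[B B0 h]; exists B => // x.
by have := h x; rewrite expr0 invr1 mulr1.
Qed.

End schwartz_class.

Section tempered_distributions.
Context {R : realType} {d : nat}.
Local Notation C := R[i].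
Local Notation Rd := 'rV[R]_d.
Implicit Types (f g : Rd -> C) (u v : distr R d).

Lemma temperedP u : tempered u <->
  (forall (a : C) f g, schwartz f -> schwartz g ->
     u (fun x => a * f x + g x) = a * u f + u g) /\
  exists c k, 0 <= c /\ forall f B, schwartz f -> sbound k f B -> cabs (u f) <= c * B.
Proof.
split=> [[ul [c [k h]]]|[ul [c [k [c0 h]]]]]; (split; first exact: ul).
  exists (`|c| * (1 + d%:R) ^+ k), k; split; first by rewrite mulr_ge0// exprn_ge0// addr_ge0.
  move=> f B sf fB; rewrite -lee_fin; apply: le_trans (h f sf) _.
  apply: (@le_trans _ _ (`|c|%:E * schwartz_norm k f)%E).
    rewrite lee_wpmul2r ?lee_fin ?ler_norm//.
    apply: le_trans (ereal_sup_ubound (ex_intro2 _ _ ([::], 0) isT erefl)).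
    by rewrite lee_fin mulr_ge0 ?cabs_ge0// exprn_ge0// addr_ge0// sqrtr_ge0.
  by rewrite -mulrA EFinM lee_wpmul2l ?lee_fin// sbound_schwartz_norm.
exists c, k => f sf.
have fn : schwartz_norm k f \is a fin_num.
  rewrite ge0_fin_numE; first by case: sf => _ /(_ k).
  apply: le_trans (ereal_sup_ubound (ex_intro2 _ _ ([::], 0) isT erefl)).
  by rewrite lee_fin mulr_ge0 ?cabs_ge0// exprn_ge0// addr_ge0// sqrtr_ge0.
rewrite -(fineK fn) -EFinM lee_fin h//.
by apply: schwartz_norm_sbound; rewrite fineK.
Qed.

Variable u : distr R d.
Hypothesis tu : tempered u.

Lemma tempered_add f g : schwartz f -> schwartz g -> u (fun x => f x + g x) = u f + u g.
Proof.
move=> sf sg; have [h _] := tu; have := h 1 f g sf sg; rewrite mul1r => <-.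
by congr u; apply/funext => x; rewrite mul1r.
Qed.

Lemma tempered0 : u (fun=> 0) = 0.
Proof.
have := tempered_add (@schwartz0 R d) (@schwartz0 R d).
have -> : (fun _ : Rd => 0 + 0 : C) = fun=> 0 by apply/funext => x; rewrite addr0.
by move=> /eqP; rewrite -subr_eq0 opprD addNKr oppr_eq0 => /eqP.
Qed.

Lemma temperedZ (c : C) f : schwartz f -> u (fun x => c * f x) = c * u f.
Proof.
move=> sf; have [h _] := tu; have := h c f _ sf (@schwartz0 R d).
by rewrite tempered0 addr0 => <-; congr u; apply/funext => x; rewrite addr0.
Qed.

Lemma tempered_sub f g : schwartz f -> schwartz g -> u (fun x => f x - g x) = u f - u g.
Proof.
move=> sf sg; have [h _] := tu; have := h (-1) g f sg sf; rewrite mulN1r addrC => <-.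
by congr u; apply/funext => x; rewrite mulN1r addrC.
Qed.

Lemma tempered_sum I (s : seq I) (P : pred I) (F : I -> Rd -> C) :
  (forall i, schwartz (F i)) ->
  u (fun x => \sum_(i <- s | P i) F i x) = \sum_(i <- s | P i) u (F i).
Proof.
move=> sF; elim: s => [|i s IH].
  by under eq_fun do rewrite big_nil; rewrite big_nil tempered0.
under eq_fun do rewrite big_cons.
rewrite big_cons; case: (P i) => //.
by rewrite tempered_add ?IH//; exact: schwartz_sum.
Qed.

End tempered_distributions.

Section smooth_step.
Context {R : realType} {d : nat}.
Local Notation C := R[i].
Local Notation Rd := 'rV[R]_d.

(** A decreasing smooth step along the line, given with all its derivatives [T n]. *)
Record smooth_step (T : nat -> R -> R) : Prop := SmoothStep {
  step_deriv : forall n t, is_derive t (1 : R) (T n) (T n.+1 t);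
  step_left : forall t, t <= 1 / 8 -> T 0%N t = 1;
  step_right : forall t, 1 / 2 <= t -> T 0%N t = 0;
  step_bounded : forall n, exists2 B : R, 0 <= B & forall t, `|T n t| <= B }.

(** The cutoff [eta], restricted to a coordinate axis, is one near zero and vanishes from 1/2
    on; replacing its left half by one gives a smooth step. *)
Lemma exists_smooth_step (eta : Rd -> C) : (0 < d)%N -> lp_cutoff eta ->
  exists T, smooth_step T.
Proof.
case: d eta => // d' eta _ [te se e1].
pose e0 : 'rV[R]_d'.+1 := delta_mx 0 ord0.
have eucl_e t : eucl (t *: e0) = `|t|.
  rewrite /eucl /dot (bigD1 ord0)//= big1 ?addr0.
    by rewrite !mxE /= mulr1 -expr2 sqrtr_sqr.
  by move=> i /negbTE i0; rewrite !mxE /= i0 !mulr0.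
pose rho n t := complex.Re (cpderiv (nseq n ord0) eta (t *: e0)).
have drho n t : is_derive t (1 : R) (rho n) (rho n.+1 t).
  have := smooth_is_cder ord0 (smooth_cpderiv (nseq n ord0) (test_smooth te)) (t *: e0 + 0).
  move=> [/is_derive_line h _]; move: h; rewrite addr0.
  by under eq_fun do rewrite addr0.
have rho1 n t : `|t| < 1 / 4 -> rho n t = (n == 0%N)%:R.
  elim: n t => [|n IH] t ht; first by rewrite /rho cpderiv_nil e1// eucl_e ltW.
  have [_ <-] := drho n t.
  have -> : 'D_1 (rho n) t = 'D_1 (cst ((n == 0%N)%:R : R)) t.
    apply: near_eq_derive.
    near=> s; rewrite IH//; near: s.
    apply: (@open_nbhs_nbhs _ t [set s | `|s| < 1 / 4]); split => //.
    by apply: (@open_comp _ _ (fun s : R => `|s|) [set r | r < 1 / 4]);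
      [move=> s _; exact: norm_continuous|exact: open_lt].
  exact: derive_cst.
pose T n t := if t < 0 then (n == 0%N)%:R else rho n t.
exists T; split.
- move=> n t; have [t4|t4] := ltP t (1 / 4).
    have TE m s : s < 1 / 4 -> T m s = (m == 0%N)%:R.
      by move=> s4; rewrite /T; case: ltP => // s0; rewrite rho1// ger0_norm.
    have h0 : is_derive t (1 : R) (cst ((n == 0%N)%:R : R)) (0 : R) by exact: is_derive_cst.
    rewrite (TE n.+1)//; apply: near_eq_is_derive h0.
    near=> s; rewrite TE//; near: s.
    by apply: (@open_nbhs_nbhs _ t [set s | s < 1 / 4]); split => //; exact: open_lt.
  have t0 : 0 < t by apply: lt_le_trans t4.
  have -> : T n.+1 t = rho n.+1 t by rewrite /T ltNge (ltW t0).
  apply: near_eq_is_derive (drho n t).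
  near=> s; rewrite /T ltNge ifF//; apply/negbF/ltW; near: s.
  by apply: (@open_nbhs_nbhs _ t [set s | 0 < s]); split => //; exact: open_gt.
- move=> t t8; rewrite /T; case: ltP => // t0; rewrite rho1 ?ger0_norm//.
  by apply: le_lt_trans t8 _; lra.
- move=> t t2; have t0 : 0 <= t by apply: le_trans t2; lra.
  rewrite /T ltNge t0 /= /rho cpderiv_nil.
  suff -> : eta (t *: e0) = 0 by [].
  apply/eqP; apply: contraT => h.
  have := se _ (@subset_closure _ [set x | eta x != 0] _ h).
  by rewrite /= eucl_e ger0_norm// ltNge => /negP[]; apply: le_trans t2; lra.
- move=> n; have [B B0 h] := schwartz_decay 0 (schwartz_cpderiv (nseq n ord0) (test_schwartz te)).
  exists (Num.max 1 B); first by rewrite le_max ler01.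
  move=> t; rewrite /T; case: ifP => _.
    by case: eqP => _; rewrite ?normr1 ?normr0 le_max ?lexx ?ler01.
  rewrite le_max; apply/orP; right; apply: le_trans (Re_le_cabs _) _.
  by have := h (t *: e0); rewrite expr0 invr1 mulr1.
Unshelve. all: by end_near. Qed.

End smooth_step.

Section cutoffs.
Context {R : realType} {d : nat} (T : nat -> R -> R) (HT : smooth_step T).
Local Notation C := R[i].
Local Notation Rd := 'rV[R]_d.

Definition step_coord (c b : R) (j : 'I_d) (x : Rd) : C := (T 0%N (c * x 0 j + b))%:C%C.

Lemma step_coord_cder (n : nat) (k c b : R) i j :
  is_cder i (fun x : Rd => (k * T n (c * x 0 j + b))%:C%C)
    (fun x => ((if i == j then k * c else 0) * T n.+1 (c * x 0 j + b))%:C%C).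
Proof.
have hd t : is_derive t (1 : R) (fun t => k * T n (c * t + b)) (k * c * T n.+1 (c * t + b)).
  have h1 := @is_deriveM R R (cst c) id t 1 0 1 (is_derive_cst _ _ _) (is_derive_id _ _).
  have h2 := is_deriveD h1 (is_derive_cst b t (1 : R)).
  have h3 := @is_derive1_comp R (T n) (fun t => c * t + b) t _ _ (step_deriv HT n _) h2.
  have h4 := @is_deriveM R R (cst k) _ t 1 0 _ (is_derive_cst _ _ _) h3.
  by apply: (derive_eq h4); rewrite /= /GRing.scale /=; ring.
have := is_cder_fun1 i j hd; congr is_cder; apply/funext => x.
by case: ifP => // _; rewrite mul0r.
Qed.

Lemma step_coord_cpderiv (c b : R) j l : exists2 k : R, `|k| <= `|c| ^+ size l &
  cpderiv l (step_coord c b j) = fun x => (k * T (size l) (c * x 0 j + b))%:C%C.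
Proof.
elim: l => [|i l [k k1 IH]].
  by exists 1; rewrite ?normr1// cpderiv_nil; apply/funext => x; rewrite mul1r.
exists (if i == j then k * c else 0).
  by case: ifP => _; rewrite ?normr0 ?exprn_ge0//= normrM exprSr ler_wpM2r.
by rewrite cpderiv_cons IH (is_cderE (step_coord_cder _ _ _ _ _ _)).
Qed.

Lemma smooth_step_coord (c b : R) j : smooth (step_coord c b j).
Proof.
apply: (@smooth_coind R d (fun f => exists k n, f = fun x => (k * T n (c * x 0 j + b))%:C%C) _ _ _).1;
  last by exists 1, 0%N; apply/funext => x; rewrite mul1r.
move=> _ [k [n ->]]; split; last first.
  move=> i; eexists; last exact: step_coord_cder.
  by do 2 eexists.
apply: ccont_lip => x; have [B B0 HB] := step_bounded HT n.+1.
exists (`|k| * (B * `|c|)); first by rewrite !mulr_ge0.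
move=> y _; rewrite cabs_realB -mulrBr normrM -mulrA ler_wpM2l//.
apply: le_trans (line_lipschitz (step_deriv HT n) (B := B) _) _; first by move=> t _.
rewrite opprD addrACA subrr addr0 -mulrBr normrM mulrA ler_wpM2l ?mulr_ge0//.
by have := coord_le (y - x) j; rewrite !mxE.
Qed.

Lemma step_coord_bound (c : R) k : exists2 A : R, 0 <= A & forall b j l x, (size l <= k)%N ->
  cabs (cpderiv l (step_coord c b j) x) <= A.
Proof.
have /choice[F HF] : forall n, exists B : R, forall t, `|T n t| <= B.
  by move=> n; have [B _ h] := step_bounded HT n; exists B.
have F0 n : 0 <= F n by apply: le_trans (HF n 0).
exists (\sum_(n < k.+1) `|c| ^+ n * F n); first by apply: sumr_ge0 => n _; rewrite mulr_ge0 ?exprn_ge0.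
move=> b j l x lk; have [q q1 ->] := step_coord_cpderiv c b j l.
rewrite cabs_real normrM (bigD1 (Ordinal (lk : (size l < k.+1)%N)))//= ler_wpDr//.
  by apply: sumr_ge0 => n _; rewrite mulr_ge0 ?exprn_ge0.
by rewrite ler_pM.
Qed.

Lemma smooth_prod I (s : seq I) (F : I -> Rd -> C) : (forall i, smooth (F i)) ->
  smooth (fun x => \prod_(i <- s) F i x).
Proof.
move=> sF; elim: s => [|i s IH].
  by under eq_fun do rewrite big_nil; exact: smooth_cst.
have := smoothM (sF i) IH; congr smooth; apply/funext => x; by rewrite big_cons.
Qed.

Lemma prod_bound I (s : seq I) k (A : R) : 0 <= A -> exists2 B : R, 0 <= B &
  forall F : I -> Rd -> C, (forall i, smooth (F i)) ->
  (forall i l x, (size l <= k)%N -> cabs (cpderiv l (F i) x) <= A) ->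
  forall l x, (size l <= k)%N -> cabs (cpderiv l (fun x => \prod_(i <- s) F i x) x) <= B.
Proof.
move=> A0; elim: s => [|i s [B B0 IH]].
  exists 1 => // F sF hF l x lk; under eq_fun do rewrite big_nil.
  by rewrite cpderiv_cst; case: l lk => [|j l] lk; rewrite ?cabs1 ?cabs0.
exists (2 ^+ k * (A * B)); first by rewrite !mulr_ge0// exprn_ge0.
move=> F sF hF l x lk; under eq_fun do rewrite big_cons.
apply: le_trans (leibniz_bound (sF i) (smooth_prod s sF) (fun l' h => hF i l' x h)
  (fun l' h => IH F sF hF l' x h) lk) _.
by rewrite ler_wpM2r ?mulr_ge0// ler_weXn2l// ler1n.
Qed.

(** The smooth indicator of a box: 1 on it, 0 beyond distance 1/2. *)
Definition plateau (c r : R) (a : Rd) (x : Rd) : C :=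
  \prod_(j < d) (step_coord c (c * (- a 0 j - r)) j x * step_coord (- c) (c * (a 0 j - r)) j x).

Lemma smooth_plateau (c r : R) (a : Rd) : smooth (plateau c r a).
Proof. by apply: smooth_prod => j; apply: smoothM; exact: smooth_step_coord. Qed.

Lemma step_coordE (c b : R) j (x : Rd) : step_coord c b j x = (T 0%N (c * x 0 j + b))%:C%C.
Proof. by []. Qed.

Lemma plateau1 (c r : R) (a x : Rd) : 0 < c -> (forall j, `|x 0 j - a 0 j| <= r) -> plateau c r a x = 1.
Proof.
move=> c0 h; rewrite /plateau big1// => j _; rewrite !step_coordE.
have := h j; rewrite ler_norml => /andP[h1 h2].
by rewrite !(step_left HT) ?mulr1//; apply: (@le_trans _ _ 0); try lra; nra.
Qed.

Lemma plateau0 (c r : R) (a x : Rd) j : 0 < c -> r + c^-1 / 2 <= `|x 0 j - a 0 j| -> plateau c r a x = 0.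
Proof.
move=> c0 h; rewrite /plateau (bigD1 j)//= !step_coordE.
have key (t : R) : r + c^-1 / 2 <= t -> 1 / 2 <= c * (t - r).
  move=> ht; rewrite -ler_pdivrMl// mulrA mulr1; lra.
move: h; rewrite ler_normr => /orP[h|h].
  rewrite -mulrDr [X in T _ (_ * X)](_ : _ = (x 0 j - a 0 j) - r); last by ring.
  by rewrite (step_right HT (key _ h)) !mul0r.
rewrite (_ : - c * x 0 j + c * (a 0 j - r) = c * (- (x 0 j - a 0 j) - r)); last by ring.
by rewrite (step_right HT (key _ h)) mulr0 mul0r.
Qed.

(** The derivatives are bounded uniformly in the size and the centre of the box. *)
Lemma plateau_bound (c : R) k : exists2 A : R, 0 <= A & forall r a l x, (size l <= k)%N ->
  cabs (cpderiv l (plateau c r a) x) <= A.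
Proof.
have [A1 A10 h1] := step_coord_bound c k; have [A2 A20 h2] := step_coord_bound (- c) k.
have [|B B0 hB] := @prod_bound 'I_d (index_enum _) k (2 ^+ k * (A1 * A2)).
  by rewrite !mulr_ge0// exprn_ge0.
exists B => // r a l x lk; apply: hB => //.
  by move=> j; apply: smoothM; exact: smooth_step_coord.
move=> j l' y lk'.
apply: le_trans (leibniz_bound (k := k) (smooth_step_coord _ _ _) (smooth_step_coord _ _ _)
   (fun l'' h => h1 _ _ l'' y h) (fun l'' h => h2 _ _ l'' y h) lk') _.
by rewrite ler_wpM2r ?mulr_ge0// ler_weXn2l// ler1n.
Qed.

Lemma test_plateau (c r : R) (a : Rd) : 0 < c -> test_function (plateau c r a).
Proof.
move=> c0; apply/test_functionP; split; first exact: smooth_plateau.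
exists (`|r| + c^-1 + `|a| + 1).
  by rewrite ltr_wpDl// !addr_ge0// invr_ge0 ltW.
move=> x hx; have ci : 0 < c^-1 by rewrite invr_gt0.
have [j hj] : exists j, r + c^-1 / 2 <= `|x 0 j - a 0 j|.
  apply: contrapT => /forallNP H; move: hx; apply/negP; rewrite -leNgt.
  have rr := ler_norm r; have r0 := normr_ge0 r; have a0 := normr_ge0 a.
  apply: norm_le => [|j]; first lra.
  have := H j; move/negP; rewrite -ltNge => h.
  have := ler_normD (x 0 j - a 0 j) (a 0 j); rewrite subrK => h2.
  by have := coord_le a j => h3; lra.
exact: plateau0 hj.
Qed.

End cutoffs.

(** * The Fourier transform *)

Lemma cabs_imag (R : realType) (t : R) : cabs (Complex 0 t) = `|t|.
Proof. by rewrite cabsE /= expr0n add0r sqrtr_sqr. Qed.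

Section parameter_integrals.
Context {R : realType} {d : nat}.
Local Notation C := R[i].
Local Notation Rd := 'rV[R]_d.
Local Notation leb := (@lebesgue_rV R d).

Variables (K : Rd -> Rd -> C) (K' : 'I_d -> Rd -> Rd -> C) (x0 : Rd) (g : Rd -> R) (B : R).
Hypothesis mK : forall x, cmeas (K x).
Hypothesis mK' : forall i x, cmeas (K' i x).
Hypothesis gB : majorant g B.
Hypothesis Kg : forall x y, `|x - x0| <= 1 -> cabs (K x y) <= g y.
Hypothesis K'g : forall i x y, `|x - x0| <= 1 -> cabs (K' i x y) <= g y.
Hypothesis dK : forall i y, is_cder i (K^~ y) (K' i ^~ y).

Let Ki x : `|x - x0| <= 1 -> cintble (K x).
Proof. by move=> h; apply: (cintble_majorant (mK x) gB) => y; exact: Kg. Qed.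

(** Differentiation under the integral sign, with a dominated parameter derivative. *)
Lemma param_lipschitz x : `|x - x0| <= 1 ->
  cabs (cint setT (K x) - cint setT (K x0)) <= (2 * d)%:R * B * `|x - x0|.
Proof.
move=> h; have h0 : `|x0 - x0| <= 1 by rewrite subrr normr0.
rewrite -cintB; [|exact: Ki|exact: Ki].
have hp : 0 <= (2 * d)%:R * `|x - x0| by rewrite mulr_ge0.
rewrite mulrAC; apply: (cabs_cint_le _ (majorantZ hp gB)).
  exact: cmeasD (mK _) (cmeasN (mK _)).
move=> y; rewrite -{1}(subrK x0 x) [x - x0 + x0]addrC.
apply: le_trans (clipschitz (B := g y) (dK ^~ y) _) _; last by rewrite mulrAC.
by move=> i z hz; apply: K'g; exact: le_trans hz h.
Qed.

Lemma param_cder i :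
  is_derive x0 (delta_mx 0 i) (fun x => complex.Re (cint setT (K x))) (complex.Re (cint setT (K' i x0))) /\
  is_derive x0 (delta_mx 0 i) (fun x => complex.Im (cint setT (K x))) (complex.Im (cint setT (K' i x0))).
Proof.
have [mg g0 ig] := gB.
have gi : leb.-integrable setT (EFin \o g).
  by apply: (integrable_le mg mg _ ig) => x; rewrite ger0_norm.
have nrm t : t \in `](-1)%R, 1[ -> `|t *: (delta_mx 0 i : Rd) + x0 - x0| <= 1.
  rewrite in_itv/= addrK => /andP[t1 t2]; apply: norm_le => // j; rewrite !mxE eqxx /=.
  case: eqP => _ /=; last by rewrite mulr0 normr0.
  by rewrite mulr1 ler_norml (ltW t1) ltW.
have key (p : C -> R) : (forall z, `|p z| <= cabs z) -> (forall x, measurable_fun setT (fun y => p (K x y))) ->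
   (forall x y, is_derive x (delta_mx 0 i) (fun x => p (K x y)) (p (K' i x y))) ->
   is_derive x0 (delta_mx 0 i) (fun x => \int[leb]_y p (K x y)) (\int[leb]_y p (K' i x0 y)).
  move=> pc mp dp.
  pose f (t : R) (y : Rd) := p (K (t *: delta_mx 0 i + x0) y).
  have df (t : R) (y : Rd) : is_derive t (1 : R) (f^~ y) (p (K' i (t *: delta_mx 0 i + x0) y)).
    by apply/(is_derive_line (fun x => p (K x y))).
  have I0 : `](-1)%R, 1[%classic (0 : R) by rewrite /= in_itv /= ltrN10 ltr01.
  have intf t : `](-1)%R, 1[%classic t -> leb.-integrable setT (EFin \o f t).
    move=> ht; apply: (integrable_le (mp _) mg _ ig) => y.
    by apply: le_trans (pc _) (Kg _ _); exact: nrm.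
  have derf t y : `](-1)%R, 1[%classic t -> setT y -> derivable (f^~ y) t 1.
    by move=> _ _; case: (df t y).
  have ub t y : `](-1)%R, 1[%classic t -> setT y -> `|partial1of2 f t y| <= g y.
    move=> ht _; rewrite /partial1of2 derive1E; have [_ ->] := df t y.
    by apply: le_trans (pc _) (K'g _ _ _); exact: nrm.
  rewrite -[X in is_derive X]add0r -[X in X + _](scale0r (delta_mx 0 i : Rd)).
  apply/(is_derive_line (fun x => \int[leb]_y p (K x y))).
  have h1 := derivable_under_integral measurableT I0 intf derf g0 gi ub.
  have h2 := differentiation_under_integral measurableT I0 intf derf g0 gi ub.
  constructor; first exact: h1.
  rewrite -derive1E h2; apply: eq_Rintegral => y _.
  by rewrite /partial1of2 derive1E; have [_ ->] := df 0 y; rewrite scale0r add0r.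
split.
  apply: (key (@complex.Re R) (@Re_le_cabs R)) => [x|x y]; first by case: (mK x).
  by case: (dK i y x).
apply: (key (@complex.Im R) (@Im_le_cabs R)) => [x|x y]; first by case: (mK x).
by case: (dK i y x).
Qed.

End parameter_integrals.

Section fourier_transform.
Context {R : realType} {d : nat}.
Local Notation C := R[i].
Local Notation Rd := 'rV[R]_d.
Local Notation leb := (@lebesgue_rV R d).
Implicit Types (m f g : Rd -> C) (x y xi : Rd).

Lemma dotC x y : dot x y = dot y x.
Proof. by apply: eq_bigr => i _; rewrite mulrC. Qed.

Lemma dotDl x y z : dot (x + y) z = dot x z + dot y z.
Proof. by rewrite /dot -big_split; apply: eq_bigr => i _; rewrite mxE mulrDl. Qed.

Lemma dotZl c x y : dot (c *: x) y = c * dot x y.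
Proof. by rewrite /dot mulr_sumr; apply: eq_bigr => i _; rewrite mxE mulrA. Qed.

Lemma dotNl x y : dot (- x) y = - dot x y.
Proof. by rewrite -scaleN1r dotZl mulN1r. Qed.

Lemma dotDr x y z : dot z (x + y) = dot z x + dot z y.
Proof. by rewrite !(dotC z) dotDl. Qed.

Lemma dotNr x y : dot y (- x) = - dot y x.
Proof. by rewrite !(dotC y) dotNl. Qed.

Lemma dotZr c x y : dot y (c *: x) = c * dot y x.
Proof. by rewrite !(dotC y) dotZl. Qed.

Lemma measurable_dot : measurable_fun setT (fun z : Rd * Rd => dot z.1 z.2).
Proof.
apply: (@measurable_sum _ _ _ _ _ _ (fun i (z : Rd * Rd) => z.1 0 i * z.2 0 i)) => i.
apply: measurable_funM.
  exact: (measurableT_comp (measurable_coor i) measurable_fst).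
exact: (measurableT_comp (measurable_coor i) measurable_snd).
Qed.

Lemma cmeas_char (k : R) : cmeas (fun z : Rd * Rd => expi (k * dot z.1 z.2)).
Proof. by apply: cmeas_expi; apply: measurable_funM => //; exact: measurable_dot. Qed.

Lemma ccont_expi (k : R) y : ccont (fun x : Rd => expi (k * dot x y)).
Proof.
apply: ccont_lip => x; exists ((2 * d)%:R * (`|k| * `|y|)); first by rewrite !mulr_ge0.
move=> z _; rewrite -{1}(subrK x z) [z - x + x]addrC.
apply: (@clipschitz _ _ (fun x => expi (k * dot x y)) (fun i x => Complex 0 (k * y 0 i) * expi (k * dot x y))).
  by move=> i; exact: is_cder_expi.
move=> i w _; rewrite cabsM cabs_expi mulr1 cabs_imag normrM.
by rewrite ler_wpM2l// coord_le.
Qed.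

Lemma fourierE f xi : fourier f xi = cint setT (fun x => f x * expi (- (2 * pi) * dot x xi)).
Proof. by rewrite /fourier; congr cint; apply/funext => x; rewrite mulNr. Qed.

Lemma ifourier_fourier f x : ifourier f x = fourier f (- x).
Proof.
rewrite fourierE /ifourier; congr cint; apply/funext => xi.
by rewrite dotNr mulrN mulNr opprK dotC.
Qed.

Lemma cmeas_fourier_integrand f k xi : cmeas f -> cmeas (fun x => f x * expi (k * dot x xi)).
Proof. by move=> mf; apply: cmeasM => //; exact/ccont_cmeas/ccont_expi. Qed.

Lemma cintble_fourier f k xi : cintble f -> cmeas f -> cintble (fun x => f x * expi (k * dot x xi)).
Proof.
move=> [/integrableP[_ f1] /integrableP[_ f2]] mf.
pose g x := `|complex.Re (f x)| + `|complex.Im (f x)|.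
have mg : measurable_fun setT g by case: mf => m1 m2; apply: measurable_funD; exact: measurableT_comp.
have gi : (\int[leb]_x (g x)%:E < +oo)%E.
  under eq_integral do rewrite /g EFinD.
  rewrite ge0_integralD//; first exact: lte_add_pinfty.
  - by case: mf => m1 m2; apply/measurable_EFinP; exact: measurableT_comp.
  - by case: mf => m1 m2; apply/measurable_EFinP; exact: measurableT_comp.
have gM : majorant g (fine (\int[leb]_x (g x)%:E)%E).
  split=> //; first by move=> x; rewrite addr_ge0.
  by rewrite fineK// ge0_fin_numE// integral_ge0// => x _; rewrite lee_fin addr_ge0.
apply: (cintble_majorant _ gM) => [|x]; first exact: cmeas_fourier_integrand.
by rewrite cabsM cabs_expi mulr1 cabs_le_ReIm.
Qed.

(** Differentiation of the transform brings down a coordinate. *)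
Definition mul_coord (i : 'I_d) m : Rd -> C := fun x => Complex 0 (- (2 * pi)) * (x 0 i)%:C%C * m x.

Lemma test_mul_coord i m : test_function m -> test_function (mul_coord i m).
Proof. by apply: testM; apply: smoothM; [exact: smooth_cst|exact: smooth_coord]. Qed.

(** [m] needs enough decay for the transform to be differentiable once. *)
Lemma fourier_cder_decay m (B : R) : 0 <= B -> cmeas m ->
  (forall x, cabs (m x) <= B * br x ^- (2 * d)) ->
  (forall j x, cabs (mul_coord j m x) <= B * br x ^- (2 * d)) ->
  ccont (fourier m) /\ forall i, is_cder i (fourier m) (fourier (mul_coord i m)).
Proof.
move=> B0 mm h1 h2.
pose K xi x := m x * expi (- (2 * pi) * dot x xi).
pose K' j xi x := mul_coord j m x * expi (- (2 * pi) * dot x xi).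
have mK xi : cmeas (K xi) by exact: cmeas_fourier_integrand.
have mK' j xi : cmeas (K' j xi).
  apply: cmeas_fourier_integrand; apply: cmeasM => //; apply: cmeasM; first exact: cmeas_cst.
  exact/ccont_cmeas/smooth_ccont/smooth_coord.
have M := majorantZ B0 (@majorant_wt0 R d).
have bw x : B * br x ^- (2 * d) <= B * wt x by rewrite ler_wpM2l// bracket_wt.
have Kg xi x : cabs (K xi x) <= B * wt x.
  by rewrite cabsM cabs_expi mulr1; exact: le_trans (h1 x) _.
have K'g j xi x : cabs (K' j xi x) <= B * wt x.
  by rewrite cabsM cabs_expi mulr1; exact: le_trans (h2 j x) _.
have dK j x : is_cder j (K^~ x) (K' j ^~ x).
  have := is_cderM (is_cder_cst j (m x)) (is_cder_expi j x (- (2 * pi))).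
  have -> : (fun xi => m x * expi (- (2 * pi) * dot xi x)) = K^~ x.
    by apply/funext => xi; rewrite /K dotC.
  congr is_cder; apply/funext => xi; rewrite /K' /mul_coord mul0r add0r dotC mulrA; congr (_ * _).
  by apply: complex_ext; rewrite ?cReM ?cImM /=; ring.
have FE : fourier m = fun xi => cint setT (K xi) by apply/funext => xi; rewrite fourierE.
split; last first.
  move=> i xi; rewrite FE fourierE.
  exact: (param_cder mK M (fun x y _ => Kg x y) (fun i x y _ => K'g i x y) dK i).
rewrite FE; apply: ccont_lip => xi; eexists; last first.
  by move=> y hy; exact: (param_lipschitz mK M (fun x y _ => Kg x y) (fun i x y _ => K'g i x y) dK hy).
by rewrite mulr_ge0// (majorant_ge0 M).
Qed.

Lemma uniform_bound (I : finType) (f : I -> Rd -> C) (g : Rd -> R) : (forall x, 0 <= g x) ->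
  (forall i, exists2 B : R, 0 <= B & forall x, cabs (f i x) <= B * g x) ->
  exists2 B : R, 0 <= B & forall i x, cabs (f i x) <= B * g x.
Proof.
move=> g0 H; have /choice[F HF] : forall i, exists B : R, 0 <= B /\ forall x, cabs (f i x) <= B * g x.
  by move=> i; have [B B0 h] := H i; exists B.
have F0 j : 0 <= F j by case: (HF j).
exists (\sum_j F j); first exact: sumr_ge0.
move=> j x; have [_ h] := HF j; apply: le_trans (h x) _.
by rewrite ler_wpM2r// (bigD1 j)//= lerDl sumr_ge0.
Qed.

Lemma fourier_cder m i : test_function m ->
  ccont (fourier m) /\ is_cder i (fourier m) (fourier (mul_coord i m)).
Proof.
move=> tm; have [B1 p1 h1] := schwartz_decay (2 * d) (test_schwartz tm).
have b0 (x : Rd) : 0 <= br x ^- (2 * d) by rewrite invr_ge0 exprn_ge0// ltW ?br_gt0.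
have [B2 p2 h2] := uniform_bound b0 (fun j => schwartz_decay (2 * d) (test_schwartz (test_mul_coord j tm))).
have [||x|j x|c h] := @fourier_cder_decay m (B1 + B2) _; last by split.
- exact: addr_ge0.
- exact: (ccont_cmeas (smooth_ccont (test_smooth tm))).
- by apply: le_trans (h1 x) _; rewrite ler_wpM2r// lerDl.
- by apply: le_trans (h2 j x) _; rewrite ler_wpM2r// lerDr.
Qed.

Lemma fourier_cpderiv m l : test_function m -> smooth (fourier m) /\
  exists2 m', test_function m' & cpderiv l (fourier m) = fourier m'.
Proof.
move=> tm; have [||sm H] := @smooth_coind R d (fun f => exists2 m, test_function m & f = fourier m) _ (fourier m) _.
- move=> _ [m' tm' ->]; split.
    case: (posnP d) => [d0|dp]; last by have [] := fourier_cder (Ordinal dp) tm'.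
    apply/ccontP => x e e0; exists 1 => // y _.
    suff -> : y = x by rewrite subrr cabs0 ltW.
    by apply/rowP => i; have := ltn_ord i; rewrite {2}d0.
  move=> i; have [_ h] := fourier_cder i tm'.
  by exists (fourier (mul_coord i m')) => //; exists (mul_coord i m') => //; exact: test_mul_coord.
- by exists m.
by split => //; exact: H.
Qed.

Lemma fourier_bounded m : test_function m -> exists2 B : R, 0 <= B & forall xi, cabs (fourier m xi) <= B.
Proof.
move=> tm; have [B B0 h] := schwartz_wt (test_schwartz tm).
have M := majorantZ B0 (@majorant_wt0 R d).
exists (B * pi ^+ d) => [|xi]; first exact: majorant_ge0 M.
rewrite fourierE; apply: (cabs_cint_le _ M) => [|x].
  exact/cmeas_fourier_integrand/schwartz_cmeas/test_schwartz.
by rewrite cabsM cabs_expi mulr1.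
Qed.

(** The integral of a derivative vanishes, as integrals are translation invariant. *)
Lemma cint_cder0 f f' i (B : R) : 0 <= B -> cmeas f -> cmeas f' -> is_cder i f f' ->
  (forall x, cabs (f x) <= B * br x ^- (2 * d)) ->
  (forall x, cabs (f' x) <= B * br x ^- (2 * d)) -> cint setT f' = 0.
Proof.
move=> B0 mf mf' df hf hf'.
have fi : cintble f.
  apply: (cintble_majorant mf (majorantZ B0 majorant_wt0)) => x.
  by apply: le_trans (hf x) _; rewrite ler_wpM2l// bracket_wt.
pose e : Rd := delta_mx 0 i.
pose g x := B * 2 ^+ (2 * d) * wt x.
have M : majorant g _ := majorantZ (mulr_ge0 B0 (exprn_ge0 _ (ler0n R 2))) (@majorant_wt0 R d).
have shiftb t x : t \in `](-1)%R, 1[ -> B * br (x + t *: e) ^- (2 * d) <= g x.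
  rewrite in_itv/= => /andP[t1 t2]; rewrite /g -mulrA ler_wpM2l//.
  apply: le_trans (_ : 2 ^+ (2 * d) * br x ^- (2 * d) <= _); last by rewrite ler_wpM2l ?bracket_wt// exprn_ge0.
  rewrite -ler_pdivrMl ?exprn_gt0// -invfM lef_pV2 ?posrE ?mulr_gt0 ?exprn_gt0 ?br_gt0//.
  rewrite -exprMn lerXn2r ?nnegrE ?mulr_ge0 ?(ltW (br_gt0 _))//.
  have := br_add (x + t *: e) (- (t *: e)); rewrite addrK brN mulrC => /le_trans; apply.
  rewrite ler_wpM2r ?(ltW (br_gt0 _))// /br.
  have : `|t *: e| <= 1.
    apply: norm_le => // j; rewrite !mxE eqxx /=.
    case: eqP => _ /=; last by rewrite mulr0 normr0.
    by rewrite mulr1 ler_norml (ltW t1) ltW.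
  lra.
have [mg g0 ig] := M.
have gi : leb.-integrable setT (EFin \o g).
  by apply: (integrable_le mg mg _ ig) => x; rewrite ger0_norm.
have maff t : measurable_fun setT (fun x : Rd => x + t *: e).
  by have := measurable_affine 1 (t *: e); under eq_fun do rewrite scale1r.
have key (p : C -> R) : (forall z, `|p z| <= cabs z) -> measurable_fun setT (fun y => p (f y)) ->
   (forall x, is_derive x e (fun x => p (f x)) (p (f' x))) ->
   (forall t, \int[leb]_y p (f (y + t *: e)) = \int[leb]_y p (f y)) -> \int[leb]_y p (f' y) = 0.
  move=> pc mp dp inv.
  pose h (t : R) (y : Rd) := p (f (y + t *: e)).
  have dh (t : R) (y : Rd) : is_derive t (1 : R) (h^~ y) (p (f' (y + t *: e))).
    have := dp (t *: e + y) => /(is_derive_line (fun x => p (f x))).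
    by rewrite addrC; under eq_fun do rewrite addrC.
  have I0 : `](-1)%R, 1[%classic (0 : R) by rewrite /= in_itv /= ltrN10 ltr01.
  have inth t : `](-1)%R, 1[%classic t -> leb.-integrable setT (EFin \o h t).
    move=> ht; apply: (integrable_le _ mg _ ig) => [|y]; first exact: (measurableT_comp mp (maff t)).
    by apply: le_trans (pc _) (le_trans (hf _) _); exact: shiftb.
  have derh t y : `](-1)%R, 1[%classic t -> setT y -> derivable (h^~ y) t 1.
    by move=> _ _; case: (dh t y).
  have ub t y : `](-1)%R, 1[%classic t -> setT y -> `|partial1of2 h t y| <= g y.
    move=> ht _; rewrite /partial1of2 derive1E; have [_ ->] := dh t y.
    by apply: le_trans (pc _) (le_trans (hf' _) _); exact: shiftb.
  have := differentiation_under_integral measurableT I0 inth derh g0 gi ub.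
  have -> : (fun t => \int[leb]_y h t y) = cst (\int[leb]_y p (f y)) by apply/funext => t; exact: inv.
  rewrite derive1_cst => ->; apply: eq_Rintegral => y _.
  by rewrite /partial1of2 derive1E; have [_ ->] := dh 0 y; rewrite scale0r addr0.
have inv t := cint_shift (t *: e) fi.
apply: complex_ext.
  apply: (key (@complex.Re R) (@Re_le_cabs R)); first by case: mf.
    by move=> x; case: (df x).
  by move=> t; have := congr1 (@complex.Re R) (inv t).
apply: (key (@complex.Im R) (@Im_le_cabs R)); first by case: mf.
  by move=> x; case: (df x).
by move=> t; have := congr1 (@complex.Im R) (inv t).
Qed.

Lemma fourier_of_cder_decay f f' i (B : R) xi : 0 <= B -> cmeas f -> cmeas f' -> is_cder i f f' ->
  (forall x, cabs (f x) <= B * br x ^- (2 * d)) ->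
  (forall x, cabs (f' x) <= B * br x ^- (2 * d)) ->
  fourier f' xi = Complex 0 (2 * pi * xi 0 i) * fourier f xi.
Proof.
move=> B0 mf mf' df hf hf'; pose k : R := - (2 * pi).
pose E := fun x : Rd => expi (k * dot x xi).
have M := majorantZ B0 (@majorant_wt0 R d).
have bw x : B * br x ^- (2 * d) <= B * wt x by rewrite ler_wpM2l// bracket_wt.
have i1 : cintble (fun x => f' x * E x).
  by apply: cintble_fourier => //; apply: (cintble_majorant mf' M) => x; exact: le_trans (hf' x) _.
have i2 : cintble (fun x => f x * E x).
  by apply: cintble_fourier => //; apply: (cintble_majorant mf M) => x; exact: le_trans (hf x) _.
have m1 := cmeas_fourier_integrand k xi mf; have m2 := cmeas_fourier_integrand k xi mf'.
pose c := Complex 0 (k * xi 0 i).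
have dE := is_cderM df (is_cder_expi i xi k).
have EE : (fun x => f' x * E x + f x * (c * E x)) = (fun x => f' x * E x + c * (f x * E x)).
  by apply/funext => x; congr (_ + _); rewrite mulrCA.
have B2 : 0 <= B + cabs c * B by rewrite addr_ge0// mulr_ge0// cabs_ge0.
have b0 (x : Rd) : 0 <= br x ^- (2 * d) by rewrite invr_ge0 exprn_ge0// ltW ?br_gt0.
have := cint_cder0 B2 m1 _ dE _ _; rewrite EE => H.
have : cint setT (fun x => f' x * E x + c * (f x * E x)) = 0.
  apply: H => [|x|x]; first by apply: cmeasD => //; apply: cmeasM => //; exact: cmeas_cst.
    rewrite cabsM cabs_expi mulr1; apply: le_trans (hf x) _; rewrite ler_wpM2r// lerDl.
    by rewrite mulr_ge0// cabs_ge0.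
  apply: le_trans (cabsD _ _) _; rewrite !cabsM !cabs_expi !mulr1 mulrDl -mulrA.
  by rewrite [X in _ + X <= _]mulrC lerD// ler_wpM2l// cabs_ge0.
rewrite cintD//; last exact: cintbleZ.
rewrite cintZ// -!fourierE => /eqP; rewrite addr_eq0 => /eqP ->.
rewrite -mulNr; congr (_ * _); rewrite /c /k; apply: complex_ext; rewrite ?cReN ?cImN /= ?oppr0//; ring.
Qed.

Lemma fourier_of_cder m i xi : test_function m ->
  fourier (cder i m) xi = Complex 0 (2 * pi * xi 0 i) * fourier m xi.
Proof.
move=> tf; have sf := test_schwartz tf; have sf' := test_schwartz (test_cder i tf).
have [B1 p1 h1] := schwartz_decay (2 * d) sf; have [B2 p2 h2] := schwartz_decay (2 * d) sf'.
apply: (@fourier_of_cder_decay m (cder i m) i (B1 + B2)).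
- exact: addr_ge0.
- exact: schwartz_cmeas.
- exact: schwartz_cmeas.
- exact/smooth_is_cder/test_smooth.
- by move=> x; apply: le_trans (h1 x) _; rewrite ler_wpM2r ?lerDl// invr_ge0 exprn_ge0// ltW ?br_gt0.
- by move=> x; apply: le_trans (h2 x) _; rewrite ler_wpM2r ?lerDr// invr_ge0 exprn_ge0// ltW ?br_gt0.
Qed.

Lemma bracket_pow_coord x k : br x ^+ k <= 2 ^+ k * (1 + \sum_i `|x 0 i| ^+ k).
Proof.
have [x1|x1] := leP `|x| 1.
  apply: (@le_trans _ _ (2 ^+ k)).
    by rewrite lerXn2r ?nnegrE ?(ltW (br_gt0 x))// /br; lra.
  by rewrite ler_peMr ?exprn_ge0// lerDl sumr_ge0// => i _; rewrite exprn_ge0.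
apply: (@le_trans _ _ (2 ^+ k * `|x| ^+ k)).
  by rewrite -exprMn lerXn2r ?nnegrE ?mulr_ge0 ?(ltW (br_gt0 x))// /br; lra.
rewrite ler_wpM2l ?exprn_ge0//.
have [i ->] : exists i, `|x| = `|x 0 i|.
  have : mx_norm x != 0 by rewrite -[mx_norm x]/(`|x|) gt_eqF// (lt_trans _ x1).
  by case/mx_norm_neq0 => -[a b] /= e; exists b; rewrite -[LHS]/(mx_norm x) e ord1.
rewrite (bigD1 i)//= addrCA lerDl; apply: addr_ge0 => //.
by apply: sumr_ge0 => j _; exact: exprn_ge0.
Qed.

(** Each power of a coordinate is traded for a derivative of [m]. *)
Lemma fourier_coord_decay m i k : test_function m ->
  exists2 B : R, 0 <= B & forall xi, `|xi 0 i| ^+ k * cabs (fourier m xi) <= B.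
Proof.
move=> tm; elim: k m tm => [|k IH] m tm.
  by have [B B0 h] := fourier_bounded tm; exists B => // xi; rewrite expr0 mul1r.
have [B B0 h] := IH _ (test_cder i tm); exists B => // xi.
apply: le_trans (h xi); rewrite fourier_of_cder// cabsM cabs_imag normrM.
rewrite exprSr -mulrA ler_wpM2l ?exprn_ge0// ler_wpM2r ?cabs_ge0//.
rewrite ler_peMl// ger0_norm ?mulr_ge0 ?pi_ge0//.
by have := @pi_ge2 R; lra.
Qed.

(** Derivatives of the transform are transforms of test functions, and their decay comes from
    the derivatives of those. *)
Lemma schwartz_fourier m : test_function m -> schwartz (fourier m).
Proof.
move=> tm; have [sm _] := fourier_cpderiv [::] tm; apply/schwartzP; split=> // l k.
have [_ [m' tm' ->]] := fourier_cpderiv l tm.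
have /choice[F HF] : forall i, exists B : R, forall xi, `|xi 0 i| ^+ k * cabs (fourier m' xi) <= B.
  by move=> i; have [B _ h] := fourier_coord_decay i k tm'; exists B.
have [B B0 hB] := fourier_bounded tm'.
exists (2 ^+ k * (B + \sum_i F i)) => xi.
apply: le_trans (ler_wpM2r (cabs_ge0 _) (bracket_pow_coord xi k)) _.
rewrite -mulrA ler_wpM2l ?exprn_ge0// mulrDl mul1r lerD// mulr_suml.
by apply: ler_sum => i _; exact: HF.
Qed.

End fourier_transform.

(** * Gaussian functions *)

Section gaussian.
Context {R : realType} {d : nat}.
Local Notation C := R[i].
Local Notation Rd := 'rV[R]_d.
Local Notation leb := (@lebesgue_rV R d).

Definition gauss1 (t : R) : R := expR (- (pi * t ^+ 2)).

Definition gaussian (x : Rd) : C := (\prod_(i < d) gauss1 (x 0 i))%:C%C.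

Lemma gauss1_le (t : R) : gauss1 t <= (1 + t ^+ 2)^-1.
Proof.
rewrite /gauss1 expRN lef_pV2 ?posrE ?expR_gt0//; last by rewrite ltr_wpDr ?sqr_ge0.
apply: le_trans (expR_ge1Dx _); rewrite lerD2l ler_peMl ?sqr_ge0//.
by have := @pi_ge2 R; lra.
Qed.

Lemma is_derive_gauss1 (s t : R) : is_derive t (1 : R) (fun t => expR (s * t ^+ 2)) (2 * s * t * expR (s * t ^+ 2)).
Proof.
have h1 := @is_deriveX R R id 2 t 1 1 (is_derive_id _ _).
have h2 := @is_deriveM R R (cst s) _ t 1 0 _ (is_derive_cst _ _ _) h1.
have h3 := @is_derive1_comp R expR (fun t => s * t ^+ 2) t _ _ (is_derive_expR _) h2.
by apply: (derive_eq h3); rewrite /= /GRing.scale /= /GRing.exp /=; ring.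
Qed.

Lemma gauss1_cont : continuous gauss1.
Proof.
move=> t; apply: differentiable_continuous; apply/derivable1_diffP.
have -> : gauss1 = fun t => expR (- pi * t ^+ 2) by apply/funext => s; rewrite /gauss1 mulNr.
by case: (is_derive_gauss1 (- pi) t).
Qed.

Lemma measurable_gauss1 : measurable_fun setT gauss1.
Proof. exact: continuous_measurable_fun gauss1_cont. Qed.

Lemma integral_gauss1 : (\int[@lebesgue_measure R]_t (gauss1 t)%:E = 1)%E.
Proof.
have p0 : 0 < Num.sqrt (pi : R) by rewrite sqrtr_gt0 pi_gt0.
have mg : measurable_fun setT (fun t : R => (gauss_fun t)%:E).
  by case/integrableP: (@integrableT_gauss R).
have := @ge0_integral_affine R (Num.sqrt pi) 0 (fun t => (gauss_fun t)%:E).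
rewrite gt_eqF// => /(_ isT mg (fun t => ltW (expR_gt0 _))).
rewrite integralT_gauss.
rewrite gtr0_norm// => /(congr1 (fun z => ((Num.sqrt pi)^-1%:E * z)%E)).
rewrite muleA -!EFinM mulVf ?gt_eqF// mul1e => <-.
apply: eq_integral => t _; rewrite /gauss1; congr (expR (- _))%:E.
by rewrite addr0 exprMn sqr_sqrtr// pi_ge0.
Qed.

Lemma gaussian_wt x : cabs (gaussian x) <= wt x.
Proof.
rewrite cabs_real ger0_norm; last by apply: prodr_ge0 => i _; exact: expR_ge0.
by apply: ler_prod => i _; rewrite expR_ge0 gauss1_le.
Qed.

Lemma cmeas_gaussian : cmeas gaussian.
Proof.
apply: cmeas_real; apply: (@measurable_prod _ _ _ _ _ _ (fun i (x : Rd) => gauss1 (x 0 i))) => i _.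
apply: (measurableT_comp (f := gauss1)); last exact: measurable_coor.
exact: measurable_gauss1.
Qed.

Lemma cintble_gaussian : cintble gaussian.
Proof. exact: (cintble_majorant cmeas_gaussian majorant_wt0 gaussian_wt). Qed.

Lemma cint_gaussian : cint setT gaussian = 1.
Proof.
apply: complex_ext; rewrite /= /Rintegral; last by rewrite integral0.
under eq_integral do rewrite -prodEFin.
rewrite (ge0_integral_prod (f := fun=> fun t => (gauss1 t)%:E)).
- by rewrite big1// => i _; exact: integral_gauss1.
- by move=> i; apply/measurable_EFinP; exact: measurable_gauss1.
- by move=> i t; rewrite lee_fin expR_ge0.
Qed.

Lemma is_cder_gauss_prod (s : R) i :
  is_cder i (fun x : Rd => (\prod_(j < d) expR (s * x 0 j ^+ 2))%:C%C)
    (fun x => (2 * s)%:C%C * (x 0 i)%:C%C * (\prod_(j < d) expR (s * x 0 j ^+ 2))%:C%C).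
Proof.
have E (x : Rd) : (\prod_(j < d) expR (s * x 0 j ^+ 2))%:C%C =
   (fun x : Rd => (expR (s * x 0 i ^+ 2))%:C%C) x * (\prod_(j < d | j != i) expR (s * x 0 j ^+ 2))%:C%C.
  by rewrite (bigD1 i)//= rmorphM.
have h1 := @is_cder_fun1 R d i i _ _ (is_derive_gauss1 s).
have h2 : is_cder i (fun x : Rd => (\prod_(j < d | j != i) expR (s * x 0 j ^+ 2))%:C%C) (fun=> 0).
  move=> x; split; last exact: is_derive_cst.
  rewrite -[X in is_derive X]add0r -[X in X + _](scale0r (delta_mx 0 i : Rd)).
  apply/(is_derive_line (fun x => complex.Re ((\prod_(j < d | j != i) expR (s * x 0 j ^+ 2))%:C%C))).
  have -> : (fun t : R => complex.Re ((\prod_(j < d | j != i) expR (s * (t *: delta_mx 0 i + x) 0 j ^+ 2))%:C%C)) =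
    cst (\prod_(j < d | j != i) expR (s * x 0 j ^+ 2)).
    apply/funext => t /=; apply: eq_bigr => j /negbTE ji.
    by rewrite !mxE /= ji mulr0 add0r.
  exact: is_derive_cst.
have := is_cderM h1 h2; congr is_cder; apply/funext => x; first by rewrite E.
rewrite E eqxx mulr0 addr0 mulrA; congr (_ * _).
by apply: complex_ext; rewrite ?cReM ?cImM /=; ring.
Qed.

Lemma gaussianE x : gaussian x = (\prod_(j < d) expR (- pi * x 0 j ^+ 2))%:C%C.
Proof. by congr (_%:C)%C; apply: eq_bigr => j _; rewrite /gauss1 mulNr. Qed.

Lemma ccont_prod I (s : seq I) (F : I -> Rd -> C) : (forall i, ccont (F i)) ->
  ccont (fun x => \prod_(i <- s) F i x).
Proof.
move=> sF; elim: s => [|i s IH]; first by under eq_fun do rewrite big_nil; exact: ccont_cst.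
by have := ccontM (sF i) IH; congr ccont; apply/funext => x; rewrite big_cons.
Qed.

Lemma ccont_gaussian : ccont gaussian.
Proof.
have := @ccont_prod 'I_d (index_enum _) (fun i x => (gauss1 (x 0 i))%:C%C).
have -> : (fun x : Rd => \prod_i (gauss1 (x 0 i))%:C%C) = gaussian.
  by apply/funext => x; rewrite /gaussian rmorph_prod.
apply => i; split => x; last exact: cst_continuous.
apply: (@continuous_comp _ _ _ (fun x : Rd => x 0 i) gauss1); first exact: coord_continuous.
exact: gauss1_cont.
Qed.

Lemma gauss1_le1 (t : R) : gauss1 t <= 1.
Proof. by rewrite -expR0 ler_expR oppr_le0 mulr_ge0 ?pi_ge0 ?sqr_ge0. Qed.

Lemma gaussian_decay k : exists2 B : R, 0 <= B & forall x, cabs (gaussian x) <= B * br x ^- k.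
Proof.
have g1 x : cabs (gaussian x) <= 1.
  rewrite cabs_real ger0_norm; last by apply: prodr_ge0 => j _; exact: expR_ge0.
  by apply: prodr_ile1 => j _; rewrite expR_ge0 gauss1_le1.
case: k => [|k]; first by exists 1 => // x; rewrite expr0 invr1 mulr1.
pose n := k.+1; exists (2 ^+ n.+1 * n`!%:R) => [|x]; first by rewrite mulr_ge0// exprn_ge0.
have f1 : (1 : R) <= n`!%:R by rewrite ler1n fact_gt0.
have p1 : (1 : R) <= 2 ^+ n.+1 by rewrite exprn_ege1// ler1n.
rewrite ler_pdivlMr ?exprn_gt0 ?br_gt0//.
have [x0|x0] := eqVneq `|x| 0.
  rewrite /br x0 addr0 expr1n mulr1; apply: le_trans (g1 x) _.
  by move: p1 f1; move: (2 ^+ n.+1) (n`!%:R) => a b; nra.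
have [i xi] : exists i, `|x| = `|x 0 i|.
  have : mx_norm x != 0 by [].
  by case/mx_norm_neq0 => -[a b] /= e; exists b; rewrite -[LHS]/(mx_norm x) e ord1.
have h1 : cabs (gaussian x) <= gauss1 (x 0 i).
  rewrite cabs_real ger0_norm; last by apply: prodr_ge0 => j _; exact: expR_ge0.
  rewrite (bigD1 i)//= ler_piMr ?expR_ge0//; apply: prodr_ile1 => j _.
  by rewrite expR_ge0 gauss1_le1.
apply: le_trans (ler_wpM2r _ h1) _; first by rewrite exprn_ge0// ltW// br_gt0.
rewrite /gauss1 expRN mulrC ler_pdivrMr ?expR_gt0// /br xi.
have pt : 0 <= pi * x 0 i ^+ 2 by rewrite mulr_ge0 ?pi_ge0 ?sqr_ge0.
apply: le_trans (ler_wpM2l _ (expR_ge1Dxn k pt)); last by rewrite mulr_ge0// exprn_ge0.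
have : `|x 0 i| ^+ (2 * n) <= (pi * x 0 i ^+ 2) ^+ n.
  rewrite exprM real_normK ?num_real// lerXn2r ?nnegrE ?sqr_ge0//.
  by rewrite ler_peMl ?sqr_ge0//; have := @pi_ge2 R; lra.
have : (1 + `|x 0 i|) ^+ n <= 2 ^+ n.+1 * (1 + `|x 0 i| ^+ (2 * n)).
  have [t1|t1] := leP `|x 0 i| 1.
    apply: (@le_trans _ _ (2 ^+ n)); first by rewrite lerXn2r ?nnegrE ?addr_ge0//; lra.
    rewrite exprS -mulrA mulrCA ler_peMr ?exprn_ge0//.
    by have : 0 <= `|x 0 i| ^+ (2 * n) by []; lra.
  apply: (@le_trans _ _ ((2 * `|x 0 i| ^+ 2) ^+ n)).
    by rewrite lerXn2r ?nnegrE ?addr_ge0 ?mulr_ge0 ?sqr_ge0//; nra.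
  rewrite exprMn -exprM exprS -mulrA mulrCA ler_wpM2l ?exprn_ge0//.
  by have : 0 <= `|x 0 i| ^+ (2 * n) by []; lra.
rewrite -[k.+1]/n; move: ((pi * x 0 i ^+ 2) ^+ n) (`|x 0 i| ^+ (2 * n)) ((1 + `|x 0 i|) ^+ n) => p q r h2 h3.
apply: le_trans h2 _; rewrite -[leRHS]mulrA ler_wpM2l ?exprn_ge0//.
rewrite mulrDr mulr1 mulrCA mulfV ?mulr1 ?gt_eqF ?(lt_le_trans _ f1)//; lra.
Qed.

Lemma is_cder_gaussian i : is_cder i gaussian (fun x => (- (2 * pi))%:C%C * (x 0 i)%:C%C * gaussian x).
Proof.
have := is_cder_gauss_prod (- pi) i; congr is_cder; apply/funext => x; rewrite gaussianE//.
by rewrite mulrN.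
Qed.

End gaussian.

Section fourier_inversion.
Context {R : realType} {d : nat}.
Local Notation C := R[i].
Local Notation Rd := 'rV[R]_d.
Implicit Types (m f g : Rd -> C) (x y xi : Rd).

Lemma fourier_gaussian_cder i : ccont (fourier (gaussian : Rd -> C)) /\
  is_cder i (fourier (gaussian : Rd -> C)) (fun xi => (- (2 * pi))%:C%C * (xi 0 i)%:C%C * fourier gaussian xi).
Proof.
pose G : Rd -> C := gaussian.
have [B1 p1 h1] := @gaussian_decay R d (2 * d).+1.
have brd x : br (x : Rd) ^- (2 * d).+1 <= br x ^- (2 * d).
  by rewrite lef_pV2 ?posrE ?exprn_gt0 ?br_gt0// br_le_exp.
have mG := @cmeas_gaussian R d.
have pi1 : (1 : R) <= 2 * pi by have := @pi_ge2 R; lra.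
pose B := 2 * pi * B1; have B0 : 0 <= B by rewrite !mulr_ge0// pi_ge0.
have hG x : cabs (G x) <= B * br x ^- (2 * d).
  apply: le_trans (h1 x) _; apply: ler_pM => //; first by rewrite invr_ge0 exprn_ge0// ltW ?br_gt0.
  by rewrite /B ler_peMl.
have hx j x : cabs ((- (2 * pi))%:C%C * (x 0 j)%:C%C * G x) <= B * br x ^- (2 * d).
  rewrite !cabsM (cabs_real (- _)) (cabs_real (x 0 j)) normrN ger0_norm ?mulr_ge0 ?pi_ge0//.
  rewrite /B -!mulrA ler_wpM2l// ler_wpM2l ?pi_ge0//.
  apply: le_trans (ler_pM _ _ (_ : _ <= br x) (h1 x)) _; rewrite ?cabs_ge0//.
    by apply: le_trans (coord_le x j) _; rewrite lerDr.
  by rewrite mulrCA exprS invfM (mulrA (br x)) divff ?mul1r ?gt_eqF ?br_gt0.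
have mE j : mul_coord j G = fun x => Complex 0 1 * ((- (2 * pi))%:C%C * (x 0 j)%:C%C * G x).
  apply/funext => x; rewrite /mul_coord !mulrA; congr (_ * _ * _).
  by apply: complex_ext; rewrite ?cReM ?cImM /=; ring.
have i1 : cabs (Complex 0 1 : C) = 1 by rewrite cabs_imag normr1.
have mx j : cmeas (fun x => (- (2 * pi))%:C%C * (x 0 j)%:C%C * G x).
  apply: cmeasM => //; apply: cmeasM; first exact: cmeas_cst.
  exact/ccont_cmeas/smooth_ccont/smooth_coord.
have [|cF dF] := fourier_cder_decay B0 mG hG; first by move=> j x; rewrite mE cabsM i1 mul1r.
split=> //; have := dF i; congr is_cder; apply/funext => xi.
rewrite mE fourierE.
rewrite (_ : cint _ _ = Complex 0 1 * fourier (fun x => (- (2 * pi))%:C%C * (x 0 i)%:C%C * G x) xi).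
  rewrite (fourier_of_cder_decay xi B0 mG (mx i) (is_cder_gaussian i) hG (hx i)) mulrA; congr (_ * _).
  by apply: complex_ext; rewrite ?cReM ?cImM /=; ring.
rewrite fourierE -cintZ; last first.
  apply: cintble_fourier => //; apply: (cintble_majorant (mx i) (majorantZ B0 (@majorant_wt0 R d))) => x.
  by apply: le_trans (hx i x) _; rewrite ler_wpM2l// bracket_wt.
by congr cint; apply/funext => x; rewrite !mulrA.
Qed.

(** The transform and the Gaussian solve the same linear differential equation, so their
    quotient is constant. *)
Lemma fourier_gaussian xi : fourier (gaussian : Rd -> C) xi = gaussian xi.
Proof.
pose E (x : Rd) := (\prod_(j < d) expR (pi * x 0 j ^+ 2))%:C%C : C.
have EG x : gaussian x * E x = 1.
  rewrite gaussianE -rmorphM -big_split /= big1 ?rmorph1// => j _.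
  by rewrite -expRD -mulrDl addNr mul0r expR0.
have dH i : is_cder i (fun x => fourier (gaussian : Rd -> C) x * E x) (fun=> 0).
  have := is_cderM (fourier_gaussian_cder i).2 (is_cder_gauss_prod pi i).
  congr is_cder; apply/funext => x; move: (fourier _ _) => F.
  by rewrite rmorphN /=; ring.
have H0 : fourier (gaussian : Rd -> C) 0 * E 0 = 1.
  rewrite /E big1 ?rmorph1 ?mulr1 => [|j _]; last by rewrite mxE expr0n mulr0 expR0.
  rewrite -[RHS](@cint_gaussian R d) fourierE; congr cint; apply/funext => x.
  by rewrite dotC (_ : dot 0 x = 0) ?mulr0 ?expi0 ?mulr1// /dot big1// => j _; rewrite mxE mul0r.
have cst x : fourier (gaussian : Rd -> C) x * E x = 1.
  apply/eqP; rewrite -H0 -subr_eq0; apply/eqP/cabs_eq0/eqP; rewrite eq_le cabs_ge0 andbT.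
  have := @clipschitz R d _ _ 0 x 0 dH _; rewrite add0r mulr0 mul0r; apply => i y _.
  by rewrite cabs0.
by rewrite -[LHS]mulr1 -(EG xi) mulrCA (cst xi) mulr1.
Qed.

End fourier_inversion.

(** * Fourier inversion *)

Section inversion.
Context {R : realType} {d : nat}.
Local Notation C := R[i].
Local Notation Rd := 'rV[R]_d.
Local Notation leb := (@lebesgue_rV R d).
Implicit Types (m f g : Rd -> C) (x y xi : Rd).

Lemma cintble_wt f (B : R) : 0 <= B -> cmeas f -> (forall x, cabs (f x) <= B * wt x) -> cintble f.
Proof. by move=> B0 mf h; apply: (cintble_majorant mf (majorantZ B0 majorant_wt0)). Qed.

Lemma real_complexV (a : R) : a != 0 -> (a^-1)%:C%C * a%:C%C = 1 :> C.
Proof. by move=> a0; rewrite -rmorphM mulVf// rmorph1. Qed.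

Lemma cmeas_dilate f (c : R) : cmeas f -> cmeas (fun x => f (c *: x)).
Proof.
move=> mf; have := cmeas_comp mf (measurable_affine c (0 : Rd)).
by congr (_ /\ _); congr measurable_fun; apply/funext => x; rewrite addr0.
Qed.

Lemma cintble_dilate f (c : R) : c != 0 -> cintble f -> cintble (fun x => f (c *: x)).
Proof. by move=> c0 fi; have [+ _] := cint_affine 0 c0 fi; under eq_fun do rewrite addr0. Qed.

Lemma null_limit_unique (a : nat -> C) (v w : C) :
  null (fun n => cabs (a n - v)) -> null (fun n => cabs (a n - w)) -> v = w.
Proof.
move=> n1 n2; apply/eqP; rewrite -subr_eq0; apply/eqP/cabs_eq0/(null_eq0 (cabs_ge0 _)).
apply: null_le (nullD n1 n2); exists 0%N => n _; rewrite (cabsBC (a n) v).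
by apply: le_trans (cabsD _ _); rewrite addrA subrK.
Qed.

Lemma ccont_null f (a : nat -> Rd) x : ccont f ->
  null (fun n => `|a n - x|) -> null (fun n => cabs (f (a n) - f x)).
Proof.
move=> /ccontP cf na e e0; have [r r0 hr] := cf x e e0.
have [N HN] := na (r / 2) (divr_gt0 r0 (ltr0n _ 2)).
by exists N => n nN; apply: hr; apply: le_lt_trans (HN n nN) _; lra.
Qed.

(** Averaging [f] against ever more concentrated copies of [g] recovers [f 0]. *)
Lemma cint_dilate_null f g (A B : R) : ccont f -> cmeas g -> 0 <= A -> 0 <= B ->
  (forall x, cabs (f x) <= A) -> (forall x, cabs (g x) <= B * wt x) ->
  null (fun n => cabs (cint setT (fun x => f (2 ^- n *: x) * g x) - f 0 * cint setT g)).
Proof.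
move=> cf mg A0 B0 fA gB.
have mf := ccont_cmeas cf; have ig := cintble_wt B0 mg gB.
have := @cint_dominated R d (fun n x => f (2 ^- n *: x) * g x) (fun x => f 0 * g x)
  (fun x => A * B * wt x) (A * B * pi ^+ d).
rewrite cintZ//; apply.
- by move=> n; apply: cmeasM => //; exact: cmeas_dilate.
- by apply: cmeasM => //; exact: cmeas_cst.
- exact: (majorantZ (mulr_ge0 A0 B0) majorant_wt0).
- by move=> n x; rewrite cabsM -mulrA; apply: ler_pM; rewrite ?cabs_ge0.
- apply: aeW => x.
  have : null (fun n => cabs (f (2 ^- n *: x) - f 0)).
    apply: ccont_null => //; apply: null_le (nullZ (normr_ge0 x) null_exp2).
    exists 0%N => n _; rewrite subr0 normrZ ger0_norm ?invr_ge0 ?exprn_ge0//.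
    by rewrite mulrC.
  move=> /(nullZ (cabs_ge0 (g x))); apply: null_le; exists 0%N => n _.
  by rewrite -mulrBl cabsM mulrC.
Qed.

Lemma fourier_scale f (c : R) x : c != 0 -> cintble f -> cmeas f ->
  (`|c| ^+ d)%:C%C * fourier (fun xi => f (c *: xi)) x = fourier f (c^-1 *: x).
Proof.
move=> c0 fi mf; rewrite !fourierE.
have [_ <-] := cint_affine 0 c0 (cintble_fourier (- (2 * pi)) (c^-1 *: x) fi mf).
congr (_ * cint _ _); apply/funext => y; rewrite addr0; congr (_ * expi (_ * _)).
by rewrite dotZr dotZl mulrA mulVf// mul1r.
Qed.

Lemma gaussian0 : gaussian (0 : Rd) = 1.
Proof.
rewrite /gaussian big1 ?rmorph1// => j _.
by rewrite /gauss1 mxE expr0n mulr0 oppr0 expR0.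
Qed.

Lemma gaussian_bounded x : cabs (gaussian x) <= 1.
Proof.
rewrite cabs_real ger0_norm; last by apply: prodr_ge0 => j _; exact: expR_ge0.
by apply: prodr_ile1 => j _; rewrite expR_ge0 gauss1_le1.
Qed.

Lemma cmeas_schwartz_fst f : cmeas f -> cmeas (fun z : Rd * Rd => f z.1).
Proof. by move=> mf; exact: cmeas_comp mf measurable_fst. Qed.

Lemma cmeas_schwartz_snd f : cmeas f -> cmeas (fun z : Rd * Rd => f z.2).
Proof. by move=> mf; exact: cmeas_comp mf measurable_snd. Qed.

(** Inversion at the origin: move the transform to a dilated Gaussian, which tends to one on one
    side and concentrates at the origin on the other. *)
Lemma cint_fourier0 m : test_function m -> cint setT (fourier m) = m 0.
Proof.
move=> tm; have sF := schwartz_fourier tm; have sm := test_schwartz tm.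
have [BF BF0 hF] := schwartz_wt sF; have [Bm Bm0 hm] := schwartz_wt sm.
have [A A0 hA] := test_bounded tm.
have cG := @ccont_gaussian R d.
have n1 := cint_dilate_null cG (schwartz_cmeas sF) ler01 BF0 gaussian_bounded hF.
have n2 := cint_dilate_null (smooth_ccont (test_smooth tm)) (@cmeas_gaussian R d) A0 ler01 hA
  (fun x => le_trans (gaussian_wt x) (eq_ind_r (fun z => _ <= z) (lexx _) (mul1r _))).
rewrite gaussian0 mul1r in n1; rewrite cint_gaussian mulr1 in n2.
have E (c : R) : 0 < c -> cint setT (fun x => gaussian (c *: x) * fourier m x) =
    cint setT (fun x => m (c *: x) * gaussian x).
  move=> c0.
  pose Gc (y : Rd) : C := gaussian (c *: y).
  have iGc : cintble Gc by exact: cintble_dilate (lt0r_neq0 c0) cintble_gaussian.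
  have mGc : cmeas Gc by exact: cmeas_dilate cmeas_gaussian.
  pose H (y x : Rd) := Gc y * (m x * expi (- (2 * pi) * dot x y)).
  have mH : cmeas (fun z : Rd * Rd => H z.1 z.2).
    apply: cmeasM; first exact: cmeas_schwartz_fst.
    apply: cmeasM; first exact: cmeas_schwartz_snd (schwartz_cmeas sm).
    have := @cmeas_char R d (- (2 * pi)).
    by have -> : (fun z : Rd * Rd => expi (- (2 * pi) * dot z.1 z.2)) =
      (fun z : Rd * Rd => expi (- (2 * pi) * dot z.2 z.1)) by apply/funext => z; rewrite dotC.
  have ci0 : 0 <= (c ^+ d)^-1 by rewrite invr_ge0 exprn_ge0// ltW.
  have M1 := majorantZ ci0 (@majorant_wt R d c 0 c0).
  have [|_ _ F] := @cint_fubini R d H _ _ _ _ mH M1 (majorantZ Bm0 (@majorant_wt0 R d)).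
    move=> y x; rewrite !cabsM cabs_expi mulr1 ler_pM ?cabs_ge0//.
    have /mulKf -> : c ^+ d != 0 by rewrite expf_neq0// gt_eqF.
    by rewrite subr0; exact: gaussian_wt.
  have -> : cint setT (fun x => gaussian (c *: x) * fourier m x) = cint setT (fun y => cint setT (H y)).
    congr cint; apply/funext => y; rewrite fourierE.
    by rewrite -(cintZ _ (cintble_fourier _ _ (schwartz_cintble sm) (schwartz_cmeas sm))).
  rewrite F.
  have -> : cint setT (fun x => cint setT (H^~ x)) = cint setT (fun x => m x * fourier Gc x).
    congr cint; apply/funext => x; rewrite fourierE.
    rewrite -(cintZ _ (cintble_fourier _ _ iGc mGc)).
    by congr cint; apply/funext => y; rewrite /H mulrCA dotC.
  have imG : cintble (fun x => m x * fourier Gc x).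
    have FGc x : fourier Gc x = (`|c| ^+ d)^-1%:C%C * gaussian (c^-1 *: x).
      rewrite -fourier_gaussian -(fourier_scale x (lt0r_neq0 c0) cintble_gaussian cmeas_gaussian).
      have cd0 : `|c| ^+ d != 0 by apply: expf_neq0; rewrite normr_eq0; exact: lt0r_neq0.
      by rewrite mulrA (real_complexV cd0) mul1r.
    have cd1 : 0 <= (`|c| ^+ d)^-1 by rewrite invr_ge0 exprn_ge0.
    have mF : cmeas (fourier Gc).
      have -> : fourier Gc = (fun x => (`|c| ^+ d)^-1%:C%C * gaussian (c^-1 *: x)) by apply/funext.
      by apply: cmeasM; [exact: cmeas_cst|exact: cmeas_dilate cmeas_gaussian].
    apply: (cintble_wt (mulr_ge0 Bm0 cd1) (cmeasM (schwartz_cmeas sm) mF)) => x.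
    rewrite FGc cabsM (cabsM (_%:C)%C) cabs_real (ger0_norm cd1) mulrCA.
    rewrite -mulrA [leRHS]mulrCA; apply: (ler_wpM2l cd1).
    apply: le_trans (ler_piMr (cabs_ge0 _) (gaussian_bounded _)) _; exact: hm.
  have [iaff <-] := cint_affine 0 (lt0r_neq0 c0) imG.
  rewrite -(cintZ _ iaff); congr cint; apply/funext => x; rewrite addr0 mulrCA; congr (_ * _).
  rewrite (fourier_scale _ (lt0r_neq0 c0) cintble_gaussian cmeas_gaussian) fourier_gaussian.
  by rewrite scalerA (mulVf (lt0r_neq0 c0)) scale1r.
apply: null_limit_unique n1 _; apply: null_le n2; exists 0%N => n _.
by rewrite E ?invr_gt0 ?exprn_gt0.
Qed.

(** Fourier inversion, reduced to the origin by a translation. *)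
Lemma ifourierK m x : test_function m -> ifourier (fourier m) x = m x.
Proof.
move=> tm; pose mx y := m (1 *: y + x).
have tmx : test_function mx by exact: test_affine (oner_neq0 _) tm.
have <- : mx 0 = m x by rewrite /mx scaler0 add0r.
rewrite -cint_fourier0// /ifourier; congr cint; apply/funext => xi.
have im := cintble_fourier (- (2 * pi)) xi (schwartz_cintble (test_schwartz tm)) (schwartz_cmeas (test_schwartz tm)).
have [_] := cint_affine x (oner_neq0 _) im.
rewrite normr1 expr1n mul1r fourierE => <-; rewrite fourierE mulrC -cintZ; last first.
  by case: (cint_affine x (oner_neq0 _) im).
congr cint; apply/funext => y; rewrite mulrCA; congr (_ * _).
rewrite -expiD; congr expi; rewrite scale1r dotDl dotC mulrDr; ring.
Qed.

End inversion.

(** * Convolutions *)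

Section convolution.
Context {R : realType} {d : nat}.
Local Notation C := R[i].
Local Notation Rd := 'rV[R]_d.
Local Notation leb := (@lebesgue_rV R d).
Implicit Types (m f g G M : Rd -> C) (x y xi : Rd).

Definition conv G M x : C := cint setT (fun y => G y * M (x - y)).

Lemma measurable_reflect x : measurable_fun setT (fun y : Rd => x - y).
Proof. by have := measurable_affine (-1) x; under eq_fun do rewrite scaleN1r addrC. Qed.

Lemma cmeas_reflect M x : cmeas M -> cmeas (fun y => M (x - y)).
Proof. by move=> mM; exact: cmeas_comp mM (measurable_reflect x). Qed.

Lemma br_wt (A : R) x k : 0 <= A -> A * br x ^- (k + 2 * d) * br x ^+ k <= A * wt x.
Proof.
move=> A0; rewrite -mulrA ler_wpM2l// exprD invfM mulrAC mulVf ?mul1r ?bracket_wt//.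
by rewrite expf_neq0// gt_eqF// br_gt0.
Qed.

Lemma conv_bound G M (A B : R) k x : 0 <= A -> 0 <= B -> cmeas G -> cmeas M ->
  (forall y, cabs (G y) <= A * br y ^- (k + 2 * d)) ->
  (forall z, br z ^+ k * cabs (M z) <= B) ->
  br x ^+ k * cabs (conv G M x) <= A * B * pi ^+ d.
Proof.
move=> A0 B0 mG mM hG hM.
have p0 : 0 < br x ^+ k by rewrite exprn_gt0// br_gt0.
rewrite mulrC -ler_pdivlMr// mulrAC.
apply: (@cabs_cint_le R d _ (fun y => A * B / br x ^+ k * wt y)).
- by apply: cmeasM => //; exact: cmeas_reflect.
- by apply: majorantZ majorant_wt0; rewrite divr_ge0 ?mulr_ge0// ltW.
move=> y; rewrite cabsM mulrAC ler_pdivlMr// -mulrA.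
apply: (@le_trans _ _ (cabs (G y) * (br y ^+ k * B))).
  rewrite ler_wpM2l ?cabs_ge0//.
  apply: le_trans (_ : cabs (M (x - y)) * (br (x - y) ^+ k * br y ^+ k) <= _).
    by rewrite ler_wpM2l ?cabs_ge0// -exprMn lerXn2r ?nnegrE ?mulr_ge0 ?(ltW (br_gt0 _))// br_sub.
  by rewrite mulrA [leRHS]mulrC ler_wpM2r ?exprn_ge0 ?(ltW (br_gt0 _))// mulrC.
rewrite mulrA [leRHS]mulrAC ler_wpM2r//; apply: le_trans (br_wt _ k A0).
by rewrite ler_wpM2r// exprn_ge0// ltW// br_gt0.
Qed.

Lemma is_cder_conv G M i : schwartz G -> schwartz M ->
  ccont (conv G M) /\ is_cder i (conv G M) (conv G (cder i M)).
Proof.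
move=> sG sM.
have [A A0 hA] := schwartz_wt sG.
have [B1 p1 h1] := schwartz_decay 0 sM.
have [B2 p2 h2] := uniform_bound (fun=> ler01) (fun j : 'I_d =>
  let: ex_intro2 B B0 h := schwartz_decay 0 (schwartz_cder j sM) in
  ex_intro2 _ _ B B0 (fun x => eq_ind _ (fun t => _ <= B * t) (h x) _ (etrans (congr1 GRing.inv (expr0 _)) (invr1 _)))).
pose K x y := G y * M (x - y).
pose K' j x y := G y * cder j M (x - y).
have mK x : cmeas (K x) by apply: cmeasM; [exact: schwartz_cmeas|exact/cmeas_reflect/schwartz_cmeas].
have mK' j x : cmeas (K' j x).
  by apply: cmeasM; [exact: schwartz_cmeas|exact/cmeas_reflect/schwartz_cmeas/schwartz_cder].
have M0 := majorantZ (mulr_ge0 A0 (addr_ge0 p1 p2)) (@majorant_wt0 R d).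
have w0 y := ltW (@wt_gt0 R d y).
have Kg x y : cabs (K x y) <= A * (B1 + B2) * wt y.
  rewrite cabsM mulrAC; apply: ler_pM; rewrite ?cabs_ge0//.
  by apply: le_trans (h1 _) _; rewrite expr0 invr1 mulr1 lerDl.
have K'g j x y : cabs (K' j x y) <= A * (B1 + B2) * wt y.
  rewrite cabsM mulrAC; apply: ler_pM; rewrite ?cabs_ge0//.
  by apply: le_trans (h2 _ _) _; rewrite mulr1 lerDr.
have dK j y : is_cder j (K^~ y) (K' j ^~ y).
  have := is_cder_affine 1 (- y) (smooth_is_cder j (schwartz_smooth sM)).
  move=> /(is_cderM (is_cder_cst j (G y))).
  have -> : (fun x => G y * M (1 *: x + - y)) = K^~ y by apply/funext => x; rewrite scale1r.
  by congr is_cder; apply/funext => x; rewrite scale1r mul0r add0r mul1r.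
split; last first.
  move=> x.
  exact: (param_cder mK M0 (fun x y _ => Kg x y) (fun i x y _ => K'g i x y) dK i).
apply: ccont_lip => x; eexists; last first.
  by move=> y hy; exact: (param_lipschitz mK M0 (fun x y _ => Kg x y) (fun i x y _ => K'g i x y) dK hy).
by rewrite mulr_ge0// (majorant_ge0 M0).
Qed.

Lemma cpderiv_conv G M : (0 < d)%N -> schwartz G -> schwartz M ->
  smooth (conv G M) /\ forall l, cpderiv l (conv G M) = conv G (cpderiv l M).
Proof.
move=> d0 sG sM; split; last first.
  elim=> [|i l IH]; first by rewrite !cpderiv_nil.
  rewrite !cpderiv_cons IH.
  exact: (is_cderE (is_cder_conv i sG (schwartz_cpderiv l sM)).2).
apply: (@smooth_coind R d (fun f => exists2 M, schwartz M & f = conv G M) _ _ _).1; last by exists M.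
move=> _ [M' sM' ->]; split; first by have [] := is_cder_conv (Ordinal d0) sG sM'.
move=> i; exists (conv G (cder i M')); last by have [] := is_cder_conv i sG sM'.
by exists (cder i M') => //; exact: schwartz_cder.
Qed.

Lemma schwartz_conv G M : (0 < d)%N -> schwartz G -> schwartz M -> schwartz (conv G M).
Proof.
move=> d0 sG sM; have [sm dl] := cpderiv_conv d0 sG sM; apply/schwartzP; split => // l k.
have [A A0 hA] := schwartz_decay (k + 2 * d) sG.
have /schwartzP[_ /(_ l k)[B hB]] := sM.
have B0 : 0 <= B.
  by apply: le_trans (hB 0); rewrite mulr_ge0 ?cabs_ge0// exprn_ge0// ltW ?br_gt0.
exists (A * B * pi ^+ d) => x; rewrite dl; apply: conv_bound => //; first exact: schwartz_cmeas.
exact/schwartz_cmeas/schwartz_cpderiv.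
Qed.

Lemma conv_cintble G M x : schwartz G -> schwartz M -> cintble (fun y => G y * M (x - y)).
Proof.
move=> sG sM; have [A A0 hA] := schwartz_wt sG; have [B B0 hB] := schwartz_decay 0 sM.
apply: (cintble_wt (mulr_ge0 A0 B0)).
  by apply: cmeasM; [exact: schwartz_cmeas|exact/cmeas_reflect/schwartz_cmeas].
move=> y; rewrite cabsM mulrAC; apply: ler_pM; rewrite ?cabs_ge0//.
by apply: le_trans (hB _) _; rewrite expr0 invr1 mulr1.
Qed.

Lemma convC G M x : schwartz G -> schwartz M -> conv G M x = conv M G x.
Proof.
move=> sG sM; rewrite /conv -(cint_reflect x (conv_cintble x sG sM)).
by congr cint; apply/funext => y; rewrite opprB addrCA subrr addr0 mulrC.
Qed.

Lemma smoothZ (c : C) f : smooth f -> smooth (fun x => c * f x).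
Proof. exact/smoothM/smooth_cst. Qed.

Lemma cpderiv_lin (c : C) l f g x : smooth f -> smooth g ->
  cpderiv l (fun x => c * f x + g x) x = c * cpderiv l f x + cpderiv l g x.
Proof.
move=> sf sg; rewrite (cpderivD _ _ (smoothZ c sf) sg); congr (_ + _); elim: l x => [|i l IH] x; first by rewrite !cpderiv_nil.
have E : cpderiv l (fun x => c * f x) = (fun x => c * cpderiv l f x) by exact/funext.
rewrite !cpderiv_cons E.
rewrite (is_cderE (is_cderM (is_cder_cst i c) (smooth_is_cder i (smooth_cpderiv l sf)))).
by rewrite mul0r add0r.
Qed.

Lemma cpderivB l f g x : smooth f -> smooth g ->
  cpderiv l (fun x => f x - g x) x = cpderiv l f x - cpderiv l g x.
Proof.
move=> sf sg; have := cpderiv_lin (- 1) l x sg sf; rewrite mulN1r [RHS]addrC => <-.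
by congr cpderiv; apply/funext => y; rewrite mulN1r addrC.
Qed.

(** Moving a Schwartz function by [v] costs a factor [|v|] in every seminorm. *)
Lemma translate_bound M k (B : R) v l x : smooth M -> sbound k.+1 M B -> (size l <= k)%N ->
  br x ^+ k * cabs (cpderiv l M (x + v) - cpderiv l M x) <= (2 * d)%:R * (br v ^+ k * B) * `|v|.
Proof.
move=> sM hB lk; have p0 y : 0 < br y ^+ k by rewrite exprn_gt0// br_gt0.
rewrite mulrC -ler_pdivlMr//; have := @clipschitz R d (cpderiv l M) _ x v (br v ^+ k * B / br x ^+ k)
  (fun i => smooth_is_cder i (smooth_cpderiv l sM)).
rewrite !mulrA [X in _ <= X]mulrAC -!mulrA; apply => i z zv.
rewrite mulrA ler_pdivlMr// mulrC.
have xz : br x ^+ k <= br v ^+ k * br z ^+ k.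
  rewrite -exprMn lerXn2r ?nnegrE ?mulr_ge0 ?(ltW (br_gt0 _))//.
  apply: le_trans (br_sub x z) _; rewrite ler_wpM2r ?(ltW (br_gt0 _))//.
  by rewrite /br lerD2l distrC.
apply: le_trans (ler_wpM2r (cabs_ge0 _) xz) _; rewrite -mulrA ler_wpM2l ?(ltW (p0 _))//.
have := hB (i :: l) z; rewrite cpderiv_cons => /(_ lk); apply: le_trans.
by rewrite ler_wpM2r ?cabs_ge0// br_le_exp.
Qed.

Lemma sbound_translate M k (B : R) v : smooth M -> sbound k.+1 M B ->
  sbound k (fun x => M (x + v) - M x) ((2 * d)%:R * (br v ^+ k * B) * `|v|).
Proof.
move=> sM hB l x lk.
have s1 : smooth (fun x => M (x + v)) by have := smooth_shift (- v) sM; rewrite opprK.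
have := translate_bound v x sM hB lk; have := cpderiv_shift l (- v) x sM; rewrite opprK => <-.
by rewrite (cpderivB l x s1 sM).
Qed.

End convolution.

Section convolution_fourier.
Context {R : realType} {d : nat}.
Local Notation C := R[i].
Local Notation Rd := 'rV[R]_d.
Local Notation leb := (@lebesgue_rV R d).
Implicit Types (m f g G M : Rd -> C) (x y xi : Rd).

Lemma ifourierE f x : ifourier f x = cint setT (fun xi => f xi * expi (2 * pi * dot xi x)).
Proof. by rewrite /ifourier; congr cint; apply/funext => xi; rewrite dotC. Qed.

(** Multiplication on the Fourier side is convolution with the transform. *)
Lemma conv_fourier m g x : test_function m -> schwartz g ->
  conv g (fourier m) x = fourier (fun xi => m xi * ifourier g xi) x.
Proof.
move=> tm sg; have sm := test_schwartz tm.
have [A A0 hA] := schwartz_wt sm; have [B B0 hB] := schwartz_wt sg.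
have mg := schwartz_cmeas sg; have mm := schwartz_cmeas sm.
pose H (xi y : Rd) := m xi * expi (- (2 * pi) * dot xi x) * (g y * expi (2 * pi * dot y xi)).
have mH : cmeas (fun z : Rd * Rd => H z.1 z.2).
  apply: cmeasM; first exact: (cmeas_schwartz_fst (cmeas_fourier_integrand (- (2 * pi)) x mm)).
  apply: cmeasM; first exact: cmeas_schwartz_snd.
  have := @cmeas_char R d (2 * pi); congr cmeas.
  by apply/funext => z; rewrite dotC.
have [|_ _ F] := @cint_fubini R d H _ _ _ _ mH (majorantZ A0 (@majorant_wt0 R d)) (majorantZ B0 (@majorant_wt0 R d)).
  by move=> xi y; rewrite !cabsM !cabs_expi !mulr1; apply: ler_pM; rewrite ?cabs_ge0.
transitivity (cint setT (fun y => cint setT (H^~ y))).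
  congr cint; apply/funext => y; rewrite fourierE.
  rewrite -(cintZ _ (cintble_fourier _ _ (schwartz_cintble sm) mm)).
  congr cint; apply/funext => xi; rewrite /H mulrCA -!mulrA; congr (_ * _).
  rewrite [RHS]mulrCA -expiD; congr (_ * expi _).
  by rewrite dotDr dotNr (dotC y); ring.
rewrite -F fourierE; congr cint; apply/funext => xi.
rewrite ifourierE mulrAC.
by rewrite -(cintZ _ (cintble_fourier _ _ (schwartz_cintble sg) mg)).
Qed.

Lemma cintble_shift (b : Rd) f : cintble f -> cintble (fun x => f (x + b)).
Proof.
move=> fi; have [+ _] := cint_affine b (oner_neq0 _) fi.
by under eq_fun do rewrite scale1r.
Qed.

Lemma eq_cint f g : (forall x, f x = g x) -> cint setT f = cint setT g.
Proof. by move=> fg; congr cint; apply/funext. Qed.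

Lemma conv_fourier2 m m' x : test_function m -> test_function m' ->
  conv (fourier m') (fourier m) x = fourier (fun xi => m xi * m' xi) x.
Proof.
move=> tm tm'; rewrite (conv_fourier x tm (schwartz_fourier tm')).
by congr fourier; apply/funext => xi; congr (_ * _); exact: ifourierK.
Qed.

Lemma fourier_modulate m xi x : test_function m ->
  fourier (fun z => m (z + xi)) x = expi (2 * pi * dot xi x) * fourier m x.
Proof.
move=> tm; have im := cintble_fourier (- (2 * pi)) x (schwartz_cintble (test_schwartz tm)) (schwartz_cmeas (test_schwartz tm)).
have iz : cintble (fun z => m (z + xi) * expi (- (2 * pi) * dot (z + xi) x)).
  have [+ _] := cint_affine xi (oner_neq0 _) im.
  by congr cintble; apply/funext => z; rewrite scale1r.
rewrite !fourierE -(cint_shift xi im) -(cintZ _ iz).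
congr cint; apply/funext => z; rewrite mulrCA -expiD; congr (_ * expi _).
by rewrite dotDl mulrDr; ring.
Qed.

(** Pieces of a product whose frequencies do not interact do not see each other. *)
Lemma fourier_disjoint m m' a x z : test_function m -> test_function m' -> test_function a ->
  (forall xi zeta, a xi * (m (zeta + xi) * m' zeta) = 0) ->
  cint setT (fun y => fourier m (y - x) * ifourier a y * fourier m' (z - y)) = 0.
Proof.
move=> tm tm' ta h; have sF := schwartz_fourier tm; have sF' := schwartz_fourier tm'.
have sa := test_schwartz ta; have sFx := schwartz_shift x sF.
have [A A0 hA] := schwartz_wt sa; have [B B0 hB] := schwartz_wt sFx.
have [B' B'0 hB'] := schwartz_decay 0 sF'.
have ma := schwartz_cmeas sa; have mF := schwartz_cmeas sFx.
have mF' := cmeas_reflect z (schwartz_cmeas sF').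
pose H (xi y : Rd) := a xi * expi (2 * pi * dot y xi) * (fourier m (y - x) * fourier m' (z - y)).
have mH : cmeas (fun z : Rd * Rd => H z.1 z.2).
  apply: cmeasM; last by apply: cmeasM; [exact: (cmeas_schwartz_snd mF)|exact: (cmeas_schwartz_snd mF')].
  apply: cmeasM; first exact: cmeas_schwartz_fst.
  have := @cmeas_char R d (2 * pi); congr cmeas.
  by apply/funext => w; rewrite dotC.
have [|_ _ F] := @cint_fubini R d H _ _ _ _ mH (majorantZ A0 (@majorant_wt0 R d)) (majorantZ (mulr_ge0 B0 B'0) (@majorant_wt0 R d)).
  move=> xi y; rewrite !cabsM !cabs_expi !mulr1; apply: ler_pM; rewrite ?mulr_ge0 ?cabs_ge0//.
  rewrite mulrAC; apply: ler_pM; rewrite ?cabs_ge0//.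
  by apply: le_trans (hB' _) _; rewrite expr0 invr1 mulr1.
transitivity (cint setT (fun y => cint setT (H^~ y))).
  congr cint; apply/funext => y; rewrite mulrAC mulrC ifourierE.
  rewrite [LHS]mulrC -(cintZ _ (cintble_fourier _ _ (schwartz_cintble sa) ma)).
  by congr cint; apply/funext => xi; rewrite /H mulrC dotC.
rewrite -F -[RHS](@cint0 R d); congr cint; apply/funext => xi.
have [a0|axi] := eqVneq (a xi) 0.
  by rewrite -[RHS](@cint0 R d); congr cint; apply/funext => y; rewrite /H a0 !mul0r.
pose m2 w := m (w + xi).
have tm2 : test_function m2.
  have := test_affine xi (oner_neq0 R) tm; congr test_function.
  by apply/funext => w; rewrite scale1r.
have : conv (fourier m2) (fourier m') (z - x) = 0.
  rewrite (conv_fourier2 _ tm' tm2) (_ : (fun _ => _) = fun=> 0); last first.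
    apply/funext => w; have := h xi w; move/eqP; rewrite mulf_eq0 (negbTE axi)/=.
    by rewrite mulrC => /eqP ->.
  by rewrite fourierE -[RHS](@cint0 R d); congr cint; apply/funext => y; rewrite mul0r.
have ic := conv_cintble (z - x) (schwartz_fourier tm2) sF'.
have ics : cintble (fun y => fourier m2 (y - x) * fourier m' (z - x - (y - x))).
  exact: (cintble_shift (- x) ic).
rewrite /conv -(cint_shift (- x) ic).
move=> /(congr1 (fun w => a xi * expi (2 * pi * dot xi x) * w)); rewrite mulr0 => <-.
have cz := cintZ (a xi * expi (2 * pi * dot xi x)) ics.
rewrite -cz.
apply: eq_cint => y.
rewrite (fourier_modulate xi (y - x) tm).
rewrite /H opprB addrA subrK -!mulrA; congr (_ * _).
rewrite [RHS]mulrA -expiD; congr (expi _ * _).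
by rewrite dotDr dotNr (dotC y); ring.
Qed.

End convolution_fourier.

(** * Convolutions and distributions *)

Section riemann_sums.
Context {R : realType} {d : nat}.
Local Notation C := R[i].
Local Notation Rd := 'rV[R]_d.
Local Notation leb := (@lebesgue_rV R d).
Implicit Types (f g G M E : Rd -> C) (x y xi : Rd).

Lemma cmeas_fl n (h : 'rV[int]_d -> C) : cmeas (fun y : Rd => h (fl n y)).
Proof.
by split; [exact: (measurable_fun_fl n (fun z => complex.Re (h z)))
          |exact: (measurable_fun_fl n (fun z => complex.Im (h z)))].
Qed.

Variable n : nat.

(** Finitely many grid cells of side [2^-n] cover the ball of radius [2^n]. *)
Definition cells : finType := {ffun 'I_d -> 'I_(2 * (4 ^ n).+1)}.

Definition cell_pos (m : cells) : 'rV[int]_d := \row_i ((m i)%:Z - (4 ^ n).+1%:Z).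

Lemma cell_pos_inj : injective cell_pos.
Proof.
move=> m m' /rowP h; apply/ffunP => i; apply/val_inj.
by have := h i; rewrite !mxE => /addIr [].
Qed.

Definition covered y := [exists m, cell_pos m == fl n y].

Lemma cell_sum (h : 'rV[int]_d -> C) y :
  \sum_m (fl n y == cell_pos m)%:R * h (cell_pos m) = (covered y)%:R * h (fl n y).
Proof.
rewrite /covered; case: existsP => [[m /eqP mE]|H].
  rewrite (bigD1 m)//= -mE eqxx big1 ?addr0// => m' m'm.
  by rewrite (inj_eq cell_pos_inj) eq_sym (negbTE m'm) mul0r.
rewrite mul0r big1// => m _; case: eqP => [e|_]; last by rewrite mul0r.
by case: H; exists m; rewrite e.
Qed.

Lemma coveredP y : `|y| <= 2 ^+ n -> covered y.
Proof.
move=> hy.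
have hf i : (- (4 ^ n)%:Z <= fl n y 0 i <= (4 ^ n)%:Z)%R.
  have : `|2 ^+ n * y 0 i| <= (4 ^ n)%:R.
    rewrite normrM ger0_norm ?exprn_ge0// natrX (_ : 4%:R = 2 * 2) ?exprMn; last by rewrite -natrM.
    by rewrite ler_wpM2l ?exprn_ge0//; exact: le_trans (coord_le y i) hy.
  rewrite mxE ler_norml => /andP[t1 t2]; apply/andP; split.
    by rewrite floor_ge_int_tmp//; rewrite rmorphN /= -pmulrn.
  by have := le_floor t2; rewrite (_ : (4 ^ n)%:R = ((4 ^ n)%:Z)%:~R :> R) ?intrKfloor//.
have lt i : (absz (fl n y 0%R i + (4 ^ n).+1%:Z)%R < 2 * (4 ^ n).+1)%N by have := hf i; lia.
apply/existsP; exists [ffun i => Ordinal (lt i)]; apply/eqP/rowP => i.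
by rewrite mxE ffunE /=; have := hf i; lia.
Qed.

Definition cell_weight G (m : cells) : C := cint setT (fun y => (fl n y == cell_pos m)%:R * G y).

Lemma cell_cintble G (m : cells) : schwartz G -> cintble (fun y => (fl n y == cell_pos m)%:R * G y).
Proof.
move=> sG; have [A A0 hA] := schwartz_wt sG; apply: (cintble_wt A0).
  by apply: cmeasM; [exact: (cmeas_fl n (fun z => (z == cell_pos m)%:R))|exact: schwartz_cmeas].
move=> y; rewrite cabsM; apply: le_trans (hA y); apply: ler_piMl; first exact: cabs_ge0.
by case: eqP => _; rewrite ?cabs1 ?cabs0.
Qed.

(** The factor [E] is replaced by its values at the corners of the dyadic cells, while the
    integrals of [G] over the cells are kept; outside the cells that are used, the growth of [E]
    is paid by the decay of [G]. *)
Lemma riemann_sum G E (A B : R) k : schwartz G -> cmeas E -> 0 <= A -> 0 <= B ->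
  (forall y, cabs (G y) <= A * br y ^- (k.+1 + 2 * d)) ->
  (forall y, cabs (E y) <= B * br y ^+ k) ->
  (forall y v, `|v| <= 1 -> cabs (E (y + v) - E y) <= B * `|v| * br y ^+ k) ->
  cabs (\sum_(m : cells) cell_weight G m * E (grid n (cell_pos m)) - cint setT (fun y => G y * E y))
    <= A * B * 2 ^- n * pi ^+ d.
Proof.
move=> sG mE A0 B0 hG hE hE'.
have mG := schwartz_cmeas sG.
pose E' y := E (grid n (fl n y)).
have n0 : 0 < 2 ^- n :> R by rewrite invr_gt0 exprn_gt0.
have n1 : 2 ^- n <= 1 :> R by rewrite invf_le1 ?exprn_gt0// exprn_ege1// ler1n.
have b1 y : 1 <= br (y : Rd) by exact: br_ge1.
have gE y : cabs (G y * E y) <= A * B * wt y.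
  rewrite cabsM; apply: le_trans (ler_pM (cabs_ge0 _) (cabs_ge0 _) (hG y) (hE y)) _.
  rewrite mulrCA [leRHS](_ : _ = B * (A * wt y)); last by ring.
  rewrite ler_wpM2l//; apply: le_trans (br_wt y k.+1 A0).
  by rewrite ler_wpM2l ?mulr_ge0 ?invr_ge0 ?exprn_ge0 ?(ltW (br_gt0 _))// br_le_exp.
have iGE : cintble (fun y => G y * E y).
  by apply: (cintble_wt (mulr_ge0 A0 B0)) => //; exact: cmeasM.
have -> : \sum_m cell_weight G m * E (grid n (cell_pos m)) =
    cint setT (fun y => (covered y)%:R * E' y * G y).
  rewrite -(eq_cint (f := fun y => \sum_m E (grid n (cell_pos m)) * ((fl n y == cell_pos m)%:R * G y))).
    rewrite cint_sum; last by move=> m; exact/cintbleZ/cell_cintble.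
    by apply: eq_bigr => m _; rewrite cintZ 1?mulrC//; exact: cell_cintble.
  move=> y; rewrite -(cell_sum (fun z => E (grid n z))) mulr_suml.
  by apply: eq_bigr => m _; rewrite mulrA [X in X * _]mulrC.
have key y : cabs ((covered y)%:R * E' y * G y - G y * E y) <= A * B * 2 ^- n * wt y.
  rewrite [X in X - _]mulrC -mulrBr cabsM.
  have : cabs ((covered y)%:R * E' y - E y) <= B * 2 ^- n * br y ^+ k.+1.
    have [cy|/negP cy] := boolP (covered y).
      rewrite mul1r /E'; have g1 := grid_fl n y; rewrite distrC in g1.
      have := hE' y (grid n (fl n y) - y) (le_trans g1 n1); rewrite [y + _]addrC subrK.
      move=> /le_trans; apply; apply: ler_pM.
      - by rewrite mulr_ge0.
      - by rewrite exprn_ge0// ltW// br_gt0.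
      - by rewrite ler_wpM2l.
      - by rewrite br_le_exp.
    rewrite mul0r sub0r cabsN; apply: le_trans (hE y) _.
    rewrite -mulrA ler_wpM2l// exprSr mulrCA ler_peMr ?exprn_ge0 ?(ltW (br_gt0 _))//.
    have [/coveredP//|/ltW hy] := leP `|y| (2 ^+ n).
    rewrite mulrC ler_pdivlMr ?exprn_gt0// mul1r; apply: le_trans hy _.
    by rewrite /br lerDr.
  move=> /(ler_wpM2l (cabs_ge0 (G y)))/le_trans; apply.
  apply: le_trans (ler_wpM2r _ (hG y)) _.
    by rewrite (mulr_ge0 (mulr_ge0 B0 (ltW n0)))// exprn_ge0// ltW ?br_gt0.
  rewrite mulrCA [leRHS](_ : _ = B * 2 ^- n * (A * wt y)); last by ring.
  exact: (ler_wpM2l (mulr_ge0 B0 (ltW n0)) (br_wt y k.+1 A0)).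
have mc : cmeas (fun y => (covered y)%:R * E' y * G y).
  apply: cmeasM => //.
  exact: (cmeas_fl n (fun z => ([exists m, cell_pos m == z])%:R * E (grid n z))).
have AB2 : 0 <= A * B * 2 ^- n := mulr_ge0 (mulr_ge0 A0 B0) (ltW n0).
rewrite -cintB//; last first.
  have h : cintble (fun y => (covered y)%:R * E' y * G y - G y * E y).
    apply: (cintble_wt AB2 _ key).
    by apply: cmeasD => //; apply: cmeasN; exact: cmeasM.
  have := cintbleD h iGE; congr cintble; apply/funext => y; exact: subrK.
apply: (@cabs_cint_le R d _ _ _ _ _ key).
  by apply: cmeasD => //; apply: cmeasN; exact: cmeasM.
exact: majorantZ AB2 majorant_wt0.
Qed.

End riemann_sums.

Section tempered_convolution.
Context {R : realType} {d : nat}.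
Local Notation C := R[i].
Local Notation Rd := 'rV[R]_d.
Implicit Types (f g G M : Rd -> C) (x y v : Rd) (u : distr R d).

Lemma br_half x v k : `|v| <= 1 -> br v ^+ k <= 2 ^+ k.
Proof. by move=> v1; rewrite lerXn2r ?nnegrE ?(ltW (br_gt0 _))// /br; lra. Qed.

(** Translation is Lipschitz in every Schwartz seminorm ([sbound_translate]), at the price of a
    power of the bracket. *)
Lemma tempered_translate u M : tempered u -> schwartz M ->
  exists k (B : R), [/\ 0 <= B, forall y, cabs (u (fun x => M (x - y))) <= B * br y ^+ k &
    forall y v, `|v| <= 1 ->
      cabs (u (fun x => M (x - (y + v))) - u (fun x => M (x - y))) <= B * `|v| * br y ^+ k].
Proof.
move=> tu sM; have /temperedP[_ [c [k [c0 hc]]]] := tu.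
have [B1 p1 h1] := schwartz_sbound k sM; have [B2 p2 h2] := schwartz_sbound k.+1 sM.
have smM := schwartz_smooth sM.
have q0 : 0 <= (2 * d)%:R * (2 ^+ k * B2) by rewrite !mulr_ge0// exprn_ge0.
exists k, (c * (B1 + (2 * d)%:R * (2 ^+ k * B2))); split; first by rewrite mulr_ge0// addr_ge0.
- move=> y; have := hc _ _ (schwartz_shift y sM) (sbound_shift y smM h1); move=> /le_trans; apply.
  rewrite -mulrA ler_wpM2l// mulrC ler_wpM2r ?exprn_ge0 ?(ltW (br_gt0 _))//; lra.
move=> y v v1.
have sMv := schwartz_shift v sM.
have sN : schwartz (fun x => M (x - v) - M x) by exact: schwartzB.
have hN : sbound k (fun x => M (x - v) - M x) ((2 * d)%:R * (2 ^+ k * B2) * `|v|).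
  move=> l x lk; apply: le_trans (sbound_translate (- v) smM h2 x lk) _.
  rewrite normrN ler_wpM2r// ler_wpM2l// ler_wpM2r//; apply: br_half => //; by rewrite normrN.
rewrite -(tempered_sub tu (schwartz_shift (y + v) sM) (schwartz_shift y sM)).
have -> : (fun x => M (x - (y + v)) - M (x - y)) = (fun x => (fun x => M (x - v) - M x) (x - y)).
  by apply/funext => x /=; rewrite opprD addrA.
have := hc _ _ (schwartz_shift y sN) (sbound_shift y (schwartz_smooth sN) hN).
move=> /le_trans; apply; rewrite -!mulrA ler_wpM2l// mulrC -!mulrA mulrA mulrA.
rewrite [leRHS](_ : _ = (B1 + (2 * d)%:R * (2 ^+ k * B2)) * (`|v| * br y ^+ k)); last by ring.
rewrite [leLHS](_ : _ = ((2 * d)%:R * (2 ^+ k * B2)) * (`|v| * br y ^+ k)); last by ring.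
by rewrite ler_wpM2r ?lerDr// mulr_ge0// exprn_ge0// ltW// br_gt0.
Qed.

Lemma ccont_translate u M : tempered u -> schwartz M -> ccont (fun y => u (fun x => M (x - y))).
Proof.
move=> tu sM; have [k [B [B0 _ h]]] := tempered_translate tu sM.
apply: ccont_lip => y; exists (B * br y ^+ k); first by rewrite mulr_ge0// exprn_ge0// ltW// br_gt0.
by move=> z zy; have := h y (z - y) zy; rewrite mulrAC [y + _]addrC subrK.
Qed.

Lemma cpderiv_sum I (s : seq I) (w : I -> C) (F : I -> Rd -> C) l x : (forall i, smooth (F i)) ->
  smooth (fun x => \sum_(i <- s) w i * F i x) /\
  cpderiv l (fun x => \sum_(i <- s) w i * F i x) x = \sum_(i <- s) w i * cpderiv l (F i) x.
Proof.
move=> sF; elim: s => [|i s [IH1 IH2]].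
  have -> : (fun x => \sum_(i <- [::]) w i * F i x) = fun=> 0.
    by apply/funext => y; rewrite big_nil.
  by rewrite big_nil cpderiv_cst; split; [exact: smooth_cst|case: l].
have -> : (fun x => \sum_(j <- i :: s) w j * F j x) = fun x => w i * F i x + \sum_(j <- s) w j * F j x.
  by apply/funext => y; rewrite big_cons.
split; first exact: (smoothD (smoothZ (w i) (sF i)) IH1).
by rewrite (cpderiv_lin (w i) l x (sF i) IH1) IH2 big_cons.
Qed.

(** A tempered distribution passes under a convolution integral: the Riemann sums of the
    integral converge in every Schwartz seminorm. *)
Lemma tempered_conv u G M : (0 < d)%N -> tempered u -> schwartz G -> schwartz M ->
  u (conv G M) = cint setT (fun y => G y * u (fun x => M (x - y))).
Proof.
move=> d0 tu sG sM; have smM := schwartz_smooth sM.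
have /temperedP[_ [c [k [c0 hc]]]] := tu.
pose F y := u (fun x => M (x - y)).
pose S n x := \sum_(m : cells n) cell_weight G m * M (x - grid n (cell_pos m)).
have sS n : schwartz (S n) by apply: schwartz_sum => m; exact/schwartzZ/schwartz_shift.
have sC := schwartz_conv d0 sG sM.
have uS n : u (S n) = \sum_(m : cells n) cell_weight G m * F (grid n (cell_pos m)).
  rewrite (tempered_sum tu); last by move=> m; exact/schwartzZ/schwartz_shift.
  by apply: eq_bigr => m _; rewrite (temperedZ tu _ (schwartz_shift _ sM)).
have n1 : null (fun n => cabs (u (S n) - cint setT (fun y => G y * F y))).
  have [k' [B [B0 h1 h2]]] := tempered_translate tu sM.
  have [A A0 hA] := schwartz_decay (k'.+1 + 2 * d) sG.
  have AB : 0 <= A * B * pi ^+ d by rewrite !mulr_ge0// exprn_ge0// pi_ge0.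
  apply: null_le (nullZ AB (@null_exp2 R)); exists 0%N => n _; rewrite uS mulrAC.
  exact: (riemann_sum n sG (ccont_cmeas (ccont_translate tu sM)) A0 B0 hA h1 h2).
have n2 : null (fun n => cabs (u (S n) - u (conv G M))).
  have [A A0 hA] := schwartz_decay (k.+1 + 2 * d) sG.
  have [B1 p1 h1] := schwartz_sbound k sM; have [B2 p2 h2] := schwartz_sbound k.+1 sM.
  pose B := B1 + (2 * d)%:R * (2 ^+ k * B2).
  have q0 : 0 <= (2 * d)%:R * (2 ^+ k * B2) by rewrite !mulr_ge0// exprn_ge0.
  have B0 : 0 <= B by rewrite addr_ge0.
  have AB : 0 <= c * (A * B * pi ^+ d) by rewrite !mulr_ge0// exprn_ge0// pi_ge0.
  apply: null_le (nullZ AB (@null_exp2 R)); exists 0%N => n _.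
  rewrite -(tempered_sub tu (sS n) sC) -mulrA.
  apply: hc; first exact: schwartzB.
  move=> l x lk; have [smC dC] := cpderiv_conv d0 sG sM.
  have sh (m : cells n) : smooth (fun x => M (x - grid n (cell_pos m))) := smooth_shift _ smM.
  have [smS dS] := cpderiv_sum (index_enum (cells n)) (cell_weight G) l x sh.
  have -> : cpderiv l (fun x => S n x - conv G M x) x =
     \sum_(m : cells n) cell_weight G m * cpderiv l M (x - grid n (cell_pos m)) - cint setT (fun y => G y * cpderiv l M (x - y)).
    apply: etrans (cpderivB l x smS smC) _; rewrite dS dC; congr (_ - _).
    by apply: eq_bigr => m _; rewrite cpderiv_shift.
  have p0 y : 0 < br (y : Rd) ^+ k by rewrite exprn_gt0// br_gt0.
  rewrite mulrC -ler_pdivlMr// [leRHS](_ : _ = A * (B / br x ^+ k) * 2 ^- n * pi ^+ d); last by ring.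
  have bxy y : br x ^+ k <= br (x - y) ^+ k * br y ^+ k.
    by rewrite -exprMn lerXn2r ?nnegrE ?mulr_ge0 ?(ltW (br_gt0 _))// br_sub.
  apply: (riemann_sum n sG _ A0 _ hA).
  - exact/cmeas_reflect/schwartz_cmeas/schwartz_cpderiv.
  - by rewrite divr_ge0// ltW.
  - move=> y; rewrite mulrAC ler_pdivlMr//.
    apply: le_trans (ler_wpM2l (cabs_ge0 _) (bxy y)) _; rewrite mulrA ler_wpM2r ?(ltW (p0 y))//.
    by rewrite mulrC; apply: le_trans (h1 l _ lk) _; rewrite lerDl.
  - move=> y v v1; rewrite 2!(mulrAC _ (_^-1)) ler_pdivlMr//.
    apply: le_trans (ler_wpM2l (cabs_ge0 _) (bxy y)) _; rewrite mulrA ler_wpM2r ?(ltW (p0 y))//.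
    rewrite mulrC opprD addrA; apply: le_trans (translate_bound (- v) _ smM h2 lk) _.
    rewrite normrN ler_wpM2r//; apply: (@le_trans _ _ ((2 * d)%:R * (2 ^+ k * B2))); last by rewrite lerDr.
    by rewrite ler_wpM2l// ler_wpM2r// br_half// normrN.
exact: null_limit_unique n2 n1.
Qed.

(** The dilation is moved from the kernel to the argument, so that one integrable function
    dominates all scales. *)
Lemma conv_dilate m h (c : R) x : c != 0 -> test_function m -> schwartz h ->
  conv (fourier (fun xi => m (c *: xi))) h x = cint setT (fun w => fourier m w * h (x - c *: w)).
Proof.
move=> c0 tm sh.
have tmc : test_function (fun xi => m (c *: xi)) by exact: test_scale.
have ic := conv_cintble x (schwartz_fourier tmc) sh.
have [ia] := cint_affine 0 c0 ic; rewrite /conv => <-; rewrite -(cintZ _ ia); apply: eq_cint => w.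
rewrite addr0 mulrA; congr (_ * _).
rewrite (fourier_scale _ c0 (schwartz_cintble (test_schwartz tm)) (schwartz_cmeas (test_schwartz tm))).
by rewrite scalerA (mulVf c0) scale1r.
Qed.

(** The transform of [m] has integral [m 0 = 1], and translating a Schwartz function by [c *: w]
    costs a factor [c]. *)
Lemma approx_identity m g k : (0 < d)%N -> test_function m -> m 0 = 1 -> schwartz g ->
  exists2 A : R, 0 <= A & forall c : R, 0 < c -> c <= 1 ->
    sbound k (fun x => conv (fourier (fun xi => m (c *: xi))) g x - g x) (A * c).
Proof.
move=> d0 tm m0 sg; have sF := schwartz_fourier tm; have smg := schwartz_smooth sg.
have mF := schwartz_cmeas sF.
have [A A0 hA] := schwartz_decay (k.+1 + 2 * d) sF; have [B B0 hB] := schwartz_sbound k.+1 sg.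
pose B' := (2 * d)%:R * B; have B'0 : 0 <= B' by rewrite mulr_ge0.
exists (A * B' * pi ^+ d) => [|c c0 c1 l x lk].
  by rewrite !mulr_ge0// exprn_ge0// pi_ge0.
have tmc : test_function (fun xi => m (c *: xi)) by exact: test_scale (lt0r_neq0 c0) tm.
have [smC dC] := cpderiv_conv d0 (schwartz_fourier tmc) sg.
have sl := schwartz_cpderiv l sg.
have p0 y : 0 < br (y : Rd) ^+ k by rewrite exprn_gt0// br_gt0.
have mx : cmeas (fun w : Rd => cpderiv l g (x - c *: w)).
  have := cmeas_dilate c (cmeas_reflect x (schwartz_cmeas sl)); exact.
have m1 : cmeas (fun w : Rd => fourier m w * cpderiv l g (x - c *: w)) by exact: cmeasM.
have i1 : cintble (fun w : Rd => fourier m w * cpderiv l g (x - c *: w)).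
  have [C1 C10 h1] := schwartz_wt sF; have [C2 C20 h2] := schwartz_decay 0 sl.
  apply: (cintble_wt (mulr_ge0 C10 C20) m1) => w; rewrite cabsM mulrAC; apply: ler_pM.
  - exact: cabs_ge0.
  - exact: cabs_ge0.
  - exact: h1.
  - by apply: le_trans (h2 _) _; rewrite expr0 invr1 mulr1.
have i2 := cintbleZ (cpderiv l g x) (schwartz_cintble sF).
have -> : cpderiv l (fun x => conv (fourier (fun xi => m (c *: xi))) g x - g x) x =
    cint setT (fun w => fourier m w * cpderiv l g (x - c *: w) - cpderiv l g x * fourier m w).
  rewrite (cintB i1 i2) (cintZ _ (schwartz_cintble sF)) (cint_fourier0 tm) m0 mulr1.
  rewrite -(conv_dilate x (lt0r_neq0 c0) tm sl) -dC.
  exact: (cpderivB l x smC smg).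
rewrite mulrC -ler_pdivlMr//.
rewrite [leRHS](_ : _ = A * B' * c / br x ^+ k * pi ^+ d); last by ring.
have K0 : 0 <= A * B' * c / br x ^+ k by rewrite divr_ge0 ?(ltW (p0 x))// !mulr_ge0// ltW.
apply: (cabs_cint_le _ (majorantZ K0 (@majorant_wt0 R d))).
  by apply: cmeasD => //; apply: cmeasN; apply: cmeasM => //; exact: cmeas_cst.
move=> w; rewrite [X in _ - X]mulrC -mulrBr cabsM.
have h1 : cabs (cpderiv l g (x - c *: w) - cpderiv l g x) <= B' * c / br x ^+ k * br w ^+ k.+1.
  rewrite mulrAC ler_pdivlMr// mulrC; apply: le_trans (translate_bound (- (c *: w)) x smg hB lk) _.
  rewrite normrN brN normrZ gtr0_norm// -!mulrA ler_wpM2l// mulrC -!mulrA ler_wpM2l//.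
  rewrite ler_wpM2l ?(ltW c0)// exprS ler_pM//.
  - by rewrite exprn_ge0// ltW// br_gt0.
  - by rewrite /br lerDr.
  - rewrite lerXn2r ?nnegrE ?(ltW (br_gt0 _))// /br lerD2l normrZ gtr0_norm//.
    by rewrite ler_piMl.
apply: le_trans (ler_pM (cabs_ge0 _) (cabs_ge0 _) (hA w) h1) _.
rewrite mulrCA [leRHS](_ : _ = B' * c / br x ^+ k * (A * wt w)); last by ring.
have K1 : 0 <= B' * c / br x ^+ k by rewrite divr_ge0 ?(ltW (p0 x))// !mulr_ge0// ltW.
exact: (ler_wpM2l K1 (br_wt w k.+1 A0)).
Qed.

End tempered_convolution.

(** * Littlewood-Paley blocks *)

Section littlewood_paley.
Context {R : realType} {d : nat}.
Local Notation C := R[i].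
Local Notation Rd := 'rV[R]_d.
Local Notation leb := (@lebesgue_rV R d).
Implicit Types (f g G M m : Rd -> C) (x y z v xi : Rd) (u : distr R d).

Lemma fourier_dilate m (c : R) x : 0 < c -> test_function m ->
  fourier (fun xi => m (c *: xi)) x = (c ^- d)%:C%C * fourier m (c^-1 *: x).
Proof.
move=> c0 tm; have sm := test_schwartz tm.
rewrite -(fourier_scale x (lt0r_neq0 c0) (schwartz_cintble sm) (schwartz_cmeas sm)) (gtr0_norm c0).
by rewrite mulrA real_complexV ?mul1r// expf_neq0// lt0r_neq0.
Qed.

(** Uniform decay of the transforms of the dilates of one test function, in the
    natural scale. *)
Lemma dilate_decay m k : test_function m -> exists2 B : R, 0 <= B & forall (c : R) x, 0 < c ->
  cabs (fourier (fun xi => m (c^-1 *: xi)) x) <= B * c ^+ d * br (c *: x) ^- k.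
Proof.
move=> tm; have [B B0 h] := schwartz_decay k (schwartz_fourier tm); exists B => // c x c0.
rewrite fourier_dilate ?invr_gt0// invrK cabsM cabs_real exprVn invrK ger0_norm; last by rewrite exprn_ge0// ltW.
by rewrite mulrAC mulrC ler_wpM2r// exprn_ge0// ltW.
Qed.

Variable eta : Rd -> C.
Hypothesis He : lp_cutoff eta.
Hypothesis d0 : (0 < d)%N.

Definition dyadic_base (j : nat) : Rd -> C :=
  if j is _.+1 then fun xi => eta xi - eta (2 *: xi) else eta.

Lemma test_eta : test_function eta. Proof. by case: He. Qed.

Lemma testB f g : test_function f -> test_function g -> test_function (fun x => f x - g x).
Proof.
move=> tf tg; have := testD tf (testM (smooth_cst (-1)) tg).
by congr test_function; apply/funext => x; rewrite mulN1r.
Qed.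

Lemma test_base j : test_function (dyadic_base j).
Proof.
case: j => [|j]; first exact: test_eta.
by apply: testB; [exact: test_eta|apply: test_scale; [exact: lt0r_neq0|exact: test_eta]].
Qed.

Lemma dyadicE j : dyadic eta j = fun xi => dyadic_base j ((2 ^+ j)^-1 *: xi).
Proof.
apply/funext => xi; case: j => [|j] /=; first by rewrite invr1 scale1r.
congr (_ - eta _); rewrite scalerA exprS invfM mulrA mulfV ?mul1r//.
Qed.

Lemma exp2_gt0 j : 0 < 2 ^+ j :> R. Proof. by rewrite exprn_gt0. Qed.

Lemma test_dyadic j : test_function (dyadic eta j).
Proof. by rewrite dyadicE; apply: test_scale (test_base j); rewrite invr_neq0// lt0r_neq0// exp2_gt0. Qed.

Definition lp_kernel j : Rd -> C := fourier (dyadic eta j).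

(** The dilated cutoff is one on the spectrum of the [j]-th block, which is therefore reproduced
    by convolution with this kernel. *)
Definition fat_kernel j : Rd -> C := fourier (fun xi => eta ((2 ^+ j.+1)^-1 *: xi)).

Lemma schwartz_lp_kernel j : schwartz (lp_kernel j).
Proof. exact/schwartz_fourier/test_dyadic. Qed.

Lemma test_fat j : test_function (fun xi => eta ((2 ^+ j.+1)^-1 *: xi)).
Proof. by apply: test_scale test_eta; rewrite invr_neq0// lt0r_neq0// exp2_gt0. Qed.

Lemma schwartz_fat_kernel j : schwartz (fat_kernel j).
Proof. exact/schwartz_fourier/test_fat. Qed.

(** All kernels but the first are dilates of a single one, which gives bounds uniform in [j]. *)
Lemma lp_kernel_decay k : exists2 B : R, 0 <= B & forall j x,
  cabs (lp_kernel j x) <= B * 2 ^+ (j * d) * br (2 ^+ j *: x) ^- k.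
Proof.
have [B1 p1 h1] := dilate_decay k (test_base 0); have [B2 p2 h2] := dilate_decay k (test_base 1).
exists (B1 + B2) => [|j x]; first exact: addr_ge0.
rewrite /lp_kernel dyadicE exprM.
have w0 : 0 <= (2 ^+ j) ^+ d * br (2 ^+ j *: x) ^- k.
  by rewrite mulr_ge0 ?exprn_ge0// invr_ge0 exprn_ge0// ltW// br_gt0.
rewrite -mulrA; case: j w0 => [|j] w0.
  by apply: le_trans (h1 _ x (exp2_gt0 0)) _; rewrite -mulrA ler_wpM2r// lerDl.
by apply: le_trans (h2 _ x (exp2_gt0 j.+1)) _; rewrite -mulrA ler_wpM2r// lerDr.
Qed.

Lemma fat_kernel_decay k : exists2 B : R, 0 <= B & forall j x,
  cabs (fat_kernel j x) <= B * 2 ^+ (j * d) * br (2 ^+ j *: x) ^- k.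
Proof.
have [B B0 h] := dilate_decay k test_eta.
exists (B * 2 ^+ d) => [|j x]; first by rewrite mulr_ge0// exprn_ge0.
apply: le_trans (h _ x (exp2_gt0 j.+1)) _; rewrite exprS exprMn exprM -!mulrA.
rewrite ler_wpM2l// ler_wpM2l ?exprn_ge0// ler_wpM2l ?exprn_ge0//.
rewrite lef_pV2 ?posrE ?exprn_gt0 ?br_gt0// lerXn2r ?nnegrE ?(ltW (br_gt0 _))//.
by rewrite /br lerD2l -scalerA [leRHS]normrZ ger0_norm// ler_peMl// ler1n.
Qed.

Lemma euclZ (c : R) x : eucl (c *: x) = `|c| * eucl x.
Proof. by rewrite /eucl dotZl dotZr mulrA -expr2 sqrtrM ?sqr_ge0// sqrtr_sqr. Qed.

Lemma eta_far xi : 3 / 8 <= eucl xi -> eta xi = 0.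
Proof.
move=> h; apply/eqP/negPn/negP => e0; have [_ se _] := He.
have /se /= : fsupp eta xi by exact: subset_closure.
by move=> /lt_le_trans/(_ h); rewrite ltxx.
Qed.

Lemma eta_near xi : eucl xi <= 1 / 4 -> eta xi = 1.
Proof. by case: He => _ _; exact. Qed.

Lemma dyadic_far j xi : 3 / 8 * 2 ^+ j <= eucl xi -> dyadic eta j xi = 0.
Proof.
move=> h; rewrite dyadicE.
have h' : 3 / 8 <= eucl ((2 ^+ j)^-1 *: xi).
  by rewrite euclZ gtr0_norm ?invr_gt0 ?exp2_gt0// [leRHS]mulrC ler_pdivlMr ?exp2_gt0.
case: j h h' => [|j] h h' /=; rewrite (eta_far h')// eta_far ?subrr// euclZ ger0_norm//.
by apply: le_trans h' _; rewrite ler_peMl ?sqrtr_ge0// ler1n.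
Qed.

Lemma dyadic_near j xi : eucl xi <= 2 ^+ j / 4 -> dyadic eta j.+1 xi = 0.
Proof.
move=> h /=; rewrite !eta_near ?subrr// euclZ gtr0_norm ?invr_gt0 ?exp2_gt0// mulrC ler_pdivrMr ?exp2_gt0//.
  by rewrite mulrC mulrA mulr1.
rewrite mul1r mulrC; apply: le_trans h _; rewrite exprS; have := exp2_gt0 j; lra.
Qed.

Lemma dyadic_fat j xi : dyadic eta j xi * eta ((2 ^+ j.+1)^-1 *: xi) = dyadic eta j xi.
Proof.
have [h|h] := leP (3 / 8 * 2 ^+ j) (eucl xi); first by rewrite dyadic_far// mul0r.
rewrite [eta _]eta_near ?mulr1// euclZ gtr0_norm ?invr_gt0 ?exp2_gt0//.
by rewrite mulrC ler_pdivrMr ?exp2_gt0// exprS; have := exp2_gt0 j; lra.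
Qed.

Lemma dyadic_sum K xi : \sum_(k < K.+1) dyadic eta k xi = eta (2 ^- K *: xi).
Proof.
elim: K => [|K IH]; first by rewrite big_ord1 /= expr0 invr1 scale1r.
by rewrite big_ord_recr /= IH addrCA subrr addr0.
Qed.

(** The function that represents the [j]-th block of [u]. *)
Definition blockf u j y : C := u (fun x => lp_kernel j (x - y)).

Lemma ccont_blockf u j : tempered u -> ccont (blockf u j).
Proof. by move=> tu; exact: ccont_translate tu (schwartz_lp_kernel j). Qed.

Lemma blockf_growth u j : tempered u ->
  exists k, exists2 B : R, 0 <= B & forall y, cabs (blockf u j y) <= B * br y ^+ k.
Proof.
move=> tu; have [k [B [B0 h _]]] := tempered_translate tu (schwartz_lp_kernel j).
by exists k, B.
Qed.

Lemma blockE u j g : schwartz g -> block eta u j g = u (conv g (lp_kernel j)).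
Proof.
move=> sg; rewrite /block /difourier /dmul /dfourier; congr u; apply/funext => x.
by rewrite (conv_fourier x (test_dyadic j) sg).
Qed.

Lemma block_blockf u j g : tempered u -> schwartz g ->
  block eta u j g = cint setT (fun y => blockf u j y * g y).
Proof.
move=> tu sg; rewrite (blockE u j sg) (tempered_conv d0 tu sg (schwartz_lp_kernel j)).
by apply: eq_cint => y; rewrite mulrC.
Qed.

Lemma blockf_cintble u j g : tempered u -> schwartz g -> cintble (fun y => blockf u j y * g y).
Proof.
move=> tu sg; have [k [B B0 h]] := blockf_growth j tu.
have [A A0 hA] := schwartz_decay (k + 2 * d) sg.
apply: (cintble_wt (mulr_ge0 B0 A0)).
  by apply: cmeasM; [exact/ccont_cmeas/ccont_blockf|exact: schwartz_cmeas].
move=> y; rewrite cabsM; apply: le_trans (ler_pM (cabs_ge0 _) (cabs_ge0 _) (h y) (hA y)) _.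
rewrite -!mulrA ler_wpM2l// mulrC; exact: br_wt.
Qed.

Lemma tempered_null u (h : nat -> Rd -> C) : tempered u -> (forall n, schwartz (h n)) ->
  (forall k, exists2 A : R, 0 <= A & forall n, sbound k (h n) (A * 2 ^- n)) ->
  null (fun n => cabs (u (h n))).
Proof.
move=> /temperedP[_ [c [k [c0 hc]]]] sh H; have [A A0 hA] := H k.
apply: null_le (nullZ (mulr_ge0 c0 A0) (@null_exp2 R)); exists 0%N => n _.
by rewrite -mulrA; exact: hc (sh n) (hA n).
Qed.

(** By telescoping, the kernel of the sum of the blocks up to [J]. *)
Definition low_kernel J : Rd -> C := fourier (fun xi => eta (2 ^- J *: xi)).

Lemma test_low_cutoff J : test_function (fun xi => eta (2 ^- J *: xi)).
Proof. by apply: test_scale (test_eta); rewrite invr_neq0// lt0r_neq0// exp2_gt0. Qed.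

Lemma low_kernelE J x : low_kernel J x = \sum_(k < J.+1) lp_kernel k x.
Proof.
pose F k y := dyadic eta k y * expi (- (2 * pi) * dot y x).
have iF k : cintble (F k).
  have sd := test_schwartz (test_dyadic k).
  exact: (cintble_fourier _ _ (schwartz_cintble sd) (schwartz_cmeas sd)).
transitivity (cint setT (fun y => \sum_(k < J.+1) F k y)).
  by rewrite /low_kernel fourierE; apply: eq_cint => y; rewrite -mulr_suml dyadic_sum.
rewrite cint_sum; last by move=> k; exact: iF.
by apply: eq_bigr => k _; rewrite /lp_kernel fourierE.
Qed.

Lemma schwartz_low_kernel J : schwartz (low_kernel J).
Proof. exact/schwartz_fourier/test_low_cutoff. Qed.

Lemma blockf_sum u J y : tempered u ->
  \sum_(k < J.+1) blockf u k y = u (fun x => low_kernel J (x - y)).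
Proof.
move=> tu; have -> : (fun x => low_kernel J (x - y)) = fun x => \sum_(k < J.+1) lp_kernel k (x - y).
  by apply/funext => x; exact: low_kernelE.
by rewrite (tempered_sum tu)// => k; exact/schwartz_shift/schwartz_lp_kernel.
Qed.

(** The partial sums are convolutions with the kernels [low_kernel K], an approximate identity.
    *)
Lemma block_sum u g : tempered u -> schwartz g ->
  null (fun K => cabs (\sum_(k < K.+1) cint setT (fun y => blockf u k y * g y) - u g)).
Proof.
move=> tu sg; have e1 : eta 0 = 1.
  by apply: eta_near; rewrite /eucl (_ : dot 0 0 = 0) ?sqrtr0 ?divr_ge0// /dot big1// => i _; rewrite mxE mul0r.
pose h K x := conv (low_kernel K) g x - g x.
have sc K : schwartz (conv (low_kernel K) g) by exact: schwartz_conv d0 (schwartz_low_kernel K) sg.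
have sh K : schwartz (h K) by exact: schwartzB.
have := tempered_null tu sh; move=> /(_ _)/null_le; apply; last first.
  move=> k; have [A A0 hA] := approx_identity k d0 test_eta e1 sg.
  by exists A => // n; apply: hA; rewrite ?invr_gt0 ?exp2_gt0// invf_le1 ?exp2_gt0// exprn_ege1// ler1n.
exists 0%N => K _; rewrite (tempered_sub tu (sc K) sg).
rewrite (_ : \sum_(k < K.+1) _ = u (conv (low_kernel K) g))//.
have -> : conv (low_kernel K) g = fun x => \sum_(k < K.+1) conv g (lp_kernel k) x.
  apply/funext => x; rewrite (convC x (schwartz_low_kernel K) sg).
  rewrite -cint_sum; last by move=> k; exact: conv_cintble sg (schwartz_lp_kernel k).
  by apply: eq_cint => y; rewrite low_kernelE mulr_sumr.
rewrite (tempered_sum tu); last by move=> k; exact: schwartz_conv d0 sg (schwartz_lp_kernel k).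
by apply: eq_bigr => k _; rewrite -(block_blockf k tu sg) blockE.
Qed.

(** On the Fourier side [psi] multiplies the symbol of the block, which is unchanged; the
    distribution passes under the convolution integral by [tempered_conv]. *)
Lemma blockf_reproduce_test u j y psi : tempered u -> test_function psi ->
  (forall xi, dyadic eta j xi * psi xi = dyadic eta j xi) ->
  blockf u j y = cint setT (fun z => blockf u j z * fourier psi (z - y)).
Proof.
move=> tu tp hp; have sl := schwartz_lp_kernel j; have sp := schwartz_fourier tp.
transitivity (u (conv (fun z => fourier psi (z - y)) (lp_kernel j))).
  congr u; apply/funext => x.
  have <- : conv (fourier psi) (lp_kernel j) (x - y) = lp_kernel j (x - y).
    rewrite (conv_fourier2 _ (test_dyadic j) tp); congr fourier.
    by apply/funext => xi; exact: hp.
  rewrite /conv -(cint_shift (- y) (conv_cintble (x - y) sp sl)).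
  by apply: eq_cint => z; congr (_ * lp_kernel j _); rewrite opprB addrA subrK.
rewrite (tempered_conv d0 tu (schwartz_shift y sp) sl); apply: eq_cint => z; exact: mulrC.
Qed.

Lemma blockf_shift_cintble u j y psi : tempered u -> test_function psi ->
  cintble (fun z => blockf u j z * fourier psi (z - y)).
Proof. by move=> tu tp; exact: blockf_cintble tu (schwartz_shift y (schwartz_fourier tp)). Qed.

Lemma blockf_reproduce u j y : tempered u ->
  blockf u j y = cint setT (fun z => blockf u j z * fat_kernel j (z - y)).
Proof. by move=> tu; apply: blockf_reproduce_test (test_fat j) _ => // xi; exact: dyadic_fat. Qed.

End littlewood_paley.

(** * The fundamental lemma of the calculus of variations *)

Section fundamental_lemma.
Context {R : realType} {d : nat}.
Local Notation C := R[i].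
Local Notation Rd := 'rV[R]_d.
Local Notation leb := (@lebesgue_rV R d).
Implicit Types (f g k : Rd -> C) (x y : Rd) (S : set Rd).

Lemma cintble_majorant_exists f : cintble f ->
  cmeas f /\ exists B, majorant (fun x => `|complex.Re (f x)| + `|complex.Im (f x)|) B.
Proof.
move=> [/integrableP[m1 f1] /integrableP[m2 f2]].
have mf : cmeas f by split; apply/measurable_EFinP.
split=> //; pose g x := `|complex.Re (f x)| + `|complex.Im (f x)|.
have mg : measurable_fun setT g by case: mf => n1 n2; apply: measurable_funD; exact: measurableT_comp.
have gi : (\int[leb]_x (g x)%:E < +oo)%E.
  under eq_integral do rewrite /g EFinD.
  rewrite ge0_integralD//; first exact: lte_add_pinfty.
  - by case: mf => n1 n2; apply/measurable_EFinP; exact: measurableT_comp.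
  - by case: mf => n1 n2; apply/measurable_EFinP; exact: measurableT_comp.
exists (fine (\int[leb]_x (g x)%:E)%E); split; [exact: mg|by move=> x; rewrite addr_ge0|].
by rewrite fineK ?lexx// ge0_fin_numE// integral_ge0// => x _; rewrite lee_fin addr_ge0.
Qed.

Lemma measurable_ball (r : R) : measurable [set x : Rd | eucl x <= r].
Proof.
have -> : [set x : Rd | eucl x <= r] = (fun x => eucl x) @^-1` `]-oo, r].
  by apply/seteqP; split => x /=; rewrite in_itv.
rewrite -[X in measurable X]setTI; apply: (_ : measurable_fun setT (@eucl R d)) => //.
apply: (measurableT_comp (f := @Num.sqrt R)).
  by apply: continuous_measurable_fun; exact: sqrt_continuous.
apply: (@measurable_sum _ _ _ _ _ _ (fun i (z : Rd) => z 0 i * z 0 i)) => i.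
by apply: measurable_funM; exact: measurable_coor.
Qed.

Definition cut_ball (r : R) f x : C := if eucl x <= r then f x else 0.

Lemma cut_ball_cintble f r : loc_integrable f -> cintble (cut_ball r f).
Proof.
move=> lf; have [iR iI] := lf r; have mD := measurable_ball r.
have rE (p : C -> R) : p 0 = 0 -> (fun x => (p (f x))%:E) \_ [set x | eucl x <= r] = (fun x => (p (cut_ball r f x))%:E).
  move=> p0; apply/funext => x; rewrite patchE /cut_ball.
  have [xr|xr] := boolP (eucl x <= r); first by rewrite mem_set.
  by rewrite memNset ?p0//; apply/negP.
by split; [have h := iR|have h := iI]; rewrite -(setTI [set x | _]) in h;
  move/(integrable_restrict leb mD measurableT) : h; rewrite rE.
Qed.

Lemma loc_cmeas f : loc_integrable f -> cmeas f.
Proof.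
move=> lf; apply: (@cmeas_cvg _ _ _ (fun n => cut_ball n%:R f)) => [n|x e e0].
  by have [] := cintble_majorant_exists (cut_ball_cintble n%:R lf).
exists (Num.trunc (eucl x)).+1 => n nN; rewrite /cut_ball ifT ?subrr ?cabs0 ?ltW//.
by apply: lt_le_trans (truncnS_gt _) _; rewrite ler_nat.
Qed.

(** Haar functions are bounded with bounded support, hence pair with all locally integrable
    functions. *)
Lemma loc_cintble_bounded f g (A r : R) : loc_integrable f -> cmeas g -> 0 <= A -> 0 <= r ->
  (forall x, cabs (g x) <= A) -> (forall x, r < `|x| -> g x = 0) -> cintble (fun x => f x * g x).
Proof.
move=> lf mg A0 r0 hA gr.
have -> : (fun x => f x * g x) = (fun x => cut_ball (d%:R * r) f x * g x).
  apply/funext => x; have [xr|xr] := leP `|x| r; last by rewrite gr// !mulr0.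
  by rewrite /cut_ball ifT//; apply: le_trans (eucl_le_norm x) _; rewrite ler_wpM2l.
have [mf [B M]] := cintble_majorant_exists (cut_ball_cintble (d%:R * r) lf).
apply: (cintble_majorant _ (majorantZ A0 M)); first exact: cmeasM.
by move=> x; rewrite cabsM mulrC ler_pM ?cabs_ge0// cabs_le_ReIm.
Qed.

Lemma loc_cintble f g : loc_integrable f -> test_function g -> cintble (fun x => f x * g x).
Proof.
move=> lf tg; have /test_functionP[_ [r r0 gr]] := tg; have [A A0 hA] := test_bounded tg.
apply: (loc_cintble_bounded lf _ A0 (ltW r0) hA gr); exact/schwartz_cmeas/test_schwartz.
Qed.

Definition orthant (a : 'I_d -> \bar R) : set Rd := [set x | forall i, (a i < (x 0 i)%:E)%E].

Lemma orthant_open (a : 'I_d -> \bar R) : measurable (orthant a).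
Proof.
have -> : orthant a = \big[setI/setT]_(i < d) [set x : Rd | (a i < (x 0 i)%:E)%E].
  apply/seteqP; split=> x /=; rewrite /orthant /=.
    by move=> h; elim/big_rec: _ => // i S _ Sx; split => //; exact: h.
  by move=> h i; move: h; rewrite (bigD1 i)//= => -[].
elim/big_ind: _ => //; first by move=> S1 S2; exact: measurableI.
move=> i _; rewrite (_ : [set x | _] = (fun x : Rd => (x 0 i)%:E) @^-1` `]a i, +oo[).
  rewrite -[X in measurable X]setTI.
  have mi : measurable_fun setT (fun x : Rd => (x 0 i)%:E) by apply/measurable_EFinP; exact: measurable_coor.
  by apply: mi => //; exact: emeasurable_itv.
by apply/seteqP; split => x /=; rewrite in_itv/= andbT.
Qed.

(** Orthants form a family stable under intersection, so that the monotone class argument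
    applies. *)
Lemma orthant_generates : (@measurable _ Rd) = <<s [set orthant a | a in [set: 'I_d -> \bar R]] >>.
Proof.
apply/seteqP; split; last first.
  apply: smallest_sub; first exact: sigma_algebra_measurable.
  by move=> _ [a _ <-]; exact: orthant_open.
apply: smallest_sub; first exact: smallest_sigma_algebra.
rewrite -bigcup_seq => A [i _ [B mB <-]]; rewrite setTI.
have : measurable_fun (setT : set (g_sigma_algebraType [set orthant a | a in [set: 'I_d -> \bar R]]))
   (fun x : Rd => x 0 i : measurableTypeR R).
  apply: (measurability (@RGenOInfty.G R)); first exact: RGenOInfty.measurableE.
  move=> _ [_ [x ->] <-].
  pose b (n : nat) := fun j : 'I_d => if j == i then x%:E else (- n%:R)%:E : \bar R.
  rewrite setTI (_ : _ @^-1` _ = \bigcup_n orthant (b n)).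
    by apply: bigcup_measurable => n _; apply: sub_sigma_algebra; exists (b n).
  apply/seteqP; split => y /=; rewrite in_itv/= andbT; last first.
    by move=> [n _ /(_ i)]; rewrite /b eqxx lte_fin.
  move=> xy; exists (Num.trunc `|y|).+1 => // j; rewrite /b; case: eqP => [->|_]; rewrite lte_fin//.
  rewrite ltrNl; apply: (@le_lt_trans _ _ `|y|).
    by apply: le_trans (coord_le y j); rewrite -normrN ler_norm.
  by rewrite truncnS_gt.
by move=> /(_ measurableT B mB); rewrite setTI.
Qed.

End fundamental_lemma.

Section fundamental_lemma2.
Context {R : realType} {d : nat}.
Local Notation C := R[i].
Local Notation Rd := 'rV[R]_d.
Local Notation leb := (@lebesgue_rV R d).
Implicit Types (f g k : Rd -> C) (x y : Rd) (S : set Rd).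
Variable T : nat -> R -> R.
Hypothesis HT : smooth_step T.

Definition half_line (a : \bar R) (n : nat) (i : 'I_d) (x : Rd) : C :=
  match a with
  | r%:E => 1 - step_coord T n%:R (- (n%:R * r)) i x
  | -oo%E => 1
  | +oo%E => 0
  end.

(** Smooth approximations of the indicator of an orthant. *)
Definition smooth_orthant (a : 'I_d -> \bar R) (n : nat) (x : Rd) : C :=
  \prod_i half_line (a i) n i x.

Lemma smooth_smooth_orthant a n : smooth (smooth_orthant a n).
Proof.
apply: (@smooth_prod R d 'I_d (index_enum _) (fun i => half_line (a i) n i)) => i.
case: (a i) => [r||]; cbn [half_line]; [|exact: smooth_cst|exact: smooth_cst].
exact: smoothB (smooth_cst 1) (smooth_step_coord HT _ _ _).
Qed.

Lemma smooth_orthant_bounded : exists2 A : R, 0 <= A & forall a n x, cabs (smooth_orthant a n x) <= A.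
Proof.
have [B B0 hB] := step_bounded HT 0%N.
have B1 : 0 <= 1 + B by rewrite addr_ge0.
exists ((1 + B) ^+ d) => [|a n x]; first by rewrite exprn_ge0.
have : (1 + B) ^+ d = \prod_(i < d) (1 + B) by rewrite prodr_const card_ord.
move=> ->; rewrite /smooth_orthant.
elim/big_ind2: _ => [||i _]; first by rewrite cabs1.
  by move=> x1 x2 y1 y2 h1 h2; rewrite cabsM ler_pM ?cabs_ge0.
case: (a i) => [r||]; cbn [half_line]; rewrite ?cabs1 ?cabs0 ?lerDl//.
apply: le_trans (cabsB _ _) _; rewrite cabs1 lerD2l step_coordE cabs_real; exact: hB.
Qed.

Lemma smooth_orthant_cvg a x : exists N, forall n, (N <= n)%N ->
  smooth_orthant a n x = (\1_(orthant a) x)%:C%C.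
Proof.
have key i : exists N, forall n, (N <= n)%N ->
    half_line (a i) n i x = ((a i < (x 0 i)%:E)%E)%:R :> C.
  case: (a i) => [r||]; cbn [half_line]; last by exists 0%N => n _; rewrite ltNyr.
    have [xr|rx] := leP (x 0 i) r.
      exists 0%N => n _; rewrite lte_fin ltNge xr /= step_coordE (step_left HT) ?subrr//.
      by rewrite -mulrBr; apply: (@le_trans _ _ 0); [rewrite mulr_ge0_le0// subr_le0|rewrite divr_ge0].
    exists (Num.trunc (x 0 i - r)^-1).+1 => n nN.
    rewrite lte_fin rx step_coordE (step_right HT) ?subr0//.
    have xr : 0 < x 0 i - r by rewrite subr_gt0.
    rewrite -mulrBr; apply: (@le_trans _ _ 1); first by rewrite ler_pdivrMr// mul1r ler1n.
    rewrite -ler_pdivrMr// mul1r; apply: ltW; apply: lt_le_trans (truncnS_gt _) _.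
    by rewrite ler_nat.
  by exists 0%N => n _; rewrite ltNge leey.
have /choice[N HN] := key.
exists (\max_i N i)%N => n nN; rewrite /smooth_orthant.
have -> : (\1_(orthant a) x : R)%:C%C = \prod_i ((a i < (x 0 i)%:E)%E)%:R :> C.
  rewrite indicE; have [/set_mem h|h] := boolP (x \in orthant a).
    by rewrite big1 ?rmorph1// => i _; rewrite h.
  have /existsNP[i ai] : ~ orthant a x by move=> H; case/negP: h; exact: mem_set.
  by rewrite (bigD1 i)//= (negbTE (introN idP ai)) mul0r.
apply: eq_bigr => i _; apply: HN; apply: leq_trans nN; exact: (leq_bigmax i).
Qed.

(** A function orthogonal to all test functions integrates to zero over orthants,
    hence over all measurable sets. *)
Lemma cint_set_zero k S : cintble k -> (forall g, smooth g -> cint setT (fun x => g x * k x) = 0) ->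
  measurable S -> cint setT (fun x => (\1_S x)%:C%C * k x) = 0.
Proof.
move=> ik hk mS; have [mk [B M]] := cintble_majorant_exists ik.
have cle x := @cabs_le_ReIm R (k x).
have mind S' : measurable S' -> cmeas (fun x : Rd => (\1_S' x : R)%:C%C).
  by move=> mS'; apply: cmeas_real; exact: measurable_indic.
have ind1 S' x : cabs (\1_S' x : R)%:C%C <= 1.
  by rewrite cabs_real ger0_norm// indicE; case: (_ \in _).
have iS S' : measurable S' -> cintble (fun x => (\1_S' x)%:C%C * k x).
  move=> mS'; apply: (cintble_majorant _ M); first by apply: cmeasM => //; exact: mind.
  by move=> x; rewrite cabsM; apply: le_trans (ler_piMl (cabs_ge0 _) (ind1 _ _)) _.
have lim (F : nat -> Rd -> C) (S' : set Rd) (A : R) : measurable S' -> 0 <= A -> (forall n, cmeas (F n)) ->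
    (forall n x, cabs (F n x) <= A) -> (forall n, cint setT (fun x => F n x * k x) = 0) ->
    (forall x, exists N, forall n, (N <= n)%N -> F n x = (\1_S' x)%:C%C) ->
    cint setT (fun x => (\1_S' x)%:C%C * k x) = 0.
  move=> mS' A0 mF hF F0 cF.
  have := @cint_dominated R d (fun n x => F n x * k x) (fun x => (\1_S' x)%:C%C * k x) _ _
    (fun n => cmeasM (mF n) mk) (cmeasM (mind _ mS') mk) (majorantZ A0 M).
  move=> H; apply: (@null_limit_unique R (fun n => cint setT (fun x => F n x * k x))).
    apply: H => [n x|].
      by rewrite cabsM ler_pM ?cabs_ge0.
    apply: aeW => x e e0; have [N HN] := cF x; exists N => n nN.
    by rewrite HN// subrr cabs0 ltW.
  by move=> e e0; exists 0%N => n _; rewrite F0 subrr cabs0 ltW.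
rewrite orthant_generates in mS.
apply: (dynkin_induction orthant_generates _ _ _ _ _ mS (P := fun S => cint setT (fun x => (\1_S x)%:C%C * k x) = 0)).
- move=> _ _ [a _ <-] [b _ <-]; exists (fun i => maxe (a i) (b i)) => //.
  apply/seteqP; split => x; rewrite /orthant /=.
    by move=> h; split => i; have := h i; rewrite gt_max => /andP[].
  by move=> [h1 h2] i; rewrite gt_max h1 h2.
- by rewrite -[RHS](hk _ (smooth_cst 1)); apply: eq_cint => x; rewrite indicT.
- move=> _ [a _ <-]; have [A A0 hA] := smooth_orthant_bounded.
  apply: (lim (smooth_orthant a) (orthant a) A) => //.
  + exact: orthant_open.
  + by move=> n; exact/ccont_cmeas/smooth_ccont/smooth_smooth_orthant.
  + by move=> n; exact/hk/smooth_smooth_orthant.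
  + exact: smooth_orthant_cvg.
- move=> S' mS' h'; rewrite -[RHS](subrr (0 : C)) -{1}(hk _ (smooth_cst 1)) -h' -cintB.
  + apply: eq_cint => x; rewrite -mulrBl; congr (_ * _); rewrite !indicE in_setC.
    by case: (x \in S'); rewrite /= ?subrr// subr0.
  + by move: ik; congr cintble; apply/funext => x; rewrite mul1r.
  + exact: iS.
- move=> F mF tF hF.
  apply: (lim (fun n x => \sum_(i < n) (\1_(F i) x)%:C%C) _ 1) => //.
  + exact: bigcup_measurable.
  + move=> n; apply: cmeas_sum => i; exact: mind.
  + move=> n x; rewrite -rmorph_sum cabs_real ger0_norm ?sumr_ge0//.
    have [[i Fi]|H] := pselect (exists i : 'I_n, F i x).
      rewrite (bigD1 i)//= big1 ?addr0 => [|j ji]; first by rewrite indicE; case: (_ \in _).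
      rewrite indicE memNset// => Fj.
      have := tF i j Logic.I Logic.I; move/(_ (ex_intro _ x (conj Fi Fj))) => ij.
      by rewrite (val_inj ij) eqxx in ji.
    by rewrite big1// => i _; rewrite indicE memNset// => Fi; apply: H; exists i.
  + move=> n; rewrite (eq_cint (g := fun x => \sum_(i < n) (\1_(F i) x)%:C%C * k x)).
      by rewrite cint_sum => [|i]; [rewrite big1|exact: iS].
    by move=> x; rewrite mulr_suml.
  + move=> x; have [[i _ Fi]|H] := pselect ((\bigcup_i F i) x).
      exists i.+1 => n ni; rewrite (bigD1 (Ordinal ni))//= big1 ?addr0 => [|j ji].
        by rewrite !indicE !mem_set//; exists i.
      rewrite indicE memNset// => Fj.
      have := tF i j Logic.I Logic.I; move/(_ (ex_intro _ x (conj Fi Fj))) => ij.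
      by rewrite (val_inj (ij : val (Ordinal ni) = val j)) eqxx in ji.
    exists 0%N => n _; rewrite (_ : \1_(\bigcup_j F j) x = 0); last by rewrite indicE memNset.
    rewrite rmorph0 big1// => i _.
    by rewrite indicE memNset// => Fi; apply: H; exists i.
Qed.

(** Integrals over measurable sets determine an integrable function almost everywhere. *)
Lemma cint_zero_ae k : cintble k -> (forall g, smooth g -> cint setT (fun x => g x * k x) = 0) ->
  {ae leb, forall x, k x = 0}.
Proof.
move=> ik hk.
have key (p : C -> R) (mp : leb.-integrable setT (fun x => (p (k x))%:E)) :
   (forall S, measurable S -> (\int[leb]_(x in S) (p (k x)))%R = 0) -> {ae leb, forall x, p (k x) = 0}.
  move=> H; have h := @integral_ae_eq _ _ R leb setT measurableT (cst 0%E) _ mp (measurable_cst _).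
  have /h : forall E, E `<=` setT -> measurable E ->
      (\int[leb]_(x in E) (p (k x))%:E = \int[leb]_(x in E) cst 0%E x)%E; last first.
    by apply: filterS => x /(_ Logic.I)/= [].
  move=> E _ mE; rewrite integral0 -[RHS](congr1 EFin (H E mE)) fineK//.
  apply: integrable_fin_num => //; exact: integrableS mp.
have kS S : measurable S -> \int[leb]_(x in S) complex.Re (k x) = 0 /\ \int[leb]_(x in S) complex.Im (k x) = 0.
  move=> mS; have := cint_set_zero ik hk mS => -[h1 h2].
  split; rewrite Rintegral_mkcond; [rewrite -[RHS]h1|rewrite -[RHS]h2]; apply: eq_Rintegral => x _;
    rewrite patchE /= ?cReM ?cImM /= indicE; case: (x \in S); rewrite /= ?mul0r ?mul1r ?subr0 ?addr0//.
have [iR iI] := ik.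
have h1 := key (@complex.Re R) iR (fun S mS => (kS S mS).1).
have h2 := key (@complex.Im R) iI (fun S mS => (kS S mS).2).
by apply: filterS2 h1 h2 => x e1 e2; exact: complex_ext.
Qed.

(** Multiplication by plateaus reduces a locally integrable function to integrable ones. *)
Lemma fundamental_lemma f : loc_integrable f -> (forall g, test_function g -> cint setT (fun x => f x * g x) = 0) ->
  {ae leb, forall x, f x = 0}.
Proof.
move=> lf hf.
pose P n := plateau T 1 n%:R (0 : Rd).
have tP n : test_function (P n) by exact: (test_plateau HT).
have : {ae leb, forall x, forall n, f x * P n x = 0}.
  apply: ae_foralln => n; apply: cint_zero_ae; first exact: loc_cintble.
  move=> g sg; rewrite -[RHS](hf _ (testM sg (tP n))); apply: eq_cint => x; exact: mulrCA.
apply: filterS => x /(_ (Num.trunc `|x|).+1); rewrite /P (plateau1 HT) ?mulr1// => j.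
by rewrite mxE subr0; apply: le_trans (coord_le x j) _; exact/ltW/truncnS_gt.
Qed.

End fundamental_lemma2.

(** * Lebesgue quasinorms *)

Section lebesgue_quasinorm.
Context {R : realType}.

(** Upper bounds of a quasinorm; unlike the quasinorm, they need no case distinction on
    finiteness and no measurability. *)
Definition Lp_le disp (T : measurableType disp) (mu : {measure set T -> \bar R}) (p : \bar R)
    (f : T -> R) (B : R) : Prop :=
  (Lnorm mu p (EFin \o f) <= B%:E)%E.

Lemma nneseries_le (F : nat -> \bar R) (B : \bar R) : (forall k, (0 <= F k)%E) ->
  (forall n, (\sum_(0 <= k < n) F k <= B)%E) -> (\sum_(0 <= k <oo) F k <= B)%E.
Proof.
move=> F0 FB; apply: lime_le; first by apply: is_cvg_nneseries => k _ _; exact: F0.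
by apply: nearW.
Qed.

Lemma powR_le (x y r : R) : 0 <= r -> 0 <= x -> x <= y -> x `^ r <= y `^ r.
Proof. by move=> r0 x0 xy; apply: ge0_ler_powR; rewrite ?nnegrE// (le_trans x0). Qed.

Lemma powRK (x r : R) : 0 < r -> 0 <= x -> (x `^ r) `^ r^-1 = x.
Proof. by move=> r0 x0; rewrite -powRrM divff ?powRr1// gt_eqF. Qed.

Lemma powRVK (x r : R) : 0 < r -> 0 <= x -> (x `^ r^-1) `^ r = x.
Proof. by move=> r0 x0; rewrite -powRrM mulVf ?powRr1// gt_eqF. Qed.

Lemma poweR_le (x y : \bar R) (r : R) : 0 <= r -> (0 <= x)%E -> (x <= y)%E -> (x `^ r <= y `^ r)%E.
Proof.
by move=> r0 x0 xy; apply: gt0_ler_poweR; rewrite // in_itv /= leey andbT// (le_trans x0).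
Qed.

Section one_measure.
Context {disp} {T : measurableType disp} (mu : {measure set T -> \bar R}).
Implicit Types (f g : T -> R).

Lemma Lp_le_fin (r : R) f (B : R) : 0 < r -> 0 <= B -> (forall x, 0 <= f x) ->
  Lp_le mu r%:E f B <-> (\int[mu]_x (f x `^ r)%:E <= (B `^ r)%:E)%E.
Proof.
move=> r0 B0 f0; have := @poweR_Lnorm _ T R mu (EFin \o f) r; rewrite gt_eqF// => /(_ isT) E.
have -> : (\int[mu]_x (f x `^ r)%:E = ('N[mu]_r%:E[EFin \o f])%E `^ r)%E.
  by rewrite E; apply: eq_integral => x _; rewrite /= ger0_norm// poweR_EFin.
have N0 := @Lnorm_ge0 _ T R mu r%:E (EFin \o f).
rewrite /Lp_le; move: ('N[mu]_r%:E[EFin \o f])%E N0 => N N0; split => h.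
  by rewrite -poweR_EFin; apply: poweR_le => //; exact: ltW.
have h' := poweR_le (_ : 0 <= r^-1) (poweR_ge0 N r) h.
move: h'; rewrite invr_ge0 (ltW r0) => /(_ isT).
by rewrite -poweRrM poweR_EFin powRK// mulfV ?gt_eqF// poweRe1.
Qed.

Lemma Lp_le_infty f (B : R) : 0 <= B -> (forall x, 0 <= f x) ->
  Lp_le mu +oo%E f B <-> {ae mu, forall x, f x <= B}.
Proof.
move=> B0 f0; rewrite /Lp_le unlock; case: ifPn => m0.
  split; last by move=> h; apply/ess_sup_inf.ess_supP; apply: filterS h => x; rewrite /= lee_fin ger0_norm.
  by move/ess_sup_inf.ess_supP; apply: filterS => x; rewrite /= lee_fin ger0_norm.
split=> _; last by rewrite lee_fin.
exists setT; split => //; first by apply/eqP; rewrite eq_le measure_ge0 andbT leNgt.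
Qed.

Lemma Lp_ae_eq (p : \bar R) f g : (0 < p)%E ->
  measurable_fun setT f -> measurable_fun setT g -> {ae mu, forall x, f x = g x} ->
  Lnorm mu p (EFin \o f) = Lnorm mu p (EFin \o g).
Proof.
move=> p0 mf mg fg; rewrite unlock; case: p p0 => [r r0||//].
  have E h : (fun x => (`|(EFin \o h) x| `^ r)%E) = (fun x : T => (`|h x| `^ r)%:E).
    by apply/funext => x; rewrite -poweR_EFin.
  congr (_ `^ _)%E; rewrite !E; apply: ae_eq_integral; first exact: measurableT.
  - by apply/measurable_EFinP/(measurableT_comp (measurable_powR _)); exact: measurableT_comp.
  - by apply/measurable_EFinP/(measurableT_comp (measurable_powR _)); exact: measurableT_comp.
  - by apply: filterS fg => x /= -> _.
by move=> _; case: ifP => // _; apply: ess_sup_inf.eq_ess_sup; apply: filterS fg => x /= ->.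
Qed.

End one_measure.

(** The union bound in a Lebesgue space, for all exponents at once: for finite exponents the
    power of the supremum is at most the sum of the powers. *)
Lemma Lp_le_sup (p : \bar R) : (0 < p)%E -> exists2 K : R, 0 <= K &
  forall disp (T : measurableType disp) (mu : {measure set T -> \bar R}) (f : T -> R) (g : nat -> T -> R) (B : R),
  0 <= B -> measurable_fun setT f -> (forall k, measurable_fun setT (g k)) ->
  (forall x, 0 <= f x) -> (forall k x, 0 <= g k x) ->
  (forall x M, 0 <= M -> (forall k, g k x <= M) -> f x <= M) ->
  (forall k, Lp_le mu p (g k) (2 ^- k * B)) -> Lp_le mu p f (K * B).
Proof.
case: p => [r||//] p0; last first.
  exists 1 => // disp T mu f g B B0 mf mg f0 g0 fg gB.
  rewrite mul1r; apply/Lp_le_infty => //.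
  have : {ae mu, forall x, forall k, g k x <= 2 ^- k * B}.
    by apply: ae_foralln => k; apply/Lp_le_infty => //; rewrite mulr_ge0.
  apply: filterS => x h; apply: fg => // k; apply: le_trans (h k) _.
  by rewrite ler_piMl// invf_le1 ?exprn_gt0// exprn_ege1// ler1n.
rewrite lte_fin in p0; pose z : R := (2^-1) `^ r.
have z0 : 0 < z by rewrite powR_gt0.
have z1 : z < 1.
  by have := @gt0_ltr_powR R r p0 2^-1 1; rewrite !nnegrE powR1; apply; rewrite ?invr_ge0// invf_lt1// ltr1n.
have zk k : (2 ^- k) `^ r = z ^+ k.
  by rewrite -powR_mulrn// ?ltW// /z -powRrM mulrC powRrM powR_mulrn ?invr_ge0// exprVn.
pose S := (1 - z)^-1; have S0 : 0 <= S by rewrite invr_ge0 subr_ge0 ltW.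
exists (S `^ r^-1) => [|disp T mu f g B B0 mf mg f0 g0 fg gB]; first exact: powR_ge0.
apply/Lp_le_fin => //; first by rewrite mulr_ge0// powR_ge0.
rewrite powRM ?powR_ge0// powRVK//.
have mp (h : T -> R) : measurable_fun setT h -> measurable_fun setT (fun x => (h x `^ r)%:E).
  by move=> mh; apply/measurable_EFinP; exact: (measurableT_comp (measurable_powR _)).
apply: (@le_trans _ _ (\int[mu]_x \sum_(0 <= k <oo) (g k x `^ r)%:E)%E).
  apply: ge0_le_integral => //.
  - by move=> x _; rewrite lee_fin powR_ge0.
  - exact: mp.
  - apply: ge0_emeasurable_sum => [k x _ _|k _]; first by rewrite lee_fin powR_ge0.
    exact: mp.
  - move=> x _.
    have gS k : ((g k x `^ r)%:E <= \sum_(0 <= k <oo) (g k x `^ r)%:E)%E.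
      apply: le_trans (nneseries_lim_ge k.+1 _) => [|n _ _]; last by rewrite lee_fin powR_ge0.
      rewrite big_nat_recr//= leeDr// sume_ge0// => n _; by rewrite lee_fin powR_ge0.
    case: (\sum_(0 <= k <oo) _)%E gS => [M|_|/(_ 0%N)//]; last by rewrite leey.
    move=> gS; rewrite lee_fin.
    have M0 : 0 <= M by have := gS 0%N; rewrite lee_fin; apply: le_trans; exact: powR_ge0.
    rewrite -[leRHS](powRVK p0)//; apply: powR_le; rewrite ?(ltW p0)//.
    apply: fg => [|k]; first exact: powR_ge0.
    rewrite -[leLHS](powRK p0)//; apply: powR_le; rewrite ?invr_ge0 ?(ltW p0) ?powR_ge0//.
    by have := gS k; rewrite lee_fin.
rewrite integral_nneseries//; last by move=> k x _; rewrite lee_fin powR_ge0.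
  apply: nneseries_le => [k|n]; first by apply: integral_ge0 => x _; rewrite lee_fin powR_ge0.
  have z2 : `|z| < 1 by rewrite ger0_norm// ltW.
  apply: (@le_trans _ _ (\sum_(0 <= k < n) (z ^+ k * B `^ r)%:E)%E).
    apply: lee_sum => k _; have := gB k => /Lp_le_fin; rewrite powRM// zk.
    by apply=> //; rewrite mulr_ge0.
  rewrite sumEFin lee_fin -mulr_suml ler_wpM2r ?powR_ge0//.
  have := @geometric_le_lim R n 1 z ler01 z0 z2.
  by rewrite mul1r /series /=; under eq_bigr do rewrite mul1r.
by move=> k; exact: mp.
Qed.

End lebesgue_quasinorm.

(** * Blocks as functions, balls of Besov spaces *)

Section block_functions.
Context {R : realType} {d : nat}.
Local Notation C := R[i].
Local Notation Rd := 'rV[R]_d.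
Local Notation leb := (@lebesgue_rV R d).
Implicit Types (f g : Rd -> C) (x y : Rd) (u v : distr R d).
Variable eta : Rd -> C.
Hypothesis He : lp_cutoff eta.
Hypothesis d0 : (0 < d)%N.

Lemma cint_ae_eq f g : cmeas f -> cmeas g -> {ae leb, forall x, f x = g x} -> cint setT f = cint setT g.
Proof.
move=> [f1 f2] [g1 g2] fg; apply: complex_ext; rewrite /= /Rintegral; congr fine; apply: ae_eq_integral => //.
- exact/measurable_EFinP.
- exact/measurable_EFinP.
- by apply: filterS fg => x -> _.
- exact/measurable_EFinP.
- exact/measurable_EFinP.
- by apply: filterS fg => x -> _.
Qed.

Lemma ccont_loc_integrable f : ccont f -> loc_integrable f.
Proof.
move=> cf r; have [T HT] := exists_smooth_step d0 He.
pose P := plateau T 1 `|r| (0 : Rd).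
have tP : test_function P by exact: (test_plateau HT).
have iP : cintble (fun x => P x * f x).
  have [A A0 hA] := test_bounded tP; have /test_functionP[_ [r' r'0 Pr]] := tP.
  have [B B0 hB] := ccont_bounded r' cf.
  have [B1 B10 [g M hg]] := @majorant_supported R d r'.
  apply: (cintble_majorant _ (majorantZ (mulr_ge0 A0 B0) M)).
    by apply: cmeasM; [exact/schwartz_cmeas/test_schwartz|exact: ccont_cmeas].
  move=> x; have := hg x; case: ifPn => [xr g1|].
    rewrite cabsM; apply: (@le_trans _ _ (A * B)); first by rewrite ler_pM ?cabs_ge0// hB.
    by rewrite ler_peMr// mulr_ge0.
  by rewrite -ltNge => xr g1; rewrite Pr// mul0r cabs0 !mulr_ge0.
have P1 x : eucl x <= r -> P x = 1.
  move=> xr; apply: (plateau1 HT) => // j; rewrite mxE subr0.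
  apply: le_trans (coord_le x j) _; apply: le_trans (norm_le_eucl x) _.
  by apply: le_trans xr _; exact: ler_norm.
have mD := @measurable_ball R d r.
have [i1 i2] := iP; split.
  have := @integrableS _ _ _ leb setT _ _ measurableT mD (@subsetT _ _) i1.
  by apply: eq_integrable => // x; rewrite inE /= => xr; rewrite P1// mul1r.
have := @integrableS _ _ _ leb setT _ _ measurableT mD (@subsetT _ _) i2.
by apply: eq_integrable => // x; rewrite inE /= => xr; rewrite P1// mul1r.
Qed.

(** The function chosen to represent a block is the continuous one almost everywhere. *)
Lemma fun_of_block u j : tempered u -> loc_integrable (fun_of (block eta u j)) /\
  {ae leb, forall x, fun_of (block eta u j) x = blockf eta u j x}.
Proof.
move=> tu; have [T HT] := exists_smooth_step d0 He.
have lb : loc_integrable (blockf eta u j) by exact/ccont_loc_integrable/ccont_blockf.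
have rb : represents (blockf eta u j) (block eta u j).
  by split=> // g tg; apply: block_blockf => //; exact: test_schwartz.
have : represents (fun_of (block eta u j)) (block eta u j) by rewrite /fun_of; case: xgetP => // /(_ _ rb).
set f := fun_of _ => -[lf hf]; split=> //.
have lfb : loc_integrable (fun x => f x - blockf eta u j x).
  move=> r; have [a1 a2] := lf r; have [b1 b2] := lb r; have mD := @measurable_ball R d r; split.
    rewrite (_ : (fun _ => _) = fun x => ((complex.Re (f x))%:E - (complex.Re (blockf eta u j x))%:E)%E).
      exact: integrableB.
    by apply/funext => x; rewrite -EFinB; congr EFin; case: (f x); case: (blockf eta u j x).
  rewrite (_ : (fun _ => _) = fun x => ((complex.Im (f x))%:E - (complex.Im (blockf eta u j x))%:E)%E).
    exact: integrableB.
  by apply/funext => x; rewrite -EFinB; congr EFin; case: (f x); case: (blockf eta u j x).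
have : {ae leb, forall x, f x - blockf eta u j x = 0}.
  apply: (fundamental_lemma HT lfb) => g tg.
  rewrite (eq_cint (g := fun x => f x * g x - blockf eta u j x * g x)); last by move=> x; rewrite mulrBl.
  rewrite cintB; [|exact: (loc_cintble lf tg)|exact: (loc_cintble lb tg)].
  have [_ h1] := rb; have e1 := hf g tg; have e2 := h1 g tg; rewrite /dist_of in e1 e2.
  by rewrite -e1 -e2 subrr.
by apply: filterS => x /eqP; rewrite subr_eq0 => /eqP.
Qed.

End block_functions.

Section besov_balls.
Context {R : realType} {d : nat}.
Local Notation C := R[i].
Local Notation Rd := 'rV[R]_d.
Local Notation leb := (@lebesgue_rV R d).
Implicit Types (f g : Rd -> C) (x y : Rd) (u v : distr R d).

Lemma measurable_nat disp (T : measurableType disp) (f : nat -> T) : measurable_fun setT f.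
Proof. by move=> _ Y _; rewrite setTI. Qed.

Lemma counting_ae (P : nat -> Prop) : {ae (@counting nat R), forall k, P k} -> forall k, P k.
Proof.
move=> [N [_ N0 PN]] k; apply: contrapT => Pk.
have Nk : N k by exact: PN.
have : ((\d_k N : \bar R) <= \sum_(0 <= n <oo) \d_n N)%E.
  apply: le_trans (nneseries_lim_ge k.+1 _) => //.
  by rewrite big_nat_recr//= leeDr// sume_ge0.
by rewrite -counting_dirac N0 diracE mem_set// lee_fin ler10.
Qed.

Lemma Lnorm_counting_le (q : \bar R) (F G : nat -> \bar R) : (0 < q)%E ->
  (forall k, (0 <= F k)%E) -> (forall k, (F k <= G k)%E) ->
  (Lnorm counting q F <= Lnorm counting q G)%E.
Proof.
move=> q0 F0 FG; have G0 k : (0 <= G k)%E by exact: le_trans (FG k).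
case: q q0 => [r||//] r0; last first.
  rewrite unlock; case: ifPn => // _; apply: ess_sup_inf.le_ess_sup.
  by apply: aeW => k /=; rewrite !gee0_abs.
have r1 : 0 <= r by rewrite -lee_fin ltW.
rewrite !Lnorm_counting//; apply: poweR_le; first by rewrite invr_ge0.
  by apply: nneseries_ge0 => k _ _; exact: poweR_ge0.
apply: lee_nneseries; first by move=> k _ _; exact: poweR_ge0.
move=> k _; rewrite (gee0_abs (F0 k)) (gee0_abs (G0 k)); exact: poweR_le.
Qed.

Lemma Lnorm_counting_ge (q : \bar R) (F : nat -> \bar R) k : (0 < q)%E ->
  (forall k, (0 <= F k)%E) -> (F k <= Lnorm counting q F)%E.
Proof.
move=> q0 F0; case: q q0 => [r||//] r0; last first.
  have cT : (0 < @counting nat R setT)%E.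
    rewrite counting_dirac; apply: (@lt_le_trans _ _ (\d_0%N [set: nat])%E); first by rewrite diracT.
    by apply: le_trans (nneseries_lim_ge 1 _) => //; rewrite big_nat1.
  rewrite unlock ifT//.
  have := counting_ae (ess_sup_inf.ess_sup_ge counting (abse \o F)).
  by move=> /(_ k) /=; rewrite gee0_abs.
rewrite Lnorm_counting//.
have -> : F k = ((F k `^ r) `^ r^-1)%E by rewrite -poweRrM mulfV ?gt_eqF// poweRe1.
apply: poweR_le; [by rewrite invr_ge0 ltW|exact: poweR_ge0|].
apply: le_trans (nneseries_lim_ge k.+1 _) => [|n _ _]; last exact: poweR_ge0.
rewrite big_nat_recr//= gee0_abs//.
by rewrite leeDr// sume_ge0// => n _; exact: poweR_ge0.
Qed.

Variable eta : Rd -> C.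
Hypothesis He : lp_cutoff eta.
Hypothesis d0 : (0 < d)%N.
Variables (s : R) (p q : \bar R).
Hypothesis p0 : (0 < p)%E.
Hypothesis q0 : (0 < q)%E.

(** The ball of radius [B] of the Besov space, in terms of bounds [b j] of the blocks. *)
Definition besov_le u (B : R) : Prop := tempered u /\ exists b : nat -> R,
  [/\ forall j, 0 <= b j, forall j, Lp_le leb p (fun x => cabs (blockf eta u j x)) (b j) &
      Lp_le counting q (fun j => 2 `^ (s * j%:R) * b j) B].

(** The continuous representatives of the blocks have the same Lebesgue quasinorms, and so may
    be used in the Besov norm. *)
Lemma besov_leP u (B : R) : 0 <= B -> (besov_norm eta s p q u <= B%:E)%E <-> besov_le u B.
Proof.
move=> B0; rewrite /besov_norm; case: asboolP => tu; last first.
  by split; [rewrite leye_eq|case].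
have E j : Lnorm leb p (fun x => (cabs (fun_of (block eta u j) x))%:E) =
           Lnorm leb p (fun x => (cabs (blockf eta u j x))%:E).
  have [lf ae] := fun_of_block He d0 j tu.
  apply: (@Lp_ae_eq _ _ _ leb p (fun x => cabs (fun_of (block eta u j) x)) (fun x => cabs (blockf eta u j x)) p0).
  - exact/measurable_cabs/loc_cmeas.
  - exact/measurable_cabs/ccont_cmeas/ccont_blockf.
  - by apply: filterS ae => x ->.
under [X in Lnorm _ _ X]eq_fun do rewrite E.
have w0 j : 0 < 2 `^ (s * j%:R) :> R by rewrite powR_gt0.
split=> [h|[_ [b [b0 hb h]]]]; last first.
  apply: le_trans h; apply: Lnorm_counting_le => // k; first by rewrite mule_ge0 ?lee_fin ?(ltW (w0 k))// Lnorm_ge0.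
  by rewrite /= EFinM lee_wpmul2l ?lee_fin ?(ltW (w0 k))//; exact: hb.
split=> //.
have F0 k : (0 <= (2 `^ (s * k%:R))%R%:E * Lnorm leb p (fun x => (cabs (blockf eta u k x))%:E))%E.
  by rewrite mule_ge0 ?lee_fin ?(ltW (w0 k))// Lnorm_ge0.
have fin j : Lnorm leb p (fun x => (cabs (blockf eta u j x))%:E) \is a fin_num.
  have := le_trans (Lnorm_counting_ge j q0 F0) h.
  rewrite ge0_fin_numE ?Lnorm_ge0// => /le_lt_trans/(_ (ltry B)).
  have := @Lnorm_ge0 _ _ _ leb p (fun x => (cabs (blockf eta u j x))%:E).
  case: (Lnorm _ _ _) => // [t _ _|_]; first exact: ltry.
  by rewrite gt0_muley ?lte_fin// ltxx.
exists (fun j => fine (Lnorm leb p (fun x => (cabs (blockf eta u j x))%:E))); split.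
- by move=> j; rewrite fine_ge0// Lnorm_ge0.
- by move=> j; rewrite /Lp_le fineK.
- move: h; congr (_ <= _)%E; congr Lnorm; apply/funext => j /=.
  by rewrite EFinM fineK.
Qed.

End besov_balls.

(** * The quasinormed structure of Besov spaces *)

Section Lp_algebra.
Context {R : realType}.

Section one_measure.
Context {disp} {T : measurableType disp} (mu : {measure set T -> \bar R}).
Implicit Types (f g h : T -> R) (p : \bar R).

Lemma Lp_le_weaken p f (B B' : R) : B <= B' -> Lp_le mu p f B -> Lp_le mu p f B'.
Proof. by move=> BB h; apply: le_trans h _; rewrite lee_fin. Qed.

Lemma Lp_le_dominated p f g (c B : R) : (0 < p)%E -> 0 <= c -> 0 <= B ->
  measurable_fun setT f -> measurable_fun setT g ->
  (forall x, 0 <= f x) -> (forall x, 0 <= g x) -> (forall x, f x <= c * g x) ->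
  Lp_le mu p g B -> Lp_le mu p f (c * B).
Proof.
move=> p0 c0 B0 mf mg f0 g0 fg; have cB : 0 <= c * B by rewrite mulr_ge0.
case: p p0 => [r||//] r0; last first.
  move=> /Lp_le_infty h; apply/Lp_le_infty => //; apply: filterS (h B0 g0) => x gB.
  by apply: le_trans (fg x) _; rewrite ler_wpM2l.
rewrite lte_fin in r0; move=> /Lp_le_fin h; apply/Lp_le_fin => //.
have mp (k : T -> R) : measurable_fun setT k -> measurable_fun setT (fun x => (k x `^ r)%:E).
  by move=> mk; apply/measurable_EFinP; exact: (measurableT_comp (measurable_powR _)).
apply: (@le_trans _ _ (\int[mu]_x ((c `^ r)%:E * (g x `^ r)%:E))%E).
  apply: ge0_le_integral => //.
  - by move=> x _; rewrite lee_fin powR_ge0.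
  - exact: mp.
  - by apply: emeasurable_funM => //; exact: mp.
  - move=> x _; rewrite -EFinM lee_fin -powRM//.
    by apply: powR_le; rewrite ?(ltW r0).
rewrite ge0_integralZl ?lee_fin ?powR_ge0//; first 1 last.
- exact: mp.
- by move=> x _; rewrite lee_fin powR_ge0.
by rewrite powRM// EFinM lee_wpmul2l ?lee_fin ?powR_ge0//; exact: h.
Qed.

Lemma Lp_le0 p (B : R) : (0 < p)%E -> 0 <= B -> Lp_le mu p (fun=> 0) B.
Proof.
move=> p0 B0; rewrite /Lp_le (_ : EFin \o _ = cst 0%E) ?Lnorm0 ?lee_fin//.
by rewrite gt_eqF.
Qed.

End one_measure.

Lemma ell_dominated (q : \bar R) (a b : nat -> R) (c B : R) : (0 < q)%E -> 0 <= c -> 0 <= B ->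
  (forall j, 0 <= a j) -> (forall j, 0 <= b j) -> (forall j, a j <= c * b j) ->
  Lp_le counting q b B -> Lp_le counting q a (c * B).
Proof.
move=> q0 c0 B0 a0 b0 ab.
exact: (@Lp_le_dominated _ _ counting q a b c B q0 c0 B0 (measurable_nat a) (measurable_nat b)).
Qed.

Lemma Lp_le_add (p : \bar R) : (0 < p)%E -> exists2 K : R, 1 <= K &
  forall disp (T : measurableType disp) (mu : {measure set T -> \bar R}) (f g h : T -> R) (B : R),
  0 <= B -> measurable_fun setT f -> measurable_fun setT g -> measurable_fun setT h ->
  (forall x, 0 <= f x) -> (forall x, 0 <= g x) -> (forall x, 0 <= h x) ->
  (forall x, h x <= f x + g x) -> Lp_le mu p f B -> Lp_le mu p g B -> Lp_le mu p h (K * B).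
Proof.
move=> p0; have [K K0 H] := @Lp_le_sup R p p0; exists (K * 4 + 1); first by rewrite lerDr mulr_ge0.
move=> disp T mu f g h B B0 mf mg mh f0 g0 h0 hfg hf hg.
apply: (@Lp_le_weaken _ _ mu p h (K * (4 * B))); first by rewrite mulrA mulrDl mul1r lerDl.
pose G k : T -> R := if k is 0%N then fun x => 2 * f x else if k is 1%N then fun x => 2 * g x else fun=> 0.
apply: (H _ _ _ h G) => //.
- by rewrite mulr_ge0.
- by case=> [|[|k]]; [exact: measurable_funM|exact: measurable_funM|exact: measurable_cst].
- by case=> [|[|k]] x //=; rewrite mulr_ge0.
- by move=> x M M0 GM; have := GM 0%N; have := GM 1%N; have := hfg x => /=; lra.
- case=> [|[|k]].
  + rewrite expr0 invr1 mul1r; apply: (@Lp_le_weaken _ _ mu p _ (2 * B)); first by rewrite ler_wpM2r// ler_nat.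
    by apply: Lp_le_dominated hf => //; [exact: measurable_funM|move=> x; rewrite mulr_ge0].
  + rewrite expr1 mulrA; have -> : 2^-1 * 4 = 2 :> R by lra.
    by apply: Lp_le_dominated hg => //; [exact: measurable_funM|move=> x; rewrite mulr_ge0].
  + by apply: Lp_le0 => //; rewrite mulr_ge0// mulr_ge0.
Qed.

End Lp_algebra.

Section besov_algebra.
Context {R : realType} {d : nat}.
Local Notation C := R[i].
Local Notation Rd := 'rV[R]_d.
Local Notation leb := (@lebesgue_rV R d).
Implicit Types (f g : Rd -> C) (x y z : Rd) (u v w : distr R d).
Variable eta : Rd -> C.
Hypothesis He : lp_cutoff eta.
Hypothesis d0 : (0 < d)%N.
Variables (s : R) (p q : \bar R).
Hypothesis p0 : (0 < p)%E.
Hypothesis q0 : (0 < q)%E.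
Local Notation bes := (besov_le eta s p q).

Lemma measurable_blockf u j : tempered u -> measurable_fun setT (fun x => cabs (blockf eta u j x)).
Proof. by move=> tu; exact/measurable_cabs/ccont_cmeas/ccont_blockf. Qed.

Lemma tempered_ext u v : (forall f, schwartz f -> u f = v f) -> tempered u -> tempered v.
Proof.
move=> uv [lu [c [k hu]]]; split=> [a f g sf sg|].
  by rewrite -!uv//; [exact: lu|exact: schwartzD (schwartzZ _ _) _].
by exists c, k => f sf; rewrite -uv//; exact: hu.
Qed.

Lemma distrDE u v f : (u + v) f = u f + v f. Proof. by []. Qed.

Lemma temperedD u v : tempered u -> tempered v -> tempered (u + v).
Proof.
move=> /temperedP[lu [c1 [k1 [p1 h1]]]] /temperedP[lv [c2 [k2 [p2 h2]]]]; apply/temperedP; split.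
  by move=> a f g sf sg; rewrite !distrDE (lu a f g sf sg) (lv a f g sf sg) mulrDr addrACA.
exists (c1 + c2), (maxn k1 k2); split; first exact: addr_ge0.
move=> f B sf hf; rewrite distrDE; apply: le_trans (cabsD _ _) _; rewrite mulrDl lerD//.
  apply: h1 => // l x lk; apply: le_trans (hf l x (leq_trans lk (leq_maxl _ _))).
  by rewrite ler_wpM2r ?cabs_ge0// br_le_exp// leq_maxl.
apply: h2 => // l x lk; apply: le_trans (hf l x (leq_trans lk (leq_maxr _ _))).
by rewrite ler_wpM2r ?cabs_ge0// br_le_exp// leq_maxr.
Qed.

Lemma temperedZd (c : C) u : tempered u -> tempered (fun f => c * u f).
Proof.
move=> /temperedP[lu [c1 [k1 [p1 h1]]]]; apply/temperedP; split.
  by move=> a f g sf sg; rewrite lu// mulrDr mulrCA.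
exists (cabs c * c1), k1; split; first by rewrite mulr_ge0// cabs_ge0.
by move=> f B sf hf; rewrite cabsM -mulrA ler_wpM2l ?cabs_ge0//; exact: h1.
Qed.

(** A distribution matters only through its values on Schwartz functions. *)
Lemma besov_le_ext u v (B : R) : (forall f, schwartz f -> u f = v f) -> bes u B -> bes v B.
Proof.
move=> uv [tu [b [b0 hb hB]]]; split; first exact: tempered_ext tu.
exists b; split=> // j; have := hb j; congr Lp_le; apply/funext => x; congr cabs.
by rewrite /blockf uv//; exact/schwartz_shift/schwartz_lp_kernel.
Qed.

Lemma besov_le_weaken u (B B' : R) : B <= B' -> bes u B -> bes u B'.
Proof. by move=> BB [tu [b [b0 hb hB]]]; split=> //; exists b; split=> //; exact: Lp_le_weaken hB. Qed.

Lemma besov_le0 (B : R) : 0 <= B -> bes (fun=> 0) B.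
Proof.
move=> B0; split.
  apply/temperedP; split; first by move=> a f g _ _; rewrite mulr0 addr0.
  exists 0, 0%N; split=> // f B' _ _; by rewrite cabs0 mul0r.
exists (fun=> 0); split=> //; first by move=> j; rewrite /blockf cabs0; exact: Lp_le0.
by under [X in Lp_le _ _ X]eq_fun do rewrite mulr0; exact: Lp_le0.
Qed.

Lemma besov_leZ (c : C) u (B : R) : 0 <= B -> bes u B -> bes (fun f => c * u f) (cabs c * B).
Proof.
move=> B0 [tu [b [b0 hb hB]]]; split; first exact: temperedZd.
have w0 j : 0 <= 2 `^ (s * j%:R) :> R by rewrite powR_ge0.
exists (fun j => cabs c * b j); split=> [j|j|]; first by rewrite mulr_ge0// cabs_ge0.
- apply: Lp_le_dominated (hb j) => //; [exact: cabs_ge0|exact: measurable_blockf (temperedZd c tu)|exact: measurable_blockf| | |].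
  + by move=> x; exact: cabs_ge0.
  + by move=> x; exact: cabs_ge0.
  + by move=> x; rewrite -cabsM.
- apply: ell_dominated hB; rewrite ?cabs_ge0// => j.
  + by rewrite !mulr_ge0// cabs_ge0.
  + by rewrite mulr_ge0.
  + by rewrite mulrCA.
Qed.

(** Inherited from the quasi-triangle inequalities of the two Lebesgue quasinorms. *)
Lemma besov_leD : exists2 K : R, 1 <= K & forall u v (B : R), 0 <= B ->
  bes u B -> bes v B -> bes (u + v) (K * B).
Proof.
have [Kp Kp1 Hp] := @Lp_le_add R p p0; have [Kq Kq1 Hq] := @Lp_le_add R q q0.
have Kp0 : 0 <= Kp by exact: le_trans Kp1. have Kq0 : 0 <= Kq by exact: le_trans Kq1.
exists (Kq * Kp) => [|u v B B0 [tu [b [b0 hb hB]]] [tv [b' [b'0 hb' hB']]]].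
  by apply: le_trans Kq1 _; rewrite ler_peMr.
have w0 j : 0 <= 2 `^ (s * j%:R) :> R by rewrite powR_ge0.
split; first exact: temperedD.
exists (fun j => Kp * (b j + b' j)); split=> [j|j|]; first by rewrite mulr_ge0// addr_ge0.
- apply: (Hp _ _ leb (fun x => cabs (blockf eta u j x)) (fun x => cabs (blockf eta v j x))).
  + exact: addr_ge0.
  + exact: measurable_blockf.
  + exact: measurable_blockf.
  + exact: measurable_blockf (temperedD tu tv).
  + by move=> x; exact: cabs_ge0.
  + by move=> x; exact: cabs_ge0.
  + by move=> x; exact: cabs_ge0.
  + by move=> x; exact: cabsD.
  + by apply: Lp_le_weaken (hb j); rewrite lerDl.
  + by apply: Lp_le_weaken (hb' j); rewrite lerDr.
rewrite -mulrA; apply: (Hq _ _ counting (fun j => Kp * (2 `^ (s * j%:R) * b j)) (fun j => Kp * (2 `^ (s * j%:R) * b' j))).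
- by rewrite mulr_ge0.
- exact: measurable_nat.
- exact: measurable_nat.
- exact: measurable_nat.
- by move=> j; rewrite !mulr_ge0.
- by move=> j; rewrite !mulr_ge0.
- by move=> j; rewrite !mulr_ge0// addr_ge0.
- by move=> j; rewrite -mulrDr -mulrDr mulrCA.
- by apply: ell_dominated hB => // j; rewrite !mulr_ge0.
- by apply: ell_dominated hB' => // j; rewrite !mulr_ge0.
Qed.

End besov_algebra.

(** * Peetre's maximal inequality *)

Section peetre.
Context {R : realType} {d : nat}.
Local Notation C := R[i].
Local Notation Rd := 'rV[R]_d.
Local Notation leb := (@lebesgue_rV R d).
Implicit Types (f g : Rd -> C) (x y z : Rd) (u v w : distr R d).
Variable eta : Rd -> C.
Hypothesis He : lp_cutoff eta.
Hypothesis d0 : (0 < d)%N.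

(** The bracket in the scale [2^-j], in which the [j]-th block is almost constant. *)
Definition sbr (j : nat) x : R := br (2 ^+ j *: x).

Lemma sbr_gt0 j x : 0 < sbr j x. Proof. exact: br_gt0. Qed.

Lemma sbrN j x : sbr j (- x) = sbr j x. Proof. by rewrite /sbr scalerN brN. Qed.

Lemma sbr_add j x y : sbr j (x + y) <= sbr j x * sbr j y.
Proof. by rewrite /sbr scalerDr br_add. Qed.

Lemma sbr_tri j x y z k : sbr j (x - z) ^+ k <= sbr j (x - y) ^+ k * sbr j (z - y) ^+ k.
Proof.
rewrite -exprMn lerXn2r ?nnegrE ?mulr_ge0 ?(ltW (sbr_gt0 _ _))//.
by rewrite -(sbrN j (z - y)) opprB; apply: le_trans (sbr_add _ _ _); rewrite addrA subrK.
Qed.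

Lemma br_sbr j x : br x <= sbr j x.
Proof. by rewrite /sbr /br lerD2l normrZ ger0_norm ?exprn_ge0// ler_peMl// exprn_ege1// ler1n. Qed.

Lemma measurable_sbr j : measurable_fun setT (sbr j).
Proof.
have : ccont (fun x => (sbr j x)%:C%C).
  apply: ccont_lip => x; exists (2 ^+ j); first by rewrite exprn_ge0.
  move=> y _; rewrite cabs_realB /sbr /br opprD addrACA subrr add0r.
  apply: le_trans (ler_dist_dist _ _) _; rewrite -scalerBr normrZ ger0_norm// exprn_ge0//.
by move=> /ccont_cmeas[].
Qed.

Definition scaled u j (N : nat) x z : R := cabs (blockf eta u j z) * sbr j (x - z) ^- N.

Lemma scaled_ge0 u j N x z : 0 <= scaled u j N x z.
Proof. by rewrite mulr_ge0 ?cabs_ge0// invr_ge0 exprn_ge0// ltW// sbr_gt0. Qed.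

Lemma measurable_scaled2 u j N : tempered u ->
  measurable_fun setT (fun w : Rd * Rd => scaled u j N w.1 w.2).
Proof.
move=> tu; apply: measurable_funM.
  by apply: measurable_cabs; apply: cmeas_schwartz_snd; exact/ccont_cmeas/ccont_blockf.
have mdiff : measurable_fun setT (fun w : Rd * Rd => w.1 - w.2).
  apply: measurable_fun_coorP => i.
  rewrite (_ : _ \o _ = fun w : Rd * Rd => w.1 0 i - w.2 0 i); last by apply/funext => w; rewrite /= !mxE.
  apply: measurable_funB; first exact: (measurableT_comp (measurable_coor i) measurable_fst).
  exact: (measurableT_comp (measurable_coor i) measurable_snd).
have := measurableT_comp (measurable_sbr j) mdiff => m1.
have -> : (fun w : Rd * Rd => sbr j (w.1 - w.2) ^- N) = (fun w : Rd * Rd => (sbr j (w.1 - w.2) ^+ N) `^ (-1)).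
  by apply/funext => w; rewrite powR_inv1// exprn_ge0// ltW// sbr_gt0.
by apply: (measurableT_comp (measurable_powR _)); exact: measurable_funX.
Qed.

Lemma measurable_scaled u j N x : tempered u -> measurable_fun setT (scaled u j N x).
Proof. by move=> tu; exact: (measurableT_comp (measurable_scaled2 j N tu) (measurable_pair1 x)). Qed.

(** The mean value inequality behind the maximal inequality: the block is an average of
    itself against a rapidly decreasing kernel in its own scale. *)
Lemma scaled_step N : exists2 K : R, 0 <= K & forall u j x (r A D J : R), tempered u -> 0 < r ->
  0 <= A -> 0 <= D -> (forall z, scaled u j N x z <= A * scaled u j N x z `^ r + D) ->
  (\int[leb]_z ((2 ^+ j) ^+ d * scaled u j N x z `^ r)%:E <= J%:E)%E ->
  forall y, scaled u j N x y <= K * (A * J + D).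
Proof.
have [B B0 hB] := fat_kernel_decay He (N + 2 * d).
exists (B * (1 + pi ^+ d)) => [|u j x r A D J tu r0 A0 D0 hz hJ y].
  by rewrite mulr_ge0// addr_ge0// exprn_ge0// pi_ge0.
have c0 := exp2_gt0 (R := R) j.
have mt := measurable_scaled j N x tu.
have J1 : majorant (fun z => (2 ^+ j) ^+ d * scaled u j N x z `^ r) J.
  split=> //; last by move=> z; rewrite mulr_ge0 ?powR_ge0// exprn_ge0// ltW.
  by apply: measurable_funM => //; exact: (measurableT_comp (measurable_powR _)).
have J0 := majorant_ge0 J1.
have pN z : 0 < sbr j z ^+ N by rewrite exprn_gt0// sbr_gt0.
have M2 := majorant_wt y c0.
have M := majorantZ (ltW (pN (x - y))) (majorantZ B0 (majorantD (majorantZ A0 J1) (majorantZ D0 M2))).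
rewrite /scaled ler_pdivrMr// mulrC (blockf_reproduce He d0 j y tu).
apply: le_trans (cabs_cint_le _ M _) _; first 1 last.
- move=> z; rewrite cabsM.
  have bz : cabs (blockf eta u j z) = scaled u j N x z * sbr j (x - z) ^+ N.
    by rewrite /scaled mulfVK// gt_eqF.
  rewrite bz; have hk := hB j (z - y); rewrite -/(sbr j (z - y)) in hk.
  have hzz := hz z; move: (scaled u j N x z) (scaled_ge0 u j N x z) hzz {bz} => t t0 hzz.
  apply: (@le_trans _ _ (t * (sbr j (x - y) ^+ N * sbr j (z - y) ^+ N) * (B * 2 ^+ (j * d) * sbr j (z - y) ^- (N + 2 * d)))).
    apply: ler_pM; [|exact: cabs_ge0|by apply: (ler_wpM2l t0); exact: sbr_tri|exact: hk].
    exact: (mulr_ge0 t0 (ltW (pN _))).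
  have -> : t * (sbr j (x - y) ^+ N * sbr j (z - y) ^+ N) * (B * 2 ^+ (j * d) * sbr j (z - y) ^- (N + 2 * d)) =
     sbr j (x - y) ^+ N * (B * (2 ^+ j) ^+ d) * (t * sbr j (z - y) ^- (2 * d)).
    rewrite exprD invfM exprM mulrA mulrA; field.
    by rewrite !expf_neq0// gt_eqF// sbr_gt0.
  rewrite -!mulrA ler_wpM2l ?(ltW (pN _))// ler_wpM2l//.
  have w1 : sbr j (z - y) ^- (2 * d) <= wt (2 ^+ j *: (z - y)) by exact: bracket_wt.
  have w2 : sbr j (z - y) ^- (2 * d) <= 1.
    by rewrite invf_le1 ?exprn_gt0 ?sbr_gt0// br_exp_ge1.
  have w0 : 0 <= sbr j (z - y) ^- (2 * d) by rewrite invr_ge0 exprn_ge0// ltW// sbr_gt0.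
  apply: (@le_trans _ _ ((2 ^+ j) ^+ d * ((A * t `^ r + D) * sbr j (z - y) ^- (2 * d)))).
    by rewrite ler_wpM2l ?exprn_ge0 ?(ltW c0)// ler_wpM2r.
  rewrite mulrDl mulrDr lerD//.
    rewrite [leLHS](_ : _ = A * ((2 ^+ j) ^+ d * t `^ r) * sbr j (z - y) ^- (2 * d)); last by ring.
    by rewrite ler_piMr// !mulr_ge0 ?powR_ge0// !exprn_ge0.
  by rewrite mulrCA ler_wpM2l// ler_wpM2l ?exprn_ge0 ?(ltW c0).
- rewrite ler_wpM2l ?(ltW (pN _))// -mulrA ler_wpM2l//.
  have := @pi_ge0 R; move=> /(exprn_ge0 d); move: (pi ^+ d) => P P0.
  have AJ : 0 <= A * J by exact: mulr_ge0.
  nra.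
apply: cmeasM; first exact/ccont_cmeas/ccont_blockf.
exact/schwartz_cmeas/(schwartz_shift y)/schwartz_fat_kernel.
Qed.

(** The average of powers over a ball of radius [2^-j], with a smooth tail. *)
Definition average u j N (r : R) x : \bar R :=
  (\int[leb]_z ((2 ^+ j) ^+ d * scaled u j N x z `^ r)%:E)%E.

Lemma scaled_le u j N x z : scaled u j N x z <= cabs (blockf eta u j z).
Proof.
by rewrite /scaled ler_piMr ?cabs_ge0// invf_le1 ?exprn_gt0 ?sbr_gt0// br_exp_ge1.
Qed.

Lemma measurable_average_integrand u j N (r : R) : tempered u ->
  measurable_fun setT (fun z : Rd * Rd => ((2 ^+ j) ^+ d * scaled u j N z.1 z.2 `^ r)%:E).
Proof.
move=> tu; apply/measurable_EFinP; apply: measurable_funM => //.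
exact: (measurableT_comp (measurable_powR _) (measurable_scaled2 j N tu)).
Qed.

Lemma average_le u j N (r b : R) x : tempered u -> 0 < r -> 0 <= b ->
  Lp_le leb r%:E (fun x => cabs (blockf eta u j x)) b ->
  (average u j N r x <= ((2 ^+ j) ^+ d * b `^ r)%:E)%E.
Proof.
move=> tu r0 b0 /Lp_le_fin hb.
have c0 : 0 <= (2 ^+ j) ^+ d :> R by rewrite !exprn_ge0.
have mp : measurable_fun setT (fun z => (cabs (blockf eta u j z) `^ r)%:E).
  by apply/measurable_EFinP/(measurableT_comp (measurable_powR _)); exact: measurable_blockf.
rewrite EFinM; apply: le_trans (lee_wpmul2l _ (hb r0 b0 (fun x => cabs_ge0 _))); last by rewrite lee_fin.
rewrite -(ge0_integralZl leb measurableT mp); first 1 last.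
- by move=> z _; rewrite lee_fin powR_ge0.
- by rewrite lee_fin.
apply: ge0_le_integral => //.
- by move=> z _; rewrite lee_fin mulr_ge0// powR_ge0.
- exact: (measurableT_comp (measurable_average_integrand j N r tu) (measurable_pair1 x)).
- exact: emeasurable_funM.
- move=> z _; rewrite -EFinM lee_fin ler_wpM2l//; apply: powR_le; rewrite ?(ltW r0)//.
    exact: scaled_ge0.
  exact: scaled_le.
Qed.

Lemma average_fin u j N (r b : R) x : tempered u -> 0 < r -> 0 <= b ->
  Lp_le leb r%:E (fun x => cabs (blockf eta u j x)) b ->
  average u j N r x = (fine (average u j N r x))%:E /\ 0 <= fine (average u j N r x).
Proof.
move=> tu r0 b0 hb; have h := average_le N x tu r0 b0 hb.
have a0 : (0 <= average u j N r x)%E.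
  by apply: integral_ge0 => z _; rewrite lee_fin mulr_ge0 ?powR_ge0// !exprn_ge0.
split; last exact: fine_ge0.
by rewrite fineK// ge0_fin_numE//; apply: le_lt_trans h (ltry _).
Qed.

(** The supremum [S] of the scaled function satisfies [S <= K * S `^ (1 - r) * J], which can be
    solved for [S] because it is finite. *)
Lemma peetre_small N : exists2 K : R, 0 <= K & forall u j x (r J T : R), tempered u -> 0 < r -> r <= 1 ->
  (forall z, scaled u j N x z <= T) -> (average u j N r x <= J%:E)%E ->
  forall y, scaled u j N x y `^ r <= K * J.
Proof.
have [K K0 H] := scaled_step N; exists K => // u j x r J T tu r0 r1 hT hJ y.
set t := scaled u j N x; have t0 z : 0 <= t z by exact: scaled_ge0.
pose E := [set t z | z in [set: Rd]].
have Es : has_sup E by split; [exists (t 0), 0|exists T => _ [z _ <-]; exact: hT].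
pose S := sup E; have tS z : t z <= S by apply: sup_upper_bound => //; exists z.
have S0 : 0 <= S by exact: le_trans (t0 0) (tS 0).
have J0 : 0 <= J.
  rewrite -lee_fin; apply: le_trans hJ; apply: integral_ge0 => z _.
  by rewrite lee_fin mulr_ge0 ?powR_ge0// !exprn_ge0.
have step z : t z <= S `^ (1 - r) * t z `^ r + 0.
  rewrite addr0; have [->|tz] := eqVneq (t z) 0; first by rewrite mulr_ge0// powR_ge0.
  have tp : 0 < t z by rewrite lt_neqAle eq_sym tz t0.
  have {1}-> : t z = t z `^ (1 - r) * t z `^ r by rewrite -powRD ?subrK ?powRr1// tz implybT.
  by rewrite ler_wpM2r ?powR_ge0//; apply: powR_le => //; rewrite subr_ge0.
(* the self-improving inequality: [t = t^(1-r) t^r] is at most [S^(1-r) t^r] *)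
have hS : S <= K * (S `^ (1 - r) * J).
  apply: sup_le_ub => [|_ [z _ <-]]; first by exists (t 0), 0.
  by have := H u j x r _ 0 J tu r0 (powR_ge0 S (1 - r)) (lexx 0) step hJ z; rewrite addr0.
have [S00|Sn] := eqVneq S 0.
  have -> : t y = 0 by apply/eqP; rewrite eq_le t0 andbT -S00 tS.
  by rewrite powR0 ?gt_eqF// mulr_ge0.
have Sp : 0 < S by rewrite lt_neqAle eq_sym Sn S0.
apply: (@le_trans _ _ (S `^ r)); first exact: powR_le (ltW r0) (t0 y) (tS y).
have q0 : 0 < S `^ (1 - r) by rewrite powR_gt0.
rewrite -(ler_pM2l q0) -powRD; last by rewrite Sn implybT.
by rewrite subrK powRr1// mulrCA.
Qed.

(** Here [t <= l `^ (1 - r) * t `^ r + l] for every level [l > 0], and [l = J `^ r^-1] balances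
    both terms. *)
Lemma peetre_large N : exists2 K : R, 0 <= K & forall u j x (r J : R), tempered u -> 1 <= r ->
  0 <= J -> (average u j N r x <= J%:E)%E -> forall y, scaled u j N x y <= K * J `^ r^-1.
Proof.
have [K K0 H] := scaled_step N; exists (K * 2) => [|u j x r J tu r1 J0 hJ y]; first by rewrite mulr_ge0.
have r0 : 0 < r by exact: lt_le_trans r1.
set t := scaled u j N x; have t0 z : 0 <= t z by exact: scaled_ge0.
have key (l : R) : J `^ r^-1 < l -> t y <= K * 2 * l.
  move=> Jl; have l0 : 0 < l by apply: le_lt_trans Jl; exact: powR_ge0.
  have step z : t z <= l `^ (1 - r) * t z `^ r + l.
    have [tl|lt] := leP (t z) l; first by apply: le_trans tl _; rewrite lerDr mulr_ge0// powR_ge0.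
    have tp := lt_trans l0 lt.
    apply: le_trans (_ : l `^ (1 - r) * t z `^ r <= _); last by rewrite lerDl ltW.
    have {1}-> : t z = t z `^ (1 - r) * t z `^ r by rewrite -powRD ?subrK ?powRr1 ?ltW// gt_eqF// implybT.
    rewrite ler_wpM2r ?powR_ge0//.
    rewrite -opprB !powRN lef_pV2 ?posrE ?powR_gt0//.
    by apply: powR_le; rewrite ?subr_ge0// ltW.
  have Jr : J <= l `^ r.
    by rewrite -[J](powRVK r0)//; apply: powR_le; [exact: ltW|exact: powR_ge0|exact: ltW].
  apply: le_trans (H u j x r _ l J tu r0 (powR_ge0 l (1 - r)) (ltW l0) step hJ y) _.
  rewrite -mulrA ler_wpM2l// mulr2n mulrDl mul1r lerD2r.
  apply: le_trans (ler_wpM2l (powR_ge0 _ _) Jr) _.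
  rewrite -powRD; last by apply/implyP => _; exact: lt0r_neq0.
  by rewrite subrK powRr1// ltW.
apply/ler_addgt0Pl => e e0; have K2 : 0 < K * 2 + 1 by rewrite ltr_wpDl// mulr_ge0.
have := key (J `^ r^-1 + e / (K * 2 + 1)); rewrite ltrDl divr_gt0// => /(_ isT)/le_trans; apply.
rewrite mulrDr addrC lerD2r mulrCA ler_piMr ?(ltW e0)// ler_pdivrMr// mul1r lerDl//.
Qed.

(** The function [G] is the [p]-th root of the average of the [p]-th powers; its quasinorm is
    computed by Tonelli's theorem. For infinite [p] a constant does. *)
Lemma peetre (p : \bar R) : (0 < p)%E -> exists N, exists2 K : R, 0 <= K &
  forall u j (b : R), tempered u -> 0 <= b -> Lp_le leb p (fun x => cabs (blockf eta u j x)) b ->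
  exists G : Rd -> R, [/\ measurable_fun setT G, forall x, 0 <= G x, Lp_le leb p G (K * b) &
    forall x y, cabs (blockf eta u j y) <= sbr j (x - y) ^+ N * G x].
Proof.
case: p => [r||//] p0; last first.
  have [B B0 hB] := fat_kernel_decay He (2 * d).
  have P0 : 0 <= (pi : R) ^+ d by rewrite exprn_ge0// pi_ge0.
  exists 0%N, (B * pi ^+ d) => [|u j b tu b0 hb]; first by rewrite mulr_ge0.
  exists (fun=> B * pi ^+ d * b); split=> //; first by move=> x; rewrite !mulr_ge0.
    by apply/Lp_le_infty => [||] //; [rewrite !mulr_ge0|move=> x; rewrite !mulr_ge0|exact: aeW].
  move=> x y; rewrite expr0 mul1r.
  have mb : cmeas (blockf eta u j) by exact/ccont_cmeas/ccont_blockf.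
  have mk : cmeas (fun z => fat_kernel eta j (z - y)).
    exact/schwartz_cmeas/(schwartz_shift y)/schwartz_fat_kernel.
  (* the essential bound of the block holds everywhere after a change on a null set *)
  pose h z : C := if cabs (blockf eta u j z) <= b then blockf eta u j z else 0.
  have mh : cmeas h.
    have mP : measurable [set z | cabs (blockf eta u j z) <= b].
      rewrite (_ : [set z | _] = (fun z => cabs (blockf eta u j z)) @^-1` `]-oo, b]).
        by rewrite -[X in measurable X]setTI; exact: (measurable_cabs mb).
      by apply/seteqP; split => z /=; rewrite in_itv.
    have -> : h = fun z => (\1_[set z | cabs (blockf eta u j z) <= b] z)%:C%C * blockf eta u j z.
      apply/funext => z; rewrite /h indicE; have [hz|hz] := boolP (cabs (blockf eta u j z) <= b).
        by rewrite mem_set// mul1r.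
      by rewrite memNset ?mul0r//; exact/negP.
    by apply: cmeasM => //; apply: cmeas_real; exact: measurable_indic.
  have c0 := exp2_gt0 (R := R) j.
  have Bb : 0 <= B * b by rewrite mulr_ge0.
  rewrite (blockf_reproduce He d0 j y tu) (cint_ae_eq (g := fun z => h z * fat_kernel eta j (z - y))).
  - rewrite [leRHS]mulrAC; apply: (cabs_cint_le _ (majorantZ Bb (majorant_wt y c0))); first exact: cmeasM.
    move=> z; rewrite cabsM; apply: (@le_trans _ _ (b * (B * 2 ^+ (j * d) * br (2 ^+ j *: (z - y)) ^- (2 * d)))).
      apply: ler_pM; [exact: cabs_ge0|exact: cabs_ge0| |exact: hB].
      by rewrite /h; case: ifPn => // _; rewrite cabs0.
    rewrite -!mulrA mulrCA ler_wpM2l// ler_wpM2l// exprM ler_wpM2l ?exprn_ge0 ?(ltW c0)//.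
    exact: bracket_wt.
  - exact: cmeasM.
  - exact: cmeasM.
  - move/Lp_le_infty : hb => /(_ b0 (fun x => cabs_ge0 _)); apply: filterS => z hz.
    by rewrite /h hz.
have r0 : 0 < r by rewrite -lte_fin.
pose N := ((Num.trunc (r^-1)).+1 * (2 * d))%N.
have Nr : (2 * d)%:R <= N%:R * r.
  have -> : N%:R = (Num.trunc (r^-1)).+1%:R * (2 * d)%:R :> R by rewrite -natrM.
  by rewrite mulrAC ler_peMl// -ler_pdivrMr// mul1r; exact/ltW/truncnS_gt.
have [K1 K10 H1] := peetre_small N; have [K2 K20 H2] := peetre_large N.
pose K := K1 `^ r^-1 + K2; have K0 : 0 <= K by rewrite addr_ge0// powR_ge0.
have P0 : 0 <= (pi : R) ^+ d by rewrite exprn_ge0// pi_ge0.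
exists N, (K * (pi ^+ d) `^ r^-1) => [|u j b tu b0 hb]; first by rewrite mulr_ge0// powR_ge0.
pose J x := fine (average u j N r x).
have JE x : average u j N r x = (J x)%:E by have [] := average_fin N x tu r0 b0 hb.
have J0 x : 0 <= J x by have [] := average_fin N x tu r0 b0 hb.
have Hge (z : Rd * Rd) : (0 <= ((2 ^+ j) ^+ d * scaled u j N z.1 z.2 `^ r)%:E)%E.
  by rewrite lee_fin mulr_ge0 ?powR_ge0// !exprn_ge0.
have mJ : measurable_fun setT J.
  apply/measurable_EFinP; have -> : EFin \o J = average u j N r by apply/funext => x; rewrite JE.
  exact: (measurable_fun_fubini_tonelli_F (m2 := leb) _ (measurable_average_integrand j N r tu) Hge).
exists (fun x => K * J x `^ r^-1); split.
- by apply: measurable_funM => //; exact: (measurableT_comp (measurable_powR _)).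
- by move=> x; rewrite mulr_ge0// powR_ge0.
- rewrite -mulrA; apply: (@Lp_le_dominated _ _ _ leb r%:E _ (fun x => J x `^ r^-1)) => //.
  + by rewrite mulr_ge0// powR_ge0.
  + by apply: measurable_funM => //; exact: (measurableT_comp (measurable_powR _)).
  + exact: (measurableT_comp (measurable_powR _)).
  + by move=> x; rewrite mulr_ge0// powR_ge0.
  + by move=> x; rewrite powR_ge0.
  apply/Lp_le_fin => //; first by rewrite mulr_ge0// powR_ge0.
    by move=> x; rewrite powR_ge0.
  under eq_integral do rewrite powRVK// -JE.
  rewrite powRM ?powR_ge0// powRVK//.
  have := fubini_tonelli (m1 := leb) (m2 := leb) _ (measurable_average_integrand j N r tu) Hge.
  rewrite /average => ->; move/Lp_le_fin : hb => /(_ r0 b0 (fun x => cabs_ge0 _)) hb.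
  rewrite EFinM; apply: le_trans (lee_wpmul2l _ hb); last by rewrite lee_fin.
  have mp : measurable_fun setT (fun z => (cabs (blockf eta u j z) `^ r)%:E).
    by apply/measurable_EFinP/(measurableT_comp (measurable_powR _)); exact: measurable_blockf.
  rewrite -ge0_integralZl//; last by move=> z _; rewrite lee_fin powR_ge0.
  apply: ge0_le_integral => //.
  + by move=> z _; exact: integral_ge0.
  + exact: (measurable_fun_fubini_tonelli_G (m1 := leb) _ (measurable_average_integrand j N r tu) Hge).
  + exact: emeasurable_funM.
  move=> z _ /=; have [mw w0 iw] := @majorant_wt R d (2 ^+ j) z (exp2_gt0 j).
  apply: (@le_trans _ _ (\int[leb]_x ((cabs (blockf eta u j z) `^ r)%:E * ((2 ^+ j) ^+ d * wt (2 ^+ j *: (x - z)))%:E))%E); last first.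
    rewrite ge0_integralZl//; first 1 last.
    * exact/measurable_EFinP.
    * by move=> x _; rewrite lee_fin.
    * by rewrite lee_fin powR_ge0.
    by rewrite muleC lee_wpmul2r// lee_fin powR_ge0.
  apply: ge0_le_integral => //.
  + by move=> x _; rewrite lee_fin mulr_ge0 ?powR_ge0// !exprn_ge0.
  + exact: (measurableT_comp (measurable_average_integrand j N r tu) (measurable_pair2 z)).
  + by apply: emeasurable_funM; [exact: measurable_cst|exact/measurable_EFinP].
  move=> x _ /=; rewrite -EFinM lee_fin mulrCA ler_wpM2l ?exprn_ge0//.
  rewrite /scaled powRM ?cabs_ge0 ?invr_ge0 ?exprn_ge0 ?(ltW (sbr_gt0 _ _))//.
  rewrite ler_wpM2l ?powR_ge0//; apply: le_trans (bracket_wt _); rewrite -/(br _) -/(sbr j _).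
  have s1 : 1 <= sbr j (x - z) by exact: br_ge1.
  rewrite -powR_inv1 ?exprn_ge0 ?(ltW (sbr_gt0 _ _))// -powRrM -powR_mulrn ?(ltW (sbr_gt0 _ _))// -powRrM.
  rewrite -[leRHS]powR_inv1 ?exprn_ge0 ?(ltW (sbr_gt0 _ _))// -powR_mulrn ?(ltW (sbr_gt0 _ _))// -powRrM.
  by apply: ler_powR => //; rewrite mulN1r mulrN mulrN1 lerN2.
move=> x y; have pN : 0 < sbr j (x - y) ^+ N by rewrite exprn_gt0// sbr_gt0.
rewrite mulrC -ler_pdivrMr//; change (scaled u j N x y <= K * J x `^ r^-1).
have hJ z : (average u j N r z <= (J z)%:E)%E by rewrite JE.
have [r1|/ltW r1] := leP r 1; last first.
  apply: le_trans (H2 u j x r (J x) tu r1 (J0 x) (hJ x) y) _.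
  by rewrite ler_wpM2r ?powR_ge0// lerDr powR_ge0.
have [k [A A0 hA]] := blockf_growth He j tu.
have [K3 K30 H3] := peetre_small k.
have bdd z : cabs (blockf eta u j z) <= (K3 * ((2 ^+ j) ^+ d * b `^ r)) `^ r^-1.
  have hT (w : Rd) : scaled u j k z w <= A * br z ^+ k.
    rewrite /scaled ler_pdivrMr ?exprn_gt0 ?sbr_gt0//; apply: le_trans (hA w) _.
    rewrite -mulrA ler_wpM2l// -exprMn lerXn2r ?nnegrE ?mulr_ge0 ?(ltW (br_gt0 _))//.
    apply: le_trans (br_sub w z) _; rewrite mulrC ler_wpM2l ?(ltW (br_gt0 _))//.
    by rewrite -brN opprB; exact: br_sbr.
  have := H3 u j z r _ _ tu r0 r1 hT (average_le k z tu r0 b0 hb) z.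
  have -> : scaled u j k z z = cabs (blockf eta u j z).
    by rewrite /scaled subrr /sbr scaler0 /br normr0 addr0 expr1n invr1 mulr1.
  move=> h; rewrite -[leLHS](powRK r0 (cabs_ge0 _)).
  by apply: powR_le => //; rewrite ?invr_ge0 ?powR_ge0// ltW.
have hT z : scaled u j N x z <= (K3 * ((2 ^+ j) ^+ d * b `^ r)) `^ r^-1.
  exact: le_trans (scaled_le _ _ _ _ _) (bdd z).
have := H1 u j x r (J x) _ tu r0 r1 hT (hJ x) y => h.
rewrite -[leLHS](powRK r0 (scaled_ge0 _ _ _ _ _)).
apply: (@le_trans _ _ ((K1 * J x) `^ r^-1)).
  by apply: powR_le => //; rewrite ?invr_ge0 ?powR_ge0// ltW.
by rewrite powRM// ler_wpM2r ?powR_ge0// lerDl.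
Qed.

End peetre.

(** * Multiplication by test functions *)

Section eucl_triangle.
Context {R : realType} {d : nat}.
Implicit Types x y : 'rV[R]_d.

Lemma eucl_ge0 x : 0 <= eucl x. Proof. exact: sqrtr_ge0. Qed.

Lemma eucl_sqr x : eucl x ^+ 2 = dot x x. Proof. by rewrite sqr_sqrtr// dot_ge0. Qed.

Lemma cauchy_schwarz x y : dot x y <= eucl x * eucl y.
Proof.
have key (a b : 'rV[R]_d) : eucl a = 0 -> dot a b = 0.
  move=> a0; have /eqP : dot a a = 0 by rewrite -eucl_sqr a0 expr0n.
  rewrite psumr_eq0 => [/allP h|i _]; last by rewrite -expr2 sqr_ge0.
  rewrite /dot big1// => i _; have := h i; rewrite mem_index_enum => /(_ isT).
  by rewrite mulf_eq0 orbb => /eqP ->; rewrite mul0r.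
have [x0|x0] := eqVneq (eucl x) 0; first by rewrite x0 key// mul0r.
have [y0|y0] := eqVneq (eucl y) 0; first by rewrite y0 dotC key// mulr0.
have xp : 0 < eucl x by rewrite lt_neqAle eq_sym x0 eucl_ge0.
have yp : 0 < eucl y by rewrite lt_neqAle eq_sym y0 eucl_ge0.
have := dot_ge0 (eucl y *: x - eucl x *: y).
rewrite dotDl !dotDr !dotNl !dotNr !dotZl !dotZr -!eucl_sqr (dotC y x).
move: (dot x y) xp yp; move: (eucl x) (eucl y) => a b c a0 b0.
rewrite (_ : _ + _ = 2 * (a * b) * (a * b - c)); last by ring.
by rewrite pmulr_rge0 ?subr_ge0// !mulr_gt0.
Qed.

Lemma eucl_add x y : eucl (x + y) <= eucl x + eucl y.
Proof.
rewrite -[leRHS]ger0_norm ?addr_ge0 ?eucl_ge0// -[leRHS]sqrtr_sqr.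
rewrite ler_wsqrtr// dotDl !dotDr (dotC y x) -!eucl_sqr sqrrD.
by have := cauchy_schwarz x y; lra.
Qed.

Lemma euclN x : eucl (- x) = eucl x. Proof. by rewrite /eucl dotNl dotNr opprK. Qed.

Lemma eucl_sub x y : eucl x - eucl y <= eucl (x + y).
Proof. by have := eucl_add (x + y) (- y); rewrite addrK euclN; lra. Qed.

End eucl_triangle.

Section product_estimate.
Context {R : realType} {d : nat}.
Local Notation C := R[i].
Local Notation Rd := 'rV[R]_d.
Local Notation leb := (@lebesgue_rV R d).
Implicit Types (f g chi : Rd -> C) (x y z : Rd) (u v : distr R d).
Variable eta : Rd -> C.
Hypothesis He : lp_cutoff eta.
Hypothesis d0 : (0 < d)%N.

Lemma eucl_dil L x : eucl (2 ^- L *: x) = eucl x / 2 ^+ L.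
Proof. by rewrite euclZ gtr0_norm ?invr_gt0 ?exp2_gt0// mulrC. Qed.

Lemma eta_dil_far L x : 3 / 8 * 2 ^+ L <= eucl x -> eta (2 ^- L *: x) = 0.
Proof. by move=> h; apply: (eta_far He); rewrite eucl_dil ler_pdivlMr ?exp2_gt0. Qed.

Lemma eta_dil_near L x : eucl x <= 2 ^+ L / 4 -> eta (2 ^- L *: x) = 1.
Proof. by move=> h; apply: (eta_near He); rewrite eucl_dil ler_pdivrMr ?exp2_gt0// mul1r mulrC. Qed.

(** The frequencies of [chi] up to about [2^L]. *)
Definition low chi L xi : C := eta (2 ^- L *: xi) * fourier chi xi.

Lemma test_low chi L : test_function chi -> test_function (low chi L).
Proof.
move=> tc; apply: testMr (schwartz_smooth (schwartz_fourier tc)).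
by apply: test_scale (test_eta He); rewrite invr_neq0// lt0r_neq0// exp2_gt0.
Qed.

Lemma cabs_expi_mul (z : C) (t : R) : cabs (z * expi t) = cabs z.
Proof. by rewrite cabsM cabs_expi mulr1. Qed.

(** The transform of a test function decays faster than any power, so the remaining frequencies
    are negligible. *)
Lemma low_approx chi M : test_function chi -> exists2 A : R, 0 <= A & forall L x,
  cabs (chi x - ifourier (low chi L) x) <= A * 2 ^- (L * M).
Proof.
move=> tc; have sF := schwartz_fourier tc.
have [B B0 hB] := schwartz_decay (M + 2 * d) sF; have [E E0 hE] := test_bounded (test_eta He).
exists ((1 + E) * B * (4 * d%:R) ^+ M * pi ^+ d) => [|L x].
  by rewrite !mulr_ge0 ?addr_ge0// exprn_ge0// ?pi_ge0// mulr_ge0.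
have sl := test_schwartz (test_low L tc).
have i1 := cintble_fourier (2 * pi) x (schwartz_cintble sF) (schwartz_cmeas sF).
have i2 := cintble_fourier (2 * pi) x (schwartz_cintble sl) (schwartz_cmeas sl).
rewrite -{1}(ifourierK x tc) !ifourierE -(cintB i1 i2).
set K := (1 + E) * B * (4 * d%:R) ^+ M.
have K0 : 0 <= K * 2 ^- (L * M) by rewrite !mulr_ge0 ?addr_ge0// ?invr_ge0 ?exprn_ge0// mulr_ge0.
rewrite mulrAC; apply: (cabs_cint_le _ (majorantZ K0 (@majorant_wt0 R d))).
  apply: cmeasD; first exact: cmeas_fourier_integrand (schwartz_cmeas sF).
  by apply: cmeasN; exact: cmeas_fourier_integrand (schwartz_cmeas sl).
move=> xi; rewrite -mulrBl cabs_expi_mul.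
have -> : fourier chi xi - low chi L xi = (1 - eta (2 ^- L *: xi)) * fourier chi xi by rewrite mulrBl mul1r.
have w0 := ltW (@wt_gt0 R d xi).
have [lo|hi] := leP (eucl (2 ^- L *: xi)) (1 / 4).
  by rewrite (eta_near He lo) subrr mul0r cabs0 mulr_ge0.
have e1 : cabs (1 - eta (2 ^- L *: xi)) <= 1 + E.
  by apply: le_trans (cabsB _ _) _; rewrite cabs1 lerD2l.
have b1 : br xi ^- M <= (4 * d%:R) ^+ M * 2 ^- (L * M).
  rewrite exprM -!exprVn -exprMn lerXn2r ?nnegrE ?invr_ge0 ?(ltW (br_gt0 _))//.
  rewrite -[leLHS]mul1r ler_pdivrMr ?br_gt0// exprVn.
  move: hi; rewrite eucl_dil ltr_pdivlMr ?exp2_gt0// => hi.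
  rewrite mulrAC ler_pdivlMr ?exp2_gt0// mul1r.
  have h : eucl xi <= d%:R * br xi.
    by apply: le_trans (eucl_le_norm xi) _; rewrite ler_wpM2l// /br lerDr.
  rewrite -mulrA; move: (d%:R * br xi) h (2 ^+ L) hi => a ha b hb.
  by have : 1 / 4 * b < a := lt_le_trans hb ha; lra.
rewrite cabsM; apply: le_trans (ler_pM (cabs_ge0 _) (cabs_ge0 _) e1 (hB xi)) _.
have c0 : 0 <= (1 + E) * B by rewrite mulr_ge0// addr_ge0.
rewrite exprD invfM mulrA [leRHS](_ : _ = (1 + E) * B * ((4 * d%:R) ^+ M * 2 ^- (L * M)) * wt xi); last by rewrite /K; ring.
rewrite -[leRHS]mulrA; apply: (ler_wpM2l c0); apply: ler_pM.
- by rewrite invr_ge0 exprn_ge0// ltW// br_gt0.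
- by rewrite invr_ge0 exprn_ge0// ltW// br_gt0.
- exact: b1.
- exact: bracket_wt.
Qed.

Lemma sbr_scale j k x : sbr k x <= 2 ^+ (k - j) * sbr j x.
Proof.
rewrite /sbr /br !normrZ !(ger0_norm (ltW (exp2_gt0 _))) mulrDr mulr1 mulrA -exprD; apply: lerD.
  by rewrite exprn_ege1// ler1n.
rewrite ler_wpM2r// ler_weXn2l ?ler1n//; lia.
Qed.

(** The kernel of scale [j] integrates the growth of a block of scale [k], which is worse by a
    factor [(2^(k - j))^N] when [j < k]. *)
Lemma pairing_bound N : exists2 A : R, 0 <= A & forall u j k x (h : Rd -> C) (H G : R), tempered u ->
  cmeas h -> 0 <= H -> 0 <= G -> (forall y, cabs (h y) <= H) ->
  (forall y, cabs (blockf eta u k y) <= sbr k (x - y) ^+ N * G) ->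
  cabs (cint setT (fun y => blockf eta u k y * (h y * lp_kernel eta j (y - x)))) <=
    A * (2 ^+ ((k - j) * N) * H * G).
Proof.
have [B B0 hB] := lp_kernel_decay He (N + 2 * d).
have P0 : 0 <= (pi : R) ^+ d by rewrite exprn_ge0// pi_ge0.
exists (B * pi ^+ d) => [|u j k x h H G tu mh H0 G0 hH hG]; first by rewrite mulr_ge0.
have c0 := exp2_gt0 (R := R) j; set Z := 2 ^+ ((k - j) * N); have Z0 : 0 <= Z by rewrite exprn_ge0.
have K0 : 0 <= B * (Z * H * G) by rewrite !mulr_ge0.
rewrite mulrAC; apply: (cabs_cint_le _ (majorantZ K0 (majorant_wt x c0))).
  apply: cmeasM; first exact/ccont_cmeas/ccont_blockf.
  apply: cmeasM => //; exact/schwartz_cmeas/(schwartz_shift x)/schwartz_lp_kernel.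
move=> y; rewrite !cabsM.
have sp : 0 < sbr j (y - x) by exact: sbr_gt0.
have hs : sbr k (x - y) ^+ N <= Z * sbr j (y - x) ^+ N.
  rewrite /Z exprM -exprMn lerXn2r ?nnegrE ?mulr_ge0 ?exprn_ge0 ?(ltW (sbr_gt0 _ _))//.
  by rewrite -[in leRHS](sbrN j) opprB; exact: sbr_scale.
apply: (@le_trans _ _ (Z * sbr j (y - x) ^+ N * G * (H * (B * 2 ^+ (j * d) * sbr j (y - x) ^- (N + 2 * d))))).
  apply: ler_pM; rewrite ?mulr_ge0 ?cabs_ge0//.
    by apply: le_trans (hG y) _; rewrite ler_wpM2r.
  by apply: ler_pM; rewrite ?cabs_ge0//; exact: hB.
have -> : Z * sbr j (y - x) ^+ N * G * (H * (B * 2 ^+ (j * d) * sbr j (y - x) ^- (N + 2 * d))) =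
    B * (Z * H * G) * ((2 ^+ j) ^+ d * sbr j (y - x) ^- (2 * d)).
  by rewrite exprD exprM; field; rewrite !expf_neq0// gt_eqF.
rewrite ler_wpM2l// ler_wpM2l ?exprn_ge0 ?(ltW c0)//; exact: bracket_wt.
Qed.

(** Frequencies of size [2^k] cannot reach size [2^j] after multiplication by a function
    whose frequencies are far below the larger of the two. *)
Lemma far_blocks_orthogonal u chi j k x : tempered u -> test_function chi ->
  (j + 4 <= k)%N \/ (k + 4 <= j)%N ->
  cint setT (fun y => blockf eta u k y *
    (ifourier (low chi (maxn j k - 4)) y * lp_kernel eta j (y - x))) = 0.
Proof.
move=> tu tc jk; set L := (maxn j k - 4)%N; have ta := test_low L tc.
have [psi tpsi [p1 p2]] : exists2 psi : Rd -> C, test_function psi &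
    (forall xi, dyadic eta k xi * psi xi = dyadic eta k xi) /\
    (forall xi zeta, low chi L xi * (dyadic eta j (zeta + xi) * psi zeta) = 0).
  have lowfar xi : 3 / 8 * 2 ^+ L <= eucl xi -> low chi L xi = 0.
    by move=> h; rewrite /low eta_dil_far ?mul0r.
  have e2 a b : (a <= b)%N -> 2 ^+ a <= 2 ^+ b :> R by move=> ab; rewrite ler_weXn2l ?ler1n.
  have q0 := exp2_gt0 (R := R).
  case: jk => jk.
    have [LE jL] : (k = L + 4 /\ j <= L)%N by rewrite /L; split; lia.
    exists (fun zeta => eta (2 ^- k.+1 *: zeta) - eta (2 ^- L.+2 *: zeta)).
      apply: testB; first exact: test_fat He k.
      by apply: test_scale (test_eta He); rewrite invr_neq0// lt0r_neq0// exp2_gt0.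
    split=> [xi|xi zeta].
      rewrite mulrBr (dyadic_fat He).
      have [h|h] := leP (eucl xi) (2 ^+ L.+3 / 4).
        by rewrite LE addnS (dyadic_near He) ?mul0r ?subrr// addn3.
      rewrite [X in _ - _ * X]eta_dil_far ?mulr0 ?subr0//.
      by move: h; rewrite !exprS; have := q0 L; lra.
    have [h|h] := leP (3 / 8 * 2 ^+ L) (eucl xi); first by rewrite lowfar// mul0r.
    have [h2|h2] := leP (eucl zeta) (2 ^+ L.+2 / 4).
      rewrite [X in _ * (_ * X)](_ : _ = 0) ?mulr0// !eta_dil_near ?subrr//.
      by apply: le_trans h2 _; rewrite ler_wpM2r ?invr_ge0//; apply: e2; lia.
    rewrite (dyadic_far He) ?mul0r ?mulr0//.
    apply: le_trans (eucl_sub zeta xi); have := e2 _ _ jL; have := q0 L; move: h h2; rewrite !exprS.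
    by move: (eucl xi) (eucl zeta) => a b h1 h2 h3 h4; lra.
  have [LE kL] : (j = L + 4 /\ k <= L)%N by rewrite /L; split; lia.
  exists (fun zeta => eta (2 ^- k.+1 *: zeta)); first exact: test_fat He k.
  split=> [xi|xi zeta]; first exact: (dyadic_fat He).
  have [h|h] := leP (3 / 8 * 2 ^+ L) (eucl xi); first by rewrite lowfar// mul0r.
  have [h2|h2] := leP (3 / 8 * 2 ^+ k.+1) (eucl zeta); first by rewrite eta_dil_far// !mulr0.
  rewrite LE addnS (dyadic_near He) ?mul0r ?mulr0// addn3.
  apply: le_trans (eucl_add zeta xi) _; have := e2 _ _ kL; move: h h2; rewrite !exprS; have := q0 L.
  by move: (eucl xi) (eucl zeta) => a b h0 h1 h2 h3; lra.
have sp := schwartz_fourier tpsi; have sl := schwartz_lp_kernel He j.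
have slx := schwartz_shift x sl.
have [n [A A0 hA]] := blockf_growth He k tu.
have [B B0 hB] := schwartz_decay (n + 2 * d) sp.
have [E E0 hE] := schwartz_decay (n + 2 * d + 2 * d) slx.
have [D D0 hD] := fourier_bounded ta.
have mb : cmeas (blockf eta u k) by exact/ccont_cmeas/ccont_blockf.
have ml := schwartz_cmeas slx.
have mi : cmeas (ifourier (low chi L)).
  have -> : ifourier (low chi L) = fun y => fourier (low chi L) (0 - y).
    by apply/funext => y; rewrite ifourier_fourier sub0r.
  exact/cmeas_reflect/schwartz_cmeas/schwartz_fourier.
pose H (y z : Rd) := ifourier (low chi L) y * lp_kernel eta j (y - x) * (blockf eta u k z * fourier psi (z - y)).
have mH : cmeas (fun z : Rd * Rd => H z.1 z.2).
  apply: cmeasM; first exact: (cmeas_schwartz_fst (cmeasM mi ml)).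
  apply: cmeasM; first exact: cmeas_schwartz_snd.
  apply: (cmeas_comp (h := fun w : Rd * Rd => w.2 - w.1) (schwartz_cmeas sp)).
  apply: measurable_fun_coorP => i.
  rewrite (_ : _ \o _ = fun w : Rd * Rd => w.2 0 i - w.1 0 i); last by apply/funext => w; rewrite /= !mxE.
  apply: measurable_funB; first exact: (measurableT_comp (measurable_coor i) measurable_snd).
  exact: (measurableT_comp (measurable_coor i) measurable_fst).
have DE : 0 <= D * E by exact: mulr_ge0.
have AB : 0 <= A * B by exact: mulr_ge0.
have [|_ _ F] := @cint_fubini R d H _ _ _ _ mH (majorantZ DE (@majorant_wt0 R d)) (majorantZ AB (@majorant_wt0 R d)).
  move=> y z; rewrite !cabsM ifourier_fourier.
  have p1' : 0 < br y ^+ (n + 2 * d) by rewrite exprn_gt0// br_gt0.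
  have b1 : cabs (fourier (low chi L) (- y)) * cabs (lp_kernel eta j (y - x)) <= D * E * wt y / br y ^+ (n + 2 * d).
    apply: le_trans (ler_pM (cabs_ge0 _) (cabs_ge0 _) (hD (- y)) (hE y)) _.
    rewrite -!mulrA ler_wpM2l// ler_wpM2l// mulrC exprD invfM ler_wpM2l ?invr_ge0 ?(ltW p1')//.
    exact: bracket_wt.
  have b2 : cabs (blockf eta u k z) * cabs (fourier psi (z - y)) <= A * B * wt z * br y ^+ (n + 2 * d).
    have pz : 0 < br z ^+ (n + 2 * d) by rewrite exprn_gt0// br_gt0.
    have hz : br (z - y) ^- (n + 2 * d) <= br y ^+ (n + 2 * d) / br z ^+ (n + 2 * d).
      rewrite -[leLHS]mul1r ler_pdivrMr ?exprn_gt0 ?br_gt0// mulrAC ler_pdivlMr// mul1r -exprMn.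
      rewrite lerXn2r ?nnegrE ?mulr_ge0 ?(ltW (br_gt0 _))//.
      by rewrite mulrC; exact: br_sub.
    apply: le_trans (ler_pM (cabs_ge0 _) (cabs_ge0 _) (hA z) (hB (z - y))) _.
    apply: le_trans (ler_wpM2l _ (ler_wpM2l B0 hz)) _; first by rewrite mulr_ge0// exprn_ge0// ltW// br_gt0.
    rewrite [leLHS](_ : _ = B * br y ^+ (n + 2 * d) * (A * br z ^- (n + 2 * d) * br z ^+ n)); last by ring.
    rewrite [leRHS](_ : _ = B * br y ^+ (n + 2 * d) * (A * wt z)); last by ring.
    by rewrite ler_wpM2l ?br_wt// mulr_ge0// ltW.
  apply: le_trans (ler_pM _ _ b1 b2) _; rewrite ?mulr_ge0 ?cabs_ge0//.
  by rewrite le_eqVlt; apply/orP; left; apply/eqP; field; rewrite lt0r_neq0.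
transitivity (cint setT (fun y => cint setT (H y))).
  apply: eq_cint => y; rewrite (blockf_reproduce_test He d0 y tu tpsi p1) mulrC.
  have ib : cintble (fun z => blockf eta u k z * fourier psi (z - y)) by exact: blockf_shift_cintble.
  by rewrite -(cintZ _ ib).
rewrite F -[RHS](@cint0 R d); apply: eq_cint => z.
rewrite (eq_cint (g := fun y => blockf eta u k z * (lp_kernel eta j (y - x) * ifourier (low chi L) y * fourier psi (z - y)))); last first.
  by move=> y; rewrite /H; ring.
have h0 := fourier_disjoint x z (test_dyadic He j) tpsi ta p2.
rewrite cintZ; first by rewrite [X in _ * X]h0 mulr0.
have [B2 B20 hB2] := schwartz_decay 0 sp; have [E2 E20 hE2] := schwartz_wt slx.
apply: (@cintble_wt _ _ _ (E2 * D * B2)).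
- by rewrite !mulr_ge0.
- by apply: cmeasM; [exact: cmeasM|exact/cmeas_reflect/schwartz_cmeas].
move=> y; rewrite !cabsM ifourier_fourier.
rewrite [leRHS](_ : _ = E2 * wt y * D * B2); last by ring.
apply: ler_pM; [by rewrite mulr_ge0 ?cabs_ge0|exact: cabs_ge0| |].
  by apply: ler_pM; [exact: cabs_ge0|exact: cabs_ge0|exact: hE2|exact: hD].
by apply: le_trans (hB2 _) _; rewrite expr0 invr1 mulr1.
Qed.

Lemma ifourier_reflect (m : Rd -> C) x : test_function m -> ifourier m x = fourier (fun xi => m (-1 *: xi)) x.
Proof.
move=> tm; have sm := test_schwartz tm; have n0 : (-1 : R) != 0 by rewrite oppr_eq0 oner_eq0.
have := fourier_scale x n0 (schwartz_cintble sm) (schwartz_cmeas sm).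
rewrite normrN normr1 expr1n mul1r => ->; rewrite ifourier_fourier; congr fourier.
by rewrite invrN invr1 scaleN1r.
Qed.

Lemma schwartz_ifourier (m : Rd -> C) : test_function m -> schwartz (ifourier m).
Proof.
move=> tm; have -> : ifourier m = fourier (fun xi => m (-1 *: xi)).
  by apply/funext => x; exact: ifourier_reflect.
by apply/schwartz_fourier/test_scale => //; rewrite oppr_eq0 oner_eq0.
Qed.

Lemma schwartz_deriv_bounded f : schwartz f -> forall l, exists B, forall x, cabs (cpderiv l f x) <= B.
Proof.
move=> sf l; have [B B0 h] := schwartz_decay 0 (schwartz_cpderiv l sf); exists B => x.
by have := h x; rewrite expr0 invr1 mulr1.
Qed.

Lemma schwartz_mul f g : schwartz f -> schwartz g -> schwartz (fun x => f x * g x).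
Proof.
move=> sf sg; apply: schwartzM sg _; first exact: schwartz_smooth.
exact: schwartz_deriv_bounded.
Qed.

Lemma exp2N_le a b : (a <= b)%N -> 2 ^- b <= 2 ^- a :> R.
Proof. by move=> ab; rewrite lef_pV2 ?posrE ?exp2_gt0// ler_weXn2l ?ler1n. Qed.

Definition gap (j k : nat) : nat := (j - k + (k - j))%N.

(** For distant scales only the high frequencies of [chi] contribute, by
    [far_blocks_orthogonal], and these are smaller than any power of the larger scale. *)
Lemma product_estimate chi M N : test_function chi -> exists2 A : R, 0 <= A & forall u j k x (G : R),
  tempered u -> 0 <= G -> (forall y, cabs (blockf eta u k y) <= sbr k (x - y) ^+ N * G) ->
  cabs (cint setT (fun y => blockf eta u k y * (chi y * lp_kernel eta j (y - x)))) <= A * 2 ^- (M * gap j k) * G.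
Proof.
move=> tc; have [A1 A10 h1] := pairing_bound N; have [A2 A20 h2] := low_approx (M + N) tc.
have [H H0 hH] := test_bounded tc.
pose c1 := A1 * H * 2 ^+ (4 * N) * 2 ^+ (4 * M); pose c2 := A1 * A2 * 2 ^+ (4 * (M + N)).
have c10 : 0 <= c1 by rewrite !mulr_ge0 ?exprn_ge0.
have c20 : 0 <= c2 by rewrite !mulr_ge0 ?exprn_ge0.
exists (c1 + c2) => [|u j k x G tu G0 hG]; first exact: addr_ge0.
have sc := test_schwartz tc; have sl := schwartz_shift x (schwartz_lp_kernel He j).
have g0 : 0 <= 2 ^- (M * gap j k) :> R by rewrite invr_ge0 exprn_ge0.
have [near|far] := leqP (gap j k) 3.
  apply: le_trans (h1 u j k x chi H G tu (schwartz_cmeas sc) H0 G0 hH hG) _.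
  apply: (@le_trans _ _ (c1 * 2 ^- (M * gap j k) * G)); last by rewrite !ler_wpM2r// lerDl.
  rewrite [leLHS](_ : _ = A1 * H * 2 ^+ ((k - j) * N) * G); last by ring.
  apply: (ler_wpM2r G0); rewrite /c1 -2!(mulrA (A1 * H)); apply: ler_wpM2l; first exact: mulr_ge0.
  have e1 : 2 ^+ ((k - j) * N) <= 2 ^+ (4 * N) :> R.
    rewrite ler_weXn2l ?ler1n// leq_mul2r; apply/orP; right; rewrite /gap in near; lia.
  apply: le_trans e1 _; rewrite -mulrA ler_peMr ?exprn_ge0// ler_pdivlMr ?exp2_gt0// mul1r.
  by rewrite ler_weXn2l ?ler1n// mulnC leq_mul2r; apply/orP; right; lia.
set L := (maxn j k - 4)%N.
have LE : (maxn j k = L + 4)%N by rewrite /gap in far; rewrite /L; lia.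
have far' : (j + 4 <= k)%N \/ (k + 4 <= j)%N by rewrite /gap in far; lia.
have sX := schwartz_ifourier (test_low L tc).
have i1 := blockf_cintble He k tu (schwartz_mul sc sl).
have i2 := blockf_cintble He k tu (schwartz_mul sX sl).
pose h y := chi y - ifourier (low chi L) y.
have -> : cint setT (fun y => blockf eta u k y * (chi y * lp_kernel eta j (y - x))) =
    cint setT (fun y => blockf eta u k y * (h y * lp_kernel eta j (y - x))).
  rewrite -[LHS]subr0 -{1}(far_blocks_orthogonal x tu tc far') -(cintB i1 i2).
  by apply: eq_cint => y; rewrite -mulrBr -mulrBl.
have mh : cmeas h by apply: cmeasD; [exact: schwartz_cmeas|exact/cmeasN/schwartz_cmeas].
have Hp : 0 <= A2 * 2 ^- (L * (M + N)) by rewrite mulr_ge0// invr_ge0 exprn_ge0.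
apply: le_trans (h1 u j k x h _ G tu mh Hp G0 (h2 L) hG) _.
apply: (@le_trans _ _ (c2 * 2 ^- (M * gap j k) * G)); last by rewrite !ler_wpM2r// lerDr.
rewrite [leLHS](_ : _ = A1 * A2 * (2 ^+ ((k - j) * N) / 2 ^+ (L * (M + N))) * G); last by ring.
apply: (ler_wpM2r G0); rewrite /c2 -(mulrA (A1 * A2)); apply: ler_wpM2l; first exact: mulr_ge0.
rewrite ler_pdivrMr ?exp2_gt0// mulrAC ler_pdivlMr ?exp2_gt0// -!exprD ler_weXn2l ?ler1n//.
by rewrite /gap; nia.
Qed.

(** A geometric series on each side of [j]. *)
Lemma gap_sum j n : \sum_(k < n) 2 ^- gap j k <= 4 :> R.
Proof.
have lo m : (m <= j)%N -> \sum_(k < m) 2 ^- gap j k <= 2 ^- (j - m) :> R.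
  elim: m => [|m IH] mj; first by rewrite big_ord0 invr_ge0 exprn_ge0.
  rewrite big_ord_recr /=; have -> : gap j m = (j - m)%N by rewrite /gap; lia.
  apply: le_trans (lerD (IH (ltnW mj)) (lexx _)) _.
  have -> : (j - m = (j - m.+1).+1)%N by lia.
  by rewrite exprS invfM; have := exp2_gt0 (R := R) (j - m.+1); rewrite -invr_gt0; move: (_^-1) => t; lra.
have hi m : \sum_(k < j + m) 2 ^- gap j k <= 3 - 2 * 2 ^- m :> R.
  elim: m => [|m IH]; first by rewrite addn0; apply: le_trans (lo j (leqnn j)) _; rewrite subnn expr0 invr1; lra.
  rewrite addnS big_ord_recr /=; have -> : gap j (j + m) = m by rewrite /gap; lia.
  apply: le_trans (lerD IH (lexx _)) _; rewrite exprS invfM; lra.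
have [nj|/ltnW jn] := leqP n j.
  by apply: le_trans (lo n nj) _; apply: le_trans (exp2N_le (leq0n _)) _; rewrite expr0 invr1; lra.
rewrite -(subnKC jn); apply: le_trans (hi _) _.
by have := exp2_gt0 (R := R) (n - j); rewrite -invr_gt0; lra.
Qed.

Lemma tempered_dmul chi u : test_function chi -> tempered u -> tempered (dmul chi u).
Proof.
move=> tc /temperedP[lu [c [k [c0 hc]]]]; have sc := test_schwartz tc; apply/temperedP; split.
  move=> a f g sf sg; rewrite /dmul -(lu a _ _ (schwartz_mul sc sf) (schwartz_mul sc sg)).
  by congr u; apply/funext => x; rewrite mulrDr mulrCA.
have [A A0 hA] := schwartz_sbound k sc.
exists (c * (2 ^+ k * A)), k; split; first by rewrite !mulr_ge0// exprn_ge0.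
move=> f B sf hf; rewrite -!mulrA; apply: hc; first exact: schwartz_mul.
apply: sboundM (test_smooth tc) (schwartz_smooth sf) _ hf => l x lk.
by apply: le_trans (hA l x lk); rewrite ler_peMl ?cabs_ge0// br_exp_ge1.
Qed.

Lemma blockf_dmul_le chi u j x (S : R) : test_function chi -> tempered u ->
  (forall k, cabs (cint setT (fun y => blockf eta u k y * (chi y * lp_kernel eta j (y - x)))) <= 2 ^- gap j k * S) ->
  cabs (blockf eta (dmul chi u) j x) <= 4 * S.
Proof.
move=> tc tu hS; have sl := schwartz_shift x (schwartz_lp_kernel He j).
have := block_sum He d0 tu (schwartz_mul (test_schwartz tc) sl).
set v := u _; have -> : blockf eta (dmul chi u) j x = v by [].
set P := fun K => \sum_(k < K.+1) cint setT (fun y => blockf eta u k y * (chi y * lp_kernel eta j (y - x))) => hP.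
have S0 : 0 <= S by have := le_trans (cabs_ge0 _) (hS j); rewrite pmulr_rge0// invr_gt0 exp2_gt0.
have PS K : cabs (P K) <= 4 * S.
  apply: le_trans (cabs_sum _ _ _) _; apply: le_trans (ler_sum _ (fun (k : 'I_K.+1) _ => hS k)) _.
  by rewrite -mulr_suml ler_wpM2r// gap_sum.
apply/ler_addgt0Pl => e e0; have [K /(_ K (leqnn K)) hK] := hP e e0.
rewrite -[v](subrK (P K)); apply: le_trans (cabsD _ _) _; rewrite lerD//.
by rewrite cabsBC.
Qed.

End product_estimate.

Section zigzag.
Context {R : realType}.

(** The scales are enumerated by their distance to [j], so that [Lp_le_sup] applies to the
    supremum over all of them. *)
Definition zigzag (j m : nat) : option nat :=
  if odd m then (if (m./2 < j)%N then Some (j - (m./2).+1)%N else None) else Some (j + m./2)%N.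

Lemma zigzag_gap j m k : zigzag j m = Some k -> (m <= 2 * gap j k)%N.
Proof.
rewrite /zigzag /gap; have := odd_double_half m.
case: ifP => om; first by case: ifP => // h; move=> e [<-]; lia.
by move=> e [<-]; lia.
Qed.

Lemma zigzag_onto j k : exists m, zigzag j m = Some k.
Proof.
have [jk|kj] := leqP j k.
  by exists (k - j).*2; rewrite /zigzag odd_double doubleK; congr Some; lia.
exists ((j - k).-1.*2.+1); rewrite /zigzag /= odd_double /= uphalf_double.
by rewrite ifT; [congr Some; lia|lia].
Qed.

Definition along (a : nat -> R) m j : R := if zigzag j m is Some k then a k else 0.

Lemma along_sum (F : nat -> \bar R) m n : (forall k, (0 <= F k)%E) ->
  (\sum_(0 <= j < n) (if zigzag j m is Some k then F k else 0) <= \sum_(0 <= k <oo) F k)%E.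
Proof.
move=> F0; have part N : (\sum_(0 <= k < N) F k <= \sum_(0 <= k <oo) F k)%E.
  by apply: nneseries_lim_ge => k _ _; exact: F0.
have [om|/negbTE om] := boolP (odd m); rewrite /zigzag om; last first.
  apply: le_trans (part (n + m./2)%N).
  rewrite (@big_cat_nat _ _ _ (m./2) 0 (n + m./2))//=; last exact: leq_addl.
  by rewrite -{3}[m./2]add0n big_addn addnK leeDr// sume_ge0.
apply: le_trans (part (n - (m./2).+1)%N).
rewrite le_eqVlt; apply/orP; left; apply/eqP; elim: n => [|n IH]; first by rewrite !big_geq.
rewrite big_nat_recr//= IH; case: ifP => h.
  by rewrite subSS -(subnSK h) [RHS]big_nat_recr.
by rewrite addr0; congr (\sum_(0 <= k < _) _)%E; move/negbT: h; rewrite -leqNgt => h; rewrite subSS; apply/eqP; rewrite eqn_leq leq_sub2l//= (eqP (h : n - m./2 == 0)%N).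
Qed.

Lemma along_le (q : \bar R) (a : nat -> R) (B : R) m : (0 < q)%E -> 0 <= B -> (forall k, 0 <= a k) ->
  Lp_le counting q a B -> Lp_le counting q (along a m) B.
Proof.
move=> q0 B0 a0; have l0 j : 0 <= along a m j by rewrite /along; case: (zigzag _ _).
case: q q0 => [r||//] r0; last first.
  move/Lp_le_infty => h; apply/Lp_le_infty => //; apply: aeW => j.
  by rewrite /along; case: (zigzag _ _) => // k; exact: counting_ae (h B0 a0) k.
rewrite lte_fin in r0; move/Lp_le_fin => h; apply/Lp_le_fin => //.
apply: le_trans (h r0 B0 a0); rewrite !ge0_integral_count; first 1 last.
- by move=> k; rewrite lee_fin powR_ge0.
- by move=> k; rewrite lee_fin powR_ge0.
apply: nneseries_le => [k|n]; first by rewrite lee_fin powR_ge0.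
apply: le_trans (along_sum m n (F := fun k => (a k `^ r)%:E) _); last by move=> k; rewrite lee_fin powR_ge0.
apply: lee_sum => j _; rewrite /along; case: (zigzag _ _) => //.
by rewrite powR0// gt_eqF.
Qed.

End zigzag.

Section multiplier.
Context {R : realType} {d : nat}.
Local Notation C := R[i].
Local Notation Rd := 'rV[R]_d.
Local Notation leb := (@lebesgue_rV R d).
Implicit Types (f g chi : Rd -> C) (x y z : Rd) (u v : distr R d).
Variable eta : Rd -> C.
Hypothesis He : lp_cutoff eta.
Hypothesis d0 : (0 < d)%N.
Variables (s : R) (p q : \bar R).
Hypothesis p0 : (0 < p)%E.
Hypothesis q0 : (0 < q)%E.
Local Notation bes := (besov_le eta s p q).

Lemma exp2_scale (S0 j k : nat) : `|s| <= S0%:R ->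
  2 `^ (s * j%:R) * 2 ^- (S0 * gap j k) <= 2 `^ (s * k%:R) :> R.
Proof.
move=> hs; rewrite -powR_mulrn// ler_pdivrMr ?powR_gt0// -powRD ?pnatr_eq0 ?implybT//.
apply: ler_powR; first by rewrite ler1n.
rewrite -lerBlDl -mulrBr; apply: le_trans (ler_norm _) _; rewrite normrM natrM ler_pM//.
have [jk|kj] := leqP j k.
  rewrite distrC -natrB// ger0_norm// ler_nat /gap; lia.
by rewrite -natrB ?(ltnW kj)// ger0_norm// ler_nat /gap; lia.
Qed.

(** Each block of the product is at most a supremum over [k] of the maximal functions of the
    blocks of [u], with weights that decay rapidly in [|j - k|]; the weights absorb the factors
    [2^(s j)], and suprema of this kind are bounded in the Lebesgue spaces and in the sequence
    spaces. *)
Theorem besov_multiplier chi : test_function chi -> exists2 K : R, 0 <= K &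
  forall u (B : R), 0 <= B -> bes u B -> bes (dmul chi u) (K * B).
Proof.
move=> tc; have [N [K0 K00 hP]] := peetre He d0 p0.
pose S0 := (Num.trunc `|s|).+1; have hs : `|s| <= S0%:R by exact/ltW/truncnS_gt.
have [A A0 hA] := product_estimate He d0 (S0 + 5) N tc.
have [Kp Kp0 hKp] := @Lp_le_sup R p p0; have [Kq Kq0 hKq] := @Lp_le_sup R q q0.
pose c := 4 * A * K0; have c0 : 0 <= c by rewrite !mulr_ge0.
have Kpc : 0 <= Kp * c by rewrite mulr_ge0.
exists (Kp * c * Kq) => [|u B B0 [tu [b [b0 hb hB]]]]; first by rewrite mulr_ge0.
split; first exact: tempered_dmul.
have /choice[G HG] := fun k => hP u k (b k) tu (b0 k) (hb k).
have w0 j : 0 < 2 `^ (s * j%:R) :> R by rewrite powR_gt0.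
pose a k := 2 `^ (s * k%:R) * b k; have a0 k : 0 <= a k by rewrite mulr_ge0// ltW.
have aB k : a k <= B.
  rewrite -lee_fin; apply: le_trans hB.
  by apply: (Lnorm_counting_ge (F := fun k => (a k)%:E)) => // i; rewrite lee_fin.
pose E j := [set 2 ^- ((S0 + 2) * gap j k) * b k | k in [set: nat]].
have E1 j k : 2 `^ (s * j%:R) * (2 ^- ((S0 + 2) * gap j k) * b k) <= 2 ^- (2 * gap j k) * a k.
  rewrite mulnDl exprD invfM /a !mulrA ler_wpM2r// [leRHS]mulrC ler_wpM2r ?invr_ge0 ?exprn_ge0//.
  exact: exp2_scale.
have g1 j k n : 2 ^- (n * gap j k) <= 1 :> R by rewrite invf_le1 ?exp2_gt0// exprn_ege1// ler1n.
have Es j : has_sup (E j).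
  split; first by exists (2 ^- ((S0 + 2) * gap j 0) * b 0%N), 0%N.
  exists (B / 2 `^ (s * j%:R)) => _ [k _ <-]; rewrite ler_pdivlMr// mulrC.
  by apply: le_trans (E1 j k) _; apply: le_trans (aB k); rewrite ler_piMl.
pose beta j := sup (E j).
have Eb j k : 2 ^- ((S0 + 2) * gap j k) * b k <= beta j by apply: sup_upper_bound => //; exists k.
have beta0 j : 0 <= beta j.
  by apply: le_trans (Eb j 0%N); rewrite mulr_ge0// invr_ge0 exprn_ge0.
have g0 n : 0 <= 2 ^- n :> R by rewrite invr_ge0 exprn_ge0.
exists (fun j => Kp * (c * beta j)); split=> [j|j|].
- by rewrite !mulr_ge0.
- pose g m x := along (fun k => 4 * A * 2 ^- ((S0 + 4) * gap j k) * G k x) m j.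
  apply: (hKp _ _ leb _ g); first by rewrite mulr_ge0.
  + exact: (measurable_blockf He j (tempered_dmul tc tu)).
  + move=> m; rewrite /g /along; case: (zigzag j m) => [k|]; last exact: measurable_cst.
    by apply: measurable_funM; [exact: measurable_cst|have [] := HG k].
  + by move=> x; exact: cabs_ge0.
  + move=> m x; rewrite /g /along; case: (zigzag j m) => // k.
    by have [_ h _ _] := HG k; rewrite !mulr_ge0.
  + move=> x M M0 gM.
    have key k : cabs (cint setT (fun y => blockf eta u k y * (chi y * lp_kernel eta j (y - x)))) <= 2 ^- gap j k * (M / 4).
      have [_ Gp _ hG] := HG k; apply: le_trans (hA u j k x (G k x) tu (Gp x) (hG x)) _.
      have [m zm] := zigzag_onto j k; have := gM m; rewrite /g /along zm.
      rewrite (_ : (S0 + 5 = (S0 + 4) + 1)%N); last by rewrite -addnA.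
      rewrite [in X in _ -> X]mulnDl mul1n [in X in _ -> X]exprD invfM.
      move: (g0 (gap j k)); move: (2 ^- ((S0 + 4) * gap j k)) (2 ^- gap j k) (G k x) => a1 b1 G1 b10 h.
      rewrite [leLHS](_ : _ = b1 * (A * a1 * G1)); last by ring.
      rewrite (ler_wpM2l b10)// ler_pdivlMr//; apply: le_trans h.
      by rewrite le_eqVlt; apply/orP; left; apply/eqP; ring.
    by have := blockf_dmul_le He d0 tc tu key; rewrite mulrC divfK.
  + move=> m; rewrite /g /along; case zm: (zigzag j m) => [k|]; last by apply: Lp_le0 => //; rewrite !mulr_ge0.
    have [mG Gp LG _] := HG k.
    have cc : 0 <= 4 * A * 2 ^- ((S0 + 4) * gap j k) by rewrite !mulr_ge0.
    apply: (@Lp_le_weaken _ _ _ leb p _ (4 * A * 2 ^- ((S0 + 4) * gap j k) * (K0 * b k))).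
      rewrite /c [leRHS](_ : _ = 4 * A * K0 * (2 ^- m * beta j)); last by ring.
      rewrite [leLHS](_ : _ = 4 * A * K0 * (2 ^- ((S0 + 4) * gap j k) * b k)); last by ring.
      rewrite ler_wpM2l// (_ : (S0 + 4 = 2 + (S0 + 2))%N); last by rewrite addnCA.
      rewrite mulnDl exprD invfM -mulrA ler_pM ?mulr_ge0//.
      exact/exp2N_le/zigzag_gap.
    apply: Lp_le_dominated LG => //.
    * by rewrite mulr_ge0.
    * by apply: measurable_funM => //.
    * by move=> x; rewrite mulr_ge0.
- have -> : Kp * c * Kq * B = (Kp * c) * (Kq * B) by rewrite !mulrA.
  apply: (@ell_dominated _ q _ (fun j => 2 `^ (s * j%:R) * beta j)) => //.
  + by rewrite mulr_ge0.
  + by move=> j; rewrite !mulr_ge0// ltW.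
  + by move=> j; rewrite mulr_ge0// ltW.
  + by move=> j; rewrite le_eqVlt; apply/orP; left; apply/eqP; ring.
  apply: (hKq _ _ counting _ (fun m j => 2 ^- m * along a m j)) => //.
  + by move=> j; rewrite mulr_ge0// ltW.
  + by move=> m j; rewrite mulr_ge0// /along; case: (zigzag _ _).
  + move=> j M M0 hM; rewrite mulrC -ler_pdivlMr//; apply: sup_le_ub => [|_ [k _ <-]].
      by have [] := Es j.
    rewrite ler_pdivlMr// mulrC; apply: le_trans (E1 j k) _.
    have [m zm] := zigzag_onto j k; apply: le_trans (hM m); rewrite /along zm ler_wpM2r//.
    exact/exp2N_le/zigzag_gap.
  + move=> m; have lp := along_le m q0 B0 a0 hB.
    by apply: ell_dominated lp => // j; rewrite ?mulr_ge0// /along; case: (zigzag _ _).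
Qed.

End multiplier.

(** * Values of Haar functions *)

Section box_measure.
Context {R : realType} {d : nat}.
Local Notation leb := (@lebesgue_rV R d).

Lemma lebesgue_rV_box (A : 'I_d -> set R) : (forall i, measurable (A i : set (measurableTypeR R))) ->
  leb [set x : 'rV[R]_d | forall i, A i (x 0 i)] = (\prod_i @lebesgue_measure R (A i))%E.
Proof.
move=> mA; set B := [set x | _].
have mB : measurable B.
  have -> : B = \bigcap_(i in [set: 'I_d]) ((fun x : 'rV[R]_d => x 0 i) @^-1` A i).
    by apply/seteqP; split=> [x /= h i _|x /= h i]; exact: h.
  apply: fin_bigcap_measurable => // i _; rewrite -[X in measurable X]setTI.
  exact: measurable_coor.
have <- : (\int[leb]_x (\1_B x)%:E)%E = leb B by rewrite integral_indic// setIT.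
have <- : (\prod_i \int[@lebesgue_measure R]_t (\1_(A i) t)%:E)%E = (\prod_i @lebesgue_measure R (A i))%E.
  by apply: eq_bigr => i _; rewrite integral_indic ?setIT.
rewrite -(@ge0_integral_prod R d (fun i t => (\1_(A i) t)%:E)); first 1 last.
- by move=> i; apply/measurable_EFinP; apply: measurable_indic; exact: mA.
- by move=> i t; rewrite lee_fin.
apply: eq_integral => x _; rewrite indicE.
have [xB|xB] := boolP (x \in B).
  rewrite big1// => i _; rewrite indicE mem_set//; move: xB; rewrite inE; exact.
have [i xi] : exists i, ~ A i (x 0 i).
  by apply/existsNP => h; move/negP: xB; apply; rewrite inE.
by rewrite (bigD1 i)//= indicE memNset// mul0e.
Qed.

End box_measure.

Section haar_values.
Context {R : realType} {d : nat}.
Local Notation C := R[i].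
Local Notation Rd := 'rV[R]_d.
Local Notation Zd := 'rV[int]_d.
Local Notation leb := (@lebesgue_rV R d).
Implicit Types (x y : Rd) (m : Zd) (k N : nat) (e : {ffun 'I_d -> bool}) (f : Rd -> C).

(** The values of the Haar functions on the two halves of their support; the halves are
    numbered by the integer part of [2 t]. *)
Definition half_value (b : bool) (n : int) : R :=
  if n == 0 then 1 else if n == 1 then (if b then -1 else 1) else 0.

Lemma haar1E b (t : R) : haar1 b t = half_value b (Num.floor (2 * t)).
Proof.
rewrite /haar1 /half_value !floor_eq !indicE !mem_setE !in_itv /=.
rewrite (_ : (0%:~R <= 2 * t < (0 + 1)%:~R) = (0 <= t < 1 / 2)); last by apply/idP/idP => /=; lra.
rewrite (_ : (1%:~R <= 2 * t < (1 + 1)%:~R) = (1 / 2 <= t < 1)); last by apply/idP/idP => /=; lra.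
have -> : (0 <= t < 1) = (0 <= t < 1 / 2) || (1 / 2 <= t < 1) by apply/idP/idP => /=; lra.
have [h1|h1] := boolP (0 <= t < 1 / 2); have [h2|h2] := boolP (1 / 2 <= t < 1); case: b => //=;
  rewrite ?subr0 ?sub0r//; move: h1 h2; lra.
Qed.

Lemma haar1_false (t : R) : haar1 false t = (Num.floor t == 0)%:R.
Proof. by rewrite /haar1 indicE mem_setE in_itv /= floor_eq. Qed.

Lemma floor_double (t : R) (m : int) : Num.floor (2 * (t - m%:~R)) = Num.floor (2 * t) - 2 * m.
Proof.
apply/eqP; rewrite floor_eq; have := floor_itv (2 * t).
move: (Num.floor _) => n; rewrite !intrD !intrN intrM /=; lra.
Qed.

Lemma haar_fl e k m x : haar e k m x = (\prod_i half_value (e i) (fl k.+1 x 0 i - 2 * m 0 i))%:C%C :> C.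
Proof.
by congr (_%:C)%C; apply: eq_bigr => i _; rewrite haar1E floor_double mxE exprS mulrA.
Qed.

Lemma half_value_le1 b n : `|half_value b n| <= 1.
Proof. by rewrite /half_value; case: (n == 0); case: (n == 1); case: b; rewrite ?normr1 ?normrN1 ?normr0. Qed.

Lemma cmeas_haar e k m : cmeas (haar e k m : Rd -> C).
Proof.
have := @cmeas_fl R d k.+1 (fun z : Zd => (\prod_i half_value (e i) (z 0 i - 2 * m 0 i))%:C%C).
by congr cmeas; apply/funext => x; rewrite haar_fl.
Qed.

Lemma cabs_haar_le1 e k m x : cabs (haar e k m x : C) <= 1.
Proof.
rewrite haar_fl cabs_real normr_prod; apply: prodr_ile1 => i _.
by rewrite normr_ge0 half_value_le1.
Qed.

Lemma floor_half (t : R) : let n := Num.floor (2 * t) - 2 * Num.floor t in n = 0 \/ n = 1.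
Proof.
move=> n; have := floor_itv (2 * t); have := floor_itv t; rewrite /n.
move: (Num.floor t) (Num.floor (2 * t)) => a b; rewrite !intrD => h1 h2.
have : (2 * a)%:~R < (b + 1)%:~R :> R by rewrite intrM intrD /=; lra.
have : b%:~R < (2 * a + 2)%:~R :> R by rewrite intrD intrM /=; lra.
rewrite !ltr_int; lia.
Qed.

Lemma fl_succ k x i : fl k.+1 x 0 i - 2 * fl k x 0 i = 0 \/ fl k.+1 x 0 i - 2 * fl k x 0 i = 1.
Proof. by rewrite !mxE exprS -mulrA; exact: floor_half. Qed.

Lemma haar_out e k m x : fl k x <> m -> haar e k m x = 0 :> C.
Proof.
move=> h; have [i hi] : exists i, fl k x 0 i != m 0 i.
  apply: contrapT => h'; apply: h; apply/rowP => i; apply/eqP; apply: contrapT => /negP hi.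
  by apply: h'; exists i.
rewrite haar_fl (bigD1 i)//= /half_value.
have := fl_succ k x i; move: hi; move: (fl k.+1 x 0 i) (fl k x 0 i) (m 0 i) => a b c bc ab.
by rewrite !ifF ?mul0r//; apply/eqP; move: bc ab => /eqP; lia.
Qed.

Lemma haar0E k m x : haar haar0 k m x = (fl k x == m)%:R :> C.
Proof.
have [<-|/eqP h] := eqVneq (fl k x) m; last by rewrite haar_out.
rewrite /haar big1// => i _; rewrite ffunE haar1_false mxE.
by rewrite (_ : Num.floor _ = 0) ?eqxx//; apply/eqP; rewrite floor_eq; have := floor_itv (2 ^+ k * x 0 i); rewrite intrD; lra.
Qed.

Lemma dyadic_cubeE N m x : dyadic_cube N m x <-> fl N x = m.
Proof.
have e0 : (0 : R) < 2 ^+ N by rewrite exprn_gt0.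
have key i : (2 ^- N * (m 0 i)%:~R <= x 0 i < 2 ^- N * ((m 0 i)%:~R + 1)) = (fl N x 0 i == m 0 i).
  by rewrite mxE floor_eq intrD !(mulrC (2 ^- N)) ler_pdivrMr// ltr_pdivlMr// !(mulrC (x 0 i)).
split=> [h|h i]; last by rewrite key h.
by apply/rowP => i; apply/eqP; rewrite -key.
Qed.

Lemma cint_dyadic_cube N m f : cint (dyadic_cube N m) f = pairing f (haar haar0 N m).
Proof.
have key (g h : Rd -> R) : (forall x, h x = if fl N x == m then g x else 0) ->
    \int[leb]_(x in dyadic_cube N m) g x = \int[leb]_(x in setT) h x.
  move=> gh; rewrite Rintegral_mkcond; apply: eq_Rintegral => x _; rewrite patchE gh.
  by case: eqVneq => [/dyadic_cubeE|/eqP h1]; [move/mem_set ->|rewrite memNset// => /dyadic_cubeE].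
rewrite /pairing; apply: complex_ext; apply: key => x; rewrite haar0E.
  by case: (fl N x == m); rewrite ?mulr1 ?mulr0.
by case: (fl N x == m); rewrite ?mulr1 ?mulr0.
Qed.

Lemma lebesgue_dyadic_cube N m : leb (dyadic_cube N m) = (2 ^- (N * d))%:E.
Proof.
have e0 : (0 : R) < 2 ^- N by rewrite invr_gt0 exprn_gt0.
have := @lebesgue_rV_box R d (fun i => `[2 ^- N * (m 0 i)%:~R, 2 ^- N * ((m 0 i)%:~R + 1)[%classic).
set B := [set x | _]; have -> : B = dyadic_cube N m.
  by apply/seteqP; split=> x /= h i; have := h i; rewrite /= in_itv.
move=> -> //; rewrite (eq_bigr (fun=> (2 ^- N)%:E)) => [|i _].
  by rewrite prodEFin prodr_const card_ord -exprVn -exprM exprVn.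
rewrite lebesgue_measure_itv /= lte_fin ifT ?ltr_pM2l ?ltrDl//.
by rewrite -EFinD -mulrBr addrAC subrr add0r mulr1.
Qed.

Lemma haar_outside e k m x : `|grid k m : Rd| + 1 < `|x| -> haar e k m x = 0 :> C.
Proof.
move=> hx; apply: haar_out => h; move: hx; rewrite ltNge => /negP; apply.
have := grid_fl k x; rewrite h => g; rewrite -[x in leLHS](subrK (grid k m)) addrC.
apply: le_trans (ler_normD _ _) _; rewrite lerD2l; apply: le_trans g _.
by rewrite invf_le1 ?exprn_gt0// exprn_ege1// ler1n.
Qed.

Lemma haar_support e k m : exists2 r : R, 0 <= r & forall x, r < `|x| -> haar e k m x = 0 :> C.
Proof. by exists (`|grid k m : Rd| + 1) => [|x]; [rewrite addr_ge0|exact: haar_outside]. Qed.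

Lemma haar_majorant e k m : exists2 M : R, 0 <= M &
  exists2 w, majorant w M & forall x, cabs (haar e k m x : C) <= w x.
Proof.
have [r r0 hr] := haar_support e k m; have [M M0 [w maj hw]] := @majorant_supported R d r.
exists M => //; exists w => // x; have [xr|/hr ->] := leP `|x| r.
  by apply: le_trans (cabs_haar_le1 _ _ _ _) _; have := hw x; rewrite xr.
by rewrite cabs0; case: maj.
Qed.

Lemma haar_cintble e k m : cintble (haar e k m : Rd -> C).
Proof. by have [M _ [w maj hw]] := haar_majorant e k m; exact: cintble_majorant (cmeas_haar e k m) maj hw. Qed.

Lemma cintble_haar f e k m : loc_integrable f -> cintble (fun x => f x * haar e k m x).
Proof.
move=> lf; have [r r0 hr] := haar_support e k m.
by apply: loc_cintble_bounded lf (cmeas_haar e k m) ler01 r0 _ hr; exact: cabs_haar_le1.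
Qed.

Lemma pairing_haar0_cst N m : pairing (fun=> 1) (haar haar0 N m) = (2 ^- (N * d))%:C%C :> C.
Proof.
have mD : measurable (dyadic_cube N m : set Rd).
  rewrite (_ : dyadic_cube N m = [set x | [set m] (fl N x)]); first exact: measurable_fl.
  by apply/seteqP; split=> x /dyadic_cubeE.
rewrite -cint_dyadic_cube; apply: complex_ext.
  transitivity (fine (\int[leb]_(x in dyadic_cube N m) (cst (1%:E : \bar R)) x)); first by [].
  rewrite integral_cst// mul1e; exact: congr1 (lebesgue_dyadic_cube N m).
transitivity (fine (\int[leb]_(x in dyadic_cube N m) (cst (0%:E : \bar R)) x)); first by [].
by rewrite integral_cst// mul0e.
Qed.

End haar_values.

(** * Haar expansions and admissible enumerations *)

Section haar_expansion.
Context {R : realType} {d : nat}.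
Local Notation C := R[i].
Local Notation Rd := 'rV[R]_d.
Local Notation Zd := 'rV[int]_d.
Local Notation Ed := {ffun 'I_d -> bool}.
Implicit Types (x y : Rd) (m : Zd) (k N L : nat) (e : Ed) (f : Rd -> C) (z : @haar_index d) (a : Zd -> Ed -> C).

Lemma fsum_single (h : Zd -> C) m : (forall m', m' <> m -> h m' = 0) -> \sum_(m' \in [set: Zd]) h m' = h m.
Proof. by move=> hm; rewrite -(fsbig_widen [set m]) ?fsbig_set1// => m' [_ /= /hm]. Qed.

Definition haar_coef f z : C := 2 ^+ (hi_level z * d) * pairing f (haar_of z).

Definition haar_term e k f x : C := haar_coef f (HaarIndex e k (fl k x)) * haar e k (fl k x) x.

(** Level 0 consists of the characteristic functions of the unit cubes, and level [k.+1]
    of the Haar functions [h^e_{k,m}] with [e != 0]; in both cases the scale is [L.-1]. *)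
Definition at_level L e : bool := if L is _.+1 then e != haar0 else e == haar0.

Definition level_op L a f x : C :=
  if L is k.+1 then haar_mult k a f x else haar_mult0 (fun m => a m haar0) f x.

Lemma level_opE L a f x :
  level_op L a f x = \sum_(e | at_level L e) a (fl L.-1 x) e * haar_term e L.-1 f x.
Proof.
case: L => [|k] /=.
  rewrite big_pred1_eq /haar_mult0 (@fsum_single _ (fl 0 x)).
    by rewrite /haar_term /haar_coef mul0n expr0 mul1r !mulrA.
  by move=> m hm; rewrite haar_out ?mulr0//; exact/nesym.
rewrite /haar_mult; apply: eq_bigr => e _; rewrite (@fsum_single _ (fl k x)).
  by rewrite /haar_term /haar_coef /= !mulrA.
by move=> m hm; rewrite haar_out ?mulr0//; exact/nesym.
Qed.

Lemma level_op_local L a b f x : (forall e, at_level L e -> a (fl L.-1 x) e = b (fl L.-1 x) e) ->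
  level_op L a f x = level_op L b f x.
Proof. by move=> ab; rewrite !level_opE; apply: eq_bigr => e /ab ->. Qed.

Lemma level_op0 L a f x : (forall e, at_level L e -> a (fl L.-1 x) e = 0) -> level_op L a f x = 0.
Proof. by move=> a0; rewrite level_opE big1// => e /a0 ->; rewrite mul0r. Qed.

Lemma level_op_sum L I (s : seq I) (a : I -> Zd -> Ed -> C) f x :
  level_op L (fun m e => \sum_(i <- s) a i m e) f x = \sum_(i <- s) level_op L (a i) f x.
Proof.
under eq_bigr do rewrite level_opE; rewrite level_opE exchange_big; apply: eq_bigr => e _.
by rewrite mulr_suml.
Qed.

(** The kernel is a product of one-dimensional ones, each of which detects whether two points
    lie in the same half of an interval. *)
Lemma haar_kernel N x y :
  \sum_e haar e N (fl N x) y * haar e N (fl N x) x = 2 ^+ d * haar haar0 N.+1 (fl N.+1 x) y :> C.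
Proof.
pose a i := fl N.+1 x 0 i - 2 * fl N x 0 i; pose b i := fl N.+1 y 0 i - 2 * fl N x 0 i.
have -> : \sum_e haar e N (fl N x) y * haar e N (fl N x) x =
    (\sum_(e : Ed) \prod_i (half_value (e i) (b i) * half_value (e i) (a i)))%:C%C :> C.
  by rewrite rmorph_sum; apply: eq_bigr => e _; rewrite !haar_fl -rmorphM -big_split.
rewrite -(bigA_distr_bigA (fun i c => half_value c (b i) * half_value c (a i))).
have -> : \prod_i \sum_(c : bool) half_value c (b i) * half_value c (a i) =
    \prod_(i < d) (2 * (b i == a i)%:R) :> R.
  apply: eq_bigr => i _; rewrite big_bool /= /half_value.
  have : a i = 0 \/ a i = 1 by exact: fl_succ.
  move: (b i) (a i) => u v [] ->; have [u0|u0] := eqVneq u 0; rewrite ?u0 /=; try lra.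
    by have [u1|u1] := eqVneq u 1; rewrite /=; lra.
  by have [u1|u1] := eqVneq u 1; rewrite /=; lra.
rewrite big_split /= prodr_const card_ord rmorphM rmorphXn /= haar0E rmorph_nat; congr (_ * _).
case: eqVneq => [e|/eqP h].
  by rewrite big1 // => i _; rewrite /a /b -e eqxx.
have [i hi] : exists i, fl N.+1 y 0 i != fl N.+1 x 0 i.
  apply: contrapT => h'; apply: h; apply/rowP => i; apply/eqP; apply: contrapT => /negP hi.
  by apply: h'; exists i.
by rewrite (bigD1 i)//= (_ : (b i == a i) = false) ?mul0r// /a /b (inj_eq (addIr _)); exact/negbTE.
Qed.

Lemma expectE N f x : expect N f x = haar_coef f (HaarIndex haar0 N (fl N x)).
Proof.
rewrite /expect (@fsum_single _ (fl N x)).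
  by rewrite cint_dyadic_cube indicE mem_set ?mul1r//; exact/dyadic_cubeE.
by move=> m hm; rewrite indicE memNset ?mul0r// => /dyadic_cubeE /nesym.
Qed.

(** Refining the averages by one generation adds the Haar functions of that generation. *)
Lemma expect_levels N f x : loc_integrable f ->
  expect N f x = \sum_(L < N.+1) level_op L (fun _ _ => 1) f x.
Proof.
move=> lf.
have expand L : level_op L (fun _ _ => 1) f x = \sum_(e | at_level L e) haar_term e L.-1 f x.
  by rewrite level_opE; apply: eq_bigr => e _; rewrite mul1r.
have term0 n : haar_term haar0 n f x = expect n f x by rewrite expectE /haar_term haar0E eqxx mulr1.
elim: N => [|N IH]; first by rewrite big_ord1 expand /= big_pred1_eq term0.
transitivity (\sum_e haar_term e N f x).
  2: by rewrite big_ord_recr -IH expand -(term0 N) [LHS](bigD1 haar0).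
rewrite expectE.
rewrite /haar_term /haar_coef /= mulSn exprD.
under [RHS]eq_bigr do rewrite -mulrA.
rewrite -mulr_sumr -mulrA mulrCA; congr (_ * _).
have cf e : cintble (fun y => haar e N (fl N x) x * (f y * haar e N (fl N x) y)).
  by apply: cintbleZ; exact: cintble_haar.
transitivity (cint setT (fun y => \sum_e haar e N (fl N x) x * (f y * haar e N (fl N x) y))).
  rewrite /pairing /haar_of /= -cintZ; last exact: cintble_haar.
  apply: eq_cint => y; rewrite mulrCA -haar_kernel mulr_sumr.
  by apply: eq_bigr => e _; rewrite [RHS]mulrC mulrA.
rewrite (cint_sum _ _ cf); apply: eq_bigr => e _.
by rewrite (cintZ (haar e N (fl N x) x) (cintble_haar e N (fl N x) lf)) mulrC.
Qed.

Definition hi_lev z : nat := if hi_type z == haar0 then 0%N else (hi_level z).+1.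

Lemma hi_lev_scale z : haar_system z -> (hi_lev z).-1 = hi_level z.
Proof. by rewrite /haar_system /hi_lev /= => -[[-> ->]|/negbTE ->]; rewrite ?eqxx. Qed.

(** The indicator function of one Haar function, as a coefficient family on level [L]. *)
Definition only z L m e : C := `[< z = HaarIndex e L.-1 m >]%:R.

Lemma level_op_only z L f x : haar_system z ->
  level_op L (only z L) f x = if L == hi_lev z then haar_coef f z * haar_of z x else 0.
Proof.
move=> hz; have off e : at_level L e -> ~ z = HaarIndex e L.-1 (fl L.-1 x) -> only z L (fl L.-1 x) e = 0.
  by move=> _ h; rewrite /only asboolF.
have [->|Lz] := eqVneq L (hi_lev z); last first.
  apply: level_op0 => e le; apply: off => // ze; move/eqP: Lz; apply.
  move: le hz; rewrite ze /hi_lev /haar_system /=; case: (L) => [|k] /=; first by move=> /eqP ->; rewrite eqxx.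
  by move=> /negbTE ->.
rewrite {off}; case: z hz => e k m hz; have kE := hi_lev_scale hz.
rewrite level_opE kE /=; have [mE|mE] := eqVneq (fl k x) m; last first.
  rewrite big1 ?/haar_of /= ?haar_out ?mulr0//; first exact/eqP.
  by move=> e' _; rewrite /only kE asboolF ?mul0r// => -[_ h]; move/eqP: mE; rewrite h.
have ae : at_level (hi_lev (HaarIndex e k m)) e.
  by rewrite /hi_lev /=; case: (eqVneq e haar0) => [->|] //=.
rewrite (bigD1 e)//= [X in _ + X]big1 => [|e' /andP[_ /eqP ee]].
  by rewrite addr0 /only kE /= mE asboolT// mul1r /haar_term mE.
by rewrite /only kE asboolF ?mul0r// => -[h _]; apply: ee.
Qed.

Variable U : nat -> @haar_index d.
Hypothesis eU : enumeration U.

Lemma enum_system n : haar_system (U n).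
Proof. by case: eU => h _ _; exact: h. Qed.

Lemma enum_inj n n' : U n = U n' -> n = n'.
Proof. by move=> h; case: eU => _ i _; apply: i h; rewrite inE. Qed.

Lemma enum_onto z : haar_system z -> exists n, U n = z.
Proof. by move=> hz; case: eU => _ _ s; have [n _ <-] := s _ hz; exists n. Qed.

(** The indicator function of the first [n] Haar functions, as a coefficient family on level
    [L]. *)
Definition first_coef n L m e : C := \sum_(i < n) only (U i) L m e.

Lemma first_coef1 n i L m e : (i < n)%N -> U i = HaarIndex e L.-1 m -> first_coef n L m e = 1.
Proof.
move=> ni h; rewrite /first_coef (bigD1 (Ordinal ni))//= {1}/only asboolT// big1 ?addr0// => j ji.
rewrite /only asboolF// -h => /enum_inj ij; move/eqP: ji; apply; exact: val_inj.
Qed.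

Lemma first_coef0 n L m e : (forall i, (i < n)%N -> U i <> HaarIndex e L.-1 m) -> first_coef n L m e = 0.
Proof. by move=> h; rewrite /first_coef big1// => i _; rewrite /only asboolF//; exact: h. Qed.

Lemma first_coef_le1 n L m e : cabs (first_coef n L m e) <= 1.
Proof.
have [[i [ni h]]|h] := pselect (exists i, (i < n)%N /\ U i = HaarIndex e L.-1 m).
  by rewrite (first_coef1 ni h) cabs1.
by rewrite first_coef0 ?cabs0// => i ni h'; apply: h; exists i.
Qed.

Lemma partial_sumE n f x :
  partial_sum_op U n f x = \sum_(i < n) level_op (hi_lev (U i)) (only (U i) (hi_lev (U i))) f x.
Proof. by apply: eq_bigr => i _; rewrite level_op_only ?eqxx//; exact: enum_system. Qed.

Lemma partial_sum_levels n f x K : (forall i, (i < n)%N -> (hi_lev (U i) < K)%N) ->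
  partial_sum_op U n f x = \sum_(L < K) level_op L (first_coef n L) f x.
Proof.
move=> hK; under eq_bigr do rewrite level_op_sum.
rewrite exchange_big /=; apply: eq_bigr => i _; have hi := hK i (ltn_ord i).
rewrite (bigD1 (Ordinal hi))//= level_op_only ?eqxx; last exact: enum_system.
rewrite big1 ?addr0// => L LU; rewrite level_op_only; last exact: enum_system.
by rewrite ifF//; apply/negbTE; move: LU; apply: contra => /eqP h; apply/eqP/val_inj.
Qed.

End haar_expansion.

Section admissible.
Context {R : realType} {d : nat}.
Local Notation C := R[i].
Local Notation Rd := 'rV[R]_d.
Local Notation Zd := 'rV[int]_d.
Local Notation Ed := {ffun 'I_d -> bool}.
Local Notation leb := (@lebesgue_rV R d).
Implicit Types (x y : Rd) (m nu : Zd) (k N L : nat) (e : Ed) (z : @haar_index d).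

(** The closed dyadic cube: each of its points is a limit of points of the half-open one. *)
Lemma fsupp_haar e k m : fsupp (haar e k m : Rd -> C) =
  [set y | forall i, `[2 ^- k * (m 0 i)%:~R, 2 ^- k * ((m 0 i)%:~R + 1)]%classic (y 0 i)].
Proof.
have p0 : (0 : R) < 2 ^- k by rewrite invr_gt0 exprn_gt0.
have cube y : haar e k m y != 0 :> C <-> dyadic_cube k m y.
  split=> [h|/dyadic_cubeE h].
    by apply/dyadic_cubeE; apply: contrapT => h'; move/eqP: h; apply; exact: haar_out.
  rewrite haar_fl; apply/eqP => /(congr1 (@complex.Re R)) /= /eqP; apply/negP.
  rewrite prodf_seq_neq0; apply/allP => i _; apply/implyP => _; rewrite -h.
  by case: (fl_succ k y i) => ->; rewrite /half_value /=; [|case: (e i)]; rewrite ?oppr_eq0 oner_eq0.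
apply/seteqP; split=> y /=.
  move=> cy i; rewrite in_itv /=; apply/andP; split; apply/ler_addgt0Pr => t t0.
    have [w [/= /cube/(_ i)/andP[h1 _] h2]] := cy _ (nbhsx_ballx y t t0).
    move: h2; rewrite -ball_normE /= => /(le_lt_trans (coord_le _ i)); rewrite !mxE ltr_norml; lra.
  have [w [/= /cube/(_ i)/andP[_ h1] h2]] := cy _ (nbhsx_ballx y t t0).
  by move: h2; rewrite -ball_normE /= => /(le_lt_trans (coord_le _ i)); rewrite !mxE ltr_norml; lra.
move=> hy B /nbhs_ballP[t /= t0 hB].
(* a point of the half-open cube close to [y] on the segment towards the lower corner *)
pose c := Num.min (1 / 2) (t / 2); have c0 : 0 < c by rewrite /c lt_min; apply/andP; split; lra.
have c1 : c <= 1 / 2 by rewrite /c ge_min lexx.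
have ct : c <= t / 2 by rewrite /c ge_min lexx orbT.
pose w : Rd := \row_i (y 0 i - c * (y 0 i - 2 ^- k * (m 0 i)%:~R)).
have k1 : 2 ^- k <= 1 :> R by rewrite invf_le1 ?exprn_gt0// exprn_ege1// ler1n.
exists w; split.
  apply/cube => i; have := hy i; rewrite in_itv /= mxE !mulrDr mulr1.
  by move: (2 ^- k) (2 ^- k * _) (y 0 i) p0 => h a u h0 /andP[h1 h2]; apply/andP; split; nra.
apply: hB; rewrite -ball_normE /=; apply: norm_lt => // i; rewrite !mxE.
have := hy i; rewrite in_itv /= !mulrDr mulr1 opprB addrC subrK.
move: (2 ^- k) (2 ^- k * _) (y 0 i) p0 k1 => h a u h0 h1 /andP[h2 h3].
rewrite ger0_norm; nra.
Qed.

Lemma measure_fsupp_haar e k m : leb (fsupp (haar e k m : Rd -> C)) = (2 ^- (k * d))%:E.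
Proof.
have e0 : (0 : R) < 2 ^- k by rewrite invr_gt0 exprn_gt0.
rewrite fsupp_haar; etransitivity.
  by apply: (lebesgue_rV_box (A := fun i => `[2 ^- k * (m 0 i)%:~R, 2 ^- k * ((m 0 i)%:~R + 1)]%classic)).
rewrite (eq_bigr (fun=> (2 ^- k)%:E)) => [|i _].
  by rewrite prodEFin prodr_const card_ord -exprVn -exprM exprVn.
rewrite lebesgue_measure_itv /= lte_fin ifT ?ltr_pM2l ?ltrDl//.
by rewrite -EFinD -mulrBr addrAC subrr add0r mulr1.
Qed.

Definition inside z nu : Prop := forall i,
  (nu 0 i)%:~R <= 2 ^- hi_level z * (hi_pos z 0 i)%:~R :> R /\
  2 ^- hi_level z * ((hi_pos z 0 i)%:~R + 1) <= (nu 0 i)%:~R + 1 :> R.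

Lemma inside_five_fold z nu nu' : inside z nu -> (forall i, `|nu 0 i - nu' 0 i| <= 1) ->
  fsupp (haar_of z : Rd -> C) `<=` five_fold_cube nu'.
Proof.
move=> zn nn y; rewrite /haar_of fsupp_haar /five_fold_cube /= => hy i.
have := hy i; rewrite in_itv /=; have [h1 h2] := zn i.
have : `|(nu 0 i)%:~R - (nu' 0 i)%:~R| <= 1 :> R by rewrite -intrB -intr_norm (_ : 1 = 1%:~R)// ler_int.
by rewrite !ler_norml; lra.
Qed.

Variable U : nat -> @haar_index d.
Hypothesis eU : enumeration U.
Hypothesis d0 : (0 < d)%N.

(** Admissibility compares Haar functions in neighbouring cubes; a chain of unit cubes
    compares those at a bounded distance. *)
Lemma admissible_chain (b : nat) :
  (forall nu n n', fsupp (haar_of (U n) : Rd -> C) `<=` five_fold_cube nu ->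
    fsupp (haar_of (U n') : Rd -> C) `<=` five_fold_cube nu ->
    ((2 ^+ (b * d))%:E * leb (fsupp (haar_of (U n')))
       <= leb (fsupp (haar_of (U n))))%E -> (n < n')%N) ->
  forall M n n' nu nu', inside (U n) nu -> inside (U n') nu' ->
  (forall i, (`|nu 0 i - nu' 0 i| <= M%:Z)) -> (hi_level (U n) + M.+1 * b <= hi_level (U n'))%N -> (n < n')%N.
Proof.
move=> adm; have vol n n' : (hi_level (U n) + b <= hi_level (U n'))%N ->
    ((2 ^+ (b * d))%:E * leb (fsupp (haar_of (U n'))) <= leb (fsupp (haar_of (U n))))%E.
  move=> h; rewrite !measure_fsupp_haar -EFinM lee_fin ler_pdivrMr ?exprn_gt0// mulrC.
  rewrite ler_pdivlMr ?exprn_gt0// -exprD ler_weXn2l ?ler1n// -mulnDl leq_mul2r; apply/orP; right; lia.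
elim=> [|M IH] n n' nu nu' hn hn' nn lev.
  apply: (adm nu'); last by apply: vol; move: lev; rewrite mul1n.
    by apply: inside_five_fold hn _ => i; apply: le_trans (nn i) _.
  by apply: inside_five_fold hn' _ => i; rewrite subrr normr0.
pose nu1 : Zd := \row_i (if nu 0 i < nu' 0 i then nu 0 i + 1 else if nu' 0 i < nu 0 i then nu 0 i - 1 else nu 0 i).
pose k := (hi_level (U n) + b)%N.
have [n1 hn1] : exists n1, U n1 = HaarIndex [ffun=> true] k (\row_i (2 ^+ k * nu1 0 i)).
  apply: (enum_onto eU); right => /=; apply/eqP => /ffunP/(_ (Ordinal d0)); by rewrite !ffunE.
have in1 : inside (U n1) nu1.
  move=> i; rewrite hn1 /= mxE intrM rmorphXn /= mulrDr mulKf ?expf_neq0// mulr1; split=> //.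
  by rewrite lerD2l invf_le1 ?exprn_gt0// exprn_ege1// ler1n.
apply: (@ltn_trans n1).
  apply: (adm nu).
  - by apply: inside_five_fold hn _ => i; rewrite subrr normr0.
  - apply: inside_five_fold in1 _ => i; rewrite mxE; case: (ltP (nu 0 i) (nu' 0 i)) => h1; first lia.
    by case: (ltP (nu' 0 i) (nu 0 i)) => h2; lia.
  - by apply: vol; rewrite hn1.
apply: IH in1 hn' _ _ => [i|]; last by move: lev; rewrite hn1 /k /= (mulSn M.+1); lia.
have := nn i; rewrite mxE; case: (ltP (nu 0 i) (nu' 0 i)) => h1; first lia.
by case: (ltP (nu' 0 i) (nu 0 i)) => h2; lia.
Qed.

Lemma inside_fl e k x : inside (HaarIndex e k (fl k x)) (fl 0 x).
Proof.
have p0 : (0 : R) < 2 ^+ k by rewrite exprn_gt0.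
move=> i /=; rewrite !mxE expr0 mul1r; have := floor_itv (x 0 i); have := floor_itv (2 ^+ k * x 0 i).
move: (Num.floor (x 0 i)) (Num.floor (2 ^+ k * x 0 i)) => a b; rewrite !intrD => /andP[b1 b2] /andP[a1 a2].
have E : (2 ^+ k)%:~R = 2 ^+ k :> R by rewrite rmorphXn.
have h1 : 2 ^+ k * a < b + 1.
  by rewrite -(ltr_int R) intrM intrD E; apply: le_lt_trans b2; rewrite ler_pM2l.
have h2 : b < 2 ^+ k * (a + 1).
  by rewrite -(ltr_int R) intrM intrD E; apply: le_lt_trans b1 _; rewrite ltr_pM2l.
split; rewrite mulrC.
  by rewrite ler_pdivlMr// mulrC -E -intrM ler_int; lia.
by rewrite ler_pdivrMr// mulrC -E -[b%:~R + 1](intrD _ b 1) -[a%:~R + 1](intrD _ a 1) -intrM ler_int; lia.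
Qed.

Definition in_box (r : R) x : Prop := forall i, `|x 0 i| <= r.

(** All supports that meet the box lie in unit cubes at bounded distance, so that
    [admissible_chain] applies with a uniform gap of levels. *)
Lemma near_order (r : R) : strongly_admissible R U -> exists B : nat, forall n n' x x',
  in_box r x -> in_box r x' -> hi_pos (U n) = fl (hi_level (U n)) x -> hi_pos (U n') = fl (hi_level (U n')) x' ->
  (hi_level (U n) + B <= hi_level (U n'))%N -> (n < n')%N.
Proof.
move=> [b adm]; pose M := ((Num.trunc (2 * r)).+1 + 1)%N.
exists (M.+1 * b)%N => n n' x x' hx hx' pn pn'.
apply: (admissible_chain adm (nu := fl 0 x) (nu' := fl 0 x')).
- by case: (U n) pn => e k m /= ->; exact: inside_fl.
- by case: (U n') pn' => e k m /= ->; exact: inside_fl.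
move=> i; rewrite !mxE expr0 !mul1r.
have := floor_itv (x 0 i); have := floor_itv (x' 0 i); have := hx i; have := hx' i.
have tr : 2 * r < ((Num.trunc (2 * r)).+1%:Z)%:~R by exact: truncnS_gt.
rewrite !ler_norml !intrD -!(ler_int R) !intrB !intrN /M PoszD intrD /= => *; lra.
Qed.

End admissible.

(** * Haar coefficients of bounded functions *)

Section haar_smoothing.
Context {R : realType} {d : nat}.
Local Notation C := R[i].
Local Notation Rd := 'rV[R]_d.
Local Notation Zd := 'rV[int]_d.
Implicit Types (x y : Rd) (m : Zd) (e : {ffun 'I_d -> bool}).
Variable T : nat -> R -> R.
Hypothesis HT : smooth_step T.

(** Smooth approximations of the indicator function of the half-line below [b]. *)
Let below (n : nat) (b t : R) : R := T 0 (n%:R * (t - b) + 1 / 2).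

Let smooth_haar1 (n : nat) (c : bool) (t : R) : R :=
  if c then 2 * below n (1 / 2) t - below n 0 t - below n 1 t else below n 1 t - below n 0 t.

Lemma below_right n b t : b <= t -> below n b t = 0.
Proof. by move=> bt; apply: (step_right HT); rewrite lerDr mulr_ge0// subr_ge0. Qed.

Lemma below_left b t : t < b -> exists N, forall n, (N <= n)%N -> below n b t = 1.
Proof.
move=> tb; have h0 : 0 < b - t by rewrite subr_gt0.
exists (Num.trunc (b - t)^-1).+1 => n Nn; apply: (step_left HT).
have : (b - t)^-1 <= n%:R by apply: le_trans (ltW (truncnS_gt _)) _; rewrite ler_nat.
by rewrite -[_^-1]mul1r ler_pdivrMr//; lra.
Qed.

Lemma smooth_haar1_eventually c t : exists N, forall n, (N <= n)%N -> smooth_haar1 n c t = haar1 c t.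
Proof.
have below_cvg b : exists N, forall n, (N <= n)%N -> below n b t = if t < b then 1 else 0.
  case: (ltP t b) => tb; first exact: below_left.
  by exists 0%N => n _; exact: below_right.
have [[N1 h1] [N2 h2] [N3 h3]] := And3 (below_cvg 0) (below_cvg (1 / 2)) (below_cvg 1).
exists (maxn N1 (maxn N2 N3)) => n; rewrite !geq_max => /and3P[n1 n2 n3].
rewrite /smooth_haar1 h1// h2// h3// /haar1 !indicE !mem_setE !in_itv /=.
have [a1|a1] := ltP t 0; have [a2|a2] := ltP t (1 / 2); have [a3|a3] := ltP t 1; case: c => /=; lra.
Qed.

Lemma smooth_haar1_out n c t : 1 < `|t| -> (0 < n)%N -> smooth_haar1 n c t = 0.
Proof.
move=> ht n0; have n1 : 1 <= n%:R :> R by rewrite ler1n.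
have [t1|t1] := leP 1 t.
  by rewrite /smooth_haar1 !below_right; try lra; case: c; lra.
have {ht}t0 : t < - 1 by move: ht; rewrite lter_normr; case/orP; lra.
have E b : 0 <= b -> below n b t = 1.
  move=> b0; apply: (step_left HT); have : t - b <= -1 by lra.
  by move: (t - b) => u; nra.
by rewrite /smooth_haar1 !E; try lra; case: c; lra.
Qed.

Lemma smooth_haar1_bounded : exists2 B : R, 0 <= B & forall n c t, `|smooth_haar1 n c t| <= B.
Proof.
have [B B0 hB] := step_bounded HT 0; exists (4 * B) => [|n c t]; first by rewrite mulr_ge0.
have := hB (n%:R * (t - 0) + 1 / 2); have := hB (n%:R * (t - 1) + 1 / 2); have := hB (n%:R * (t - 1 / 2) + 1 / 2).
by rewrite /smooth_haar1 /below !ler_norml; case: c; lra.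
Qed.

(** Smooth half-lines in the one-dimensional factors give test functions that approximate the
    Haar functions from a fixed compact set. *)
Definition smooth_haar (n : nat) e k m x : C :=
  (\prod_i smooth_haar1 n.+1 (e i) (2 ^+ k * x 0 i - (m 0 i)%:~R))%:C%C.

Lemma smooth_haar_out n e k m x : `|grid k m : Rd| + 1 < `|x| -> smooth_haar n e k m x = 0.
Proof.
move=> hx; have [i hi] : exists i, 1 < `|x 0 i - grid k m 0 i|.
  apply: contrapT => h; move: hx; rewrite ltNge => /negP; apply.
  rewrite -[x in leLHS](subrK (grid k m)) addrC; apply: le_trans (ler_normD _ _) _; rewrite lerD2l.
  apply: norm_le => // i; rewrite !mxE leNgt; apply/negP => hi; apply: h; exists i.
  by move: hi; rewrite !mxE.
rewrite /smooth_haar (bigD1 i)//= smooth_haar1_out ?mul0r//.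
have p0 : (0 : R) < 2 ^+ k by rewrite exprn_gt0.
have -> : 2 ^+ k * x 0 i - (m 0 i)%:~R = 2 ^+ k * (x 0 i - grid k m 0 i).
  by rewrite mxE mulrBr mulVKf// gt_eqF.
rewrite normrM gtr0_norm//; apply: (lt_le_trans hi); by rewrite ler_peMl// exprn_ege1// ler1n.
Qed.

Lemma test_smooth_haar n e k m : test_function (smooth_haar n e k m).
Proof.
apply/test_functionP; split; last first.
  by exists (`|grid k m : Rd| + 1) => [|x /smooth_haar_out //]; rewrite ltr_wpDl.
pose S b i : Rd -> C := step_coord T (n.+1%:R * 2 ^+ k) (n.+1%:R * (- (m 0 i)%:~R - b) + 1 / 2) i.
have sS b i : smooth (S b i) by exact: (smooth_step_coord HT).
have SE b i x : S b i x = (below n.+1 b (2 ^+ k * x 0 i - (m 0 i)%:~R))%:C%C.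
  by rewrite /S step_coordE /below; congr ((T _ _)%:C)%C; ring.
pose F i x : C := if e i then 2%:R * S (1 / 2) i x - S 0 i x - S 1 i x else S 1 i x - S 0 i x.
rewrite (_ : smooth_haar n e k m = fun x => \prod_i F i x).
  apply: smooth_prod => i; rewrite /F; case: (e i); last exact: smoothB.
  by apply: smoothB => //; apply: smoothB => //; exact: smoothZ.
apply/funext => x; rewrite /smooth_haar rmorph_prod; apply: eq_bigr => i _.
by rewrite /F /smooth_haar1; case: (e i); rewrite !SE !rmorphB // rmorphM rmorph_nat.
Qed.

Lemma smooth_haar_bounded : exists2 B : R, 0 <= B & forall n e k m x, cabs (smooth_haar n e k m x) <= B.
Proof.
have [B B0 hB] := smooth_haar1_bounded; exists (B ^+ d) => [|n e k m x]; first exact: exprn_ge0.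
rewrite /smooth_haar cabs_real normr_prod -[X in B ^+ X](card_ord d) -prodr_const.
by apply: ler_prod => i _; rewrite normr_ge0 hB.
Qed.

Lemma smooth_haar_cvg e k m x : null (fun n => cabs (smooth_haar n e k m x - haar e k m x)).
Proof.
have /choice[N hN] := fun i => smooth_haar1_eventually (e i) (2 ^+ k * x 0 i - (m 0 i)%:~R).
apply: null_le (nullZ (lexx 0) (@null_exp2 R)); exists (\max_i N i)%N => n Nn.
rewrite mul0r /smooth_haar /haar (eq_bigr (fun i => haar1 (e i) (2 ^+ k * x 0 i - (m 0 i)%:~R))) ?subrr ?cabs0//.
by move=> i _; apply: hN; apply: leq_trans (leqW Nn); exact: leq_bigmax.
Qed.

End haar_smoothing.

Section coefficients.
Context {R : realType} {d : nat}.
Local Notation C := R[i].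
Local Notation Rd := 'rV[R]_d.
Local Notation Zd := 'rV[int]_d.
Local Notation leb := (@lebesgue_rV R d).
Implicit Types (f g : Rd -> C) (x y : Rd) (u : distr R d) (m : Zd) (z : @haar_index d).
Variable eta : Rd -> C.
Hypothesis He : lp_cutoff eta.
Hypothesis d0 : (0 < d)%N.

Lemma majorant_cint (w : Rd -> R) : measurable_fun setT w -> (forall x, 0 <= w x) ->
  cintble (fun x => (w x)%:C%C) -> majorant w (cabs (cint setT (fun x => (w x)%:C%C))).
Proof.
move=> mw w0 [iw _]; split=> //.
rewrite -[leLHS]fineK; last exact: (integrable_fin_num measurableT iw).
rewrite lee_fin; apply: (le_trans (ler_norm _)).
exact: (Re_le_cabs (cint setT (fun x => (w x)%:C%C))).
Qed.

Lemma tempered_bounded g (A : R) : cmeas g -> 0 <= A -> (forall x, cabs (g x) <= A) -> tempered (dist_of g).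
Proof.
move=> mg A0 hA; have bound f B : schwartz f -> sbound (2 * d) f B -> forall x, cabs (g x * f x) <= A * B * wt x.
  move=> sf hf x; rewrite cabsM -mulrA; apply: ler_pM; [exact: cabs_ge0|exact: cabs_ge0|exact: hA|].
  have B0 := sbound_ge0 hf; apply: (@le_trans _ _ (B * br x ^- (2 * d))); last by rewrite ler_wpM2l// bracket_wt.
  by rewrite ler_pdivlMr ?exprn_gt0 ?br_gt0// mulrC; have := hf [::] x (leq0n _); rewrite cpderiv_nil.
have ig f : schwartz f -> cintble (fun x => g x * f x).
  move=> sf; have [B B0 hf] := schwartz_sbound (2 * d) sf.
  apply: (cintble_wt (mulr_ge0 A0 B0)); last exact: bound.
  by apply: cmeasM => //; exact: schwartz_cmeas.
apply/temperedP; split=> [a f h sf sh|].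
  rewrite /dist_of -(cintZ a (ig _ sf)) -(cintD (cintbleZ a (ig _ sf)) (ig _ sh)).
  by apply: eq_cint => x; rewrite mulrDr mulrCA.
exists (A * pi ^+ d), (2 * d)%N; split; first by rewrite mulr_ge0// exprn_ge0// pi_ge0.
move=> f B sf hf; have AB : 0 <= A * B by rewrite mulr_ge0// (sbound_ge0 hf).
rewrite mulrAC; apply: (cabs_cint_le _ (majorantZ AB (@majorant_wt0 R d)) (bound f B sf hf)).
by apply: cmeasM => //; exact: schwartz_cmeas.
Qed.

(** The kernels [low_kernel J] are bounded in [L^1], being dilates of one function. *)
Lemma low_blocks_bounded : exists2 B : R, 0 <= B & forall g (A : R) J y, cmeas g -> 0 <= A ->
  (forall x, cabs (g x) <= A) -> cabs (\sum_(k < J.+1) blockf eta (dist_of g) k y) <= B * A.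
Proof.
have [B B0 hB] := dilate_decay (2 * d) (test_eta He).
have P0 : 0 <= (pi : R) ^+ d by rewrite exprn_ge0// pi_ge0.
exists (B * pi ^+ d) => [|g A J y mg A0 hA]; first by rewrite mulr_ge0.
rewrite (blockf_sum He _ _ (tempered_bounded mg A0 hA)).
have AB : 0 <= A * B by rewrite mulr_ge0.
rewrite mulrC mulrA; apply: (cabs_cint_le _ (majorantZ AB (majorant_wt y (exp2_gt0 J)))).
  by apply: cmeasM => //; exact/schwartz_cmeas/schwartz_shift/(schwartz_low_kernel He).
move=> x; rewrite cabsM -!mulrA; apply: ler_pM; [exact: cabs_ge0|exact: cabs_ge0|exact: hA|].
apply: le_trans (hB _ _ (exp2_gt0 J)) _; rewrite -mulrA ler_wpM2l// ler_wpM2l ?exprn_ge0 ?(ltW (exp2_gt0 _))//.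
exact: bracket_wt.
Qed.

(** The Haar functions are limits in [L^1] of test functions, for which [block_sum] gives
    convergence, and the partial sums of the blocks are uniformly bounded. *)
Lemma haar_coef_cvg g (A : R) e k m : cmeas g -> 0 <= A -> (forall x, cabs (g x) <= A) ->
  null (fun J => cabs (\sum_(j < J.+1) pairing (blockf eta (dist_of g) j) (haar e k m) - pairing g (haar e k m))).
Proof.
move=> mg A0 hA; have [T HT] := exists_smooth_step d0 He.
have [B B0 hB] := low_blocks_bounded; have [H H0 hH] := smooth_haar_bounded HT (d := d).
have tg := tempered_bounded mg A0 hA.
pose phi n := smooth_haar T n e k m; pose h : Rd -> C := haar e k m.
pose r := `|grid k m : Rd| + 1.
have hout x : r < `|x| -> h x = 0 by exact: haar_outside.
have mh : cmeas h by exact: cmeas_haar.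
have sphi n : schwartz (phi n) by exact/test_schwartz/(test_smooth_haar HT).
have [M M0 [w0 maj hw0]] := @majorant_supported R d r.
have supported f (K : R) : cmeas f -> 0 <= K -> (forall x, cabs (f x) <= K) ->
    (forall x, r < `|x| -> f x = 0) -> forall x, cabs (f x) <= K * w0 x.
  move=> mf K0 fK fr x; have [xr|xr] := leP `|x| r.
    by apply: le_trans (fK x) _; rewrite ler_peMr//; have := hw0 x; rewrite xr.
  by rewrite fr// cabs0 mulr_ge0//; case: maj.
have H1 : 0 <= H + 1 by exact: addr_ge0.
have hphi x n : cabs (phi n x - h x) <= (H + 1) * w0 x.
  apply: (supported (fun y => phi n y - h y)) => //.
  - by apply: cmeasD; [exact: schwartz_cmeas|exact: cmeasN].
  - by move=> y; apply: le_trans (cabsB _ _) _; apply: lerD; [exact: hH|exact: cabs_haar_le1].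
  - by move=> y hy; rewrite hout// /phi (smooth_haar_out HT)// subrr.
pose w n x := cabs (phi n x - h x).
have mw n : measurable_fun setT (w n).
  by apply: measurable_cabs; apply: cmeasD; [exact: schwartz_cmeas|exact: cmeasN].
have wcvg : null (fun n => cabs (cint setT (fun x => (w n x)%:C%C) - cint setT (fun _ : Rd => 0 : C))).
  apply: (cint_dominated _ _ (majorantZ H1 maj)).
  - by move=> n; exact: cmeas_real.
  - exact: cmeas_cst.
  - by move=> n x; rewrite cabs_real ger0_norm ?cabs_ge0//; exact: hphi.
  - apply: aeW => x; have := smooth_haar_cvg HT e k m x; congr null; apply/funext => n.
    by rewrite subr0 cabs_real ger0_norm ?cabs_ge0.
have majw n : majorant (w n) (cabs (cint setT (fun x => (w n x)%:C%C))).
  apply: majorant_cint => // [x|]; first exact: cabs_ge0.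
  apply: (cintble_majorant _ (majorantZ H1 maj)); first exact: cmeas_real.
  by move=> x; rewrite cabs_real ger0_norm ?cabs_ge0//; exact: hphi.
pose F J y := \sum_(j < J.+1) blockf eta (dist_of g) j y.
have mF J : cmeas (F J) by apply: cmeas_sum => j; exact/ccont_cmeas/ccont_blockf.
have D0 : 0 <= B * A + A by rewrite addr_ge0// mulr_ge0.
have hD J y : cabs (F J y - g y) <= B * A + A.
  by apply: le_trans (cabsB _ _) _; apply: lerD; [exact: hB|exact: hA].
have iD J f (K : R) : cmeas f -> 0 <= K -> (forall x, cabs (f x) <= K * w0 x) -> cintble (fun y => (F J y - g y) * f y).
  move=> mf K0 hf; apply: (cintble_majorant _ (majorantZ (mulr_ge0 D0 K0) maj)).
    by apply: cmeasM => //; apply: cmeasD => //; exact: cmeasN.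
  move=> x; rewrite cabsM -mulrA; apply: ler_pM; [exact: cabs_ge0|exact: cabs_ge0|exact: hD|exact: hf].
have lb j : loc_integrable (blockf eta (dist_of g) j) by exact: (ccont_loc_integrable He d0 (ccont_blockf He j tg)).
have hh x : cabs (h x) <= 1 * w0 x by apply: (supported h) => // y; exact: cabs_haar_le1.
have hph n x : cabs (phi n x) <= H * w0 x.
  by apply: (supported (phi n)) => [|//|y|y hy]; [exact: schwartz_cmeas|exact: hH|exact: (smooth_haar_out HT)].
have ig f (K : R) : cmeas f -> 0 <= K -> (forall x, cabs (f x) <= K * w0 x) -> cintble (fun y => g y * f y).
  move=> mf K0 hf; apply: (cintble_majorant _ (majorantZ (mulr_ge0 A0 K0) maj)).
    exact: cmeasM.
  move=> x; rewrite cabsM -mulrA; apply: ler_pM; [exact: cabs_ge0|exact: cabs_ge0|exact: hA|exact: hf].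
have split_sum J f : (forall j, cintble (fun y => blockf eta (dist_of g) j y * f y)) -> cintble (fun y => g y * f y) ->
    \sum_(j < J.+1) cint setT (fun y => blockf eta (dist_of g) j y * f y) - cint setT (fun y => g y * f y) =
    cint setT (fun y => (F J y - g y) * f y).
  move=> h1 h2; have h3 : forall j : 'I_J.+1, cintble (fun y => blockf eta (dist_of g) j y * f y) by move=> j; exact: h1.
  rewrite -(cint_sum _ _ h3) -(cintB (cintble_sum _ _ h3) h2).
  by apply: eq_cint => y; rewrite mulrBl mulr_suml.
move=> eps eps0.
(* half of [eps] for the smoothing of the Haar function, half for the convergence on the
   smooth function *)
have e2 : 0 < eps / 2 / (B * A + A + 1) by rewrite !divr_gt0// ltr_wpDl.
have [n0 /(_ n0 (leqnn _))] := wcvg _ e2; rewrite cint0 subr0 => hn.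
have [J0 hJ0] := block_sum He d0 tg (sphi n0) (divr_gt0 eps0 (ltr0n _ 2)).
exists J0 => J /hJ0; rewrite /pairing.
rewrite (split_sum J h); [|by move=> j; exact: cintble_haar|exact: ig hh].
have -> : dist_of g (phi n0) = cint setT (fun y => g y * phi n0 y) by [].
rewrite (split_sum J (phi n0)); [|by move=> j; exact: (blockf_cintble He j tg (sphi n0))|exact: (ig _ _ (schwartz_cmeas (sphi n0)) H0 (hph n0))].
move=> hJ; have i1 := iD J _ _ (schwartz_cmeas (sphi n0)) H0 (hph n0).
have i2 := iD J _ _ mh ler01 hh.
rewrite -[X in cabs X](subrK (cint setT (fun y => (F J y - g y) * phi n0 y))).
apply: le_trans (cabsD _ _) _; rewrite [leRHS](splitr eps); apply: lerD => //.
rewrite -(cintB i2 i1).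
apply: (@le_trans _ _ ((B * A + A) * cabs (cint setT (fun x => (w n0 x)%:C%C)))).
  apply: (cabs_cint_le _ (majorantZ D0 (majw n0))).
    have mD : cmeas (fun x => F J x - g x) by apply: cmeasD; [exact: mF|exact: cmeasN].
    apply: cmeasD; first exact: cmeasM.
    by apply: cmeasN; apply: cmeasM => //; exact: schwartz_cmeas.
  move=> y; rewrite -mulrBr cabsM /w cabsBC; apply: ler_wpM2r; [exact: cabs_ge0|exact: hD].
move: hn; rewrite ler_pdivlMr ?ltr_wpDl// => hn; apply: le_trans hn.
by rewrite mulrC ler_wpM2l ?cabs_ge0// lerDl.
Qed.

End coefficients.

(** * Haar coefficients far from the support *)

Section supports.
Context {R : realType} {d : nat}.
Local Notation C := R[i].
Local Notation Rd := 'rV[R]_d.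
Local Notation Zd := 'rV[int]_d.
Local Notation leb := (@lebesgue_rV R d).
Implicit Types (f g : Rd -> C) (c x y : Rd) (u : distr R d) (m : Zd).
Variable eta : Rd -> C.
Hypothesis He : lp_cutoff eta.
Hypothesis d0 : (0 < d)%N.

(** A distribution vanishes off its support: cut the test function into pieces supported in
    small cubes. *)
Lemma dsupp_test u g : tempered u -> test_function g -> (forall x, fsupp g x -> ~ dsupp u x) -> u g = 0.
Proof.
move=> tu tg gu; have [T HT] := exists_smooth_step d0 He; have [sg kg] := tg.
pose P x (r : R) := plateau T (2 / r) (r / 4) x.
have tP x r : 0 < r -> test_function (P x r) by move=> r0; apply: (test_plateau HT); rewrite divr_gt0.
have local x : exists r : R, 0 < r /\ (fsupp g x -> forall f, test_function f -> u (fun y => f y * P x r y) = 0).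
  have [gx|gx] := pselect (fsupp g x); last by exists 1.
  have [V [oV Vx hV]] : exists V : set Rd, [/\ open V, V x & forall f, test_function f -> fsupp f `<=` V -> u f = 0].
    apply: contrapT => h; apply: (gu x gx) => V oV Vx; apply: contrapT => hf; apply: h; exists V; split=> // f tf fV.
    by apply/eqP; apply: contrapT => /negP uf; apply: hf; exists f.
  have /nbhs_ballP[r /= r0 hr] : nbhs x V by exact: open_nbhs_nbhs.
  exists r; split=> // _ f tf; apply: hV; first exact: testM (test_smooth tf) (tP x r r0).
  move=> y hy; apply: hr; have r4 : 0 < r / 4 by rewrite divr_gt0.
  have [z [/= hz]] := hy _ (nbhsx_ballx y _ r4); rewrite -!ball_normE /= => yz.
  have xz : `|x - z| <= r / 2.
    apply: norm_le => [|i]; first by rewrite ltW// divr_gt0.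
    rewrite leNgt; apply/negP => hi; move/eqP: hz; apply.
    rewrite /P (plateau0 HT (j := i)) ?mulr0 ?divr_gt0//.
    by move: hi; rewrite !mxE invf_div distrC; lra.
  rewrite -[x](subrK z) -addrA; apply: le_lt_trans (ler_normD _ _) _.
  by move: yz; rewrite distrC; lra.
have /choice[r hr] := local.
have : compact (fsupp g) by [].
rewrite compact_cover => /(_ _ (fsupp g) (fun x => (ball x (r x / 4))^°)) [] => [x _|x gx|D DK cov].
- exact: open_interior.
- exists x => //; apply: nbhsx_ballx; rewrite divr_gt0//; by have [] := hr x.
(* one plateau after the other is split off; what remains is multiplied by the product *)
have kill (s : seq Rd) f : (forall x, x \in s -> fsupp g x) -> test_function f ->
    (forall y, f y * \prod_(x <- s) (1 - P x (r x) y) = 0) -> u f = 0.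
  elim: s f => [|x s IH] f sK tf hf.
    by rewrite -[RHS](tempered0 tu); congr u; apply/funext => y; rewrite -[LHS]mulr1 -[RHS](hf y) big_nil.
  have [rx0 hx] := hr x; have tfP := testM (test_smooth tf) (tP x _ rx0).
  have sub := tempered_sub tu (test_schwartz tf) (test_schwartz tfP).
  have xK : fsupp g x by apply: sK; rewrite inE eqxx.
  rewrite (hx xK f tf) subr0 in sub; rewrite -sub; apply: IH.
  - by move=> y ys; apply: sK; rewrite inE ys orbT.
  - exact: testB.
  - move=> y; have -> : f y - f y * P x (r x) y = f y * (1 - P x (r x) y) by rewrite mulrBr mulr1.
    by rewrite -[RHS](hf y) big_cons mulrA.
apply: (kill (finmap.enum_fset D) g) => // [x xD|y]; first by have := DK x xD; rewrite inE.
have [->|gy] := eqVneq (g y) 0; first by rewrite mul0r.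
have Ky : fsupp g y by apply: subset_closure.
have [x /= xD hx] := cov y Ky; rewrite (big_rem x)//= (_ : P x (r x) y = 1) ?subrr ?mul0r ?mulr0//.
have [rx0 _] := hr x; apply: (plateau1 HT); first by rewrite divr_gt0.
move=> j; have := interior_subset hx; rewrite -ball_normE /= distrC => /ltW.
by apply: le_trans; have := coord_le (y - x) j; rewrite !mxE.
Qed.

(** Cutting off at radius [2^n] costs a factor [2^-n] in each Schwartz seminorm. *)
Lemma truncation u g : tempered u -> schwartz g -> (forall f, test_function f -> u (fun x => f x * g x) = 0) -> u g = 0.
Proof.
move=> tu sg hu; have [T HT] := exists_smooth_step d0 He.
pose P n := plateau T 1 (2 ^+ n) (0 : Rd).
have tP n : test_function (P n) by exact: (test_plateau HT).
have sm1 n : smooth (fun x => 1 - P n x) by apply: smoothB; [exact: smooth_cst|exact: (smooth_plateau HT)].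
have sgP n : schwartz (fun x => P n x * g x) by exact/test_schwartz/testMr/schwartz_smooth.
suff : null (fun n => cabs (u (fun x => g x - P n x * g x))).
  move=> h; apply: cabs_eq0; apply: null_eq0; first exact: cabs_ge0.
  apply: null_le h; exists 0%N => n _; rewrite (tempered_sub tu sg (sgP n)) hu ?subr0//; exact: tP.
apply: tempered_null => // [n|k]; first exact: schwartzB.
have [A A0 hA] := plateau_bound HT (d := d) 1 k; have [B B0 hB] := schwartz_sbound k.+1 sg.
exists (2 ^+ k * ((1 + A) * B)) => [|n l x lk]; first by rewrite !mulr_ge0// ?addr_ge0// exprn_ge0.
have K0 : 0 <= 2 ^+ k * ((1 + A) * B) * 2 ^- n.
  by rewrite !mulr_ge0 ?addr_ge0 ?exprn_ge0// invr_ge0 exprn_ge0.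
have E : (fun x => g x - P n x * g x) = fun x => (1 - P n x) * g x.
  by apply/funext => y; rewrite mulrBl mul1r.
rewrite E; have sE : smooth (fun x => (1 - P n x) * g x) by exact: smoothM (sm1 n) (schwartz_smooth sg).
have [xn|xn] := ltP `|x| (2 ^+ n).
  rewrite (@cpderiv_local_zero R d _ [set y | `|y| < 2 ^+ n]) ?cabs0 ?mulr0//.
    apply: (@open_comp _ _ (fun y : Rd => `|y|) [set t | t < 2 ^+ n]); last exact: open_lt.
    by move=> y _; exact: norm_continuous.
  move=> y /= hy; rewrite /P (plateau1 HT) ?subrr ?mul0r// => j.
  by rewrite mxE subr0; exact: le_trans (coord_le y j) (ltW hy).
have brn : 2 ^+ n <= br x by apply: le_trans xn _; rewrite lerDr.
have bx := br_gt0 x.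
have h1 l' : (size l' <= k)%N -> cabs (cpderiv l' (fun x => 1 - P n x) x) <= 1 + A.
  move=> lk'; rewrite (cpderivB _ _ (smooth_cst _) (smooth_plateau HT _ _ _)).
  apply: le_trans (cabsB _ _) _; apply: lerD; last exact: hA.
  by rewrite cpderiv_cst; case: (l') => [|? ?]; rewrite ?cabs1 ?cabs0.
have h2 l' : (size l' <= k)%N -> cabs (cpderiv l' g x) <= B / br x ^+ k.+1.
  by move=> lk'; rewrite ler_pdivlMr ?exprn_gt0// mulrC; apply: hB; exact: leqW.
apply: (@le_trans _ _ (br x ^+ k * (2 ^+ k * ((1 + A) * (B / br x ^+ k.+1))))).
  rewrite ler_wpM2l ?exprn_ge0 ?(ltW bx)//; apply: le_trans (leibniz_bound (sm1 n) (schwartz_smooth sg) h1 h2 lk) _.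
  apply: ler_wpM2r; last by rewrite ler_weXn2l ?ler1n.
  by rewrite mulr_ge0 ?addr_ge0// mulr_ge0// invr_ge0 exprn_ge0// ltW.
rewrite [leLHS](_ : _ = 2 ^+ k * ((1 + A) * B) / br x); last first.
  by rewrite exprS; field; rewrite expf_neq0 gt_eqF.
rewrite ler_wpM2l ?mulr_ge0 ?addr_ge0 ?exprn_ge0// lef_pV2 ?posrE ?exp2_gt0//.
Qed.

(** By [truncation], from test functions to Schwartz functions; the margin makes the support of
    [g] disjoint from that of [u]. *)
Lemma dsupp_schwartz u c (r : R) g : tempered u -> dsupp u `<=` open_cube c r -> schwartz g ->
  (forall x, open_cube c (r + 1) x -> g x = 0) -> u g = 0.
Proof.
move=> tu uc sg gc; apply: truncation => // f tf; apply: dsupp_test => //.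
  exact: testMr tf (schwartz_smooth sg).
move=> x fx /uc ux; have [z [/= hz]] := fx _ (nbhsx_ballx x 1 ltr01); rewrite -ball_normE /= => xz.
move/eqP: hz; apply; rewrite gc ?mulr0// => i; have := ux i; have := le_lt_trans (coord_le _ i) xz.
by rewrite !mxE !ltr_norml; lra.
Qed.

(** A derivative of a dilated kernel costs a power of the dilation. *)
Lemma low_kernel_deriv k M : exists2 B : R, 0 <= B & forall J l x, (size l <= k)%N ->
  cabs (cpderiv l (low_kernel eta J) x) <= B * 2 ^+ (J * (d + k)) * br (2 ^+ J *: x) ^- M.
Proof.
have sF := schwartz_fourier (test_eta He); have [B B0 hB] := schwartz_sbound (maxn k M) sF.
exists B => // J l x lk; have p0 := exp2_gt0 (R := R) J.
have -> : low_kernel eta J = fun x => (2 ^+ (J * d))%:C%C * fourier eta (2 ^+ J *: x + 0).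
  apply/funext => y; rewrite /low_kernel fourier_dilate; [|by rewrite invr_gt0|exact: (test_eta He)].
  by rewrite invrK addr0 exprVn invrK -exprM.
have sa : smooth (fun x => fourier eta (2 ^+ J *: x + 0)).
  by have := smooth_affine (2 ^+ J) 0 (schwartz_smooth sF).
have E : (fun x : Rd => (2 ^+ (J * d))%:C%C * fourier eta (2 ^+ J *: x + 0)) =
    fun x => (2 ^+ (J * d))%:C%C * fourier eta (2 ^+ J *: x + 0) + 0 by apply/funext => y; rewrite [RHS]addr0.
rewrite E (cpderiv_lin _ _ _ sa (smooth_cst 0)) cpderiv_cst (_ : (if l is [::] then 0 else 0) = 0); last by case: (l).
rewrite addr0 (cpderiv_affine _ _ _ _ (schwartz_smooth sF)) addr0 !cabsM !cabs_real !ger0_norm ?exprn_ge0//.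
have h : cabs (cpderiv l (fourier eta) (2 ^+ J *: x)) <= B * br (2 ^+ J *: x) ^- M.
  rewrite ler_pdivlMr ?exprn_gt0 ?br_gt0// mulrC.
  apply: le_trans (hB l (2 ^+ J *: x) (leq_trans lk (leq_maxl _ _))).
  by rewrite ler_wpM2r ?cabs_ge0// br_le_exp// leq_maxr.
rewrite mulrA -exprM -exprD [leRHS]mulrAC [leRHS]mulrC; apply: ler_pM h; rewrite ?exprn_ge0 ?cabs_ge0//.
by rewrite ler_weXn2l ?ler1n// mulnDr leq_add2l leq_mul2l lk orbT.
Qed.

(** Only the values of the kernel near the support matter, at distance at least one from its
    centre, where it decays faster than any power of [2^-J]. *)
Lemma far_low_blocks u c (r : R) : 0 < r -> tempered u -> dsupp u `<=` open_cube c r ->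
  exists2 A : R, 0 <= A & forall J x i, r + 3 <= `|x 0 i - c 0 i| ->
    cabs (u (fun y => low_kernel eta J (y - x))) <= A * 2 ^- J.
Proof.
move=> r0 tu uc; have [T HT] := exists_smooth_step d0 He.
pose P := plateau T 1 (r + 1) c; have tP : test_function P by exact: (test_plateau HT).
have /temperedP[_ [cu [k [c0 hu]]]] := tu.
have [A A0 hA] := plateau_bound HT (d := d) 1 k; have [B B0 hB] := low_kernel_deriv k (d + k + 1).
pose W := 1 + (`|c| + (r + 2)); have W0 : 0 <= W by rewrite !addr_ge0// ltW.
have K0 : 0 <= W ^+ k * (2 ^+ k * (A * B)) by rewrite !mulr_ge0// exprn_ge0.
exists (cu * (W ^+ k * (2 ^+ k * (A * B)))) => [|J x i hx]; first exact: mulr_ge0.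
have sL := schwartz_shift x (schwartz_low_kernel He J).
pose L y := low_kernel eta J (y - x).
have sPL : schwartz (fun y => P y * L y) by apply/test_schwartz/testMr => //; exact: schwartz_smooth.
have -> : u L = u (fun y => P y * L y).
  apply/eqP; rewrite -subr_eq0 -(tempered_sub tu sL sPL); apply/eqP.
  apply: (dsupp_schwartz tu uc) => [|y hy]; first exact: schwartzB.
  by rewrite /P (plateau1 HT) ?mul1r ?subrr// => j; exact/ltW/hy.
rewrite -mulrA; apply: hu => // l y lk.
have [[j hj]|hy] := pselect (exists j, r + 3 / 2 < `|y 0 j - c 0 j|).
  rewrite (@cpderiv_local_zero R d _ [set y : Rd | r + 3 / 2 < `|y 0 j - c 0 j|]) ?cabs0 ?mulr0//.
  - by rewrite mulr_ge0// invr_ge0 exprn_ge0.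
  - exact: schwartz_smooth.
  - rewrite openE => z /= hz; apply/nbhs_ballP; exists (`|z 0 j - c 0 j| - (r + 3 / 2)); first by rewrite /= subr_gt0.
    move=> w; rewrite -ball_normE /= => zw; have := le_lt_trans (coord_le (z - w) j) zw.
    have := ler_normD (w 0 j - c 0 j) ((z - w) 0 j); rewrite !mxE.
    by rewrite (_ : w 0 j - c 0 j + (z 0 j - w 0 j) = z 0 j - c 0 j); [lra|ring].
  - by move=> z /= hz; rewrite /P (plateau0 HT (j := j)) ?mul0r//; move: hz; rewrite invr1; lra.
have {}hy j : `|y 0 j - c 0 j| <= r + 3 / 2 by rewrite leNgt; apply/negP => h; apply: hy; exists j.
have yW : br y <= W.
  rewrite /br /W lerD2l -[y in leLHS](subrK c) addrC; apply: le_trans (ler_normD _ _) _; rewrite lerD2l.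
  by apply: norm_le => [|j]; [lra|rewrite !mxE; have := hy j; lra].
have yx : 1 <= `|y - x|.
  apply: le_trans (coord_le _ i); rewrite !mxE; have := hy i; move: hx.
  rewrite lter_normr ler_norml ler_normr => /orP[h1|h1] /andP[h2 h3]; apply/orP; [right|left]; lra.
have h1 l' : (size l' <= k)%N -> cabs (cpderiv l' P y) <= A by exact: hA.
have h2 l' : (size l' <= k)%N -> cabs (cpderiv l' L y) <= B * 2 ^- J.
  move=> lk'; rewrite /L (cpderiv_shift _ _ _ (schwartz_smooth (schwartz_low_kernel He J))).
  apply: le_trans (hB J l' (y - x) lk') _; rewrite -mulrA ler_wpM2l//.
  have big : 2 ^+ J <= br (2 ^+ J *: (y - x)).
    by rewrite /br normrZ ger0_norm ?exprn_ge0// ler_wpDl// ler_peMr ?exprn_ge0.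
  rewrite ler_pdivrMr ?exprn_gt0 ?br_gt0// mulrC ler_pdivlMr ?exp2_gt0//.
  apply: le_trans (_ : (2 ^+ J) ^+ (d + k + 1) <= _); last by rewrite lerXn2r ?nnegrE ?exprn_ge0// ltW// br_gt0.
  by rewrite -exprM -exprD -mulnSr addn1.
rewrite -mulrA; apply: ler_pM; rewrite ?exprn_ge0 ?cabs_ge0 ?(ltW (br_gt0 _))//.
  by rewrite lerXn2r ?nnegrE// ltW// br_gt0.
have sLs : smooth L by exact: schwartz_smooth.
apply: le_trans (leibniz_bound (test_smooth tP) sLs h1 h2 lk) _.
rewrite !mulrA ler_wpM2r ?invr_ge0 ?exprn_ge0// -!mulrA ler_wpM2r ?mulr_ge0//.
by rewrite ler_weXn2l ?ler1n.
Qed.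

(** By [far_low_blocks], integrated against the Haar function. *)
Lemma far_haar_coef u c (r : R) e k m : 0 < r -> tempered u -> dsupp u `<=` open_cube c r ->
  (forall x, haar e k m x != 0 :> C -> exists i, r + 3 <= `|x 0 i - c 0 i|) ->
  null (fun J => cabs (\sum_(j < J.+1) pairing (blockf eta u j) (haar e k m))).
Proof.
move=> r0 tu uc far; have [A A0 hA] := far_low_blocks r0 tu uc.
have [M M0 [w0 maj hw0]] := haar_majorant e k m (R := R).
apply: null_le (nullZ (mulr_ge0 A0 M0) (@null_exp2 R)); exists 0%N => J _.
have lb j : loc_integrable (blockf eta u j) by exact: (ccont_loc_integrable He d0 (ccont_blockf He j tu)).
have ib : forall j : 'I_J.+1, cintble (fun y => blockf eta u j y * haar e k m y) by move=> j; exact: cintble_haar.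
rewrite /pairing -(cint_sum _ _ ib).
have AJ : 0 <= A * 2 ^- J by rewrite mulr_ge0// invr_ge0 exprn_ge0.
rewrite mulrAC; apply: (cabs_cint_le _ (majorantZ AJ maj)).
  apply: cmeas_sum => j; apply: cmeasM; [exact/ccont_cmeas/ccont_blockf|exact: cmeas_haar].
move=> y; rewrite -mulr_suml (blockf_sum He J y tu) cabsM.
have [_ w00 _] := maj.
have [->|hy] := eqVneq (haar e k m y : C) 0; first by rewrite cabs0 mulr0 mulr_ge0.
have [i hi] := far y hy; apply: ler_pM; [exact: cabs_ge0|exact: cabs_ge0|exact: hA hi|exact: hw0].
Qed.

End supports.

(** * Orthogonality of Haar functions and Haar polynomials *)

Section haar_moments.
Context {R : realType} {d : nat}.
Local Notation C := R[i].
Local Notation Rd := 'rV[R]_d.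
Local Notation Zd := 'rV[int]_d.
Local Notation Ed := {ffun 'I_d -> bool}.
Local Notation leb := (@lebesgue_rV R d).
Implicit Types (f g : Rd -> C) (x y : Rd) (m : Zd) (e : Ed) (k n L : nat) (z : @haar_index d) (a : Zd -> Ed -> C).

(** In a direction where it oscillates, a Haar function is the difference of two translates
    of its first half. *)
Lemma haar_mean0 e k m : e != haar0 -> cint setT (haar e k m : Rd -> C) = 0.
Proof.
move=> e0; have [i ei] : exists i, e i.
  apply: contrapT => h; move/eqP: e0; apply; apply/ffunP => i; rewrite ffunE.
  by apply/negbTE/negP => ei; apply: h; exists i.
pose part (j : int) x : C :=
  ((\prod_(l | l != i) half_value (e l) (fl k.+1 x 0 l - 2 * m 0 l)) * (fl k.+1 x 0 i - 2 * m 0 i == j)%:R : R)%:C%C.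
pose v : Rd := 2 ^- k.+1 *: delta_mx 0 i.
have p0 : (0 : R) < 2 ^+ k.+1 by rewrite exprn_gt0.
have flv x l : fl k.+1 (x - v) 0 l = fl k.+1 x 0 l - (l == i)%:R.
  apply/eqP; rewrite mxE floor_eq !mxE /= mulrBr mulVKf ?(gt_eqF p0)//.
  have := floor_itv (2 ^+ k.+1 * x 0 l); set w := Num.floor (2 ^+ k.+1 * x 0 l).
  by case: (l == i) => /=; rewrite !intrD ?rmorphN /=; lra.
have haarE x : haar e k m x = part 0 x - part 0 (x - v).
  have -> : part 0 (x - v) = part 1 x.
    rewrite /part; congr ((_ * _%:R)%:C)%C; last by rewrite flv eqxx; apply/eqP/eqP; lia.
    by apply: eq_bigr => l /negbTE li; rewrite flv li subr0.
  rewrite haar_fl (bigD1 i)//= /part -rmorphB /= -mulrBr mulrC; congr ((_ * _)%:C)%C.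
  rewrite /half_value ei; move: (_ - 2 * m 0 i) => w.
  by have [w0|w0] := eqVneq w 0; [rewrite w0 /=; lra|have [w1|w1] := eqVneq w 1; rewrite /=; lra].
have m1 : cmeas (part 0).
  exact: (cmeas_fl k.+1 (fun w : Zd => ((\prod_(l | l != i) half_value (e l) (w 0 l - 2 * m 0 l)) * (w 0 i - 2 * m 0 i == 0)%:R : R)%:C%C)).
have partE x : part 0 x = haar e k m x * (fl k.+1 x 0 i - 2 * m 0 i == 0)%:R.
  rewrite haar_fl (bigD1 i)//= /part ei /half_value.
  by have [w0|w0] := eqVneq (fl k.+1 x 0 i - 2 * m 0 i) 0; rewrite ?mulr0// !mulr1 mul1r.
have [M _ [w maj hw]] := haar_majorant e k m (R := R).
have i1 : cintble (part 0).
  apply: (cintble_majorant m1 maj) => x; apply: le_trans (hw x); rewrite partE cabsM.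
  by case: (_ == _); rewrite ?cabs1 ?cabs0 ?mulr1// mulr0 cabs_ge0.
have i2 : cintble (fun x => part 0 (x - v)) by exact: cintble_shift.
by rewrite (eq_cint haarE) (cintB i1 i2) (cint_shift (- v) i1) subrr.
Qed.

Lemma fl_half k x : fl k x = \row_i divz (fl k.+1 x 0 i) 2.
Proof. by apply/rowP => i; rewrite mxE; have := fl_succ k x i; lia. Qed.

Lemma cmeas_fl_succ k (h : Zd -> Zd -> C) : cmeas (fun x : Rd => h (fl k x) (fl k.+1 x)).
Proof.
have := @cmeas_fl R d k.+1 (fun w => h (\row_i divz (w 0 i) 2) w).
by congr cmeas; apply/funext => x; rewrite -fl_half.
Qed.

Lemma fl_coarse k n x y : (k <= n)%N -> fl n x = fl n y -> fl k x = fl k y.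
Proof.
move=> kn; rewrite -(subnKC kn); elim: (n - k)%N => [|j IH]; first by rewrite addn0.
by rewrite addnS => h; apply: IH; rewrite (fl_half _ x) (fl_half _ y) h.
Qed.

Lemma fl_close k x y : fl k x = fl k y -> `|x - y| <= 1.
Proof.
have p0 : (0 : R) < 2 ^+ k by rewrite exprn_gt0.
have k1 : 1 <= 2 ^+ k :> R by rewrite exprn_ege1// ler1n.
move=> h; apply: norm_le => // i; have := congr1 (fun w : Zd => w 0 i) h; rewrite !mxE => hi.
have := floor_itv (2 ^+ k * x 0 i); have := floor_itv (2 ^+ k * y 0 i); rewrite hi intrD => h1 h2.
apply: (@le_trans _ _ (2 ^+ k * `|x 0 i - y 0 i|)); first by rewrite ler_peMl.
by rewrite -{1}(gtr0_norm p0) -normrM mulrBr ler_norml; lra.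
Qed.

Lemma haar_term_meas e k f : cmeas (haar_term e k f).
Proof.
have := cmeas_fl_succ k (fun m w => haar_coef f (HaarIndex e k m) *
  (\prod_i half_value (e i) (w 0 i - 2 * m 0 i))%:C%C).
by congr cmeas; apply/funext => x; rewrite /haar_term haar_fl.
Qed.

Definition poly_growth f : Prop := cmeas f /\ exists n (A : R), 0 <= A /\ forall x, cabs (f x) <= A * br x ^+ n.

Lemma poly_growthD f g : poly_growth f -> poly_growth g -> poly_growth (fun x => f x + g x).
Proof.
move=> [mf [n [A [A0 hA]]]] [mg [n' [B [B0 hB]]]]; split; first exact: cmeasD.
exists (maxn n n'), (A + B); split; first exact: addr_ge0.
move=> x; apply: le_trans (cabsD _ _) _; rewrite mulrDl; apply: lerD.
  by apply: le_trans (hA x) _; rewrite ler_wpM2l// br_le_exp// leq_maxl.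
by apply: le_trans (hB x) _; rewrite ler_wpM2l// br_le_exp// leq_maxr.
Qed.

Lemma poly_growth_sum (I : Type) (s : seq I) (P : pred I) (F : I -> Rd -> C) : (forall i, poly_growth (F i)) ->
  poly_growth (fun x => \sum_(i <- s | P i) F i x).
Proof.
move=> gF; elim: s => [|i s IH].
  under eq_fun do rewrite big_nil; split; first exact: cmeas_cst.
  by exists 0%N, 0; split=> // x; rewrite cabs0 mul0r.
under eq_fun do rewrite big_cons; case: (P i) => //; exact: poly_growthD.
Qed.

Lemma poly_growthM f g (A : R) : cmeas g -> (forall x, cabs (g x) <= A) -> poly_growth f -> poly_growth (fun x => g x * f x).
Proof.
move=> mg hg [mf [n [B [B0 hB]]]]; have A0 : 0 <= A := le_trans (cabs_ge0 _) (hg 0).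
split; first exact: cmeasM.
exists n, (A * B); split; first exact: mulr_ge0.
by move=> x; rewrite cabsM -mulrA; apply: ler_pM; [exact: cabs_ge0|exact: cabs_ge0|exact: hg|exact: hB].
Qed.

Lemma poly_growth_cintble f g : poly_growth f -> schwartz g -> cintble (fun x => f x * g x).
Proof.
move=> [mf [n [A [A0 hA]]]] sg; have [B B0 hB] := schwartz_decay (n + 2 * d) sg.
apply: (cintble_wt (mulr_ge0 A0 B0)); first by apply: cmeasM => //; exact: schwartz_cmeas.
move=> x; rewrite cabsM; apply: le_trans (ler_pM (cabs_ge0 _) (cabs_ge0 _) (hA x) (hB x)) _.
by rewrite -!mulrA ler_wpM2l// mulrC; exact: br_wt.
Qed.

Lemma haar_term_growth e k f : poly_growth f -> poly_growth (haar_term e k f).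
Proof.
move=> [mf [n [A [A0 hA]]]]; split; first exact: haar_term_meas.
exists n, (A * 2 ^+ n); split => [|x]; first by rewrite mulr_ge0// exprn_ge0.
rewrite /haar_term cabsM -[leRHS]mulr1.
apply: ler_pM; [exact: cabs_ge0|exact: cabs_ge0| |exact: cabs_haar_le1].
have K0 : 0 <= A * 2 ^+ n * br x ^+ n by rewrite !mulr_ge0// exprn_ge0// ltW// br_gt0.
pose w (y : Rd) : R := (fl k y == fl k x)%:R.
have wE y : (w y)%:C%C = haar haar0 k (fl k x) y :> C by rewrite haar0E rmorph_nat.
have mw : measurable_fun setT w by exact: (measurable_fun_fl k (fun m => (m == fl k x)%:R : measurableTypeR R)).
have [M _ [w0 maj hw0]] := haar_majorant haar0 k (fl k x) (R := R).
have maw : majorant w (2 ^- (k * d)).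
  have E : cint setT (fun y => (w y)%:C%C) = (2 ^- (k * d))%:C%C.
    by rewrite -(pairing_haar0_cst k (fl k x)); apply: eq_cint => y; rewrite mul1r wE.
  have := majorant_cint mw; rewrite E cabs_real ger0_norm ?invr_ge0 ?exprn_ge0//; apply=> //.
  by apply: (cintble_majorant _ maj) => [|y]; [exact: cmeas_real|rewrite wE].
rewrite /haar_coef /= /haar_of /= cabsM (_ : 2 ^+ (k * d) = (2 ^+ (k * d))%:C%C); last by rewrite rmorphXn rmorph_nat.
rewrite cabs_real ger0_norm ?exprn_ge0// mulrC -ler_pdivlMr ?exp2_gt0//.
apply: (cabs_cint_le _ (majorantZ K0 maw)); first by apply: cmeasM => //; exact: cmeas_haar.
move=> y; rewrite /w; have [yx|/eqP yx] := eqVneq (fl k y) (fl k x); last by rewrite haar_out// mulr0 cabs0 mulr0.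
rewrite cabsM; apply: ler_pM; [exact: cabs_ge0|exact: cabs_ge0| |exact: cabs_haar_le1].
apply: le_trans (hA y) _; rewrite -mulrA ler_wpM2l// -exprMn lerXn2r ?nnegrE ?mulr_ge0 ?(ltW (br_gt0 _))//.
have := fl_close yx; have := ler_normD (y - x) x; rewrite subrK /br => h1 h2.
by have := normr_ge0 x; lra.
Qed.

(** On the support of the Haar function [g] is constant, and the Haar function has mean zero. *)
Lemma haar_coef_fine n e k m g : (forall x y, fl n x = fl n y -> g x = g y) -> (n <= k)%N -> e != haar0 ->
  haar_coef g (HaarIndex e k m) = 0.
Proof.
move=> gn nk e0; rewrite /haar_coef /pairing /haar_of /=.
pose w : Rd := grid k m.
have fw : fl k w = m.
  apply/dyadic_cubeE => i; rewrite mxE lexx /= ltr_pM2l ?invr_gt0 ?exprn_gt0//; lra.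
rewrite (eq_cint (g := fun y => g w * haar e k m y)).
  by rewrite (cintZ (g w) (haar_cintble e k m)) haar_mean0// !mulr0.
move=> y; have [ym|ym] := eqVneq (fl k y) m; last by rewrite haar_out ?mulr0//; exact/eqP.
by rewrite (gn y w)//; apply: fl_coarse nk _; rewrite ym fw.
Qed.

(** Averages of functions that are constant on the cubes of the generation. *)
Lemma expect_fixed n g x : (forall x y, fl n x = fl n y -> g x = g y) -> expect n g x = g x.
Proof.
move=> gn; rewrite expectE /haar_coef /pairing /haar_of /=.
have -> : cint setT (fun y => g y * haar haar0 n (fl n x) y) = cint setT (fun y => g x * haar haar0 n (fl n x) y).
  apply: eq_cint => y; have [yx|/eqP yx] := eqVneq (fl n y) (fl n x); first by rewrite (gn y x).
  by rewrite haar_out ?mulr0.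
rewrite (cintZ (g x) (haar_cintble haar0 n (fl n x))).
have -> : cint setT (haar haar0 n (fl n x)) = (2 ^- (n * d))%:C%C :> C.
  by rewrite -(pairing_haar0_cst n (fl n x)); apply: eq_cint => y; rewrite mul1r.
have -> : 2 ^+ (n * d) = (2 ^+ (n * d))%:C%C :> C by rewrite rmorphXn rmorph_nat.
by rewrite mulrCA -rmorphM /= mulfV ?expf_neq0// mulr1.
Qed.

End haar_moments.

Section haar_expansions_near.
Context {R : realType} {d : nat}.
Local Notation C := R[i].
Local Notation Rd := 'rV[R]_d.
Local Notation Zd := 'rV[int]_d.
Local Notation Ed := {ffun 'I_d -> bool}.
Implicit Types (f g : Rd -> C) (x y : Rd) (m : Zd) (e : Ed) (k n L : nat) (z : @haar_index d).
Variable U : nat -> @haar_index d.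
Hypothesis eU : enumeration U.
Local Arguments level_op : simpl never.
Hypothesis sU : strongly_admissible R U.
Hypothesis d0 : (0 < d)%N.

Lemma at_level_system L e m : at_level L e -> haar_system (HaarIndex e L.-1 m).
Proof. by case: L => [/eqP ->|L le]; [left|right]. Qed.

(** Inside a bounded box, an initial segment of the enumeration contains all Haar functions
    below some level and none from [B.+1] levels above on. *)
Lemma first_levels (r : R) : 0 <= r -> exists B : nat, forall n, exists N : nat,
  forall x L e, in_box r x -> at_level L e ->
    ((L < N)%N -> first_coef U n L (fl L.-1 x) e = 1 :> C) /\
    ((N + B < L)%N -> first_coef U n L (fl L.-1 x) e = 0 :> C).
Proof.
move=> r0; have [B hB] := near_order eU d0 r sU; exists B => n.
pose missing L := exists x e, [/\ in_box r x, at_level L e & forall i, (i < n)%N -> U i <> HaarIndex e L.-1 (fl L.-1 x)].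
have ex : exists L, `[< missing L >].
  pose K := (\max_(i < n) hi_level (U i)).+1; exists K.+1; apply/asboolP; exists 0, [ffun=> true]; split.
  - by move=> i; rewrite mxE normr0.
  - by apply/eqP => /ffunP/(_ (Ordinal d0)); rewrite !ffunE.
  move=> i ni Ui; have := leq_bigmax (F := fun i : 'I_n => hi_level (U i)) (Ordinal ni).
  by rewrite /= Ui /= ltnn.
have [N /asboolP[x0 [e0 [bx0 le0 miss]]] minN] := ex_minnP ex.
(* [N] is the lowest level with a missing index; by [near_order] this index precedes all
   indices of the box that lie more than [B] levels above *)
exists N => x L e bx le; split=> [LN|NL].
  have : ~ missing L by move=> /asboolP /minN; rewrite leqNgt LN.
  move=> h; have [i [ni Ui]] : exists i, (i < n)%N /\ U i = HaarIndex e L.-1 (fl L.-1 x).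
    by apply: contrapT => h'; apply: h; exists x, e; split=> // i ni Ui; apply: h'; exists i.
  exact: first_coef1 ni Ui.
apply: first_coef0 => i ni Ui.
have [n0 Un0] := enum_onto eU (at_level_system (fl N.-1 x0) le0).
have nn0 : (n <= n0)%N by rewrite leqNgt; apply/negP => /miss.
have : (n0 < i)%N.
  by apply: (hB _ _ x0 x) => //; rewrite ?Un0 ?Ui //=; lia.
by move=> /(leq_ltn_trans nn0); rewrite ltnNge (ltnW ni).
Qed.

(** On the levels that occur in [g], long partial sums contain all Haar functions near the
    support of [g], which gives [expect M g = g]; on the finer levels the coefficients of [g]
    vanish. *)
Lemma haar_span_reproduced g : haar_span g -> exists N0, forall n x, (N0 <= n)%N ->
  \sum_(i < n) haar_coef g (U i) * haar_of (U i) x = g x.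
Proof.
move=> [l [c [z [hz gE]]]].
have lg : loc_integrable g.
  rewrite gE => t; have [i1 i2] : cintble (fun x : Rd => \sum_(i < l) c i * haar_of (z i) x).
    by apply: cintble_sum => i; apply: cintbleZ; exact: haar_cintble.
  by split; apply: (integrableS measurableT) => //; exact: measurable_ball.
pose M := (\max_(i < l) hi_level (z i)).+1.
have gM x y : fl M x = fl M y -> g x = g y.
  move=> h; rewrite gE; apply: eq_bigr => i _; congr (_ * _); rewrite /haar_of !haar_fl.
  suff -> : fl (hi_level (z i)).+1 x = fl (hi_level (z i)).+1 y by [].
  by apply: fl_coarse h; rewrite ltnS; exact: (leq_bigmax (F := fun i : 'I_l => hi_level (z i))).
have [r r0 gr] : exists2 r : R, 0 <= r & forall x, r < `|x| -> g x = 0.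
  have /choice[r hr] : forall i, exists r : R, 0 <= r /\ forall x, r < `|x| -> haar_of (z i) x = 0 :> C.
    by move=> i; have [r r0 h] := haar_support (hi_type (z i)) (hi_level (z i)) (hi_pos (z i)) (R := R); exists r.
  exists (\sum_i r i) => [|x hx]; first by apply: sumr_ge0 => i _; have [] := hr i.
  rewrite gE big1// => i _; have [_ ->] := hr i; rewrite ?mulr0//; apply: le_lt_trans hx.
  by rewrite (bigD1 i)//= lerDl; apply: sumr_ge0 => j _; have [] := hr j.
have [B hB] := near_order eU d0 (r + 1) sU.
(* the position of one fine Haar function near the origin: all coarse ones of the box come
   earlier *)
have [N0 UN0] : exists N0, U N0 = HaarIndex [ffun=> true] (M + B) (fl (M + B) (0 : Rd)).
  by apply: (enum_onto eU); right => /=; apply/eqP => /ffunP/(_ (Ordinal d0)); rewrite !ffunE.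
exists N0 => n x Nn.
have [K hK] : exists K, forall i, (i < n)%N -> (hi_lev (U i) < K)%N.
  by exists (\max_(i < n) hi_lev (U i)).+1 => i ni; rewrite ltnS; exact: (leq_bigmax (F := fun i : 'I_n => hi_lev (U i)) (Ordinal ni)).
transitivity (partial_sum_op U n g x); first by [].
have {}hK i : (i < n)%N -> (hi_lev (U i) < M.+1 + K)%N by move=> /hK; lia.
rewrite (partial_sum_levels eU g x hK) big_split_ord /= [X in _ + X]big1 ?addr0; last first.
  move=> L _; rewrite level_opE big1// => e le; rewrite /haar_term (haar_coef_fine _ gM)//=; last exact: leq_addr.
  by rewrite mul0r mulr0.
have [xr|xr] := leP `|x| (r + 1); last first.
  rewrite gr; last by lra.
  rewrite big1// => L _; rewrite level_opE big1// => e le; rewrite /haar_term /haar_coef.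
  rewrite (_ : pairing g _ = 0) ?mulr0 ?mul0r ?mulr0// -[RHS](@cint0 R d); apply: eq_cint => y /=.
  have [yx|/eqP yx] := eqVneq (fl L.-1 y) (fl L.-1 x); last by rewrite /haar_of haar_out ?mulr0.
  rewrite gr ?mul0r//; have := fl_close yx; have := ler_normD (x - y) y; rewrite subrK distrC; lra.
rewrite -[RHS](expect_fixed x gM) (expect_levels _ _ lg); apply: eq_bigr => L _.
apply: level_op_local => e le.
have [i Ui] := enum_onto eU (at_level_system (fl L.-1 x) le).
apply: (first_coef1 eU _ Ui); apply: leq_trans Nn.
have bx : in_box (r + 1) x by move=> j; exact: le_trans (coord_le x j) xr.
apply: (hB _ _ x 0) => //; rewrite ?Ui ?UN0 //=.
  by move=> j; rewrite mxE normr0 addr_ge0.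
by rewrite leq_add2r; have := ltn_ord L; lia.
Qed.

End haar_expansions_near.

(** * Convergence in Besov spaces and values of operators *)

Section besov_convergence.
Context {R : realType} {d : nat}.
Local Notation C := R[i].
Local Notation Rd := 'rV[R]_d.
Implicit Types (u v w : distr R d) (V W : nat -> distr R d).
Variable eta : Rd -> C.
Hypothesis He : lp_cutoff eta.
Hypothesis d0 : (0 < d)%N.
Variables (s : R) (p q : \bar R).
Hypothesis p0 : (0 < p)%E.
Hypothesis q0 : (0 < q)%E.
Local Notation bes := (besov_le eta s p q).
Local Notation bnorm := (besov_norm eta s p q).

Definition same u v : Prop := forall f, schwartz f -> u f = v f.

Definition bnull V : Prop := forall e : R, 0 < e -> exists N, forall n, (N <= n)%N -> bes (V n) e.

(** Elements of norm zero play the role of zero, as functionals are not identified when they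
    agree on Schwartz functions. *)
Definition bzero v : Prop := forall e : R, 0 < e -> bes v e.

Lemma besov_norm_ge0 u : (0 <= bnorm u)%E.
Proof. by rewrite /besov_norm; case: asboolP => // _; exact: Lnorm_ge0. Qed.

Lemma besovP u : besov eta s p q u <-> exists2 B : R, 0 < B & bes u B.
Proof.
rewrite /besov /=; split=> [h|[B B0 h]].
  have f : bnorm u \is a fin_num by rewrite ge0_fin_numE// besov_norm_ge0.
  exists (fine (bnorm u) + 1); first by rewrite ltr_wpDl// fine_ge0// besov_norm_ge0.
  apply/(besov_leP He d0 s p0 q0); first by rewrite addr_ge0// fine_ge0// besov_norm_ge0.
  by rewrite EFinD fineK// leeDl// lee_fin.
by apply: (@le_lt_trans _ _ B%:E); [apply/(besov_leP He d0 s p0 q0) => //; exact: ltW|exact: ltry].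
Qed.

Lemma bnull_cvg V : bnull V <-> bnorm (V n) @[n --> \oo] --> 0%E.
Proof.
split=> [h|/fine_cvgP[/= fin /cvgrPdist_le h] e e0].
  apply/fine_cvgP; split.
    have [N hN] := h 1 ltr01; exists N => // n Nn; have := hN n Nn.
    move=> /(besov_leP He d0 s p0 q0 _ ler01) le1; rewrite ge0_fin_numE ?besov_norm_ge0//.
    exact: le_lt_trans le1 (ltry _).
  apply/cvgrPdist_le => e e0; have [N hN] := h e e0; exists N => // n Nn /=.
  have /(besov_leP He d0 s p0 q0 _ (ltW e0)) le1 := hN n Nn.
  have b0 := besov_norm_ge0 (V n).
  have fin : bnorm (V n) \is a fin_num by rewrite ge0_fin_numE//; exact: le_lt_trans le1 (ltry _).
  by rewrite sub0r normrN ger0_norm ?fine_ge0// -lee_fin fineK.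
have [N1 _ h1] := fin; have [N2 _ h2] := h e e0; exists (maxn N1 N2) => n; rewrite geq_max => /andP[n1 n2].
have b0 := besov_norm_ge0 (V n).
apply/(besov_leP He d0 s p0 q0 _ (ltW e0)); rewrite -(fineK (h1 n n1)) lee_fin.
by have := h2 n n2; rewrite /= sub0r normrN ger0_norm ?fine_ge0.
Qed.

Lemma bnull_same V W : (forall n, same (V n) (W n)) -> bnull V -> bnull W.
Proof. by move=> VW hV e /hV[N h]; exists N => n /h; apply: (besov_le_ext He); exact: VW. Qed.

Lemma bnullD V W : bnull V -> bnull W -> bnull (fun n => V n + W n).
Proof.
move=> hV hW; have [K K1 hK] := besov_leD He s p0 q0; have K0 : 0 < K by exact: lt_le_trans K1.
move=> e e0; have eK : 0 < e / K by rewrite divr_gt0.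
have [N1 h1] := hV _ eK; have [N2 h2] := hW _ eK; exists (maxn N1 N2) => n; rewrite geq_max => /andP[n1 n2].
by rewrite -(divfK (lt0r_neq0 K0) e) mulrC; apply: hK; [exact: ltW|exact: h1|exact: h2].
Qed.

Lemma bnullZ (c : C) V : bnull V -> bnull (fun n f => c * V n f).
Proof.
move=> hV e e0; have c0 : 0 < cabs c + 1 by rewrite ltr_wpDl// cabs_ge0.
have [N h] := hV (e / (cabs c + 1)) (divr_gt0 e0 c0); exists N => n /h hn.
apply: besov_le_weaken _ (besov_leZ He p0 q0 c (ltW (divr_gt0 e0 c0)) hn).
by rewrite mulrCA ler_piMr ?(ltW e0)// ler_pdivrMr// mul1r lerDl.
Qed.

Lemma bnull_dmul chi V : test_function chi -> bnull V -> bnull (fun n => dmul chi (V n)).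
Proof.
move=> tc hV; have [K K0 hK] := besov_multiplier He d0 s p0 q0 tc.
move=> e e0; have K1 : 0 < K + 1 by rewrite ltr_wpDl.
have eK := divr_gt0 e0 K1; have [N h] := hV _ eK; exists N => n /h hn.
apply: besov_le_weaken _ (hK _ _ (ltW eK) hn).
by rewrite mulrCA ler_piMr ?(ltW e0)// ler_pdivrMr// mul1r lerDl.
Qed.

Lemma bzero_null v : bzero v <-> bnull (fun=> v).
Proof. by split=> h e e0; [exists 0%N => n _; exact: h|have [N hN] := h e e0; exact: (hN N)]. Qed.

Lemma bzero_same v w : same v w -> bzero v -> bzero w.
Proof. by move=> vw hv e /hv; exact: (besov_le_ext He). Qed.

Lemma bzeroD v w : bzero v -> bzero w -> bzero (v + w).
Proof. by move=> /bzero_null hv /bzero_null hw; apply/bzero_null; exact: bnullD. Qed.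

Lemma bzeroN v : bzero v -> bzero (- v).
Proof.
move=> /bzero_null/(bnullZ (-1))/bzero_null; apply: bzero_same => f _; exact: mulN1r.
Qed.

Lemma bzero_trans v w u : bzero (v - w) -> bzero (w - u) -> bzero (v - u).
Proof.
move=> h1 h2; apply: bzero_same (bzeroD h1 h2) => f _.
by rewrite -[LHS]/((v f - w f) + (w f - u f)) addrA subrK.
Qed.

Lemma bnull_unique V v w : bnull (fun n => V n - v) -> bnull (fun n => V n - w) -> bzero (v - w).
Proof.
move=> hv hw; apply/bzero_null; apply: bnull_same (bnullD hw (bnullZ (-1) hv)) => n f _.
rewrite -[LHS]/((V n f - w f) + (-1) * (V n f - v f)) -[RHS]/(v f - w f); ring.
Qed.

Lemma besov_sub : exists2 K : R, 1 <= K & forall u v (B : R), 0 < B ->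
  bes u B -> bes (v - u) B -> bes v (K * B).
Proof.
have [K K1 hK] := besov_leD He s p0 q0; exists K => // u v B B0 hu hv.
apply: (besov_le_ext He _ (hK _ _ _ (ltW B0) hu hv)) => f _.
by rewrite -[LHS]/(u f + (v f - u f)) addrC subrK.
Qed.

End besov_convergence.

Section haar_operators.
Context {R : realType} {d : nat}.
Local Notation C := R[i].
Local Notation Rd := 'rV[R]_d.
Local Notation Zd := 'rV[int]_d.
Local Notation Ed := {ffun 'I_d -> bool}.
Implicit Types (f g : Rd -> C) (x y : Rd) (m : Zd) (e : Ed) (k n L : nat) (z : @haar_index d)
  (a : Zd -> Ed -> C) (u v w : distr R d) (T : (Rd -> C) -> Rd -> C).
Variable eta : Rd -> C.
Hypothesis He : lp_cutoff eta.
Hypothesis d0 : (0 < d)%N.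

(** Linear operators given by Haar coefficients: they see only the class of their argument
    modulo equality almost everywhere. *)
Record haar_operator T : Prop := HaarOperator {
  ho_growth : forall f, poly_growth f -> poly_growth (T f);
  ho_block : forall u j, tempered u -> T (fun_of (block eta u j)) = T (blockf eta u j);
  ho_linear : forall (c : C) f g x, poly_growth f -> poly_growth g ->
    T (fun y => c * f y + g y) x = c * T f x + T g x }.

Lemma blockf_poly u j : tempered u -> poly_growth (blockf eta u j).
Proof.
move=> tu; split; first exact/ccont_cmeas/ccont_blockf.
by have [n [A A0 hA]] := blockf_growth He j tu; exists n, A.
Qed.

Lemma poly_growth_haar f e k m : poly_growth f -> cintble (fun y => f y * haar e k m y).
Proof.
move=> [mf [n [A [A0 hA]]]]; have [r r0 hr] := haar_support e k m (R := R).
have [M M0 [w0 maj hw0]] := @majorant_supported R d r.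
have K0 : 0 <= A * (1 + r) ^+ n by rewrite mulr_ge0// exprn_ge0// addr_ge0.
apply: (cintble_majorant _ (majorantZ K0 maj)); first by apply: cmeasM => //; exact: cmeas_haar.
move=> y; have [_ w00 _] := maj; have [yr|/hr ->] := leP `|y| r; last by rewrite mulr0 cabs0 mulr_ge0.
rewrite cabsM; apply: ler_pM; [exact: cabs_ge0|exact: cabs_ge0| |].
  apply: le_trans (hA y) _; rewrite ler_wpM2l//; apply: lerXn2r; rewrite ?nnegrE; [exact/ltW/br_gt0|exact: addr_ge0|by rewrite lerD2l].
by apply: le_trans (cabs_haar_le1 _ _ _ _) _; have := hw0 y; rewrite yr.
Qed.

Lemma haar_coef_block u j z : tempered u -> haar_coef (fun_of (block eta u j)) z = haar_coef (blockf eta u j) z.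
Proof.
move=> tu; have [lf ae] := fun_of_block He d0 j tu; congr (_ * _); apply: cint_ae_eq.
- by apply: cmeasM; [exact: loc_cmeas|exact: cmeas_haar].
- by apply: cmeasM; [exact/ccont_cmeas/ccont_blockf|exact: cmeas_haar].
- by apply: filterS ae => x ->.
Qed.

Lemma haar_coef_linear (c : C) f g z : poly_growth f -> poly_growth g ->
  haar_coef (fun y => c * f y + g y) z = c * haar_coef f z + haar_coef g z.
Proof.
move=> pf pg; have i1 := poly_growth_haar (hi_type z) (hi_level z) (hi_pos z) pf.
have i2 := poly_growth_haar (hi_type z) (hi_level z) (hi_pos z) pg.
rewrite /haar_coef /pairing mulrCA -mulrDr; congr (_ * _).
rewrite -(cintZ c i1) -(cintD (cintbleZ c i1) i2); apply: eq_cint => y.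
by rewrite /haar_of mulrDl mulrA.
Qed.

Lemma ho_haar_term e k : haar_operator (haar_term e k).
Proof.
split=> [f|u j tu|c f g x pf pg]; first exact: haar_term_growth.
  by apply/funext => x; rewrite /haar_term haar_coef_block.
by rewrite /haar_term haar_coef_linear// mulrDl mulrA.
Qed.

Lemma ho_mul T g (A : R) : cmeas g -> (forall x, cabs (g x) <= A) -> haar_operator T ->
  haar_operator (fun f x => g x * T f x).
Proof.
move=> mg hg [h1 h2 h3]; split=> [f pf|u j tu|c f h x pf ph].
- exact: poly_growthM mg hg (h1 f pf).
- by rewrite h2.
- by rewrite h3// mulrDr mulrCA.
Qed.

Lemma ho_sum (I : Type) (s : seq I) (P : pred I) (T : I -> (Rd -> C) -> Rd -> C) :
  (forall i, haar_operator (T i)) -> haar_operator (fun f x => \sum_(i <- s | P i) T i f x).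
Proof.
move=> hT; split=> [f pf|u j tu|c f h x pf ph].
- by apply: poly_growth_sum => i; exact: ho_growth (hT i) f pf.
- by apply/funext => x; apply: eq_bigr => i _; rewrite (ho_block (hT i)).
- by rewrite mulr_sumr -big_split; apply: eq_bigr => i _; rewrite (ho_linear (hT i)).
Qed.

Lemma ho_eq T T' : (forall f x, T' f x = T f x) -> haar_operator T -> haar_operator T'.
Proof. by move=> TT; have -> : T' = T by apply/funext => f; apply/funext. Qed.

Lemma ho_add T T' : haar_operator T -> haar_operator T' -> haar_operator (fun f x => T f x + T' f x).
Proof.
move=> hT hT'; have := @ho_sum bool [:: true; false] xpredT (fun b => if b then T else T').
move=> /(_ (fun b => if b return haar_operator (if b then T else T') then hT else hT')).
by apply: ho_eq => f x; rewrite !big_cons big_nil addr0.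
Qed.

Lemma ho_level L a : (forall m e, cabs (a m e) <= 1) -> haar_operator (level_op L a).
Proof.
move=> ha; apply: (ho_eq (fun f x => level_opE L a f x)); apply: ho_sum => e.
apply: (ho_mul (g := fun x => a (fl L.-1 x) e) (A := 1)) (ho_haar_term e L.-1); last by move=> x; exact: ha.
exact: (cmeas_fl L.-1 (fun m => a m e)).
Qed.

Lemma ho_expect N : haar_operator (expect N).
Proof. by apply: ho_eq (ho_haar_term haar0 N) => f x; rewrite expectE /haar_term haar0E eqxx mulr1. Qed.

End haar_operators.

Section operator_values.
Context {R : realType} {d : nat}.
Local Notation C := R[i].
Local Notation Rd := 'rV[R]_d.
Local Notation Zd := 'rV[int]_d.
Local Notation Ed := {ffun 'I_d -> bool}.
Implicit Types (f g chi : Rd -> C) (x y : Rd) (z : @haar_index d) (u v w : distr R d) (T : (Rd -> C) -> Rd -> C).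
Variable eta : Rd -> C.
Hypothesis He : lp_cutoff eta.
Hypothesis d0 : (0 < d)%N.
Variables (s : R) (p q : \bar R).
Hypothesis p0 : (0 < p)%E.
Hypothesis q0 : (0 < q)%E.
Local Notation bes := (besov_le eta s p q).
Local Notation bnorm := (besov_norm eta s p q).
Local Notation bnull := (bnull eta s p q).
Local Notation bzero := (bzero eta s p q).
Local Notation ho := (haar_operator eta).

(** The partial sums that define the value of [T] at [u], with the continuous representatives of
    the blocks. *)
Definition op_sum T u (J : nat) : distr R d := fun f => \sum_(j < J) cint setT (fun x => T (blockf eta u j) x * f x).

Definition value T u v : Prop := (exists2 B : R, 0 < B & bes v B) /\ bnull (fun J => op_sum T u J - v).

Lemma valueP T u v : ho T -> tempered u -> op_value eta s p q T u v <-> value T u v.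
Proof.
move=> hT tu; rewrite /op_value /value (besovP He d0 s p0 q0).
have E J : \sum_(j < J) dist_of (T (fun_of (block eta u j))) = op_sum T u J.
  by apply/funext => f; rewrite fct_sumE; apply: eq_bigr => j _; rewrite (ho_block hT).
have -> : (fun J => bnorm (\sum_(j < J) dist_of (T (fun_of (block eta u j))) - v)) = fun J => bnorm (op_sum T u J - v).
  by apply/funext => J; rewrite E.
by split=> -[h1 h2]; split=> //; apply/(bnull_cvg He d0 s p0 q0).
Qed.

Lemma op_sum_cintble T u j f : ho T -> tempered u -> schwartz f -> cintble (fun x => T (blockf eta u j) x * f x).
Proof. by move=> hT tu; apply: poly_growth_cintble; apply: (ho_growth hT); exact: blockf_poly. Qed.

Lemma op_sumD T T' u J : ho T -> ho T' -> tempered u ->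
  same (op_sum (fun f x => T f x + T' f x) u J) (op_sum T u J + op_sum T' u J).
Proof.
move=> hT hT' tu f sf; rewrite -[RHS]/(op_sum T u J f + op_sum T' u J f) -big_split; apply: eq_bigr => j _ /=.
rewrite -(cintD (op_sum_cintble j hT tu sf) (op_sum_cintble j hT' tu sf)).
by apply: eq_cint => x; rewrite mulrDl.
Qed.

Lemma valueD T T' u v v' : ho T -> ho T' -> tempered u -> value T u v -> value T' u v' ->
  value (fun f x => T f x + T' f x) u (v + v').
Proof.
move=> hT hT' tu [[B B0 hB] hv] [[B' B'0 hB'] hv']; split.
  have [K K1 hK] := besov_leD He s p0 q0; exists (K * (B + B')).
    by rewrite mulr_gt0 ?addr_gt0//; exact: lt_le_trans K1.
  apply: hK; first by rewrite addr_ge0 ?ltW.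
    by apply: besov_le_weaken _ hB; rewrite lerDl ltW.
  by apply: besov_le_weaken _ hB'; rewrite lerDr ltW.
apply: (bnull_same He _ (bnullD He p0 q0 hv hv')) => J f sf.
rewrite -[RHS]/(op_sum _ u J f - (v f + v' f)) (op_sumD J hT hT' tu sf).
rewrite -[LHS]/((op_sum T u J f - v f) + (op_sum T' u J f - v' f)).
by rewrite -[RHS]/(op_sum T u J f + op_sum T' u J f - (v f + v' f)) opprD addrACA.
Qed.

Lemma value_eq T T' u v : (forall j x, T (blockf eta u j) x = T' (blockf eta u j) x) -> value T u v -> value T' u v.
Proof.
move=> TT [hB hv]; split=> //; apply: (bnull_same He _ hv) => J f _; congr (_ - _).
by apply: eq_bigr => j _; apply: eq_cint => x; rewrite TT.
Qed.

Lemma value_same T u v w : value T u v -> value T u w -> bzero (v - w).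
Proof. by move=> [_ hv] [_ hw]; exact: (bnull_unique He p0 q0 hv hw). Qed.

Lemma blockf_linear (c : C) u v j : blockf eta (fun f => c * u f + v f) j = fun y => c * blockf eta u j y + blockf eta v j y.
Proof. by []. Qed.

Lemma op_sum_linear T (c : C) u v J : ho T -> tempered u -> tempered v ->
  same (op_sum T (fun f => c * u f + v f) J) (fun f => c * op_sum T u J f + op_sum T v J f).
Proof.
move=> hT tu tv f sf; rewrite /op_sum mulr_sumr -big_split; apply: eq_bigr => j _ /=.
have i1 := op_sum_cintble j hT tu sf; have i2 := op_sum_cintble j hT tv sf.
rewrite -(cintZ c i1) -(cintD (cintbleZ c i1) i2); apply: eq_cint => x.
by rewrite blockf_linear (ho_linear hT) ?mulrDl ?mulrA//; exact: blockf_poly.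
Qed.

Lemma valueL T (c : C) u v u' v' : ho T -> tempered u -> tempered u' -> value T u v -> value T u' v' ->
  value T (fun f => c * u f + u' f) (fun f => c * v f + v' f).
Proof.
move=> hT tu tu' [[B B0 hB] hv] [[B' B'0 hB'] hv']; split.
  have [K K1 hK] := besov_leD He s p0 q0; have c0 := cabs_ge0 c.
  exists (K * (cabs c * B + B')).
    by rewrite mulr_gt0 ?ltr_wpDl// ?mulr_ge0 ?(ltW B0)//; exact: lt_le_trans K1.
  apply: (hK (fun f => c * v f)); first by rewrite addr_ge0 ?(ltW B'0)// mulr_ge0// ltW.
    by apply: besov_le_weaken _ (besov_leZ He p0 q0 c (ltW B0) hB); rewrite lerDl ltW.
  by apply: besov_le_weaken _ hB'; rewrite lerDr mulr_ge0// ltW.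
apply: (bnull_same He _ (bnullD He p0 q0 (bnullZ He p0 q0 c hv) hv')) => J f sf.
rewrite -[RHS]/(op_sum T _ J f - (c * v f + v' f)) (op_sum_linear c J hT tu tu' sf).
rewrite -[LHS]/(c * (op_sum T u J f - v f) + (op_sum T u' J f - v' f)); ring.
Qed.

(** Operators that agree where [chi] lives have the same values there. *)
Lemma value_local chi T T' u v v' : test_function chi -> 
  (forall j x, chi x * T (blockf eta u j) x = chi x * T' (blockf eta u j) x) ->
  value T u v -> value T' u v' -> bzero (dmul chi v - dmul chi v').
Proof.
move=> tc TT [_ hv] [_ hv']; have h1 := bnull_dmul He d0 p0 q0 tc hv; have h2 := bnull_dmul He d0 p0 q0 tc hv'.
apply: (@bnull_unique _ _ _ He _ _ _ p0 q0 (fun J => dmul chi (op_sum T u J))).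
  by apply: (bnull_same He _ h1) => J f _.
apply: (bnull_same He _ h2) => J f _; rewrite -[LHS]/(op_sum T' u J _ - v' _) -[RHS]/(op_sum T u J _ - v' _).
congr (_ - _); apply: eq_bigr => j _; apply: eq_cint => x.
by rewrite ![_ * (chi x * _)]mulrA ![_ * chi x]mulrC TT.
Qed.

(** By homogeneity the bound of a linear operator is stated for all radii at once. *)
Definition bounded_op T (M : R) : Prop :=
  forall (la : R) u, 0 < la -> bes u la -> exists2 v, value T u v & bes v (M * la).

Lemma value0 u : value (fun _ _ => 0) u (fun=> 0).
Proof.
split; first by exists 1 => //; exact: (besov_le0 eta s p0 q0).
move=> e e0; exists 0%N => n _; apply: (besov_le_ext He _ (besov_le0 eta s p0 q0 (ltW e0))) => f _.
rewrite -[RHS]/(op_sum _ u n f - 0) subr0 /op_sum big1// => j _; rewrite -[RHS](@cint0 R d).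
by apply: eq_cint => x; rewrite mul0r.
Qed.

Lemma bounded_sum : exists2 K : R, 1 <= K & forall n (T : nat -> (Rd -> C) -> Rd -> C) (M : R), 0 <= M ->
  (forall i, (i < n)%N -> ho (T i) /\ bounded_op (T i) M) ->
  ho (fun f x => \sum_(i < n) T i f x) /\ bounded_op (fun f x => \sum_(i < n) T i f x) (K ^+ n * M).
Proof.
have [K K1 hK] := besov_leD He s p0 q0; have K0 : 0 <= K := le_trans ler01 K1.
exists K => // n T M M0; elim: n => [|n IH] hT.
  have E : (fun (f : Rd -> C) (x : Rd) => \sum_(i < 0) T i f x) = fun _ _ => 0.
    by apply/funext => f; apply/funext => x; rewrite big_ord0.
  rewrite E; split; first by split=> *; [split; [exact: cmeas_cst|by exists 0%N, 0; split=> // x; rewrite cabs0 mul0r]| |rewrite mulr0 addr0].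
  move=> la u la0 hu; exists (fun=> 0); first exact: value0.
  by apply: (besov_le0 eta s p0 q0); rewrite !mulr_ge0 ?exprn_ge0// ltW.
have [h1 h2] := hT n (ltnSn n); have [|h3 h4] := IH; first by move=> i ni; exact/hT/leqW.
have E : (fun (f : Rd -> C) (x : Rd) => \sum_(i < n.+1) T i f x) = fun f x => \sum_(i < n) T i f x + T n f x.
  by apply/funext => f; apply/funext => x; rewrite big_ord_recr.
rewrite E; split; first exact: ho_add.
move=> la u la0 hu; have [tu _] := hu; have [v hv bv] := h4 la u la0 hu; have [w hw bw] := h2 la u la0 hu.
have P0 : 0 <= K ^+ n * M * la by rewrite !mulr_ge0 ?exprn_ge0// ltW.
exists (v + w); first exact: valueD.
rewrite exprS -!mulrA mulrA -mulrA; apply: hK; rewrite ?mulrA//.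
by apply: besov_le_weaken _ bw; rewrite ler_wpM2r ?(ltW la0)// ler_peMl// exprn_ege1.
Qed.

End operator_values.

(** * Localized partial sums *)

Section partial_sums.
Context {R : realType} {d : nat}.
Local Notation C := R[i].
Local Notation Rd := 'rV[R]_d.
Local Notation Zd := 'rV[int]_d.
Local Notation Ed := {ffun 'I_d -> bool}.
Implicit Types (f g chi : Rd -> C) (c x y : Rd) (z : @haar_index d) (u v w : distr R d) (T : (Rd -> C) -> Rd -> C).
Variable eta : Rd -> C.
Hypothesis He : lp_cutoff eta.
Hypothesis d0 : (0 < d)%N.
Variables (s : R) (p q : \bar R).
Hypothesis p0 : (0 < p)%E.
Hypothesis q0 : (0 < q)%E.
Local Notation bes := (besov_le eta s p q).
Local Notation bnorm := (besov_norm eta s p q).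
Local Notation bnull := (bnull eta s p q).
Local Notation bzero := (bzero eta s p q).
Local Notation ho := (haar_operator eta).
Local Notation value := (value eta s p q).
Local Notation bounded_op := (bounded_op eta s p q).
Local Arguments level_op : simpl never.

(** The infimum in [op_norm] is attained up to one unit; scaling to the unit ball uses
    linearity. *)
Lemma bounded_of_norm T (M : R) : 0 <= M -> ho T -> (op_norm eta s p q T setT <= M%:E)%E -> bounded_op T (M + 1).
Proof.
move=> M0 hT hM la u la0 hu; have [tu _] := hu; pose c : C := (la^-1)%:C%C.
have li : 0 < la^-1 by rewrite invr_gt0.
have hu1 : bes (fun f => c * u f) 1.
  have := besov_leZ He p0 q0 c (ltW la0) hu; apply: besov_le_weaken.
  by rewrite /c cabs_real gtr0_norm// mulVf// lt0r_neq0.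
have tu1 : tempered (fun f => c * u f) by case: hu1.
pose u1 : distr R d := fun f => c * u f.
have lt : (ereal_inf [set bnorm v | v in op_value eta s p q T u1] < (M + 1)%:E)%E.
  apply: le_lt_trans (_ : (_ <= M%:E)%E) _; last by rewrite lte_fin ltrDl.
  apply: le_trans hM; apply: ereal_sup_ubound; exists u1 => //; split=> //.
  exact/(besov_leP He d0 s p0 q0).
have [_ [v hv <-] lv] := ereal_inf_lt lt.
have /(valueP He d0 s p0 q0 _ hT tu1) vv := hv.
have bv : bes v (M + 1) by apply/(besov_leP He d0 s p0 q0); [rewrite addr_ge0|exact: ltW].
have tz : tempered (fun _ : Rd -> C => 0 : C) by case: (besov_le0 eta s p0 q0 ler01).
have cz : la%:C%C * c = 1 by rewrite /c -rmorphM /= mulfV ?lt0r_neq0.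
have v0 : value T (fun=> 0) (fun=> 0).
  split; first by exists 1 => //; exact: (besov_le0 eta s p0 q0).
  move=> e e0; exists 0%N => n _; apply: (besov_le_ext He _ (besov_le0 eta s p0 q0 (ltW e0))) => f _.
  rewrite -[RHS]/(op_sum _ _ _ n f - 0) subr0 /op_sum big1// => j _; rewrite -[RHS](@cint0 R d).
  apply: eq_cint => x; have z0 : poly_growth (fun _ : Rd => 0 : C).
    by split; [exact: cmeas_cst|exists 0%N, 0; split=> // y; rewrite cabs0 mul0r].
  have := ho_linear hT (-1) x z0 z0; rewrite -[blockf eta _ j]/(fun=> 0).
  have -> : (fun _ : Rd => -1 * 0 + 0 : C) = fun=> 0 by apply/funext => y; rewrite mulr0 addr0.
  by rewrite mulN1r addNr => ->; rewrite mul0r.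
exists (fun f => la%:C%C * v f + 0).
  have := valueL He p0 q0 (la%:C%C) hT tu1 tz vv v0.
  by congr value; apply/funext => f; rewrite mulrA cz mul1r addr0.
have : bes (fun f => la%:C%C * v f) (cabs la%:C%C * (M + 1)).
  by apply: (besov_leZ He p0 q0) => //; rewrite addr_ge0.
rewrite cabs_real gtr0_norm// mulrC; apply: (besov_le_ext He) => f _; by rewrite addr0.
Qed.

(** The zero distribution belongs to the unit ball, and norms are nonnegative. *)
Lemma op_norm_ge0 T : (0 <= op_norm eta s p q T setT)%E.
Proof.
pose z : distr R d := fun=> 0.
apply: (@le_trans _ _ (ereal_inf [set bnorm v | v in op_value eta s p q T z])).
  by apply: le_ereal_inf_tmp => _ [v _ <-]; exact: besov_norm_ge0.
apply: ereal_sup_ubound; exists z => //; split=> //.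
by apply/(besov_leP He d0 s p0 q0) => //; exact: (besov_le0 eta s p0 q0).
Qed.

(** Both suprema are nonnegative, so that the finite sum bounds each of them. *)
Lemma family_bounded :
  (ereal_sup [set op_norm eta s p q (expect N) setT | N in [set: nat]] +
   ereal_sup
     ([set op_norm eta s p q (haar_mult0 a) setT
        | a in [set a : 'rV[int]_d -> R[i] | forall m, (cabs (a m) <= 1)%R]] `|`
      [set op_norm eta s p q (haar_mult z.1 z.2) setT
        | z in [set z : nat * ('rV[int]_d -> {ffun 'I_d -> bool} -> R[i]) |
                forall m e, e != haar0 -> (cabs (z.2 m e) <= 1)%R]])
   < +oo)%E ->
  exists2 M : R, 0 <= M & (forall N, bounded_op (expect N) M) /\
    forall L (a : Zd -> Ed -> C), (forall m e, cabs (a m e) <= 1) -> bounded_op (level_op L a) M.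
Proof.
set A := ereal_sup _; set B := ereal_sup _ => AB.
have eA N : (op_norm eta s p q (expect N) setT <= A)%E by apply: ereal_sup_ubound; exists N.
have lB L a : (forall m e, cabs (a m e) <= 1) -> (op_norm eta s p q (level_op L a) setT <= B)%E.
  move=> ha; apply: ereal_sup_ubound; case: L => [|k]; [left|right].
    by exists (fun m => a m haar0).
  by exists (k, a).
have A0 : (0 <= A)%E := le_trans (op_norm_ge0 _) (eA 0%N).
have B0 : (0 <= B)%E.
  by apply: le_trans (lB 0%N (fun _ _ => 0) _); [exact: op_norm_ge0|move=> *; rewrite cabs0].
have Af : A \is a fin_num by rewrite ge0_fin_numE//; apply: le_lt_trans AB; rewrite leeDl.
have Bf : B \is a fin_num by rewrite ge0_fin_numE//; apply: le_lt_trans AB; rewrite leeDr.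
have a0 : 0 <= fine A by exact: fine_ge0. have b0 : 0 <= fine B by exact: fine_ge0.
exists (fine A + fine B + 1); first by rewrite !addr_ge0.
split=> [N|L a ha]; apply: bounded_of_norm; rewrite ?addr_ge0//.
- exact: ho_expect.
- by apply: le_trans (eA N) _; rewrite EFinD !fineK// leeDl.
- exact: ho_level.
- by apply: le_trans (lB L a ha) _; rewrite EFinD !fineK// leeDr.
Qed.

Variable M : R.
Hypothesis M0 : 0 <= M.
Hypothesis hE : forall N, bounded_op (expect N) M.
Hypothesis hL : forall L (a : Zd -> Ed -> C), (forall m e, cabs (a m e) <= 1) -> bounded_op (level_op L a) M.
Variable U : nat -> @haar_index d.
Hypothesis eU : enumeration U.

(** The projection onto one Haar function. *)
Definition rank_one z : (Rd -> C) -> Rd -> C := level_op (hi_lev z) (only z (hi_lev z)).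

Lemma only_le1 z L m e : cabs (only z L m e : C) <= 1.
Proof. by rewrite /only; case: asboolP => _; rewrite ?cabs1 ?cabs0. Qed.

Lemma ho_rank_one z : ho (rank_one z).
Proof. by apply: ho_level => // m e; exact: only_le1. Qed.

Lemma bounded_rank_one z : bounded_op (rank_one z) M.
Proof. by apply: hL => m e; exact: only_le1. Qed.

Lemma partial_sum_rank_one n : partial_sum_op U n = fun f x => \sum_(i < n) rank_one (U i) f x.
Proof. by apply/funext => f; apply/funext => x; exact: partial_sumE. Qed.

Lemma ho_partial_sum n : ho (partial_sum_op U n).
Proof. by rewrite partial_sum_rank_one; apply: ho_sum => i; exact: ho_rank_one. Qed.

Lemma partial_sum_value n u : besov eta s p q u -> exists v, value (partial_sum_op U n) u v.
Proof.
move=> /(besovP He d0 s p0 q0)[la la0 hu]; have [K _ hK] := bounded_sum He s p0 q0.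
have [|_ h] := hK n (fun i => rank_one (U i)) M M0.
  by move=> i _; split; [exact: ho_rank_one|exact: bounded_rank_one].
by have [v hv _] := h la u la0 hu; exists v; rewrite partial_sum_rank_one.
Qed.

(** The Haar levels below [N] add up to a conditional expectation, if there are any. *)
Lemma bounded_prefix N : ho (fun f x => \sum_(L < N) level_op L (fun _ _ => 1) f x) /\
  bounded_op (fun f x => \sum_(L < N) level_op L (fun _ _ => 1) f x) M.
Proof.
split; first by apply: ho_sum => L; apply: ho_level => // *; rewrite cabs1.
move=> la u la0 hu; have [tu _] := hu; case: N => [|N].
  exists (fun=> 0); last by apply: (besov_le0 eta s p0 q0); rewrite mulr_ge0// ltW.
  by apply: (value_eq He _ (value0 He s p0 q0 u)) => j x; rewrite big_ord0.
have [v hv bv] := hE N la0 hu; exists v => //; apply: (value_eq He _ hv) => j x.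
exact/expect_levels/(ccont_loc_integrable He d0)/ccont_blockf.
Qed.

Lemma value_sum n u (v : nat -> distr R d) : tempered u -> (forall i, (i < n)%N -> value (rank_one (U i)) u (v i)) ->
  value (partial_sum_op U n) u (fun f => \sum_(i < n) v i f).
Proof.
move=> tu; rewrite partial_sum_rank_one; elim: n => [|n IH] hv.
  have -> : (fun f : Rd -> C => \sum_(i < 0) v i f) = fun=> 0 by apply/funext => f; rewrite big_ord0.
  by apply: (value_eq He _ (value0 He s p0 q0 u)) => j x; rewrite big_ord0.
have := valueD He p0 q0 _ (ho_rank_one (U n)) tu (IH (fun i ni => hv i (leqW ni))) (hv n (ltnSn n)).
have -> : (fun f : Rd -> C => \sum_(i < n.+1) v i f) = (fun f => \sum_(i < n) v i f) + v n.
  by apply/funext => f; rewrite big_ord_recr.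
move=> h; apply: (value_eq He _ (h _)) => [j x|]; first by rewrite big_ord_recr.
by apply: ho_sum => i; exact: ho_rank_one.
Qed.

(** The operator sums are multiples of the Haar function [h] whose factors converge. If [h] has
    finite norm they converge to the multiple by the limit; otherwise they are eventually zero,
    as the value has finite norm. *)
Lemma rank_one_value z u v (l : C) : haar_system z -> tempered u -> value (rank_one z) u v ->
  null (fun J => cabs (\sum_(j < J.+1) pairing (blockf eta u j) (haar_of z) - l)) ->
  bzero (v - (fun f => 2 ^+ (hi_level z * d) * l * dist_of (haar_of z) f)).
Proof.
move=> hz tu [[Bv Bv0 bv] hv] hl; pose h : distr R d := dist_of (haar_of z); pose k : R := 2 ^+ (hi_level z * d).
have k0 : 0 < k by exact: exp2_gt0.
have kE : 2 ^+ (hi_level z * d) = k%:C%C :> C by rewrite rmorphXn rmorph_nat.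
pose cJ J : C := \sum_(j < J) haar_coef (blockf eta u j) z.
have VE J : same (op_sum eta (rank_one z) u J) (fun f => cJ J * h f).
  move=> f sf; rewrite /op_sum mulr_suml; apply: eq_bigr => j _.
  have i1 : cintble (fun x => haar_of z x * f x).
    apply: poly_growth_cintble sf; split; first exact: cmeas_haar.
    by exists 0%N, 1; split=> // x; rewrite expr0 mulr1; exact: cabs_haar_le1.
  rewrite -(cintZ _ i1); apply: eq_cint => x; by rewrite /rank_one level_op_only// eqxx mulrA.
pose l' := 2 ^+ (hi_level z * d) * l.
have cl : null (fun J => cabs (cJ J.+1 - l')).
  have := nullZ (ltW k0) hl; congr null; apply/funext => J.
  rewrite -[k](gtr0_norm k0) -cabs_real -cabsM -kE mulrBr mulr_sumr; congr cabs.
suff hw : bnull (fun J => op_sum eta (rank_one z) u J - (fun f => l' * h f)).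
  exact: (bnull_unique He p0 q0 hv hw).
(* a Haar function of infinite norm can only occur with eventually vanishing factors *)
have [[Bh Bh0 bh]|nb] := pselect (exists2 B : R, 0 < B & bes h B).
  move=> e e0; have [N hN] := cl (e / Bh) (divr_gt0 e0 Bh0); exists N.+1 => -[//|J]; rewrite ltnS => /hN le.
  apply: (besov_le_ext He (u := fun f => (cJ J.+1 - l') * h f)).
    by move=> f sf; rewrite -[RHS]/(op_sum _ _ _ _ f - l' * h f) VE// mulrBl.
  by apply: besov_le_weaken _ (besov_leZ He p0 q0 _ (ltW Bh0) bh); rewrite -ler_pdivlMr.
have [N hN] := hv 1 ltr01.
have c0 J : (N <= J)%N -> cJ J = 0.
  move=> /hN hJ; apply: contrapT => /eqP cn; apply: nb.
  have [K K1 hK] := besov_leD He s p0 q0; have K0 : 0 < K := lt_le_trans ltr01 K1.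
  have b1 : bes (op_sum eta (rank_one z) u J - v + v) (K * (1 + Bv)).
    apply: hK; first by rewrite addr_ge0// ltW.
      by apply: besov_le_weaken _ hJ; rewrite lerDl ltW.
    by apply: besov_le_weaken _ bv; rewrite lerDr.
  have KB : 0 <= K * (1 + Bv) by rewrite mulr_ge0 ?(ltW K0)// addr_ge0// ltW.
  have b2 := besov_leZ He p0 q0 (cJ J)^-1 KB b1.
  exists (cabs (cJ J)^-1 * (K * (1 + Bv)) + 1); first by rewrite ltr_wpDl// mulr_ge0// cabs_ge0.
  apply: (besov_le_ext He _ (besov_le_weaken _ b2)) => [f sf|]; last by rewrite lerDl.
  by rewrite -[_ f]/(op_sum _ _ _ _ f - v f + v f) subrK VE// mulKf.
have l0 : l' = 0.
  apply: cabs_eq0; apply: null_eq0; first exact: cabs_ge0.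
  apply: null_le cl; exists N => n Nn; rewrite c0; last exact: leqW.
  by rewrite sub0r cabsN.
move=> e e0; exists N => J NJ; apply: (besov_le_ext He _ (besov_le0 eta s p0 q0 (ltW e0))) => f sf.
by rewrite -[RHS]/(op_sum _ _ _ _ f - l' * h f) VE// c0// l0 !mul0r subrr.
Qed.

Hypothesis sU : strongly_admissible R U.

(** Locally, partial sums are conditional expectations up to boundedly many levels. *)
Lemma partial_sum_local chi : test_function chi -> exists2 A : R, 0 <= A & forall n (la : R) u v, 0 < la ->
  bes u la -> value (partial_sum_op U n) u v -> bes (dmul chi v) (A * la).
Proof.
move=> tc; have /test_functionP[_ [r r0 cr]] := tc; have [B hB] := first_levels eU sU d0 (ltW r0).
have [K K1 hK] := bounded_sum He s p0 q0; have [Km Km0 hKm] := besov_multiplier He d0 s p0 q0 tc.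
have [Ks Ks1 hKs] := besov_sub He s p0 q0; have [Kd Kd1 hKd] := besov_leD He s p0 q0.
have K0 : 0 <= K := le_trans ler01 K1. have Kd0 : 0 <= Kd := le_trans ler01 Kd1.
have Ks0 : 0 <= Ks := le_trans ler01 Ks1.
pose D := Kd * (K ^+ B.+1 * M); have D0 : 0 <= D by rewrite !mulr_ge0// exprn_ge0.
exists (Ks * (Km * D + 1)) => [|n la u v la0 hu hv]; first by rewrite mulr_ge0// addr_ge0// mulr_ge0.
have [tu _] := hu; have [N hN] := hB n.
(* near [chi] the partial sum is the full expansion below level [N] plus [B.+1] incomplete
   levels *)
pose T1 f x := \sum_(L < N) level_op L (fun _ _ => 1) f x.
pose T2 f x := \sum_(i < B.+1) level_op (N + i) (first_coef U n (N + i)) f x.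
have [ho1 b1] := bounded_prefix N.
have [|ho2 b2] := hK B.+1 (fun i => level_op (N + i) (first_coef U n (N + i))) M M0.
  move=> i _; split; [apply: ho_level => //|apply: hL] => m e; exact: first_coef_le1.
have [w1 hw1 bw1] := b1 la u la0 hu; have [w2 hw2 bw2] := b2 la u la0 hu.
have hw := valueD He p0 q0 ho1 ho2 tu hw1 hw2.
have bw : bes (w1 + w2) (D * la).
  rewrite -mulrA; apply: hKd => //; first by rewrite !mulr_ge0 ?exprn_ge0// ltW.
  by apply: besov_le_weaken _ bw1; rewrite ler_wpM2r ?(ltW la0)// ler_peMl// exprn_ege1.
have Dla : 0 <= D * la by rewrite mulr_ge0// ltW.
have bcw := hKm _ _ Dla bw.
rewrite -mulrA; apply: (hKs (dmul chi (w1 + w2))).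
- by rewrite mulr_gt0// ltr_wpDl// mulr_ge0.
- by apply: besov_le_weaken _ bcw; rewrite mulrDl mulrA lerDl mul1r ltW.
have loc : bzero (dmul chi v - dmul chi (w1 + w2)).
  apply: (value_local He d0 p0 q0 tc _ hv hw) => j x.
  have [xr|xr] := ltP r `|x|; first by rewrite cr// !mul0r.
  have bx : in_box r x by move=> i; exact: le_trans (coord_le x i) xr.
  congr (_ * _); have [K2 hK2] : exists K2, forall i, (i < n)%N -> (hi_lev (U i) < K2)%N.
    by exists (\max_(i < n) hi_lev (U i)).+1 => i ni; rewrite ltnS; exact: (leq_bigmax (F := fun i : 'I_n => hi_lev (U i)) (Ordinal ni)).
  have {}hK2 i : (i < n)%N -> (hi_lev (U i) < N + (B.+1 + K2))%N by move=> /hK2 h; apply: (leq_trans h); rewrite addnA leq_addl.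
  rewrite (partial_sum_levels eU _ x hK2) big_split_ord /=; congr (_ + _).
    by apply: eq_bigr => L _; apply: level_op_local => e le; have [-> //] := hN x L e bx le.
  rewrite big_split_ord /= [X in _ + X]big1 ?addr0// => i _; apply: level_op0 => e le.
  by have [_ ->] := hN x _ e bx le; rewrite // ltn_add2l addSn ltnS leq_addr.
by apply: loc; rewrite mulr_gt0// ltr_wpDl// mulr_ge0.
Qed.

End partial_sums.

(** * Local basic sequences *)

Section conclusion.
Context {R : realType} {d : nat}.
Local Notation C := R[i].
Local Notation Rd := 'rV[R]_d.
Local Notation Zd := 'rV[int]_d.
Local Notation Ed := {ffun 'I_d -> bool}.
Implicit Types (f g chi : Rd -> C) (c x y : Rd) (z : @haar_index d) (u v w : distr R d).
Variable eta : Rd -> C.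
Hypothesis He : lp_cutoff eta.
Hypothesis d0 : (0 < d)%N.
Variables (s : R) (p q : \bar R).
Hypothesis p0 : (0 < p)%E.
Hypothesis q0 : (0 < q)%E.
Local Notation bes := (besov_le eta s p q).
Local Notation bnorm := (besov_norm eta s p q).
Local Notation bnull := (bnull eta s p q).
Local Notation bzero := (bzero eta s p q).
Local Notation value := (value eta s p q).
Local Notation bounded_op := (bounded_op eta s p q).
Local Arguments level_op : simpl never.

Lemma bzero_sum n (v : nat -> distr R d) : (forall i, (i < n)%N -> bzero (v i)) -> bzero (fun f => \sum_(i < n) v i f).
Proof.
elim: n => [|n IH] hv e e0.
  by apply: (besov_le_ext He _ (besov_le0 eta s p0 q0 (ltW e0))) => f _; rewrite big_ord0.
have := bzeroD He p0 q0 (IH (fun i ni => hv i (leqW ni))) (hv n (ltnSn n)).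
move=> /(_ e e0); apply: (besov_le_ext He) => f _.
by rewrite [RHS]big_ord_recr.
Qed.

Lemma bzero_dmul chi v : test_function chi -> bzero v -> bzero (dmul chi v).
Proof. by move=> tc /bzero_null/(bnull_dmul He d0 p0 q0 tc)/bzero_null. Qed.

(** Multiplication by [chi] leaves the Haar function unchanged, hence every operator sum. *)
Lemma rank_one_supported chi z u v : test_function chi -> haar_system z ->
  (forall x, haar_of z x != 0 :> C -> chi x = 1) -> value (rank_one z) u v -> bzero (v - dmul chi v).
Proof.
move=> tc hz c1 [_ hv]; apply: (bnull_unique He p0 q0 hv).
apply: (bnull_same He _ (bnull_dmul He d0 p0 q0 tc hv)) => J f _.
rewrite -[LHS]/(op_sum _ _ _ J _ - v _) -[RHS]/(op_sum _ _ _ J f - v _); congr (_ - _).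
apply: eq_bigr => j _; apply: eq_cint => x; rewrite mulrA; congr (_ * _).
rewrite /rank_one level_op_only// eqxx.
by have [->|/c1 ->] := eqVneq (haar_of z x : C) 0; rewrite ?mulr1// mulr0 mul0r.
Qed.

Variable M : R.
Hypothesis M0 : 0 <= M.
Hypothesis hE : forall N, bounded_op (expect N) M.
Hypothesis hL : forall L (a : Zd -> Ed -> C), (forall m e, cabs (a m e) <= 1) -> bounded_op (level_op L a) M.
Variable U : nat -> @haar_index d.
Hypothesis eU : enumeration U.
Hypothesis sU : strongly_admissible R U.

(** On distributions supported in a cube the partial sums live near the cube, since the
    coefficients of the far Haar functions vanish. *)
Lemma partial_sum_supported c (r : R) : 0 < r -> exists2 A : R, 0 <= A & forall n u v,
  bes u 1 -> dsupp u `<=` open_cube c r -> value (partial_sum_op U n) u v -> bes v A.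
Proof.
move=> r0; have [T HT] := exists_smooth_step d0 He.
pose chi := plateau T 1 (r + 5) c; have tc : test_function chi by exact: (test_plateau HT).
have [A A0 hA] := partial_sum_local He d0 p0 q0 M0 hE hL eU sU tc.
have [K K1 hK] := besov_sub He s p0 q0; have K0 : 0 <= K := le_trans ler01 K1.
exists (K * (A + 1)) => [|n u v hu uc hv]; first by rewrite mulr_ge0// addr_ge0.
have [tu _] := hu.
have /choice[w hw] : forall i, exists w, value (rank_one (U i)) u w.
  by move=> i; have [w hw _] := bounded_rank_one hL (U i) ltr01 hu; exists w.
(* Haar functions that meet the cube of half side [r + 3] are supported where [chi = 1]; the
   others have vanishing coefficients in the limit *)
have near i : bzero (w i - dmul chi (w i)).
  have hz := enum_system eU i; set z := U i in hz *.
  have [[x0 [zx0 x0c]]|far] := pselect (exists x0, haar_of z x0 != 0 :> C /\ forall j, `|x0 0 j - c 0 j| < r + 3).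
    apply: rank_one_supported tc hz _ (hw i) => x zx; apply: (plateau1 HT) => // j.
    have same_cube y : haar_of z y != 0 :> C -> fl (hi_level z) y = hi_pos z.
      by move=> /eqP zy; apply: contrapT => h; apply: zy; exact: haar_out.
    have := fl_close (etrans (same_cube x zx) (esym (same_cube x0 zx0))); have := x0c j.
    have := coord_le (x - x0) j; rewrite !mxE => h1 h2 h3.
    have := ler_normD (x 0 j - x0 0 j) (x0 0 j - c 0 j); rewrite addrA subrK; lra.
  have n0 : null (fun J => cabs (\sum_(j < J.+1) pairing (blockf eta u j) (haar_of z) - 0)).
    have hf x : haar_of z x != 0 :> C -> exists j, r + 3 <= `|x 0 j - c 0 j|.
      move=> zx; apply: contrapT => h'; apply: far; exists x; split=> // j.
      by rewrite ltNge; apply/negP => h''; apply: h'; exists j.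
    have := far_haar_coef He d0 r0 tu uc hf; congr null; apply/funext => J; by rewrite subr0.
  have z0 : bzero (w i).
    have := rank_one_value He p0 q0 hz tu (hw i) n0; apply: (bzero_same He) => f _.
    by rewrite -[LHS]/(w i f - _) mulr0 mul0r subr0.
  have := bzeroD He p0 q0 z0 (bzeroN He p0 q0 (bzero_dmul tc z0)); exact: (bzero_same He).
have hs := value_sum He d0 p0 q0 eU tu (fun i (_ : (i < n)%N) => hw i).
pose W : distr R d := fun f => \sum_(i < n) w i f.
have vW : bzero (v - W) := value_same He p0 q0 hv hs.
have cvW : bzero (dmul chi W - dmul chi v).
  by have := bzero_dmul tc (bzeroN He p0 q0 vW); apply: (bzero_same He) => f _; exact: opprB.
have WcW : bzero (W - dmul chi W).
  have := @bzero_sum n (fun i => w i - dmul chi (w i)) (fun i _ => near i); apply: (bzero_same He) => f _.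
  by rewrite -[RHS]/(W f - W _) /W -sumrB.
have vcv : bzero (v - dmul chi v) := bzero_trans He p0 q0 vW (bzero_trans He p0 q0 WcW cvW).
have bcv := hA n 1 u v ltr01 hu hv.
apply: (hK (dmul chi v)); first by rewrite ltr_wpDl.
  by apply: besov_le_weaken _ bcv; rewrite mulr1 lerDl.
by apply: vcv; rewrite ltr_wpDl.
Qed.

(** By additivity the value is the sum of those of the rank one projections, and these are the
    terms of the Haar expansion of [g]. *)
Lemma partial_sum_span g : haar_span g -> exists N0, forall n v, (N0 <= n)%N ->
  (exists2 B : R, 0 < B & bes (dist_of g) B) -> value (partial_sum_op U n) (dist_of g) v -> bzero (v - dist_of g).
Proof.
move=> hg; have [N0 hN] := haar_span_reproduced eU sU d0 hg; exists N0 => n v Nn [B B0 hB] hv.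
have [tg _] := hB; have [l [a [z [hz gE]]]] := hg.
have mg : cmeas g.
  by rewrite gE; apply: cmeas_sum => i; apply: cmeasM; [exact: cmeas_cst|exact: cmeas_haar].
have gb x : cabs (g x) <= \sum_i cabs (a i).
  rewrite gE; apply: le_trans (cabs_sum _ _ _) _; apply: ler_sum => i _; rewrite cabsM.
  by rewrite ler_piMr ?cabs_ge0//; exact: cabs_haar_le1.
have G0 : 0 <= \sum_i cabs (a i) by apply: sumr_ge0 => i _; exact: cabs_ge0.
have /choice[w hw] : forall i, exists w, value (rank_one (U i)) (dist_of g) w.
  by move=> i; have [w hw _] := bounded_rank_one hL (U i) B0 hB; exists w.
have hs := value_sum He d0 p0 q0 eU tg (fun i (_ : (i < n)%N) => hw i).
apply: (bzero_trans He p0 q0 (value_same He p0 q0 hv hs)).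
have each i : bzero (w i - (fun f => haar_coef g (U i) * dist_of (haar_of (U i)) f)).
  apply: (rank_one_value He p0 q0 (enum_system eU i) tg (hw i)).
  exact: (haar_coef_cvg He d0 (hi_type (U i)) (hi_level (U i)) (hi_pos (U i)) mg G0 gb).
have := @bzero_sum n _ (fun i _ => each i); apply: (bzero_same He) => f sf.
rewrite -[RHS]/(\sum_(i < n) w i f - dist_of g f) sumrB; congr (_ - _).
have ih i : cintble (fun x => haar_of (U i) x * f x).
  apply: poly_growth_cintble sf; split; first exact: cmeas_haar.
  by exists 0%N, 1; split=> // x; rewrite expr0 mulr1; exact: cabs_haar_le1.
transitivity (cint setT (fun x => \sum_(i < n) haar_coef g (U i) * (haar_of (U i) x * f x))).
  rewrite cint_sum; last by move=> i; exact: cintbleZ.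
  by apply: eq_bigr => i _; rewrite (cintZ _ (ih i)).
apply: eq_cint => x; rewrite -(hN n x Nn) mulr_suml; apply: eq_bigr => i _; exact: mulrA.
Qed.

(** With [u = h + g], [S n - u] is the value at [h] minus [h], up to an element of norm zero. *)
Lemma partial_sum_closure chi u (S : nat -> distr R d) : test_function chi -> haar_closure eta s p q u ->
  (forall n, value (partial_sum_op U n) u (S n)) -> bnull (fun n => dmul chi (S n - u)).
Proof.
move=> tc [bu hu] hS; have /(besovP He d0 s p0 q0)[Bu Bu0 hBu] := bu; have [tu _] := hBu.
have [A A0 hA] := partial_sum_local He d0 p0 q0 M0 hE hL eU sU tc.
have [Km Km0 hKm] := besov_multiplier He d0 s p0 q0 tc.
have [Ks Ks1 hKs] := besov_sub He s p0 q0; have Ks0 : 0 < Ks := lt_le_trans ltr01 Ks1.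
have [Kd Kd1 hKd] := besov_leD He s p0 q0; have Kd0 : 0 < Kd := lt_le_trans ltr01 Kd1.
move=> e e0; pose D := A + Km + 1; have D0 : 0 < D by rewrite ltr_wpDl// addr_ge0.
(* [D * de] bounds the localized values of the partial sum at [h] and of [h] itself; [Kd] and
   [Ks] pay for two applications of the quasi-triangle inequality *)
pose de := e / (Ks * (Kd * D)); have de0 : 0 < de by rewrite divr_gt0// !mulr_gt0.
have [g hg gl] := hu de de0; pose ga : distr R d := dist_of g; pose h : distr R d := u - ga.
have hh : bes h de by apply/(besov_leP He d0 s p0 q0); [exact: ltW|exact: (ltW gl)].
have [th _] := hh.
have hga : exists2 B : R, 0 < B & bes ga B.
  exists (Kd * (Bu + de)); first by rewrite mulr_gt0// addr_gt0.
  have nh : bes (- h) de.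
    have := besov_leZ He p0 q0 (-1) (ltW de0) hh; rewrite cabsN cabs1 mul1r.
    by apply: (besov_le_ext He) => f _; exact: mulN1r.
  have P : 0 <= Bu + de by rewrite addr_ge0// ltW.
  have b1 : bes u (Bu + de) by apply: besov_le_weaken _ hBu; rewrite lerDl ltW.
  have b2 : bes (- h) (Bu + de) by apply: besov_le_weaken _ nh; rewrite lerDr ltW.
  apply: (besov_le_ext He _ (hKd _ _ _ P b1 b2)) => f _.
  by rewrite -[LHS]/(u f - (u f - ga f)) opprB addrC subrK.
have [Bg Bg0 hBg] := hga; have [tg _] := hBg.
have [N0 hN0] := partial_sum_span hg; exists N0 => n Nn.
have bh : besov eta s p q h by apply/(besovP He d0 s p0 q0); exists de.
have bg : besov eta s p q ga by apply/(besovP He d0 s p0 q0); exists Bg.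
have [w hw] := partial_sum_value He d0 p0 q0 M0 hL eU n bh.
have [y hy] := partial_sum_value He d0 p0 q0 M0 hL eU n bg.
have zy : bzero (y - ga) := hN0 n y Nn (ex_intro2 _ _ Bg Bg0 hBg) hy.
have hwy := valueL He p0 q0 1 (ho_partial_sum He d0 eU n) th tg hw hy.
have uE : (fun f => 1 * h f + ga f) = u.
  by apply/funext => f; rewrite mul1r -[h f]/(u f - ga f) subrK.
rewrite uE in hwy; have z1 := value_same He p0 q0 (hS n) hwy.
have z2 : bzero (dmul chi (S n - u) - dmul chi (w - h)).
  have := bzero_dmul tc (bzeroD He p0 q0 z1 zy); apply: (bzero_same He) => f _.
  rewrite -[LHS]/((S n _ - (1 * w _ + y _)) + (y _ - ga _)) -[RHS]/((S n _ - u _) - (w _ - (u _ - ga _))); ring.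
have Dde : 0 < D * de by rewrite mulr_gt0.
have b1 : bes (dmul chi w) (D * de).
  apply: besov_le_weaken _ (hA n de h w de0 hh hw); rewrite ler_wpM2r ?(ltW de0)// /D -addrA lerDl addr_ge0//.
have b2 : bes (- dmul chi h) (D * de).
  have := besov_leZ He p0 q0 (-1) (mulr_ge0 Km0 (ltW de0)) (hKm _ _ (ltW de0) hh).
  rewrite cabsN cabs1 mul1r => b3; apply: (besov_le_ext He _ (besov_le_weaken _ b3)) => [f _|]; first exact: mulN1r.
  by rewrite ler_wpM2r ?(ltW de0)// /D addrAC lerDr addr_ge0.
have b3 := hKd _ _ _ (ltW Dde) b1 b2.
have -> : e = Ks * (Kd * (D * de)).
  by rewrite /de; field; rewrite !lt0r_neq0.
apply: (hKs (dmul chi (w - h))); [by rewrite mulr_gt0| |by apply: z2; rewrite mulr_gt0].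
by apply: (besov_le_ext He _ b3).
Qed.

End conclusion.

Theorem proposition9p2 (R : realType) (d : nat) (s : R) (p q : \bar R)
    (eta : 'rV[R]_d -> R[i]) :
  (0 < d)%N -> (0 < p)%E -> (0 < q)%E -> lp_cutoff eta ->
  (ereal_sup [set op_norm eta s p q (expect N) setT | N in [set: nat]] +
   ereal_sup
     ([set op_norm eta s p q (haar_mult0 a) setT
        | a in [set a : 'rV[int]_d -> R[i] | forall m, (cabs (a m) <= 1)%R]] `|`
      [set op_norm eta s p q (haar_mult z.1 z.2) setT
        | z in [set z : nat * ('rV[int]_d -> {ffun 'I_d -> bool} -> R[i]) |
                forall m e, e != haar0 -> (cabs (z.2 m e) <= 1)%R]])
   < +oo)%E ->
  forall U : nat -> haar_index, enumeration U -> strongly_admissible R U ->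
  (forall (c : 'rV[R]_d) (r : R), 0 < r ->
     (ereal_sup [set op_norm eta s p q (partial_sum_op U N)
                       [set u | dsupp u `<=` open_cube c r]
                 | N in [set: nat]] < +oo)%E) /\
  (forall (chi : 'rV[R]_d -> R[i]) (f : distr R d),
     test_function chi -> haar_closure eta s p q f ->
     exists S : nat -> distr R d,
       (forall N, op_value eta s p q (partial_sum_op U N) f (S N)) /\
       besov_norm eta s p q (dmul chi (S N - f)) @[N --> \oo] --> 0%E).
Proof.
move=> d0 p0 q0 He hyp U eU sU; have [M M0 [hE hL]] := family_bounded He d0 p0 q0 hyp; split.
  move=> c r r0; have [A A0 hA] := partial_sum_supported He d0 p0 q0 M0 hE hL eU sU c r0.
  apply: (@le_lt_trans _ _ A%:E); last exact: ltry.
  apply: ge_ereal_sup => _ [n _ <-]; apply: ge_ereal_sup => _ [u [uc nu] <-].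
  have hu : besov_le eta s p q u 1 by apply/(besov_leP He d0 s p0 q0).
  have bu : besov eta s p q u by apply/(besovP He d0 s p0 q0); exists 1.
  have [tu _] := hu; have [v hv] := partial_sum_value He d0 p0 q0 M0 hL eU n bu.
  apply: (@le_trans _ _ (besov_norm eta s p q v)).
    apply: ereal_inf_lbound; exists v => //.
    by apply/(valueP He d0 s p0 q0 _ (ho_partial_sum He d0 eU n) tu).
  apply/(besov_leP He d0 s p0 q0) => //; exact: hA hu uc hv.
move=> chi f tc hf; have [bf _] := hf; have /(besovP He d0 s p0 q0)[B B0 [tf _]] := bf.
have /choice[S hS] : forall n, exists v, value eta s p q (partial_sum_op U n) f v.
  by move=> n; exact: (partial_sum_value He d0 p0 q0 M0 hL eU n bf).
exists S; split=> [n|].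
  by apply/(valueP He d0 s p0 q0 _ (ho_partial_sum He d0 eU n) tf).
by apply/(bnull_cvg He d0 s p0 q0); exact: (partial_sum_closure He d0 p0 q0 M0 hE hL eU sU tc hf hS).
Qed.
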